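(* Suppose that $\mathbf E Z=0$ and that $Z$ is multivariate regularly varying with index $\alpha>1$ and spectral probability measure $\mathbf S$ on $\mathfrak N_d$. Suppose there is $D\in[1,\infty)$ such that $\|\sigma(x)-\sigma(y)\|\vee\|a(x)-a(y)\|\le D\|x-y\|$ for all $x,y\in\mathbb R^m$. Let $k\in\mathbb N=\{0,1,2,\dots\}$, $b,T,\epsilon\in(0,\infty)$, and let $A\subset\mathbb R^m$ be nonempty and compact. Then, as $\eta\downarrow0$, $$\lambda^{-k}(\eta)\,\mathbf P\big(X^{\eta|b}_{[0,T]}(x)\in\cdot\,\big)\to\mathbf C^{(k)|b}_{[0,T]}(\,\cdot\,;x)\quad\text{in }\mathbb M\big(\mathbb D[0,T]\setminus\mathbb D^{(k-1)|b}_A[0,T](\epsilon)\big)\text{ uniformly in }x\text{ on }A.$$ Furthermore, for any Borel set $B\subseteq\mathbb D[0,T]$ that is bounded away from $\mathbb D^{(k-1)|b}_A[0,T](\epsilon)$ for some (and hence all) $\epsilon>0$ small enough, $$\inf_{x\in A}\mathbf C^{(k)|b}_{[0,T]}(B^\circ;x)\le\liminf_{\eta\downarrow0}\frac{\inf_{x\in A}\mathbf P(X^{\eta|b}_{[0,T]}(x)\in B)}{\lambda^k(\eta)}\le\limsup_{\eta\downarrow0}\frac{\sup_{x\in A}\mathbf P(X^{\eta|b}_{[0,T]}(x)\in B)}{\lambda^k(\eta)}\le\sup_{x\in A}\mathbf C^{(k)|b}_{[0,T]}(B^-;x)<\infty,$$ where $B^\circ$ and $B^-$ are the interior and closure of 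$B$.
   Context: $\|\cdot\|$ is the Euclidean norm (operator norm for matrices); $u\vee v=\max\{u,v\}$, $u\wedge v=\min\{u,v\}$. $\mathbb M$-convergence. For a metric space $(\mathbb S,\mathbf d)$ and Borel $\mathbb C\subseteq\mathbb S$, let $\mathbb C^r=\{y:\inf_{c\in\mathbb C}\mathbf d(c,y)\le r\}$ ($\inf\emptyset=\infty$). $\mathbb M(\mathbb S\setminus\mathbb C)$ is the set of Borel measures $\nu$ on $\mathbb S\setminus\mathbb C$ with $\nu(\mathbb S\setminus\mathbb C^r)<\infty$ for all $r>0$; $\mathcal C(\mathbb S\setminus\mathbb C)$ is the set of non-negative bounded continuous functions on $\mathbb S\setminus\mathbb C$ vanishing on $\mathbb C^r$ for some $r>0$. $\nu_n\to\nu$ in $\mathbb M(\mathbb S\setminus\mathbb C)$ means $\nu_n(f)\to\nu(f)$ for all $f\in\mathcal C(\mathbb S\setminus\mathbb C)$, where $\nu(f)=\int f\,d\nu$; for families, $\mu^\eta_\theta\to\mu_\theta$ uniformly in $\theta$ on $\Theta$ as $\eta\downarrow0$ means $\sup_{\theta\in\Theta}|\mu^\eta_\theta(f)-\mu_\theta(f)|\to0$ for all such $f$. Measures on $\mathbb S$ are restricted to $\mathbb S\setminus\mathbb C$. Sets $E,F$ are bounded away from each other if $\inf_{x\in E,y\in F}\mathbf d(x,y)>0$. Noise. $Z,Z_1,Z_2,\dots$ are iid random vectors in $\mathbb R^d$; $H(x)=\mathbf P(\|Z\|>x)$; $\lambda(\eta)=\eta^{-1}H(\eta^{-1})$, $\lambda^k(\eta)=(\lambda(\eta))^k$.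 $\mathfrak N_d$ is the unit sphere of $\mathbb R^d$; $\Phi(x)=(\|x\|,x/\|x\|)$ for $x\ne0$, $\Phi(0)=(0,(1,0,\dots,0))$; $\nu_\alpha$ is the Borel measure on $(0,\infty)$ with $\nu_\alpha[x,\infty)=x^{-\alpha}$. ''$Z$ is multivariate regularly varying with index $\alpha$ and spectral measure $\mathbf S$'' means: $\lim_{x\to\infty}H(tx)/H(x)=t^{-\alpha}$ for all $t>0$, and with $(R,\Theta)=\Phi(Z)$, $\mathbf P((x^{-1}R,\Theta)\in\cdot)/H(x)\to\nu_\alpha\times\mathbf S$ in $\mathbb M\big(([0,\infty)\times\mathfrak N_d)\setminus(\{0\}\times\mathfrak N_d)\big)$ as $x\to\infty$. Process. $a:\mathbb R^m\to\mathbb R^m$, $\sigma:\mathbb R^m\to\mathbb R^{m\times d}$. For $b\in(0,\infty)$, $\varphi_b(w)=(\frac b{\|w\|}\wedge1)w$ for $w\ne0$, $\varphi_b(0)=0$. For $\eta>0$: $X^{\eta|b}_0(x)=x$, $X^{\eta|b}_t(x)=X^{\eta|b}_{t-1}(x)+\varphi_b\big(\eta a(X^{\eta|b}_{t-1}(x))+\eta\sigma(X^{\eta|b}_{t-1}(x))Z_t\big)$ for $t\ge1$, and $X^{\eta|b}_{[0,T]}(x)=\{X^{\eta|b}_{\lfloor t/\eta\rfloor}(x):t\in[0,T]\}$. Path space. $\mathbb D[0,T]$ is the space of càdlàg functions $[0,T]\to\mathbb R^m$ with the Skorokhod $J_1$ metric $\inf_{\lambda}\sup_{t\in[0,T]}|\lambda(t)-t|\vee\|x(\lambda(t))-y(t)\|$,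 infimum over increasing homeomorphisms $\lambda$ of $[0,T]$. For $E\subseteq\mathbb R$, $E^{k\uparrow}=\{(t_1,\dots,t_k)\in E^k:t_1<\dots<t_k\}$. Perturbed ODE. For $x\in\mathbb R^m$, $W=(w_1,\dots,w_k)\in\mathbb R^{d\times k}$, $V=(v_1,\dots,v_k)\in\mathbb R^{m\times k}$, $\mathbf t=(t_1,\dots,t_k)\in(0,T]^{k\uparrow}$, let $\bar h^{(k)|b}_{[0,T]}(x,W,V,\mathbf t)=\xi\in\mathbb D[0,T]$ be the solution of $\xi_0=x$; $d\xi_s/ds=a(\xi_s)$ for $s\in[0,T]\setminus\{t_1,\dots,t_k\}$; $\xi_s=\xi_{s-}+v_j+\varphi_b(\sigma(\xi_{s-}+v_j)w_j)$ if $s=t_j$. Put $h^{(k)|b}_{[0,T]}(x,W,\mathbf t)=\bar h^{(k)|b}_{[0,T]}(x,W,(0,\dots,0),\mathbf t)$. For $k=0$ it is the solution of the ODE started at $x$. With $\bar B_\epsilon(0)$ the closed $\epsilon$-ball in $\mathbb R^m$, $\mathbb D^{(k)|b}_A[0,T](\epsilon)=\bar h^{(k)|b}_{[0,T]}\big(A\times\mathbb R^{d\times k}\times(\bar B_\epsilon(0))^k\times(0,T]^{k\uparrow}\big)$ and $\mathbb D^{(-1)|b}_A[0,T](\epsilon)=\emptyset$. Limit measure. $((\nu_\alpha\times\mathbf S)\circ\Phi)(E)=(\nu_\alpha\times\mathbf S)(\Phi(E))$ for Borel $E\subseteq\mathbb R^d\setminus\{0\}$, with $k$-fold product $((\nu_\alpha\times\mathbf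 S)\circ\Phi)^k$ in $W=(w_1,\dots,w_k)$; $\mathcal L^{k\uparrow}_T$ is Lebesgue measure restricted to $(0,T)^{k\uparrow}$; $$\mathbf C^{(k)|b}_{[0,T]}(\cdot;x)=\int\mathbb I\{h^{(k)|b}_{[0,T]}(x,W,\mathbf t)\in\cdot\}\,((\nu_\alpha\times\mathbf S)\circ\Phi)^k(dW)\times\mathcal L^{k\uparrow}_T(d\mathbf t),$$ which for $k=0$ is the Dirac mass at $h^{(0)|b}_{[0,T]}(x)$. *)

(* Defs.v *)
From HB Require Import structures.
From mathcomp Require Import all_boot all_order all_algebra.
From mathcomp Require Import finmap.
From mathcomp Require Import all_classical all_reals all_analysis.
From mathcomp Require Import ring lra.

Set Implicit Arguments.
Unset Strict Implicit.
Unset Printing Implicit Defensive.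

Import Order.TTheory GRing.Theory Num.Def Num.Theory.
Import numFieldTopology.Exports numFieldNormedType.Exports.

Local Open Scope classical_set_scope.
Local Open Scope ring_scope.

Section euclidean.
Context {R : realType}.

Definition enorm n (w : 'cV[R]_n) : R := Num.sqrt (\sum_i w i 0 ^+ 2).

Definition opnorm n p (M : 'M[R]_(n, p)) : R :=
  sup [set enorm (M *m w) | w in [set w : 'cV[R]_p | enorm w <= 1]].

Lemma enorm_ge0 n (w : 'cV[R]_n) : 0 <= enorm w.
Proof. exact: sqrtr_ge0. Qed.

Lemma enorm_sqr n (w : 'cV[R]_n) : enorm w ^+ 2 = \sum_i w i 0 ^+ 2.
Proof. by rewrite sqr_sqrtr// sumr_ge0// => i _; exact: sqr_ge0. Qed.

Lemma enorm0 n : enorm (0 : 'cV[R]_n) = 0.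
Proof. by rewrite /enorm big1 ?sqrtr0// => i _; rewrite mxE expr0n. Qed.

Lemma enorm0_eq0 n (w : 'cV[R]_n) : enorm w = 0 -> w = 0.
Proof.
move=> w0; have : \sum_i w i 0 ^+ 2 == 0 by rewrite -enorm_sqr w0 expr0n.
rewrite psumr_eq0 => [/allP h|i _]; last exact: sqr_ge0.
apply/matrixP => i j; rewrite (ord1 j) mxE; apply/eqP.
by have := h i (mem_index_enum _); rewrite /= sqrf_eq0.
Qed.

Lemma enormZ n (c : R) (w : 'cV[R]_n) : enorm (c *: w) = `|c| * enorm w.
Proof.
rewrite /enorm (eq_bigr (fun i => c ^+ 2 * w i 0 ^+ 2)).
  by rewrite -mulr_sumr sqrtrM ?sqr_ge0// sqrtr_sqr.
by move=> i _; rewrite mxE exprMn.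
Qed.

Lemma enormB n (v w : 'cV[R]_n) : enorm (v - w) = enorm (w - v).
Proof. by rewrite -opprB -scaleN1r enormZ normrN normr1 mul1r. Qed.

Lemma cauchy_schwarz n (v w : 'cV[R]_n) :
  \sum_i v i 0 * w i 0 <= enorm v * enorm w.
Proof.
have [->|v0] := eqVneq v 0.
  by rewrite enorm0 mul0r big1// => i _; rewrite mxE mul0r.
have [->|w0] := eqVneq w 0.
  by rewrite enorm0 mulr0 big1// => i _; rewrite mxE mulr0.
have pv : 0 < enorm v.
  by rewrite lt_neqAle enorm_ge0 andbT eq_sym; apply: contra v0 => /eqP/enorm0_eq0->.
have pw : 0 < enorm w.
  by rewrite lt_neqAle enorm_ge0 andbT eq_sym; apply: contra w0 => /eqP/enorm0_eq0->.
set c := enorm v; set e := enorm w.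
have : 0 <= \sum_i (e * v i 0 - c * w i 0) ^+ 2 by apply: sumr_ge0 => i _; exact: sqr_ge0.
rewrite (eq_bigr (fun i => e ^+ 2 * v i 0 ^+ 2 + (c ^+ 2 * w i 0 ^+ 2) +
    (- (c * e *+ 2)) * (v i 0 * w i 0))); last by move=> i _; ring.
rewrite !big_split/= -!mulr_sumr -!enorm_sqr -/c -/e => h.
rewrite -(@ler_pM2l _ (c * e *+ 2)) ?pmulrn_lgt0 ?mulr_gt0//.
rewrite -subr_ge0; apply: le_trans h _; rewrite le_eqVlt; apply/orP; left; apply/eqP; ring.
Qed.

Lemma enormD n (v w : 'cV[R]_n) : enorm (v + w) <= enorm v + enorm w.
Proof.
rewrite -(@ler_pXn2r _ 2)// ?nnegrE ?addr_ge0 ?enorm_ge0//.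
rewrite sqrrD enorm_sqr !enorm_sqr.
rewrite (eq_bigr (fun i => v i 0 ^+ 2 + (v i 0 * w i 0) *+ 2 + w i 0 ^+ 2)); last first.
  by move=> i _; rewrite mxE sqrrD.
by rewrite !big_split/= lerD2r lerD2l -mulr2n lerMn2r/= cauchy_schwarz.
Qed.

Lemma enorm_dist_triangle n (u v w : 'cV[R]_n) :
  enorm (u - w) <= enorm (u - v) + enorm (v - w).
Proof. by rewrite -[u - w](subrKA v) enormD. Qed.

Lemma enorm_le_norm n (w : 'cV[R]_n) : enorm w <= n%:R * `|w|.
Proof.
rewrite -(@ler_pXn2r _ 2)// ?nnegrE ?enorm_ge0 ?mulr_ge0//.
rewrite enorm_sqr (@le_trans _ _ (\sum_(i < n) `|w| ^+ 2))//.
  apply: ler_sum => i _; rewrite -[leLHS]ger0_norm ?sqr_ge0// normrX.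
  rewrite ler_pXn2r ?nnegrE//.
  by rewrite [leRHS]/normr/= mx_normrE; apply: (le_bigmax _ _ (i, 0)).
rewrite sumr_const card_ord exprMn -[leLHS]mulr_natl. rewrite ler_wpM2r ?sqr_ge0//.
by case: n w => [|n] w; rewrite ?expr0n// ler_eXnr// ler1n.
Qed.

End euclidean.

Section product_metric.
Context {R : realType} {U V : metricType R}.
Implicit Types p q : U * V.

Let dist p q : R := Num.max (mdist p.1 q.1) (mdist p.2 q.2).

Let dist_ge0 p q : 0 <= dist p q.
Proof. by rewrite /dist le_max mdist_ge0. Qed.

Let dist_pos p q : dist p q = 0 -> p = q.
Proof.
move=> pq; have [h1 h2] : mdist p.1 q.1 <= 0 /\ mdist p.2 q.2 <= 0.
  by apply/andP; rewrite -ge_max -/(dist p q) pq.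
case: p q {pq} h1 h2 => p1 p2 [q1 q2] /= h1 h2.
by congr (_, _); apply: mdist_positivity; apply/eqP; rewrite eq_le mdist_ge0 ?h1 ?h2.
Qed.

Let dist_ball p d : ball p d = [set q | dist p q < d].
Proof.
apply/seteqP; split => q; rewrite /ball/= /prod_ball !ballEmdist/= gt_max.
  by move=> [-> ->].
by move/andP.
Qed.

HB.instance Definition _ :=
  @PseudoMetric_isMetric.Build R (U * V)%type dist dist_ge0 dist_pos dist_ball.

End product_metric.

#[short(type="pmetricType")]
HB.structure Definition PointedMetric (R : numDomainType) :=
  {T of Metric R T & isPointed T}.

HB.instance Definition _ (R : realType) (U V : pmetricType R) :=
  Metric.on (U * V)%type.

Definition borel_space (T : ptopologicalType) := g_sigma_algebraType (@open T).

Section m_convergence.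
Context {R : realType} {T : pmetricType R}.
Implicit Types (C E F : set T) (nu : set T -> \bar R).
Local Open Scope ereal_scope.

Definition fattening C (r : R) : set T :=
  [set y | ereal_inf [set (mdist c y)%:E | c in C] <= r%:E].

Definition bounded_away E F : Prop :=
  0 < ereal_inf [set (mdist p.1 p.2)%:E | p in E `*` F].

(* A Borel measure on ~` C is given as the restriction of a Borel measure on the
   whole space; only the values of nu on Borel subsets of ~` C matter. *)
Definition in_M C nu : Prop :=
  (exists mu : {measure set (borel_space T) -> \bar R},
     forall E : set (borel_space T), measurable E -> E `<=` ~` C -> nu E = mu E) /\
  (forall r : R, (0 < r)%R -> nu (~` fattening C r) < +oo).

(* Only the values of f on ~` C matter. *)
Definition test_function C (f : T -> R) : Prop :=
  [/\ {within ~` C, continuous f},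
      forall y, ~ C y -> (0 <= f y)%R,
      exists M : R, forall y, ~ C y -> (f y <= M)%R &
      exists2 r : R, (0 < r)%R &
        forall y, ~ C y -> fattening C r y -> f y = 0%R].

Definition M_integral C nu (f : T -> R) : \bar R :=
  \int[nu : set (borel_space T) -> \bar R]_(y in ~` C) (f y)%:E.

Definition M_cvg C I (F : set_system I) (mu : I -> set T -> \bar R) nu : Prop :=
  [/\ \forall i \near F, in_M C (mu i), in_M C nu &
      forall f, test_function C f ->
        M_integral C (mu i) f @[i --> F] --> M_integral C nu f].

Definition M_cvg_unif C I (F : set_system I) J (Theta : set J)
    (mu : I -> J -> set T -> \bar R) (nu : J -> set T -> \bar R) : Prop :=
  [/\ \forall i \near F, forall th, Theta th -> in_M C (mu i th),
      forall th, Theta th -> in_M C (nu th) &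
      forall f, test_function C f ->
        ereal_sup [set `|M_integral C (mu i th) f - M_integral C (nu th) f|
                  | th in Theta] @[i --> F] --> 0].

End m_convergence.

Section skorokhod.
Context {R : realType}.

Definition cadlag (T : R) n (f : R -> 'cV[R]_n) : Prop :=
  (forall t : R, 0 <= t < T -> f s @[s --> t^'+] --> f t) /\
  (forall t : R, 0 < t <= T -> cvg (f s @[s --> t^'-])).

(* Functions on [0, T] are encoded as functions on R that vanish off [0, T]. *)
Record skorokhod (T : R) n := Skorokhod {
  path :> R -> 'cV[R]_n ;
  path_cadlag : cadlag T path ;
  path_out : forall t : R, t \notin `[0, T] -> path t = 0 }.

Lemma skorokhod_ext T n (x y : skorokhod T n) :
  {in `[0, T], x =1 y} -> x = y.
Proof.
move=> xy; have e : path x = path y.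
  apply/funext => t; have [/xy//|tT] := boolP (t \in `[0, T]).
  by rewrite !path_out.
case: x y e {xy} => x cx ox [y cy oy] /= e; subst y.
by congr Skorokhod; exact: Prop_irrelevance.
Qed.

Lemma cadlag0 T n : cadlag T (fun=> 0 : 'cV[R]_n).
Proof. by split=> t _; [exact: cvg_cst|exact: is_cvg_cst]. Qed.

Definition skorokhod0 T n : skorokhod T n :=
  @Skorokhod T n (fun=> 0) (cadlag0 T n) (fun=> fun=> erefl).

HB.instance Definition _ T n := gen_eqMixin (skorokhod T n).
HB.instance Definition _ T n := gen_choiceMixin (skorokhod T n).
HB.instance Definition _ T n := isPointed.Build (skorokhod T n) (skorokhod0 T n).

Lemma cadlag_bounded T n (f : R -> 'cV[R]_n) : cadlag T f ->
  exists M : R, forall t : R, t \in `[0, T] -> enorm (f t) <= M.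
Proof.
move=> [fr fl].
have locr t : t \in `[0, T] -> exists2 e : R, 0 < e &
    exists c : R, forall s, s \in `[0, T] -> t < s -> `|t - s| < e -> `|f s| <= c.
  move=> /[!in_itv]/= /andP[t0 tT].
  have [tltT|Tlet] := ltP t T; last first.
    exists 1 => //; exists 0 => s /[!in_itv]/= /andP[_ sT] ts _.
    by have := lt_le_trans ts (le_trans sT Tlet); rewrite ltxx.
  have /fr /cvgrPdist_lt /(_ 1 ltr01)[e e0 he] : 0 <= t < T by rewrite t0.
  exists e => //; exists (`|f t| + 1) => s _ ts tse.
  have {}he := he s tse ts.
  by rewrite -[f s](subrK (f t)) (le_trans (ler_normD _ _))// addrC lerD2l distrC ltW.
have locl t : t \in `[0, T] -> exists2 e : R, 0 < e &
    exists c : R, forall s, s \in `[0, T] -> s < t -> `|t - s| < e -> `|f s| <= c.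
  move=> /[!in_itv]/= /andP[t0 tT].
  have [tgt0|tle0] := ltP 0 t; last first.
    exists 1 => //; exists 0 => s /[!in_itv]/= /andP[s0 _] st _.
    by have := lt_le_trans st (le_trans tle0 s0); rewrite ltxx.
  have /fl /cvg_ex[l] : 0 < t <= T by rewrite tgt0.
  move=> /cvgrPdist_lt /(_ 1 ltr01)[e e0 he].
  exists e => //; exists (`|l| + 1) => s _ ts tse.
  have {}he := he s tse ts.
  by rewrite -[f s](subrK l) (le_trans (ler_normD _ _))// addrC lerD2l distrC ltW.
have /compact_near_coveringP/near_covering_withinP/(_ R +oo%R
    (fun M s => `|f s| <= M)) := @segment_compact R 0 T.
case.
  move=> t /= tT.
  have [e1 e10 [c1 h1]] := locr _ tT.
  have [e2 e20 [c2 h2]] := locl _ tT.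
  exists ([set s | `|t - s| < Num.min e1 e2],
          [set M | Num.max `|f t| (Num.max c1 c2) <= M]) => /=.
    split; first by exists (Num.min e1 e2) => //=; rewrite lt_min e10.
    by apply: nbhs_pinfty_ge; rewrite num_real.
  move=> [s M] /= []; rewrite lt_min !ge_max => /andP[se1 se2] /and3P[M0 M1 M2] sT.
  have [st|ts|->//] := ltgtP s t.
    exact: le_trans (h2 s sT st se2) M2.
  exact: le_trans (h1 s sT ts se1) M1.
move=> M0 [_ hM]; exists (n%:R * (M0 + 1)) => t tT.
apply: le_trans (enorm_le_norm _) _.
by apply: ler_wpM2l => //; apply: hM tT; rewrite ltrDl.
Qed.

(* Increasing homeomorphisms of [0, T], l' being the inverse of l; values off
   [0, T] are irrelevant. *)
Definition time_change (T : R) (l : R -> R) : Prop :=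
  {in `[0, T] &, {homo l : s t / s < t}} /\
  exists l' : R -> R,
    [/\ {homo l : t / t \in `[0, T]}, {homo l' : t / t \in `[0, T]},
        {in `[0, T], cancel l l'} /\ {in `[0, T], cancel l' l},
        {within `[0, T], continuous l} & {within `[0, T], continuous l'}].

Definition J1_cost T n (x y : R -> 'cV[R]_n) (l : R -> R) : R :=
  sup [set Num.max `|l t - t| (enorm (x (l t) - y t)) | t in `[0, T]].

Definition J1_dist T n (x y : R -> 'cV[R]_n) : R :=
  inf [set J1_cost T x y l | l in time_change T].

Lemma time_change_id T : time_change T id.
Proof.
by split=> //; exists id; split=> //; apply: continuous_subspaceT => t; exact: cvg_id.
Qed.

Lemma time_change_inv T l : time_change T l ->
  exists2 l', time_change T l' & [/\ {homo l : t / t \in `[0, T]},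
    {homo l' : t / t \in `[0, T]}, {in `[0, T], cancel l l'} &
    {in `[0, T], cancel l' l}].
Proof.
move=> [li [l' [h h' [k k'] c c']]]; exists l' => //; split; last by exists l.
move=> s t sT tT st; rewrite ltNge; apply/negP; rewrite le_eqVlt => /orP[/eqP e|e].
  have := k' _ tT; rewrite e (k' _ sT) => ets; by move: st; rewrite ets ltxx.
have := li _ _ (h' _ tT) (h' _ sT) e.
by rewrite k'// k'// ltNge (ltW st).
Qed.

Lemma within_continuous_itv_comp T (f g : R -> R) :
  {homo f : t / t \in `[0, T]} ->
  {within `[0, T], continuous f} -> {within `[0, T], continuous g} ->
  {within `[0, T], continuous (g \o f)}.
Proof.
move=> h /subspace_continuousP cf /subspace_continuousP cg.
apply/subspace_continuousP => t /= tT U Ug.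
have := cf _ tT _ (cg _ (h _ tT) _ Ug).
by rewrite /nbhs/= /within/=; apply: filterS => s hs sT; apply: hs => //; exact: h.
Qed.

Lemma time_change_comp T l1 l2 : time_change T l1 -> time_change T l2 ->
  time_change T (l1 \o l2).
Proof.
move=> [i1 [l1' [h1 h1' [k1 k1'] c1 c1']]] [i2 [l2' [h2 h2' [k2 k2'] c2 c2']]].
split.
  by move=> s t sT tT st /=; apply: i1; [exact: h2|exact: h2|exact: i2].
exists (l2' \o l1'); split.
- by move=> t tT /=; apply/h1/h2.
- by move=> t tT /=; apply/h2'/h1'.
- by split=> t tT /=; [rewrite k1 ?k2 ?h2|rewrite k2' ?k1' ?h1'].
- exact: within_continuous_itv_comp.
- exact: within_continuous_itv_comp.
Qed.

Lemma J1_cost_ubound T n (x y : skorokhod T n) l : time_change T l ->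
  has_ubound [set Num.max `|l t - t| (enorm (x (l t) - y t)) | t in `[0, T]].
Proof.
move=> [_ [_ [h _ _ _ _]]].
have [M hM] := cadlag_bounded (path_cadlag x).
have [N hN] := cadlag_bounded (path_cadlag y).
exists (Num.max T (M + N)) => _ [t /= tT <-]; rewrite ge_max; apply/andP; split.
  rewrite le_max ler_norml; apply/orP; left.
  by move: (h _ tT) (tT); rewrite !in_itv/= => /andP[? ?] /andP[? ?]; apply/andP; split; lra.
rewrite le_max; apply/orP; right.
apply: le_trans (enormD _ _) _; rewrite -scaleN1r enormZ normrN1 mul1r lerD ?hN ?hM//.
exact: h.
Qed.

Lemma J1_cost_ge0 T n (x y : R -> 'cV[R]_n) l : 0 <= J1_cost T x y l.
Proof.
rewrite /J1_cost; set E := (X in sup X).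
have [hE|/sup_out ->//] := pselect (has_sup E).
have [[z Ez] ubE] := hE; apply: le_trans (ub_le_sup ubE Ez).
by case: Ez => t _ <-; rewrite le_max normr_ge0.
Qed.

Lemma J1_cost_ge T n (x y : skorokhod T n) l t : time_change T l ->
  t \in `[0, T] ->
  `|l t - t| <= J1_cost T x y l /\ enorm (x (l t) - y t) <= J1_cost T x y l.
Proof.
move=> hl tT; apply/andP; rewrite -ge_max.
by apply: (ub_le_sup (J1_cost_ubound x y hl)); exists t.
Qed.

Lemma J1_has_inf T n (x y : R -> 'cV[R]_n) :
  has_inf [set J1_cost T x y l | l in time_change T].
Proof.
split; first by exists (J1_cost T x y id); exists id => //; exact: time_change_id.
by exists 0 => _ [l _ <-]; exact: J1_cost_ge0.
Qed.

Lemma J1_ge0 T n (x y : R -> 'cV[R]_n) : 0 <= J1_dist T x y.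
Proof.
apply: lb_le_inf; first by have [] := J1_has_inf T x y.
by move=> _ [l _ <-]; exact: J1_cost_ge0.
Qed.

Lemma J1_approx T n (x y : R -> 'cV[R]_n) e : J1_dist T x y < e ->
  exists2 l, time_change T l & J1_cost T x y l < e.
Proof.
by move=> /(inf_lt (proj1 (J1_has_inf T x y)))[_ [l hl <-] le]; exists l.
Qed.

Lemma J1_xx T n (x : skorokhod T n) : J1_dist T x x = 0.
Proof.
apply/eqP; rewrite eq_le J1_ge0 andbT.
have hid := time_change_id T.
apply: (@le_trans _ _ (J1_cost T x x id)).
  by apply: (ge_inf (proj2 (J1_has_inf T x x))); exists id.
rewrite /J1_cost; have [e|] := eqVneq ([set Num.max `|id t - t|
    (enorm (x (id t) - x t)) | t in `[0, T]]) set0; first by rewrite e sup0.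
move=> /set0P ne; apply: ge_sup => // _ [t _ <-].
by rewrite !subrr normr0 enorm0 maxxx.
Qed.

Lemma time_change_bnd T l : 0 <= T -> time_change T l -> l T = T.
Proof.
move=> T0 hl; have [l' _ [h h' k k']] := time_change_inv hl.
have TT : T \in `[0, T] by rewrite in_itv/= T0 lexx.
have := h _ TT; rewrite in_itv/= => /andP[_].
rewrite le_eqVlt => /orP[/eqP//|lT].
have := h' _ TT; rewrite in_itv/= => /andP[_].
rewrite le_eqVlt => /orP[/eqP e|l'T]; first by move: (k' _ TT); rewrite e.
have [hi _] := hl; have := hi _ _ (h' _ TT) TT l'T.
by rewrite k'// => /(lt_trans lT); rewrite ltxx.
Qed.

Lemma J1_eq0 T n (x y : skorokhod T n) : J1_dist T x y = 0 -> x = y.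
Proof.
move=> xy0; apply: skorokhod_ext => t tT.
have /andP[t0 tleT] : 0 <= t <= T by rewrite in_itv/= in tT.
apply/subr0_eq/enorm0_eq0/eqP; rewrite eq_le enorm_ge0 andbT.
apply/ler_addgt0Pr => e e0; rewrite add0r.
have e3 : 0 < e / 3 by rewrite divr_gt0.
move: tleT; rewrite le_eqVlt => /orP[/eqP tE|tltT].
  have [|l hl le] := @J1_approx T n x y e; first by rewrite xy0.
  have [_] := J1_cost_ge x y hl tT.
  by rewrite tE (time_change_bnd _ hl) -?tE// => /le_trans; apply; exact: ltW.
have tTi : 0 <= t < T by rewrite t0.
have small (z : skorokhod T n) : exists2 r : R, 0 < r &
    forall s, t < s -> `|t - s| < r -> enorm (z s - z t) < e / 3.
  have [zr _] := path_cadlag z.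
  have d0 : 0 < e / 3 / n.+1%:R by rewrite divr_gt0.
  have /cvgrPdist_lt /(_ _ d0)[r r0 hr] := zr _ tTi.
  exists r => // s ts tsr; rewrite enormB (le_lt_trans (enorm_le_norm _))//.
  have := hr s tsr ts; rewrite ltr_pdivlMr// mulrC; apply: le_lt_trans.
  by rewrite ler_wpM2r// ler_nat.
have [r1 r10 hx] := small x; have [r2 r20 hy] := small y.
pose r := Num.min (Num.min r1 r2) (T - t).
have r0 : 0 < r by rewrite !lt_min r10 r20 subr_gt0.
have [rr1 rr2 rT] : [/\ r <= r1, r <= r2 & r <= T - t].
  by rewrite /r !ge_min !lexx !orbT.
have [|l hl le] := @J1_approx T n x y (Num.min (r / 4) (e / 3)).
  by rewrite xy0 lt_min divr_gt0.
have sT : t + r / 2 \in `[0, T] by rewrite in_itv/=; apply/andP; split; lra.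
have [] := J1_cost_ge x y hl sT.
move: le; rewrite lt_min => /andP[le1 le2].
move=> /le_lt_trans/(_ le1) + /le_lt_trans/(_ le2) le.
rewrite ltr_norml => /andP[ls1 ls2].
have hyy : enorm (y (t + r / 2) - y t) < e / 3.
  by apply: hy; [lra|rewrite ltr_norml; apply/andP; split; lra].
have hxx : enorm (x (l (t + r / 2)) - x t) < e / 3.
  by apply: hx; [lra|rewrite ltr_norml; apply/andP; split; lra].
apply: le_trans (enorm_dist_triangle _ (x (l (t + r / 2))) _) _.
rewrite enormB.
have := enorm_dist_triangle (x (l (t + r / 2))) (y (t + r / 2)) (y t).
lra.
Qed.

Lemma J1_sym_le T n (x y : R -> 'cV[R]_n) : J1_dist T x y <= J1_dist T y x.
Proof.
apply: lb_le_inf; first by have [] := J1_has_inf T y x.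
move=> _ [l hl <-]; have [l' hl' [h h' k k']] := time_change_inv hl.
suff <- : J1_cost T x y l' = J1_cost T y x l.
  by apply: (ge_inf (proj2 (J1_has_inf T x y))); exists l'.
rewrite /J1_cost; congr sup; apply/seteqP; split => _ [t tT <-].
  by exists (l' t); [exact: h'|rewrite k'// distrC enormB].
by exists (l t); [exact: h|rewrite k// distrC enormB].
Qed.

Lemma J1_sym T n (x y : skorokhod T n) : J1_dist T x y = J1_dist T y x.
Proof. by apply/eqP; rewrite eq_le !J1_sym_le. Qed.

Lemma J1_triangle T n (y x z : skorokhod T n) :
  J1_dist T x z <= J1_dist T x y + J1_dist T y z.
Proof.
apply/ler_addgt0Pr => e e0; have e2 : 0 < e / 2 by rewrite divr_gt0.
have [|l1 hl1 c1] := @J1_approx T n x y (J1_dist T x y + e / 2).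
  by rewrite ltrDl.
have [|l2 hl2 c2] := @J1_approx T n y z (J1_dist T y z + e / 2).
  by rewrite ltrDl.
apply: (@le_trans _ _ (J1_cost T x z (l1 \o l2))).
  apply: (ge_inf (proj2 (J1_has_inf T x z))); exists (l1 \o l2) => //.
  exact: time_change_comp.
apply: (@le_trans _ _ (J1_cost T x y l1 + J1_cost T y z l2)); last lra.
have [_ _ [h2 _ _ _]] := time_change_inv hl2.
rewrite {1}/J1_cost; have [->|] := eqVneq ([set Num.max `|(l1 \o l2) t - t|
    (enorm (x ((l1 \o l2) t) - z t)) | t in `[0, T]]) set0.
  by rewrite sup0 addr_ge0// J1_cost_ge0.
move=> /set0P ne; apply: ge_sup => // _ [t /= tT <-].
have [a1 b1] := J1_cost_ge x y hl1 (h2 _ tT).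
have [a2 b2] := J1_cost_ge y z hl2 tT.
rewrite ge_max; apply/andP; split.
  by rewrite -(subrKA (l2 t)) (le_trans (ler_normD _ _))// lerD.
by rewrite (le_trans (enorm_dist_triangle _ (y (l2 t)) _))// lerD.
Qed.

HB.instance Definition _ T n := @isMetric.Build R (skorokhod T n)
  (fun x y => J1_dist T x y) (@J1_xx T n) (@J1_eq0 T n) (@J1_sym T n)
  (@J1_triangle T n).

End skorokhod.

Section noise.
Context {R : realType}.

Definition sphere d := {v : 'cV[R]_d.+1 | enorm v == 1}.
Definition ray := {r : R | 0 <= r}.

Lemma enorm_e1 d : enorm (delta_mx 0 0 : 'cV[R]_d.+1) == 1.
Proof.
rewrite /enorm (bigD1 0)//= big1 => [|i i0].
  by rewrite mxE !eqxx expr1n addr0 sqrtr1.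
by rewrite mxE (negbTE i0) expr0n.
Qed.

Definition e1 d : sphere d := exist (fun v => enorm v == 1) _ (enorm_e1 d).

HB.instance Definition _ d := Choice.on (sphere d).
HB.instance Definition _ := Choice.on ray.
HB.instance Definition _ d := isPointed.Build (sphere d) (e1 d).
HB.instance Definition _ := isPointed.Build ray (exist (fun r => 0 <= r) 0 (lexx 0)).

Section sphere_metric.
Variable d : nat.
Implicit Types u v w : sphere d.
Let dist u v : R := enorm (val u - val v).
Let dist_xx u : dist u u = 0. Proof. by rewrite /dist subrr enorm0. Qed.
Let dist_pos u v : dist u v = 0 -> u = v.
Proof. by move=> /enorm0_eq0/subr0_eq/val_inj. Qed.
Let dist_sym u v : dist u v = dist v u. Proof. exact: enormB. Qed.
Let dist_triangle v u w : dist u w <= dist u v + dist v w.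
Proof. exact: enorm_dist_triangle. Qed.
HB.instance Definition _ := @isMetric.Build R (sphere d)
  dist dist_xx dist_pos dist_sym dist_triangle.
End sphere_metric.

Section ray_metric.
Implicit Types r s t : ray.
Let dist r s : R := `|val r - val s|.
Let dist_xx r : dist r r = 0. Proof. by rewrite /dist subrr normr0. Qed.
Let dist_pos r s : dist r s = 0 -> r = s.
Proof. by move=> /normr0_eq0/subr0_eq/val_inj. Qed.
Let dist_sym r s : dist r s = dist s r. Proof. exact: distrC. Qed.
Let dist_triangle s r t : dist r t <= dist r s + dist s t.
Proof. by rewrite /dist -(subrKA (val s)) ler_normD. Qed.
HB.instance Definition _ := @isMetric.Build R ray
  dist dist_xx dist_pos dist_sym dist_triangle.
End ray_metric.

(* Elements of [0, +oo[ x sphere are identified with their images in R x sphere,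
   where Phi and the product measure nu_alpha x S take their values. *)
Definition polar_val d (p : ray * sphere d) : R * sphere d := (val p.1, p.2).

(* For w = 0 the vector enorm w ^-1 *: w is 0, so insubd returns e1. *)
Definition Phi d (w : 'cV[R]_d.+1) : R * sphere d :=
  (enorm w, insubd (e1 d) ((enorm w)^-1 *: w)).

Lemma Phi0 d : Phi (0 : 'cV[R]_d.+1) = (0, e1 d).
Proof.
rewrite /Phi enorm0 scaler0 /insubd insubF// enorm0.
by apply/negbTE; rewrite eq_sym oner_neq0.
Qed.

Lemma Phi_neq0 d (w : 'cV[R]_d.+1) : w != 0 ->
  val (Phi w).2 = (enorm w)^-1 *: w.
Proof.
move=> w0; have n0 : enorm w != 0 by apply: contra w0 => /eqP/enorm0_eq0->.
rewrite /Phi/= insubdK// /in_mem/= enormZ ger0_norm ?invr_ge0 ?enorm_ge0//.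
by rewrite mulVf.
Qed.

Local Open Scope ereal_scope.

Definition nu_alpha (alpha : R) (E : set R) : \bar R :=
  \int[lebesgue_measure]_(r in E `&` `]0%R, +oo[)
    (alpha * r `^ (- alpha - 1))%:E.

Lemma nu_alpha_tail (alpha x : R) : (0 < alpha)%R -> (0 < x)%R ->
  nu_alpha alpha `[x, +oo[ = (x `^ (- alpha))%:E.
Proof.
move=> a0 x0; rewrite /nu_alpha setIidl; last first.
  by move=> r /=; rewrite !in_itv/= !andbT; exact: lt_le_trans.
have dpow (r : R) : (0 < r)%R -> is_derive r 1%R
    (fun s => - s `^ (- alpha))%R (alpha * r `^ (- alpha - 1))%R.
  move=> r0; have := is_deriveN (is_derive1_powR (- alpha) r0).
  by rewrite -mulNr opprK.
rewrite (@ge0_continuous_FTC2y _ _ (fun r => - r `^ (- alpha))%R _ 0%R).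
- by rewrite sub0e EFinN oppeK.
- by move=> r _; rewrite mulr_ge0 ?powR_ge0// ltW.
- apply: derivable_within_continuous => r; rewrite in_itv/= andbT => xr.
  have r0 := lt_le_trans x0 xr.
  have := is_derive1_powR (- alpha - 1) r0 => ?.
  by apply: derivableM => //; exact: ex_derive.
- rewrite -oppr0; apply: cvgN.
  apply/cvgrPdist_le => e e0; near=> r.
  have M0 : (0 <= (e^-1) `^ alpha^-1)%R by exact: powR_ge0.
  rewrite sub0r normrN ger0_norm ?powR_ge0// powRN.
  rewrite -[leRHS]invrK lef_pV2 ?posrE ?invr_gt0 ?powR_gt0//.
  have -> : (e^-1 = (e^-1 `^ alpha^-1) `^ alpha)%R.
    by rewrite -powRrM mulVf ?gt_eqF// powRr1// invr_ge0 ltW.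
  by apply: ge0_ler_powR; rewrite ?nnegrE// ltW.
- by move=> r xr; have [] := dpow _ (lt_trans x0 xr).
- apply: cvg_at_right_filter.
  suff : {for x, continuous (fun s : R => (- s `^ (- alpha))%R)} by [].
  apply/differentiable_continuous/derivable1_diffP.
  by have [] := dpow _ x0.
- move=> r; rewrite in_itv/= andbT => xr.
  by have [_ dE] := dpow _ (lt_trans x0 xr); rewrite derive1E dE.
Unshelve. all: by end_near. Qed.


Definition polar_measure d (alpha : R)
    (S : set (borel_space (sphere d)) -> \bar R) (E : set (ray * sphere d)) :=
  (nu_alpha alpha \x S) (@polar_val d @` E).

Definition jump_measure d (alpha : R)
    (S : set (borel_space (sphere d)) -> \bar R)
    (E : set (borel_space 'cV[R]_d.+1)) : \bar R :=
  (nu_alpha alpha \x S) (@Phi d @` (E `\ 0%R)).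

Section law.
Context {disp : measure_display} {Omega : measurableType disp}.
Context (P : probability Omega R) (d : nat).
Implicit Type Z : nat -> {RV P >-> borel_space 'cV[R]_d.+1}.

Definition mutually_independent Z : Prop :=
  forall (J : {fset nat}) (B : nat -> set (borel_space 'cV[R]_d.+1)),
    (forall i, measurable (B i)) ->
    P (\bigcap_(i in [set` J]) (Z i @^-1` B i)) =
    \prod_(i <- J) P (Z i @^-1` B i).

Definition identically_distributed Z : Prop :=
  forall i (B : set (borel_space 'cV[R]_d.+1)), measurable B ->
    P (Z i @^-1` B) = P (Z 0%N @^-1` B).

Definition iid Z := mutually_independent Z /\ identically_distributed Z.

(* With +oo - oo = -oo, a null expectation forces integrability. *)
Definition centered (X : Omega -> 'cV[R]_d.+1) : Prop :=
  forall i, 'E_P[fun w => X w i 0%R] = 0.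

Definition norm_tail (X : Omega -> 'cV[R]_d.+1) (x : R) : R :=
  fine (P [set w | x < enorm (X w)]%R).

Definition lambda X (eta : R) : R := (eta^-1 * norm_tail X eta^-1)%R.

Definition mv_regularly_varying (X : Omega -> 'cV[R]_d.+1) (alpha : R)
    (S : set (borel_space (sphere d)) -> \bar R) : Prop :=
  (forall t : R, (0 < t)%R ->
     (norm_tail X (t * x) / norm_tail X x)%R @[x --> +oo%R] --> (t `^ (- alpha))%R) /\
  M_cvg [set p : ray * sphere d | val p.1 = 0%R] (+oo%R : set_system R)
    (fun x E => P [set w | (@polar_val d @` E) (x^-1 * (Phi (X w)).1, (Phi (X w)).2)%R]
                * ((norm_tail X x)^-1)%:E)
    (polar_measure alpha S).

End law.
End noise.

Arguments sphere R d : clear implicits.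
Arguments ray R : clear implicits.

Section process.
Context {R : realType} {m d : nat}.
Variables (a : 'cV[R]_m -> 'cV[R]_m) (sigma : 'cV[R]_m -> 'M[R]_(m, d)).
Variable b : R.

Definition clip n (w : 'cV[R]_n) : 'cV[R]_n :=
  if w == 0 then 0 else Num.min (b / enorm w) 1 *: w.

Fixpoint chain (z : nat -> 'cV[R]_d) (eta : R) (x : 'cV[R]_m) (t : nat) :=
  if t is s.+1 then
    let y := chain z eta x s in
    y + clip (eta *: a y + eta *: (sigma y *m z t))
  else x.

Definition step_path (T eta : R) (u : nat -> 'cV[R]_m) (t : R) : 'cV[R]_m :=
  if t \in `[0, T] then u (Num.truncn (t / eta)) else 0.

Lemma step_path_cadlag T eta u : cadlag T (step_path T eta u).
Proof.
have [eta0|eta0] := leP eta 0.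
  have st (s : R) : s \in `[0, T] -> step_path T eta u s = u 0%N.
    rewrite /step_path => /[dup] sT ->; congr u; apply/eqP.
    rewrite -leqn0 -(@truncn0 R); apply: le_truncn.
    by apply: mulr_ge0_le0; [move: sT; rewrite in_itv/= => /andP[]|rewrite invr_le0].
  split=> t /andP[h1 h2].
    rewrite st ?in_itv/= ?h1 ?ltW//; apply: cvg_near_cst; near=> s.
    by rewrite st// in_itv/= (le_trans h1)//= ltW.
  apply: (cvgP (u 0%N)); apply: cvg_near_cst; near=> s.
  by rewrite st// in_itv/= ltW//= (le_trans _ h2)// ltW.
have itv (s : R) j : 0 <= s <= T -> j%:R * eta <= s < j.+1%:R * eta ->
    step_path T eta u s = u j.
  rewrite /step_path in_itv/= => -> js; congr u; apply: truncn_def.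
  by rewrite ler_pdivlMr// ltr_pdivrMr.
split=> t /andP[h1 h2].
  have /truncn_itv/andP[] : 0 <= t / eta by rewrite divr_ge0// ltW.
  set n := Num.truncn _; rewrite ler_pdivlMr// ltr_pdivrMr// => n1 n2.
  rewrite (itv t n) ?h1 ?n1 ?(ltW h2)//; apply: cvg_near_cst; near=> s.
  apply: itv; first by rewrite (le_trans h1)//= ltW.
  by apply/andP; split; [rewrite (le_trans n1)// ltW|].
have [j /andP[j1 j2]] : exists j : nat, j%:R * eta < t <= j.+1%:R * eta.
  have /truncn_itv/andP[] : 0 <= t / eta by rewrite divr_ge0// ltW.
  set n := Num.truncn _; rewrite ler_pdivlMr// ltr_pdivrMr//.
  rewrite le_eqVlt => /orP[/eqP nt _|n1 n2]; last by exists n; rewrite n1 ltW.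
  have n0 : (0 < n)%N.
    by rewrite lt0n; apply/eqP => n0; move: h1; rewrite -nt n0 mul0r ltxx.
  by exists n.-1; rewrite prednK// -nt lexx andbT ltr_pM2r// ltr_nat prednK.
apply: (cvgP (u j)); apply: cvg_near_cst; near=> s.
apply: itv; first by rewrite ltW//= (le_trans _ h2)// ltW.
by apply/andP; split; [rewrite ltW|rewrite (lt_le_trans _ j2)].
Unshelve. all: by end_near. Qed.

Lemma step_path_out T eta u (t : R) : t \notin `[0, T] -> step_path T eta u t = 0.
Proof. by rewrite /step_path => /negbTE->. Qed.

Definition chain_path (T : R) z eta x : skorokhod T m :=
  Skorokhod (step_path_cadlag T eta (chain z eta x))
            (@step_path_out T eta (chain z eta x)).

Definition increasing_times k (I : interval R) : set (k.-tuple R) :=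
  [set t | sorted <%R t /\ all (fun s => s \in I) t].

Definition perturbed_ode (T : R) k (x : 'cV[R]_m) (W : k.-tuple 'cV[R]_d)
    (V : k.-tuple 'cV[R]_m) (t : k.-tuple R) (xi : skorokhod T m) : Prop :=
  [/\ xi 0 = x,
      forall s : R, s \in `[0, T] -> s \notin (t : seq R) ->
        h^-1 *: (xi (s + h) - xi s)
          @[h --> within [set h | s + h \in `[0, T]] 0^'] --> a (xi s) &
      forall j : 'I_k,
        let y := lim (xi s @[s --> (tnth t j)^'-]) + tnth V j in
        xi (tnth t j) = y + clip (sigma y *m tnth W j)].

(* Under Lipschitz coefficients the solution exists and is unique for strictly
   increasing times in ]0, T]; point is the null path. *)
Definition hbar (T : R) k x (W : k.-tuple 'cV[R]_d) (V : k.-tuple 'cV[R]_m)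
    (t : k.-tuple R) : skorokhod T m :=
  xget point (perturbed_ode x W V t).

Definition h_map (T : R) k x (W : k.-tuple 'cV[R]_d) (t : k.-tuple R) :
  skorokhod T m := hbar T x W [tuple of nseq k 0] t.

Definition jump_paths (T : R) k (A : set 'cV[R]_m) (eps : R) :
    set (skorokhod T m) :=
  [set xi | exists x W V t,
     [/\ A x, forall j : 'I_k, enorm (tnth V j) <= eps,
         increasing_times `]0, T] t & xi = hbar T x W V t]].

(* jump_paths at index k - 1, empty for k = 0 *)
Definition jump_paths_pred (T : R) k (A : set 'cV[R]_m) (eps : R) :
    set (skorokhod T m) :=
  if k is j.+1 then @jump_paths T j A eps else set0.

End process.

Arguments jump_paths {R m d} a sigma b T k A eps _.
Arguments jump_paths_pred {R m d} a sigma b T k A eps _.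

Section limit_measure.
Context {R : realType}.
Local Open Scope ereal_scope.

Fixpoint product_power {disp : measure_display} {X : measurableType disp}
    (mu : set X -> \bar R) (k : nat) : set (k.-tuple X) -> \bar R :=
  if k is j.+1 then
    fun E => (mu \x product_power mu (k:=j))
      [set p : X * j.-tuple X | E (cons_tuple p.1 p.2)]
  else fun E => \d_([tuple] : 0.-tuple X) E.

Definition lebesgue_times (T : R) k (E : set (k.-tuple R)) : \bar R :=
  product_power lebesgue_measure (E `&` increasing_times `]0%R, T[).

Definition limit_measure {m d} a sigma (b alpha : R)
    (S : set (borel_space (sphere R d)) -> \bar R) (T : R) k (x : 'cV[R]_m.+1)
    (B : set (skorokhod T m.+1)) : \bar R :=
  \int[product_power (jump_measure alpha S) (k:=k) \x @lebesgue_times T k]_p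
    (\1_B (h_map a sigma b T x p.1 p.2))%:E.

End limit_measure.

Arguments limit_measure {R m d} a sigma b alpha S T k x B.

(* Main.v *)
Require Import Defs.
From HB Require Import structures.
From mathcomp Require Import all_boot all_order all_algebra.
From mathcomp Require Import finmap.
From mathcomp Require Import all_classical all_reals all_analysis.
From mathcomp Require Import measurable_realfun lebesgue_integral_fubini.
From mathcomp Require Import ring lra.

Set Implicit Arguments.
Unset Strict Implicit.
Unset Printing Implicit Defensive.

Import Order.TTheory GRing.Theory Num.Def Num.Theory.
Import numFieldTopology.Exports numFieldNormedType.Exports.

Local Open Scope classical_set_scope.
Local Open Scope ring_scope.


(* Lambda(eta) eta is the probability that one step has a noise eta Z of norm > 1,
   so a path with k jumps of macroscopic size costs lambda^k(eta).  Split the noise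
   at levels delta << delta'.  The contribution of the marks below delta is a
   truncated martingale, and an exponential-moment estimate makes the probability
   that it exceeds rho smaller than any power of eta.  Off this event Gronwall's
   inequality puts the chain within C (rho + delta + eta) of the perturbed ODE driven
   by the marks above delta.  More than k of these has probability o(lambda^k), and
   fewer than k marks, or a mark below delta', leave the path close to the set of paths
   with k - 1 jumps, where the test function vanishes.  Hence, for a Lipschitz test
   function f,
     f(X) = sum over k-subsets I of the steps of f(h(x, (eta Z_i)_(i in I), (eta i)_(i in I)))
   up to negligible errors.  By independence the expectation of the sum is an iterated
   integral: k noise integrals, which converge by regular variation, and k Riemann
   sums, which converge to Lebesgue integrals.  Errors are uniform for x near a given
   point, and compactness of A makes the limit uniform.  Semicontinuous functions
   (continuous test functions, indicators of open and closed sets) are reached by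
   monotone Lipschitz approximation. *)

(** The displacements [v_j] allowed in the excluded set make the comparison work. The gap between
    the chain and a flow line just before a large mark is booked as a displacement, so the
    comparison path restarts next to the chain and the error constant depends neither on the number
    nor on the size of the marks. A bound on the marks is needed only for [h_map], which is compared
    without displacements and is Lipschitz for bounded marks and times in the open interval; hence a
    cutoff at a level N, removed at the end by monotone convergence. The expected number of k-tuples
    of marks above a fixed level is of order lambda^k, so after division by lambda^k each term of
    the sum may carry an error of order rho with rho fixed, whereas exceptional events must be
    o(lambda^k). The level below which a mark makes the test function vanish is fixed first, then N,
    then rho, and last the truncation level del. The chain is adapted, not independent of the past;
    instead of conditional expectations, noise vectors are integrated one at a time, the chain being
    restarted after its first step. *)

Section euclid.
Context {R : realType}.

Lemma norm_le_enorm n (w : 'cV[R]_n) : `|w| <= enorm w.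
Proof.
rewrite [leLHS]/normr/= mx_normrE; apply: bigmax_le; first exact: enorm_ge0.
move=> [i j] _ /=; rewrite (ord1 j) -(@ler_pXn2r _ 2)// ?nnegrE ?enorm_ge0//.
rewrite enorm_sqr real_normK ?num_real// (bigD1 i)//= lerDl.
by apply: sumr_ge0 => l _; exact: sqr_ge0.
Qed.

Lemma entry_le_enorm n (w : 'cV[R]_n) i : `|w i 0| <= enorm w.
Proof.
apply: le_trans (norm_le_enorm w).
by rewrite [leRHS]/normr/= mx_normrE; apply: (le_bigmax _ _ (i, 0)).
Qed.

Lemma enorm_le_sum n (w : 'cV[R]_n) (c : R) :
  (forall i, `|w i 0| <= c) -> enorm w <= n%:R * c.
Proof.
case: n w => [|n] w h.
  by rewrite mul0r /enorm big_ord0 sqrtr0.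
apply: le_trans (enorm_le_norm _) _; rewrite ler_wpM2l//.
rewrite [leLHS]/normr/= mx_normrE; apply: bigmax_le => [|[i j] _].
  exact: le_trans (h ord0).
by rewrite (ord1 j).
Qed.

Lemma enormN n (w : 'cV[R]_n) : enorm (- w) = enorm w.
Proof. by rewrite -scaleN1r enormZ normrN normr1 mul1r. Qed.

Lemma enormBl n (v w : 'cV[R]_n) : enorm (v - w) <= enorm v + enorm w.
Proof. by rewrite -(enormN w) enormD. Qed.

Lemma enorm_sub_dist n (v w : 'cV[R]_n) : enorm v - enorm w <= enorm (v - w).
Proof. by rewrite lerBlDr -{1}(subrK w v) enormD. Qed.

Lemma enorm_dist n (v w : 'cV[R]_n) : `|enorm v - enorm w| <= enorm (v - w).
Proof.
by rewrite ler_norml enorm_sub_dist andbT lerNl opprB enormB enorm_sub_dist.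
Qed.

Lemma enorm_sum n (I : Type) (r : seq I) (P : pred I) (F : I -> 'cV[R]_n) :
  enorm (\sum_(i <- r | P i) F i) <= \sum_(i <- r | P i) enorm (F i).
Proof.
elim/big_rec2: _ => [|i y x _ h]; first by rewrite enorm0.
by apply: le_trans (enormD _ _) _; rewrite lerD2l.
Qed.

Lemma enorm_eq0 n (w : 'cV[R]_n) : (enorm w == 0) = (w == 0).
Proof. by apply/eqP/eqP => [/enorm0_eq0//|->]; rewrite enorm0. Qed.

Lemma enorm_gt0 n (w : 'cV[R]_n) : (0 < enorm w) = (w != 0).
Proof. by rewrite lt_neqAle enorm_ge0 andbT eq_sym enorm_eq0. Qed.

(** The topology of matrices comes from the sup norm; this lemma and the next pass to the Euclidean
    norm, in which all estimates are written. *)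
Lemma cvg_enorm n (T : Type) (F : set_system T) {FF : Filter F} (f : T -> 'cV[R]_n) (l : 'cV[R]_n) :
  (forall e : R, 0 < e -> \forall x \near F, enorm (l - f x) <= e) -> f @ F --> l.
Proof.
move=> h; apply/cvgrPdist_le => e e0; near=> x.
by apply: le_trans (norm_le_enorm _) _; near: x; exact: h.
Unshelve. all: by end_near. Qed.

Lemma cvg_enormP n (T : Type) (F : set_system T) {FF : Filter F} (f : T -> 'cV[R]_n) (l : 'cV[R]_n) :
  f @ F --> l -> forall e : R, 0 < e -> \forall x \near F, enorm (l - f x) <= e.
Proof.
move=> h e e0; have e1 : 0 < e / n.+1%:R by rewrite divr_gt0.
move/cvgrPdist_le : h => /(_ _ e1); apply: filterS => x hx.
apply: le_trans (enorm_le_norm _) _.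
apply: (@le_trans _ _ (n.+1%:R * `|l - f x|)); first by rewrite ler_wpM2r// ler_nat.
by rewrite mulrC -ler_pdivlMr.
Qed.

Lemma near_ball (t r : R) (P : R -> Prop) : 0 < r ->
  (forall s, `|t - s| < r -> P s) -> \forall s \near t, P s.
Proof. by move=> r0 h; exists r => // s /= /h. Qed.

Lemma near_ballP (t : R) (P : R -> Prop) : (\forall s \near t, P s) ->
  exists2 r : R, 0 < r & forall s, `|t - s| < r -> P s.
Proof. by move=> [r /= r0 h]; exists r => // s /h. Qed.

Lemma mulmx_enorm_bound n p (M : 'M[R]_(n, p)) (w : 'cV[R]_p) : enorm w <= 1 ->
  enorm (M *m w) <= n%:R * (\sum_i \sum_j `|M i j|).
Proof.
move=> w1; apply: enorm_le_sum => i; rewrite mxE.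
apply: le_trans (ler_norm_sum _ _ _) _.
rewrite [leRHS](bigD1 i)//= -[leLHS]addr0 lerD//; last first.
  by apply: sumr_ge0 => j _; apply: sumr_ge0 => l _; exact: normr_ge0.
apply: ler_sum => j _; rewrite normrM ler_piMr//.
exact: le_trans (entry_le_enorm _ _) w1.
Qed.

Lemma opnorm_has_sup n p (M : 'M[R]_(n, p)) :
  has_sup [set enorm (M *m w) | w in [set w : 'cV[R]_p | enorm w <= 1]].
Proof.
split; first by exists (enorm (M *m 0)), 0 => //=; rewrite enorm0.
exists (n%:R * (\sum_i \sum_j `|M i j|)) => _ [w w1 <-].
exact: mulmx_enorm_bound.
Qed.

Lemma opnorm_ge0 n p (M : 'M[R]_(n, p)) : 0 <= opnorm M.
Proof.
apply: (@le_trans _ _ (enorm (M *m 0))); first exact: enorm_ge0.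
by apply: ub_le_sup; [exact: (opnorm_has_sup M).2|exists 0 => //=; rewrite enorm0].
Qed.

Lemma opnormP n p (M : 'M[R]_(n, p)) (w : 'cV[R]_p) :
  enorm (M *m w) <= opnorm M * enorm w.
Proof.
have [->|w0] := eqVneq w 0; first by rewrite mulmx0 !enorm0 mulr0.
have w0' : 0 < enorm w by rewrite enorm_gt0.
rewrite -ler_pdivrMr//; apply: ub_le_sup; first exact: (opnorm_has_sup M).2.
exists ((enorm w)^-1 *: w) => /=.
  by rewrite enormZ ger0_norm ?invr_ge0 ?enorm_ge0// mulVf ?gt_eqF.
by rewrite -scalemxAr enormZ ger0_norm ?invr_ge0 ?enorm_ge0// mulrC.
Qed.

Lemma opnorm_le_sub n p (M N : 'M[R]_(n, p)) : opnorm M <= opnorm (M - N) + opnorm N.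
Proof.
apply: ge_sup; first by exists (enorm (M *m 0)), 0 => //=; rewrite enorm0.
move=> _ [w /= w1 <-]; rewrite -{1}(subrK N M) mulmxDl.
apply: le_trans (enormD _ _) _; rewrite lerD//.
  by apply: le_trans (opnormP _ _) _; rewrite ler_piMr// opnorm_ge0.
by apply: le_trans (opnormP _ _) _; rewrite ler_piMr// opnorm_ge0.
Qed.

End euclid.

(** * Lipschitz property of the truncation of jumps *)

Section clip.
Context {R : realType}.
Variable b : R.
Hypothesis b0 : 0 < b.

Lemma clip_small n (w : 'cV[R]_n) : enorm w <= b -> clip b w = w.
Proof.
rewrite /clip; case: eqVneq => [->//|w0] wb.
rewrite min_r ?scale1r// ler_pdivlMr ?enorm_gt0// mul1r//.
Qed.

Lemma clip_large n (w : 'cV[R]_n) : b < enorm w -> clip b w = (b / enorm w) *: w.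
Proof.
rewrite /clip; case: eqVneq => [->|w0] wb; first by rewrite scaler0.
by rewrite min_l// ler_pdivrMr ?enorm_gt0// mul1r ltW.
Qed.

Lemma enorm_clip n (w : 'cV[R]_n) : enorm (clip b w) <= b.
Proof.
have [wb|wb] := leP (enorm w) b; first by rewrite clip_small.
rewrite clip_large// enormZ ger0_norm ?divr_ge0 ?enorm_ge0 ?(ltW b0)//.
by rewrite divfK// gt_eqF// (lt_trans b0).
Qed.

Lemma enorm_clip_le n (w : 'cV[R]_n) : enorm (clip b w) <= enorm w.
Proof.
have [wb|wb] := leP (enorm w) b; first by rewrite clip_small.
by rewrite (le_trans (enorm_clip _))// ltW.
Qed.

(** Projection on a ball is even 1-Lipschitz; the factor 2 suffices here and needs only the triangle
    inequality. *)
Lemma clip_lip n (v w : 'cV[R]_n) :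
  enorm (clip b v - clip b w) <= 2 * enorm (v - w).
Proof.
wlog vw : v w / enorm v <= enorm w.
  move=> H; have [/H//|/ltW /H] := leP (enorm v) (enorm w).
  by rewrite enormB (enormB w).
have [wb|wb] := leP (enorm w) b.
  by rewrite !clip_small ?(le_trans vw)//; rewrite ler_peMl ?enorm_ge0 ?ler1n.
have w0 : 0 < enorm w by rewrite (lt_trans b0).
have [vb|vb] := leP (enorm v) b.
  rewrite clip_small// clip_large//.
  apply: le_trans (enorm_dist_triangle _ w _) _.
  have -> : w - (b / enorm w) *: w = (1 - b / enorm w) *: w by rewrite scalerBl scale1r.
  rewrite enormZ ger0_norm ?subr_ge0 ?ler_pdivrMr// ?mul1r ?(ltW wb)//.
  rewrite mulrBl mul1r divfK ?gt_eqF//.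
  have := enorm_sub_dist w v; rewrite enormB; lra.
have v0 : 0 < enorm v by rewrite (lt_trans b0).
rewrite !clip_large//.
(* Both vectors are scaled with the factor of the longer one; what remains is radial, of length (b /
   |w|) (|w| - |v|). *)
have -> : (b / enorm v) *: v - (b / enorm w) *: w =
    (b / enorm w) *: (v - w) + (b / enorm v * (1 - enorm v / enorm w)) *: v.
  apply/matrixP => i j; rewrite !mxE; field.
  by rewrite !gt_eqF.
apply: le_trans (enormD _ _) _; rewrite !enormZ.
have h1 : b / enorm w <= 1 by rewrite ler_pdivrMr// mul1r ltW.
rewrite ger0_norm ?divr_ge0 ?enorm_ge0 ?(ltW b0)//.
have h2 : 0 <= 1 - enorm v / enorm w by rewrite subr_ge0 ler_pdivrMr// mul1r.
rewrite ger0_norm ?mulr_ge0 ?invr_ge0 ?enorm_ge0 ?(ltW b0)//.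
have -> : b / enorm v * (1 - enorm v / enorm w) * enorm v = b / enorm w * (enorm w - enorm v).
  by field; rewrite !gt_eqF.
have h3 := enorm_sub_dist w v; rewrite enormB in h3.
rewrite -mulrDr; apply: (@le_trans _ _ (1 * (enorm (v - w) + (enorm w - enorm v)))).
  by rewrite ler_wpM2r// addr_ge0 ?enorm_ge0 ?subr_ge0.
rewrite mul1r mulr_natl mulr2n; lra.
Qed.

End clip.

(** * The flow of a Lipschitz field *)

Section flow.
Context {R : realType}.

(** Properties of the flow are proved for Euler polygons with an error O(1/n); this lemma removes
    the error. *)
Lemma le_inv_nat_le0 (x K : R) : (forall n, x <= K * n.+1%:R^-1) -> x <= 0.
Proof.
move=> h; rewrite leNgt; apply/negP => x0.
have K0 : 0 < K by rewrite (lt_le_trans x0)// (le_trans (h 0%N))// invr1 mulr1.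
have := h (Num.truncn (K / x)); rewrite ler_pdivlMr// leNgt => /negP; apply.
by rewrite mulrC -ltr_pdivrMr// truncnS_gt.
Qed.

Lemma expr_le_expR (x : R) n : 0 <= x -> (1 + x) ^+ n <= expR (x * n%:R).
Proof.
move=> x0; rewrite expRM_natr lerXn2r ?nnegrE ?addr_ge0 ?expR_ge0//.
exact: expR_ge1Dx.
Qed.

Variables (m : nat) (a : 'cV[R]_m -> 'cV[R]_m) (D : R).
Hypothesis D0 : 0 <= D.
Implicit Types (h t : R) (x y : 'cV[R]_m).
Hypothesis aL : forall x y, enorm (a x - a y) <= D * enorm (x - y).

Definition euler_step (h : R) (y : 'cV[R]_m) := y + h *: a y.

Lemma enorm_a_le x y : enorm (a x) <= enorm (a y) + D * enorm (x - y).
Proof. by rewrite -lerBlDl (le_trans (enorm_sub_dist _ _)). Qed.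

Lemma euler_step_lip h y z : 0 <= h ->
  enorm (euler_step h y - euler_step h z) <= (1 + D * h) * enorm (y - z).
Proof.
move=> h0; rewrite /euler_step opprD addrACA -scalerBr.
apply: le_trans (enormD _ _) _; rewrite enormZ ger0_norm// mulrDl mul1r lerD2l.
by rewrite -mulrA mulrCA ler_wpM2l.
Qed.

Lemma iter_euler_lip h n y z : 0 <= h ->
  enorm (iter n (euler_step h) y - iter n (euler_step h) z) <=
    expR (D * (h * n%:R)) * enorm (y - z).
Proof.
move=> h0; apply: (@le_trans _ _ ((1 + D * h) ^+ n * enorm (y - z))); last first.
  by rewrite ler_wpM2r ?enorm_ge0// mulrA expr_le_expR// mulr_ge0.
elim: n => [|n IH]; first by rewrite expr0 mul1r.
rewrite !iterS (le_trans (euler_step_lip _ _ h0))// exprS -mulrA ler_wpM2l//.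
by rewrite addr_ge0// mulr_ge0.
Qed.

Lemma a_iter_euler h n y : 0 <= h ->
  enorm (a (iter n (euler_step h) y)) <= expR (D * (h * n%:R)) * enorm (a y).
Proof.
move=> h0; apply: (@le_trans _ _ ((1 + D * h) ^+ n * enorm (a y))); last first.
  by rewrite ler_wpM2r ?enorm_ge0// mulrA expr_le_expR// mulr_ge0.
elim: n => [|n IH]; first by rewrite expr0 mul1r.
rewrite iterS; set z := iter n _ _ in IH *.
apply: (@le_trans _ _ ((1 + D * h) * enorm (a z))); last first.
  by rewrite exprS -mulrA ler_wpM2l// addr_ge0// mulr_ge0.
apply: le_trans (enorm_a_le _ z) _.
by rewrite /euler_step [z + _]addrC addrK enormZ ger0_norm// mulrA mulrDl mul1r.
Qed.

Lemma expR_le_step h i n : 0 <= h -> (i <= n)%N ->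
  expR (D * (h * i%:R)) <= expR (D * (h * n%:R)).
Proof. by move=> h0 i_n; rewrite ler_expR !ler_wpM2l// ler_nat. Qed.

Lemma iter_euler_dist h n y : 0 <= h ->
  enorm (iter n (euler_step h) y - y) <=
    h * n%:R * (expR (D * (h * n%:R)) * enorm (a y)).
Proof.
move=> h0; elim: n => [|n IH]; first by rewrite subrr enorm0 mulr0 mul0r.
rewrite iterS {1}/euler_step addrAC; apply: le_trans (enormD _ _) _.
rewrite enormZ ger0_norm//; set e := expR (D * (h * n.+1%:R)).
rewrite -[in leRHS]natr1 mulrDr mulr1 mulrDl lerD//.
  apply: le_trans IH _; rewrite ler_wpM2l ?mulr_ge0// ler_wpM2r ?enorm_ge0//.
  exact: expR_le_step.
rewrite ler_wpM2l// (le_trans (a_iter_euler _ _ h0))// ler_wpM2r ?enorm_ge0//.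
exact: expR_le_step.
Qed.

(** The local error of one long Euler step against n short ones is quadratic in the total time,
    because [a] varies by at most D times the distance travelled. *)
Lemma iter_euler_step h n y : 0 <= h ->
  enorm (iter n (euler_step h) y - euler_step (h * n%:R) y) <=
    D * (h * n%:R) ^+ 2 * (expR (D * (h * n%:R)) * enorm (a y)).
Proof.
move=> h0; elim: n => [|n IH].
  by rewrite /euler_step mulr0 scale0r addr0 subrr enorm0 expr0n mulr0 mul0r.
set z := iter n (euler_step h) y in IH *.
have -> : iter n.+1 (euler_step h) y - euler_step (h * n.+1%:R) y =
    (z - euler_step (h * n%:R) y) + h *: (a z - a y).
  rewrite iterS -/z /euler_step -natr1 mulrDr mulr1.
  by apply/matrixP => i j; rewrite !mxE; ring.
apply: le_trans (enormD _ _) _; rewrite enormZ ger0_norm//.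
set e := expR (D * (h * n.+1%:R)); set A := enorm (a y).
have en : expR (D * (h * n%:R)) <= e by exact: expR_le_step.
apply: (@le_trans _ _ (D * (h * n%:R) ^+ 2 * (e * A) + h * (D * (h * n%:R * (e * A))))).
  rewrite lerD//.
    by rewrite (le_trans IH)// ler_wpM2l ?mulr_ge0 ?exprn_ge0 ?mulr_ge0// ler_wpM2r ?enorm_ge0.
  rewrite ler_wpM2l// (le_trans (aL _ _))// ler_wpM2l//.
  by rewrite (le_trans (iter_euler_dist _ _ h0))// ler_wpM2l ?mulr_ge0// ler_wpM2r ?enorm_ge0.
rewrite -subr_ge0 -natr1.
have -> : D * (h * (n%:R + 1)) ^+ 2 * (e * A) - (D * (h * n%:R) ^+ 2 * (e * A) +
   h * (D * (h * n%:R * (e * A)))) = D * h ^+ 2 * (n%:R + 1) * (e * A) by ring.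
by rewrite !mulr_ge0 ?exprn_ge0 ?expR_ge0 ?enorm_ge0.
Qed.

(** Each coarse step adds the local error of [iter_euler_step]; earlier errors are multiplied by at
    most exp(D H) per step, H being the coarse step size. *)
Lemma iter_euler_refine h n p x : 0 <= h ->
  enorm (iter n (euler_step (h * p%:R)) x - iter (n * p) (euler_step h) x) <=
    n%:R * D * (h * p%:R) ^+ 2 * (expR (D * (h * p%:R * n%:R)) * enorm (a x)).
Proof.
move=> h0; set H := h * p%:R; have H0 : 0 <= H by rewrite mulr_ge0.
elim: n => [|n IH]; first by rewrite mul0n /= subrr enorm0 !mul0r.
rewrite iterS mulSn iterD.
set y := iter n _ x in IH *; set z := iter (n * p) _ x in IH *.
apply: le_trans (enorm_dist_triangle _ (euler_step H z) _) _.
set A := enorm (a x) in IH *; set e := expR (D * (H * n.+1%:R)).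
have eE : e = expR (D * H) * expR (D * (H * n%:R)).
  by rewrite -expRD /e -natr1; congr expR; ring.
have h1 : enorm (euler_step H y - euler_step H z) <= n%:R * D * H ^+ 2 * (e * A).
  apply: le_trans (euler_step_lip _ _ H0) _.
  apply: (@le_trans _ _ (expR (D * H) * (n%:R * D * H ^+ 2 * (expR (D * (H * n%:R)) * A)))).
    by apply: ler_pM; rewrite ?enorm_ge0 ?addr_ge0 ?mulr_ge0//; exact: expR_ge1Dx.
  by rewrite eE le_eqVlt; apply/orP; left; apply/eqP; ring.
have h2 : enorm (euler_step H z - iter p (euler_step h) z) <= D * H ^+ 2 * (e * A).
  rewrite enormB; apply: le_trans (iter_euler_step _ _ h0) _.
  rewrite -/H ler_wpM2l ?mulr_ge0 ?exprn_ge0// eE -mulrA ler_wpM2l ?expR_ge0//.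
  have := a_iter_euler (n * p) x h0; rewrite -/z -/A natrM.
  by have -> : D * (h * (n%:R * p%:R)) = D * (H * n%:R) by rewrite /H; ring.
rewrite -[in leRHS]natr1; apply: le_trans (lerD h1 h2) _.
by rewrite le_eqVlt; apply/orP; left; apply/eqP; ring.
Qed.

Definition euler_iter n (t : R) x := iter n (euler_step (t / n%:R)) x.

Let err (t : R) x := D * t ^+ 2 * (expR (D * t) * enorm (a x)).

Let err_ge0 t x : 0 <= err t x.
Proof. by rewrite /err; apply: mulr_ge0; apply: mulr_ge0; rewrite ?sqr_ge0 ?expR_ge0 ?enorm_ge0. Qed.

Lemma euler_iter_refine n p t x : 0 <= t ->
  enorm (euler_iter n.+1 t x - euler_iter (n.+1 * p.+1) t x) <= err t x * n.+1%:R^-1.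
Proof.
move=> t0; rewrite /euler_iter.
have h0 : 0 <= t / (n.+1 * p.+1)%:R by rewrite divr_ge0.
have E1 : t / (n.+1 * p.+1)%:R * p.+1%:R = t / n.+1%:R.
  by rewrite natrM; field; rewrite !nat1r !pnatr_eq0.
have := iter_euler_refine n.+1 p.+1 x h0; rewrite E1 divfK ?pnatr_eq0//.
move=> /le_trans; apply; rewrite le_eqVlt; apply/orP; left; apply/eqP.
by rewrite /err; field; rewrite nat1r pnatr_eq0.
Qed.

Lemma euler_iter_dist n p t x : 0 <= t ->
  enorm (euler_iter n.+1 t x - euler_iter p.+1 t x) <=
    err t x * (n.+1%:R^-1 + p.+1%:R^-1).
Proof.
(* Two step sizes are compared through their common refinement. *)
move=> t0; apply: le_trans (enorm_dist_triangle _ (euler_iter (n.+1 * p.+1) t x) _) _.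
rewrite mulrDr; apply: lerD; first exact: euler_iter_refine.
by rewrite enormB mulnC; exact: euler_iter_refine.
Qed.

(** The global solution of the ODE for [0 <= t], as the limit of Euler polygons. *)
Definition flow t x : 'cV[R]_m := lim (euler_iter n.+1 t x @[n --> \oo]).


Lemma euler_iter_cvg t x : 0 <= t -> euler_iter n.+1 t x @[n --> \oo] --> flow t x.
Proof.
move=> t0.
have : cvg (euler_iter n.+1 t x @[n --> \oo]); last by [].
apply: cauchy_cvg; apply: cauchy_exP => e e0.
have e1 : 0 < e / (2 * (err t x + 1)) by rewrite divr_gt0// mulr_gt0// ltr_wpDl.
have /(_ (PosNum e1)) [N _ hN] := @near_infty_natSinv_lt R.
exists (euler_iter N.+1 t x); exists N => // n /= Nn.
rewrite -ball_normE /ball_/=; apply: le_lt_trans (norm_le_enorm _) _.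
apply: le_lt_trans (euler_iter_dist _ _ _ t0) _.
have h1 := hN N (leqnn N); have h2 := hN n Nn; rewrite /= in h1 h2.
apply: (@le_lt_trans _ _ ((err t x + 1) * (N.+1%:R^-1 + n.+1%:R^-1))).
  by rewrite ler_wpM2r ?addr_ge0// lerDl.
have E0 : 0 < err t x + 1 by rewrite ltr_wpDl.
rewrite mulrC -ltr_pdivlMr//.
have -> : e / (err t x + 1) = e / (2 * (err t x + 1)) + e / (2 * (err t x + 1)).
  by field; rewrite gt_eqF.
exact: ltrD.
Qed.

Lemma flow_euler n t x : 0 <= t ->
  enorm (flow t x - euler_iter n.+1 t x) <= err t x * n.+1%:R^-1.
Proof.
move=> t0; apply/ler_addgt0Pr => e e0.
have e2 : 0 < (e : R) / 2 by rewrite divr_gt0.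
have h1 : \forall n \near \oo, enorm (flow t x - euler_iter n.+1 t x) <= e / 2.
  by apply: cvg_enormP e2; exact: euler_iter_cvg.
have e1 : 0 < e / (2 * (err t x + 1)) by rewrite divr_gt0// mulr_gt0// ltr_wpDl.
have h2 := near_infty_natSinv_lt (PosNum e1).
have /filter_ex[p [hp1 hp2]] : \forall p \near \oo,
    enorm (flow t x - euler_iter p.+1 t x) <= e / 2 /\
    p.+1%:R^-1 < e / (2 * (err t x + 1)) by apply: filterI.
apply: le_trans (enorm_dist_triangle _ (euler_iter p.+1 t x) _) _.
have h3 := euler_iter_dist p n x t0.
have h4 : err t x * p.+1%:R^-1 <= e / 2.
  apply: (@le_trans _ _ ((err t x + 1) * p.+1%:R^-1)).
    by rewrite ler_wpM2r// lerDl.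
  rewrite mulrC -ler_pdivlMr ?ltr_wpDl//.
  have -> : e / 2 / (err t x + 1) = e / (2 * (err t x + 1)).
    by field; rewrite gt_eqF// ltr_wpDl.
  exact: ltW.
rewrite mulrDr in h3; move: (p.+1%:R^-1) (n.+1%:R^-1) h3 h4 => v w h3 h4; lra.
Qed.

Lemma flow0 x : flow 0 x = x.
Proof.
apply/subr0_eq/enorm0_eq0/eqP; rewrite eq_le enorm_ge0 andbT.
have := @flow_euler 0 0 x (lexx 0).
rewrite /euler_iter /= /euler_step mul0r scale0r addr0 invr1 mulr1.
by rewrite /err expr0n mulr0 mul0r.
Qed.

Lemma flow_step t x : 0 <= t ->
  enorm (flow t x - x - t *: a x) <= D * t ^+ 2 * (expR (D * t) * enorm (a x)).
Proof.
move=> t0; have := flow_euler 0 x t0.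
by rewrite /euler_iter/= /euler_step !invr1 !mulr1 opprD addrA.
Qed.

Lemma flow_lip t x y : 0 <= t ->
  enorm (flow t x - flow t y) <= expR (D * t) * enorm (x - y).
Proof.
move=> t0; rewrite -subr_le0; apply: (@le_inv_nat_le0 _ (err t x + err t y)) => n.
have hx := flow_euler n x t0; have hy := flow_euler n y t0.
have n0 : (n.+1%:R : R) != 0 by rewrite pnatr_eq0.
have := iter_euler_lip n.+1 x y (divr_ge0 t0 (ler0n R n.+1)).
rewrite divfK// -/(euler_iter _ _ _) -/(euler_iter _ _ _).
move: hx hy; set p := euler_iter _ _ x; set q := euler_iter _ _ y => hx hy h.
have := enorm_dist_triangle (flow t x) p (flow t y).
have := enorm_dist_triangle p q (flow t y).
rewrite (enormB q) mulrDl; move: (n.+1%:R^-1) hx hy => u hx hy; lra.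
Qed.

Lemma a_flow t x : 0 <= t -> enorm (a (flow t x)) <= expR (D * t) * enorm (a x).
Proof.
move=> t0; rewrite -subr_le0; apply: (@le_inv_nat_le0 _ (D * err t x)) => n.
have hx := flow_euler n x t0.
have n0 : (n.+1%:R : R) != 0 by rewrite pnatr_eq0.
have := a_iter_euler n.+1 x (divr_ge0 t0 (ler0n R n.+1)).
rewrite divfK// -/(euler_iter _ _ _) => h.
have := enorm_a_le (flow t x) (euler_iter n.+1 t x).
have : D * enorm (flow t x - euler_iter n.+1 t x) <= D * (err t x * n.+1%:R^-1).
  by rewrite ler_wpM2l.
rewrite -mulrA; move: (n.+1%:R^-1) => u; lra.
Qed.

(** Keeping the number of steps and changing their size compares the flow at two times without the
    semigroup property, which is not yet available. *)
Lemma iter_euler_time h h' n x : 0 <= h' -> h' <= h ->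
  enorm (iter n (euler_step h) x - iter n (euler_step h') x) <=
    (h - h') * n%:R * (expR (D * (h * n%:R)) * enorm (a x)).
Proof.
move=> h'0 hh; have h0 := le_trans h'0 hh; have hh' : 0 <= h - h' by rewrite subr_ge0.
elim: n => [|n IH]; first by rewrite subrr enorm0 mulr0 mul0r.
rewrite !iterS; set y := iter n _ x in IH *; set z := iter n (euler_step h') x in IH *.
apply: le_trans (enorm_dist_triangle _ (euler_step h z) _) _.
set A := enorm (a x) in IH *; set e := expR (D * (h * n.+1%:R)).
have eE : e = expR (D * h) * expR (D * (h * n%:R)).
  by rewrite -expRD /e -natr1; congr expR; ring.
have h1 : enorm (euler_step h y - euler_step h z) <= (h - h') * n%:R * (e * A).
  apply: le_trans (euler_step_lip _ _ h0) _.
  apply: (@le_trans _ _ (expR (D * h) * ((h - h') * n%:R * (expR (D * (h * n%:R)) * A)))).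
    by apply: ler_pM; rewrite ?enorm_ge0 ?addr_ge0 ?mulr_ge0//; exact: expR_ge1Dx.
  by rewrite eE le_eqVlt; apply/orP; left; apply/eqP; ring.
have h2 : enorm (euler_step h z - euler_step h' z) <= (h - h') * (e * A).
  rewrite /euler_step opprD addrACA subrr add0r -scalerBl enormZ ger0_norm//.
  rewrite ler_wpM2l// (le_trans (a_iter_euler _ _ h'0))// ler_wpM2r ?enorm_ge0//.
  by rewrite ler_expR ler_wpM2l// ler_pM// ler_nat.
rewrite -[in leRHS]natr1; apply: le_trans (lerD h1 h2) _.
by rewrite le_eqVlt; apply/orP; left; apply/eqP; ring.
Qed.

Lemma flow_time s t x : 0 <= s -> s <= t ->
  enorm (flow t x - flow s x) <= (t - s) * (expR (D * t) * enorm (a x)).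
Proof.
move=> s0 st; have t0 := le_trans s0 st.
rewrite -subr_le0; apply: (@le_inv_nat_le0 _ (err t x + err s x)) => n.
have hx := flow_euler n x t0; have hy := flow_euler n x s0.
have n0 : (n.+1%:R : R) != 0 by rewrite pnatr_eq0.
have := @iter_euler_time (t / n.+1%:R) (s / n.+1%:R) n.+1 x.
rewrite divr_ge0// ler_pM2r ?invr_gt0// -mulrBl !divfK// => /(_ isT st).
rewrite -/(euler_iter _ _ _) -/(euler_iter _ _ _).
move: hx hy; set p := euler_iter _ t x; set q := euler_iter _ s x => hx hy h.
have := enorm_dist_triangle (flow t x) p (flow s x).
have := enorm_dist_triangle p q (flow s x).
rewrite (enormB q) mulrDl; move: (n.+1%:R^-1) hx hy => u hx hy; lra.
Qed.

(** Euler schemes with a common step compose exactly, so the semigroup property is obtained first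
    for multiples of one time. *)
Lemma iter_flow n t x : 0 <= t -> iter n (flow t) x = flow (t * n%:R) x.
Proof.
move=> t0; case: n => [|n]; first by rewrite mulr0 flow0.
apply/subr0_eq/enorm0_eq0/eqP; rewrite eq_le enorm_ge0 andbT.
(* The Euler errors of the k blocks, each amplified by the Lipschitz constants of the blocks that
   follow it. *)
pose G k : R := \sum_(i < k) expR (D * t) ^+ i * err t (iter (k - i.+1) (flow t) x).
have key p k : enorm (iter k (flow t) x - iter k (euler_iter p.+1 t) x) <= G k * p.+1%:R^-1.
  elim: k => [|k IH]; first by rewrite subrr enorm0 /G big_ord0 mul0r.
  rewrite !iterS.
  apply: le_trans (enorm_dist_triangle _ (euler_iter p.+1 t (iter k (flow t) x)) _) _.
  rewrite /G big_ord_recl /= expr0 mul1r subn1 /= mulrDl.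
  apply: lerD; first exact: flow_euler.
  have n0 : (p.+1%:R : R) != 0 by rewrite pnatr_eq0.
  have := iter_euler_lip p.+1 (iter k (flow t) x) (iter k (euler_iter p.+1 t) x)
    (divr_ge0 t0 (ler0n R p.+1)).
  rewrite divfK// -/(euler_iter _ _ _) -/(euler_iter _ _ _) => /le_trans; apply.
  under eq_bigr do rewrite /bump/= add1n exprS subSS -mulrA.
  by rewrite -mulr_sumr -mulrA ler_wpM2l ?expR_ge0.
apply: (@le_inv_nat_le0 _ (G n.+1 + err (t * n.+1%:R) x)) => p.
have tn0 : 0 <= t * n.+1%:R by rewrite mulr_ge0.
have h1 := key p n.+1.
have h2 : enorm (flow (t * n.+1%:R) x - euler_iter (n.+1 * p.+1) (t * n.+1%:R) x) <=
    err (t * n.+1%:R) x * p.+1%:R^-1.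
  apply: le_trans (flow_euler _ _ tn0) _.
  rewrite ler_wpM2l// lef_pV2 ?posrE ?ltr0n// ler_nat.
  exact: (leq_pmull p.+1 (ltn0Sn n)).
have E : iter n.+1 (euler_iter p.+1 t) x = euler_iter (n.+1 * p.+1) (t * n.+1%:R) x.
  rewrite /euler_iter.
  have -> : t * n.+1%:R / (n.+1 * p.+1)%:R = t / p.+1%:R.
    by rewrite natrM; field; rewrite !nat1r !pnatr_eq0.
  by elim: (n.+1) => // k IH; rewrite iterS IH mulSn iterD.
rewrite E in h1; rewrite mulrDl.
apply: le_trans (enorm_dist_triangle _ _ _) (lerD h1 _).
by rewrite enormB.
Qed.

Lemma flowD s t x : 0 <= s -> 0 <= t -> flow (s + t) x = flow t (flow s x).
Proof.
move=> s0 t0; apply/subr0_eq/enorm0_eq0/eqP; rewrite eq_le enorm_ge0 andbT.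
(* Both times are rounded down to multiples of 1 / (n + 1), for which [iter_flow] applies; [K]
   collects the three rounding errors. *)
pose K := 2 * (expR (D * (s + t)) * enorm (a x)) +
   (expR (D * t) * enorm (a (flow s x)) + expR (D * t) * (expR (D * s) * enorm (a x))).
apply: (@le_inv_nat_le0 _ K) => n.
pose h : R := n.+1%:R^-1; have h0 : 0 <= h by rewrite invr_ge0.
have N0 : (0 : R) < n.+1%:R by [].
have fl (u : R) : 0 <= u -> exists p : nat, h * p%:R <= u /\ u - h * p%:R <= h.
  move=> u0; exists (Num.truncn (u * n.+1%:R)).
  have /truncn_itv/andP[] : 0 <= u * n.+1%:R by rewrite mulr_ge0.
  set p := Num.truncn _ => p1 p2.
  have hE : h * n.+1%:R = 1 by rewrite mulVf// gt_eqF.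
  split; first by rewrite mulrC ler_pdivrMr.
  rewrite lerBlDl -[X in _ + X]mulr1 -mulrDr natr1 mulrC ler_pdivlMr//.
  exact: ltW.
rewrite -/h; clearbody h.
have [p [p1 p2]] := fl s s0; have [q [q1 q2]] := fl t t0.
have hp0 : 0 <= h * p%:R by rewrite mulr_ge0.
have hq0 : 0 <= h * q%:R by rewrite mulr_ge0.
have h1 := @flow_time (h * (p + q)%:R) (s + t) x (mulr_ge0 h0 (ler0n _ _)).
rewrite natrD mulrDr lerD// in h1; have {}h1 := h1 isT.
have h2 := flow_time (flow s x) hq0 q1.
have h3 := flow_time x hp0 p1.
have h4 := flow_lip (flow s x) (flow (h * p%:R) x) hq0.
have E : flow (h * p%:R + h * q%:R) x = flow (h * q%:R) (flow (h * p%:R) x).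
  by rewrite -!iter_flow// -iterD addnC iter_flow// natrD mulrDr.
rewrite E in h1.
set A := flow (s + t) x in h1 *; set B := flow t (flow s x) in h2 *.
set C := flow (h * q%:R) _ in h1 h4 *; set F := flow (h * q%:R) _ in h2 h4 *.
have k0 : s + t - (h * p%:R + h * q%:R) <= 2 * h.
  rewrite (_ : s + t - _ = (s - h * p%:R) + (t - h * q%:R)); last by ring.
  by rewrite mulr_natl mulr2n lerD.
have k1 : (s + t - (h * p%:R + h * q%:R)) * (expR (D * (s + t)) * enorm (a x)) <=
  2 * h * (expR (D * (s + t)) * enorm (a x)).
  by apply: ler_wpM2r k0; apply: mulr_ge0; [exact: expR_ge0|exact: enorm_ge0].
have k2 : (t - h * q%:R) * (expR (D * t) * enorm (a (flow s x))) <=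
   h * (expR (D * t) * enorm (a (flow s x))).
  by rewrite ler_wpM2r// mulr_ge0 ?expR_ge0 ?enorm_ge0.
have k3 : expR (D * (h * q%:R)) * enorm (flow s x - flow (h * p%:R) x) <=
   expR (D * t) * (h * (expR (D * s) * enorm (a x))).
  apply: ler_pM; rewrite ?expR_ge0 ?enorm_ge0 ?ler_expR ?ler_wpM2l//.
  by apply: le_trans h3 _; rewrite ler_wpM2r// mulr_ge0 ?expR_ge0 ?enorm_ge0.
clearbody A B C F.
have := enorm_dist_triangle A C B; have := enorm_dist_triangle C F B.
rewrite (enormB C F) (enormB F B) /K.
have -> : (2 * (expR (D * (s + t)) * enorm (a x)) + (expR (D * t) * enorm (a (flow s x)) +
  expR (D * t) * (expR (D * s) * enorm (a x)))) * h =
  2 * h * (expR (D * (s + t)) * enorm (a x)) + h * (expR (D * t) * enorm (a (flow s x))) +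
   expR (D * t) * (h * (expR (D * s) * enorm (a x))) by ring.
lra.
Qed.

End flow.

(** * Differentiability of the flow and uniqueness of solutions *)

Section ode_unique.
Context {R : realType}.
Variables (m : nat) (a : 'cV[R]_m -> 'cV[R]_m) (D : R).
Hypothesis D0 : 0 <= D.
Hypothesis aL : forall x y, enorm (a x - a y) <= D * enorm (x - y).
Implicit Types (h t s : R) (x y : 'cV[R]_m).

Lemma flow_deriv_le K t h x : 0 <= t -> `|h| <= 1 -> 0 <= t + h ->
  t + 1 <= K ->
  enorm (flow a (t + h) x - flow a t x - h *: a (flow a t x)) <=
   2 * D * h ^+ 2 * (expR (D * (K + 1)) * enorm (a x)).
Proof.
move=> t0 h1 th0 tK.
have [h0|h0] := leP 0 h.
  rewrite (flowD D0 aL)//.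
  apply: le_trans (flow_step D0 aL _ h0) _.
  rewrite [2 * _]mulr_natl mulr2n !mulrDl -[leLHS]addr0 lerD//; last first.
    by rewrite !mulr_ge0 ?sqr_ge0 ?expR_ge0 ?enorm_ge0.
  rewrite ler_wpM2l ?mulr_ge0 ?sqr_ge0//.
  apply: le_trans (ler_wpM2l (expR_ge0 _) (a_flow D0 aL x t0)) _.
  rewrite mulrA -expRD ler_wpM2r ?enorm_ge0// ler_expR -mulrDr ler_wpM2l//.
  by rewrite ger0_norm// in h1; lra.
(* Backward increments: the flow at t is restarted from the earlier point [y], where the forward
   expansion applies. *)
pose s := - h; have s0 : 0 <= s by rewrite /s oppr_ge0 ltW.
have hE : h = - s by rewrite opprK.
have s1 : s <= 1 by rewrite hE normrN ger0_norm in h1.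
set y := flow a (t + h) x.
have tE : flow a t x = flow a s y.
  by rewrite /y -(flowD D0 aL)// hE subrK.
have -> : y - flow a t x - h *: a (flow a t x) =
    - (flow a s y - y - s *: a y) + s *: (a (flow a t x) - a y).
  by rewrite tE hE; apply/matrixP => i j; rewrite !mxE; ring.
apply: le_trans (enormD _ _) _; rewrite enormN enormZ (ger0_norm s0).
have ay : enorm (a y) <= expR (D * (t + h)) * enorm (a x) by exact: a_flow.
have E1 : expR (D * s) * enorm (a y) <= expR (D * (K + 1)) * enorm (a x).
  apply: le_trans (ler_wpM2l (expR_ge0 _) ay) _.
  rewrite mulrA -expRD ler_wpM2r ?enorm_ge0// ler_expR -mulrDr ler_wpM2l//; lra.
have k1 := flow_step D0 aL y s0.
have k2 : enorm (flow a t x - y) <= s * (expR (D * s) * enorm (a y)).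
  rewrite tE -{2}(flow0 D0 aL y).
  by have := flow_time D0 aL y (lexx 0) s0; rewrite subr0.
have k3 : enorm (a (flow a t x) - a y) <= D * (s * (expR (D * s) * enorm (a y))).
  by apply: le_trans (aL _ _) _; rewrite ler_wpM2l.
have k4 : s * enorm (a (flow a t x) - a y) <=
   D * s ^+ 2 * (expR (D * (K + 1)) * enorm (a x)).
  apply: le_trans (ler_wpM2l s0 k3) _.
  rewrite mulrCA expr2 -2!mulrA ler_wpM2l// ler_wpM2l// ler_wpM2l//.
have k5 : D * s ^+ 2 * (expR (D * s) * enorm (a y)) <=
   D * s ^+ 2 * (expR (D * (K + 1)) * enorm (a x)).
  by rewrite ler_wpM2l ?mulr_ge0 ?sqr_ge0.
rewrite hE sqrrN.
apply: (@le_trans _ _ (D * s ^+ 2 * (expR (D * (K + 1)) * enorm (a x)) +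
   D * s ^+ 2 * (expR (D * (K + 1)) * enorm (a x)))).
  by apply: lerD => //; exact: le_trans k5.
by rewrite le_eqVlt; apply/orP; left; apply/eqP; ring.
Qed.

(** The mean value theorem, in each coordinate. *)
Lemma deriv0_cst n (f : R -> 'cV[R]_n) (s0 s1 : R) : s0 <= s1 ->
  {within `[s0, s1], continuous f} ->
  (forall s, s0 < s < s1 -> forall e : R, 0 < e ->
     \forall h \near 0^', enorm (f (s + h) - f s) <= e * `|h|) ->
  f s1 = f s0.
Proof.
move=> s01 fc fd; apply/matrixP => i j; rewrite (ord1 j).
pose g s := f s i 0.
have [->//|s0s1] := eqVneq s0 s1.
have {}s01 : s0 < s1 by rewrite lt_neqAle s0s1.
have gc : {within `[s0, s1], continuous g}.
  move=> s; apply: (@continuous_comp _ _ _ (f : subspace `[s0, s1] -> _)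
    (fun w : 'cV[R]_n => w i 0) s); first exact: fc.
  exact: coord_continuous.
have gd (s : R) : s \in `]s0, s1[ -> is_derive s (1 : R) g 0.
  rewrite in_itv/= => sI.
  have lim0 : h^-1 *: ((g \o shift s) (h *: (1 : R)) - g s) @[h --> 0^'] --> (0 : R).
    apply/cvgrPdist_le => e e0; near=> h.
    have h0 : h != 0 by near: h; exact: nbhs_dnbhs_neq.
    rewrite sub0r normrN normrZ normfV ler_pdivrMl ?normr_gt0// mulrC.
    apply: (@le_trans _ _ (enorm (f (s + h) - f s))).
      rewrite /= (_ : h *: 1 + s = s + h); last by rewrite [_ *: _]mulr1 addrC.
      by have := entry_le_enorm (f (s + h) - f s) i; rewrite mxE [X in _ + X]mxE.
    by near: h; exact: fd.
  by apply: DeriveDef; [apply/cvg_ex; exists 0|exact: cvg_lim].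
have [c _] := MVT s01 gd gc.
by rewrite mul0r => /subr0_eq.
Unshelve. all: by end_near. Qed.

Lemma ode_unique (u : R -> 'cV[R]_m) (s0 s1 : R) : s0 <= s1 ->
  {within `[s0, s1], continuous u} ->
  (forall s, s0 < s < s1 -> forall e : R, 0 < e ->
     \forall h \near 0^', enorm (u (s + h) - u s - h *: a (u s)) <= e * `|h|) ->
  u s1 = flow a (s1 - s0) (u s0).
Proof.
move=> s01 uc ud.
(* The solution is carried by the flow from time s to the fixed time s1. This function of s has
   derivative zero, which gives uniqueness without Gronwall's inequality and without a backward
   flow. *)
pose w s := flow a (s1 - s) (u s).
suff : w s1 = w s0 by rewrite /w subrr (flow0 D0 aL).
set K := expR (D * (s1 - s0)).
have K0 : 0 < K by exact: expR_gt0.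
apply: deriv0_cst => //.
  move/subspace_continuousP : uc => uc'.
  suff H : forall s : R, s \in `[s0, s1] -> w x @[x --> within `[s0, s1] (nbhs s)] --> w s.
    by apply/subspace_continuousP => s /= sI; exact: H.
  move=> s sI; apply: cvg_enorm => e e0.
  have := sI; rewrite /= in_itv/= => /andP[s0s ss1].
  have e1 : 0 < e / 2 / K by rewrite !divr_gt0.
  set A := K * enorm (a (u s)).
  have A0 : 0 <= A by rewrite mulr_ge0 ?enorm_ge0 ?ltW.
  have e2 : 0 < e / 2 / (A + 1) by rewrite !divr_gt0// ltr_wpDl.
  have h1 : \forall s' \near within `[s0, s1] (nbhs s), enorm (u s - u s') <= e / 2 / K.
    by apply: (@cvg_enormP _ _ _ _ _ u (u s) _ _ e1); exact: uc'.
  have h2 : \forall s' \near within `[s0, s1] (nbhs s), `|s - s'| <= e / 2 / (A + 1).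
    by apply: cvg_within; have /cvgrPdist_le := @cvg_id _ (nbhs s); exact.
  have h3 : \forall s' \near within `[s0, s1] (nbhs s), s' \in `[s0, s1].
    by apply: withinT; exact: nbhs_filter.
  near=> s'.
  have /andP[s0s' s's1] : s0 <= s' <= s1.
    by have : s' \in `[s0, s1]; [near: s'|rewrite in_itv].
  have k1 : enorm (u s - u s') <= e / 2 / K by near: s'.
  have k2 : `|s - s'| <= e / 2 / (A + 1) by near: s'.
  apply: le_trans (enorm_dist_triangle _ (flow a (s1 - s') (u s)) _) _.
  have -> : e = e / 2 + e / 2 by field.
  apply: lerD; last first.
    apply: le_trans (flow_lip D0 aL _ _ _) _; first by rewrite subr_ge0.
    apply: (@le_trans _ _ (K * (e / 2 / K))); last by rewrite mulrC divfK// gt_eqF.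
    apply: ler_pM; rewrite ?expR_ge0 ?enorm_ge0// ler_expR ler_wpM2l//; lra.
  have bnd (p q : R) : 0 <= p -> p <= q -> q <= s1 - s0 ->
      enorm (flow a q (u s) - flow a p (u s)) <= (q - p) * A.
    move=> p0 pq qs; apply: le_trans (flow_time D0 aL _ p0 pq) _.
    rewrite ler_wpM2l ?subr_ge0// ler_wpM2r ?enorm_ge0// ler_expR ler_wpM2l//.
  apply: (@le_trans _ _ (`|s - s'| * A)); last first.
    apply: (@le_trans _ _ (e / 2 / (A + 1) * (A + 1))).
      by apply: ler_pM; rewrite ?normr_ge0 ?lerDl.
    by rewrite divfK// gt_eqF// ltr_wpDl.
  have [ss|ss] := leP s s'.
    rewrite distrC ger0_norm ?subr_ge0//.
    have -> : s' - s = s1 - s - (s1 - s') by ring.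
    apply: bnd; lra.
  rewrite ger0_norm ?subr_ge0 ?(ltW ss)// enormB.
  have -> : s - s' = s1 - s' - (s1 - s) by ring.
  apply: bnd; lra.
move=> s /andP[s0s ss1] e e0.
have eK : 0 < e / 2 / K by rewrite !divr_gt0.
pose B := enorm (a (u s)) + e / 2 / K.
have B0 : 0 <= B by rewrite addr_ge0 ?enorm_ge0// ltW.
pose B2 := enorm (a (u s)) + D * B.
have B20 : 0 <= B2 by rewrite addr_ge0 ?enorm_ge0// mulr_ge0.
pose A := K * (D * (expR D * B2) + D * B) + 1.
have A0 : 0 < A.
  by rewrite ltr_wpDl// mulr_ge0 ?addr_ge0 ?mulr_ge0 ?expR_ge0// ltW.
have := ud s; rewrite s0s => /(_ ss1 _ eK) udd.
near=> h.
have h0 : h != 0 by near: h; exact: nbhs_dnbhs_neq.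
have hs : `|h| <= s1 - s.
  near: h; apply: dnbhs0_le; rewrite subr_gt0//.
have hs0 : `|h| <= s - s0.
  near: h; apply: dnbhs0_le; rewrite subr_gt0//.
have h1 : `|h| <= 1 by near: h; exact: dnbhs0_le.
have hA : `|h| <= e / 2 / A.
  by near: h; apply: dnbhs0_le; rewrite !divr_gt0.
have hd : enorm (u (s + h) - u s - h *: a (u s)) <= e / 2 / K * `|h|.
  by near: h.
(* Second-order terms are absorbed by taking |h| below e / 2 / A; the first-order error of [u] is
   only multiplied by the Lipschitz constant [K] of the flow. *)
have fin X : 0 <= X -> X <= K * (`|h| ^+ 2 * (D * (expR D * B2) + D * B)
    + e / 2 / K * `|h|) -> X <= e * `|h|.
  move=> X0 /le_trans; apply.
  have -> : K * (`|h| ^+ 2 * (D * (expR D * B2) + D * B) + e / 2 / K * `|h|) =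
      `|h| * (`|h| * (A - 1) + e / 2).
    by rewrite /A; field; rewrite gt_eqF.
  rewrite mulrC ler_wpM2r//.
  have : `|h| * (A - 1) <= e / 2; last lra.
  apply: (@le_trans _ _ (e / 2 / A * A)); last by rewrite divfK// gt_eqF.
  by apply: ler_pM => //; rewrite ?lerBlDr ?lerDl// /A addrK mulr_ge0 ?addr_ge0 ?mulr_ge0 ?expR_ge0// ltW.
have step y t : 0 <= t -> t <= 1 -> t = `|h| -> enorm (a y) <= B2 ->
    enorm (flow a t y - y - t *: a y) <= `|h| ^+ 2 * (D * (expR D * B2)).
  move=> t0 t1 th ay; apply: le_trans (flow_step D0 aL _ t0) _.
  rewrite th in t0 t1 *.
  rewrite -mulrA mulrCA ler_wpM2l ?sqr_ge0// ler_wpM2l//.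
  by apply: ler_pM; rewrite ?expR_ge0 ?enorm_ge0// ler_expR ler_piMr.
have [hp|hn] := leP 0 h.
  rewrite ger0_norm// in hs hs0 h1.
  apply: fin; first exact: enorm_ge0.
  have -> : w s = flow a (s1 - (s + h)) (flow a h (u s)).
    rewrite /w -(flowD D0 aL)//; last lra.
    by congr flow; ring.
  apply: le_trans (flow_lip D0 aL _ _ _) _; first by lra.
  apply: ler_pM; rewrite ?expR_ge0 ?enorm_ge0//.
    rewrite /K ler_expR ler_wpM2l//; lra.
  have -> : u (s + h) - flow a h (u s) = (u (s + h) - u s - h *: a (u s)) -
     (flow a h (u s) - u s - h *: a (u s)).
    by apply/matrixP => i j; rewrite !mxE; ring.
  apply: le_trans (enormBl _ _) _; rewrite addrC lerD//.
  have aB2 : enorm (a (u s)) <= B2.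
    by rewrite /B2 -[leLHS]addr0 lerD2l mulr_ge0.
  have := step (u s) h hp h1; rewrite ger0_norm// => /(_ erefl aB2) /le_trans; apply.
  by rewrite ler_wpM2l ?sqr_ge0// lerDl mulr_ge0.
pose t := - h; have tp : 0 <= t by rewrite /t oppr_ge0 ltW.
have hE : h = - t by rewrite opprK.
have ht : `|h| = t by rewrite hE normrN ger0_norm.
rewrite ht in hs hs0 h1 hA hd fin step *.
set y := u (s + h) in hd *.
have yu : enorm (y - u s) <= t * B.
  have -> : y - u s = (y - u s - h *: a (u s)) + h *: a (u s) by rewrite subrK.
  apply: le_trans (enormD _ _) _; rewrite enormZ ht /B mulrDr addrC lerD//.
  by rewrite mulrC.
have ayu : enorm (a y - a (u s)) <= D * (t * B) by apply: le_trans (aL _ _) _; rewrite ler_wpM2l.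
have ay : enorm (a y) <= B2.
  rewrite -[a y](subrK (a (u s))) (le_trans (enormD _ _))// addrC /B2 lerD2l.
  apply: le_trans ayu _; rewrite ler_wpM2l// -[leRHS]mul1r ler_wpM2r//.
apply: fin; first exact: enorm_ge0.
have -> : w (s + h) = flow a (s1 - s) (flow a t y).
  rewrite /w -/y -(flowD D0 aL)//; last lra.
  by congr flow; rewrite hE; ring.
apply: le_trans (flow_lip D0 aL _ _ _) _; first by lra.
apply: ler_pM; rewrite ?expR_ge0 ?enorm_ge0//.
  rewrite /K ler_expR ler_wpM2l//; lra.
have -> : flow a t y - u s = (flow a t y - y - t *: a y) + (y - u s - h *: a (u s))
    + t *: (a y - a (u s)).
  by rewrite hE; apply/matrixP => i j; rewrite !mxE; ring.
apply: le_trans (enormD _ _) _; apply: le_trans (lerD (enormD _ _) (lexx _)) _.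
rewrite enormZ (ger0_norm tp).
have k1 := step y t tp h1 erefl ay.
have k2 : t * enorm (a y - a (u s)) <= t ^+ 2 * (D * B).
  by apply: le_trans (ler_wpM2l tp ayu) _; rewrite le_eqVlt; apply/orP; left; apply/eqP; ring.
apply: le_trans (lerD (lerD k1 hd) k2) _.
by rewrite mulrDr le_eqVlt; apply/orP; left; apply/eqP; ring.
Unshelve. all: by end_near. Qed.
Lemma flow_ge0_cont t x (e : R) : 0 <= t -> 0 < e ->
  \forall s \near t, 0 <= s -> enorm (flow a t x - flow a s x) <= e.
Proof.
move=> t0 e0.
pose A := expR (D * (t + 1)) * enorm (a x) + 1.
have A0 : 0 < A by rewrite ltr_wpDl// mulr_ge0 ?expR_ge0 ?enorm_ge0.
have bnd (p q : R) : 0 <= p -> p <= q -> q <= t + 1 ->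
    enorm (flow a q x - flow a p x) <= (q - p) * A.
  move=> p0 pq qt; apply: le_trans (flow_time D0 aL _ p0 pq) _.
  rewrite ler_wpM2l ?subr_ge0// /A (@le_trans _ _ (expR (D * (t + 1)) * enorm (a x)))//.
    by rewrite ler_wpM2r ?enorm_ge0// ler_expR ler_wpM2l.
  by rewrite lerDl.
apply: (near_ball (r := Num.min 1 (e / A))); first by rewrite lt_min ltr01 divr_gt0.
move=> s; rewrite lt_min => /andP[h1 h2] s0.
rewrite ltr_norml in h1; case/andP: h1 => h3 h4.
apply: (@le_trans _ _ (`|t - s| * A)); last by rewrite -ler_pdivlMr// ltW.
have [ts|st] := leP t s.
  rewrite enormB distrC ger0_norm ?subr_ge0//; apply: bnd => //; lra.
rewrite ger0_norm ?subr_ge0 ?(ltW st)//; apply: bnd => //; lra.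
Qed.

Lemma flow_deriv_near t x (e : R) : 0 <= t -> 0 < e ->
  \forall h \near (0 : R), 0 <= t + h ->
    enorm (flow a (t + h) x - flow a t x - h *: a (flow a t x)) <= e * `|h|.
Proof.
move=> t0 e0; pose A := 2 * D * (expR (D * (t + 1 + 1)) * enorm (a x)) + 1.
have A0 : 0 < A by rewrite ltr_wpDl// !mulr_ge0 ?expR_ge0 ?enorm_ge0.
apply: (near_ball (r := Num.min 1 (e / A))); first by rewrite lt_min ltr01 divr_gt0.
move=> h; rewrite sub0r normrN lt_min => /andP[/ltW h1 /ltW h2] th0.
apply: le_trans (flow_deriv_le x t0 h1 th0 (lexx _)) _.
rewrite -(real_normK (num_real h)) expr2.
apply: (@le_trans _ _ (A * `|h| * `|h|)); last first.
  by rewrite ler_wpM2r// mulrC -ler_pdivlMr.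
rewrite mulrAC -[leRHS]mulrA ler_wpM2r ?mulr_ge0//.
by rewrite /A lerDl.
Qed.

End ode_unique.

(** * The perturbed ODE *)

Section pflow.
Context {R : realType}.
Variables (m d : nat) (a : 'cV[R]_m -> 'cV[R]_m) (sigma : 'cV[R]_m -> 'M[R]_(m, d)).
Variables (D b : R).
Hypothesis D0 : 0 <= D.
Hypothesis aL : forall x y, enorm (a x - a y) <= D * enorm (x - y).
Implicit Types (h t s : R) (x y u v : 'cV[R]_m) (w : 'cV[R]_d)
  (js : seq (R * ('cV[R]_d * 'cV[R]_m))).

Definition jump_map y w := y + clip b (sigma y *m w).

(** Explicit solution of the perturbed ODE started at time [s0] from [u]; an entry of the list is a
    jump time with its mark w and the displacement v that precedes the jump. *)
Fixpoint pflow s0 u js s : 'cV[R]_m :=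
  if js is (t, (w, v)) :: js' then
    if s < t then flow a (s - s0) u
    else pflow t (jump_map (flow a (t - s0) u + v) w) js' s
  else flow a (s - s0) u.

(** Left limits of [pflow]: a jump takes effect only strictly after its time. *)
Fixpoint pflow_left s0 u js s : 'cV[R]_m :=
  if js is (t, (w, v)) :: js' then
    if s <= t then flow a (s - s0) u
    else pflow_left t (jump_map (flow a (t - s0) u + v) w) js' s
  else flow a (s - s0) u.

Let times js := [seq p.1 | p <- js].

Lemma pflow_right s0 u js s : path <%R s0 (times js) -> s0 <= s ->
  pflow s0 u js s' @[s' --> s^'+] --> pflow s0 u js s.
Proof.
have flow_r s1 u1 t : s1 <= t -> flow a (s' - s1) u1 @[s' --> t^'+] --> flow a (t - s1) u1.
  move=> s1t; apply: cvg_enorm => e e0.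
  have t0 : 0 <= t - s1 by rewrite subr_ge0.
  have := flow_ge0_cont D0 aL u1 t0 e0.
  move=> /(@cvgB _ _ _ (t^'+) _ id (cst s1) t s1 (cvg_at_right_filter cvg_id) (cvg_cst _)) H.
  near=> s'; have : 0 <= s' - s1.
    by rewrite subr_ge0 (le_trans s1t)//; near: s'; exact: nbhs_right_ge.
  by near: s'; exact: H.
elim: js s0 u => [|[t [w v]] js IH] s0 u /=; first by move=> _; exact: flow_r.
move=> /andP[s0t pt] s0s; have [st|ts] := ltP s t.
  apply: cvg_trans (flow_r s0 u s s0s); apply: near_eq_cvg; near=> s'.
  by rewrite ifT//; near: s'; exact: nbhs_right_lt.
apply: cvg_trans (IH t _ pt ts); apply: near_eq_cvg; near=> s'.
rewrite ifF//; apply/negbTE; rewrite -leNgt (le_trans ts)//.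
Unshelve. all: by end_near. Qed.

Lemma pflow_leftP s0 u js s : path <%R s0 (times js) -> s0 < s ->
  pflow s0 u js s' @[s' --> s^'-] --> pflow_left s0 u js s.
Proof.
have flow_l s1 u1 t : s1 < t -> flow a (s' - s1) u1 @[s' --> t^'-] --> flow a (t - s1) u1.
  move=> s1t; apply: cvg_enorm => e e0.
  have t0 : 0 <= t - s1 by rewrite subr_ge0 ltW.
  have := flow_ge0_cont D0 aL u1 t0 e0.
  move=> /(@cvgB _ _ _ (t^'-) _ id (cst s1) t s1 (cvg_at_left_filter cvg_id) (cvg_cst _)) H.
  near=> s'; have : 0 <= s' - s1.
    by rewrite subr_ge0; near: s'; exact: nbhs_left_ge.
  by near: s'; exact: H.
elim: js s0 u => [|[t [w v]] js IH] s0 u /=; first by move=> _; exact: flow_l.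
move=> /andP[s0t pt] s0s; have [st|ts] := leP s t.
  apply: cvg_trans (flow_l s0 u s s0s); apply: near_eq_cvg; near=> s'.
  by rewrite ifT// (lt_le_trans _ st)//; near: s'; exact: nbhs_left_lt.
apply: cvg_trans (IH t _ pt ts); apply: near_eq_cvg; near=> s'.
by rewrite ifF//; apply/negbTE; rewrite -leNgt; near: s'; exact: nbhs_left_ge.
Unshelve. all: by end_near. Qed.

Lemma pflow_deriv s0 u js s (e : R) : path <%R s0 (times js) -> s0 <= s -> s \notin times js ->
  0 < e -> \forall h \near (0 : R), s0 <= s + h ->
  enorm (pflow s0 u js (s + h) - pflow s0 u js s - h *: a (pflow s0 u js s)) <= e * `|h|.
Proof.
have flow_d s1 u1 t : s1 <= t -> 0 < e -> \forall h \near (0 : R), s1 <= t + h ->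
    enorm (flow a (t + h - s1) u1 - flow a (t - s1) u1
           - h *: a (flow a (t - s1) u1)) <= e * `|h|.
  move=> s1t e0; have t0 : 0 <= t - s1 by rewrite subr_ge0.
  have := flow_deriv_near D0 aL u1 t0 e0; apply: filterS => h.
  by rewrite addrAC subr_ge0; exact.
elim: js s0 u => [|[t [w v]] js IH] s0 u /=; first by move=> _ h _; exact: flow_d.
move=> /andP[s0t pt] s0s; rewrite inE negb_or => /andP[st sjs] e0.
have [s_t|t_s] := ltP s t.
  have /near_ballP[r r0 hr] := flow_d s0 u s s0s e0.
  apply: (near_ball (r := Num.min r (t - s))); first by rewrite lt_min r0 subr_gt0.
  move=> h; rewrite lt_min => /andP[h1 h2]; rewrite ifT; first exact: hr.
  by move: h2; rewrite sub0r normrN ltr_norml => /andP[_]; rewrite ltrBrDl.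
have ts : t < s by rewrite lt_neqAle eq_sym st.
have /near_ballP[r r0 hr] := IH t (jump_map (flow a (t - s0) u + v) w) pt t_s sjs e0.
apply: (near_ball (r := Num.min r (s - t))); first by rewrite lt_min r0 subr_gt0.
move=> h; rewrite lt_min => /andP[h1 h2] s0h.
have th : t <= s + h.
  by move: h2; rewrite sub0r normrN ltr_norml => /andP[/ltW + _]; rewrite opprB lerBlDl addrC.
rewrite ifF; last by apply/negbTE; rewrite -leNgt.
exact: hr.
Qed.

Lemma pflow_start s0 u js : path <%R s0 (times js) -> pflow s0 u js s0 = u.
Proof.
case: js => [|[t [w v]] js] /=; first by rewrite subrr (flow0 D0 aL).
by move=> /andP[-> _]; rewrite subrr (flow0 D0 aL).
Qed.

Lemma pflow_jump s0 u js p : path <%R s0 (times js) -> p \in js ->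
  pflow s0 u js p.1 = jump_map (pflow_left s0 u js p.1 + p.2.2) p.2.1.
Proof.
elim: js s0 u => //= -[t [w v]] js IH s0 u /= /andP[s0t pt].
rewrite inE => /orP[/eqP->|pjs] /=; first by rewrite ltxx lexx pflow_start.
have tp : t < p.1.
  by move: pt; rewrite lt_path_sortedE => /andP[/allP + _]; apply; exact: map_f.
by rewrite ltNge (ltW tp)/= leNgt tp /=; exact: IH.
Qed.


Let left_limit (xi : R -> 'cV[R]_m) t := lim (xi s @[s --> t^'-]).

(** Solution of the ODE on [s0, T] away from [bad]. At s0 only right continuity is asked, since a
    jump may just have been made there; at T the increments are one-sided. *)
Definition ode_off (xi : R -> 'cV[R]_m) s0 T (bad : seq R) :=
  (forall s, s0 <= s < T -> xi s' @[s' --> s^'+] --> xi s) /\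
  (forall s, s0 < s <= T -> s \notin bad -> forall e : R, 0 < e ->
     exists2 r : R, 0 < r & forall h, `|h| < r -> s0 <= s + h <= T ->
       enorm (xi (s + h) - xi s - h *: a (xi s)) <= e * `|h|).

Lemma ode_off_sub xi s0 s1 T bad bad' : s0 <= s1 ->
  (forall s, s1 < s <= T -> s \notin bad' -> s \notin bad) ->
  ode_off xi s0 T bad -> ode_off xi s1 T bad'.
Proof.
move=> s01 bb [xr xd]; split.
  by move=> s /andP[s1s sT]; apply: xr; rewrite (le_trans s01).
move=> s /andP[s1s sT] sb e e0.
have [] := xd s _ _ e e0; first by rewrite (le_lt_trans s01).
  by apply: bb => //; rewrite s1s.
move=> r r0 hr; exists r => // h hh /andP[sh1 sh2]; apply: hr => //.
by rewrite (le_trans s01).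
Qed.

Lemma ode_off_cont xi s0 T bad t : ode_off xi s0 T bad -> s0 < t <= T -> t \notin bad ->
  forall e : R, 0 < e -> exists2 r : R, 0 < r & forall s, `|t - s| < r -> s0 <= s <= T ->
    enorm (xi t - xi s) <= e.
Proof.
move=> [_ xd] tT tb e e0; have [r r0 hr] := xd t tT tb 1 ltr01.
have A0 : 0 < 1 + enorm (a (xi t)) by rewrite ltr_pwDl ?enorm_ge0.
exists (Num.min r (e / (1 + enorm (a (xi t))))); first by rewrite lt_min r0 divr_gt0.
move=> s; rewrite lt_min => /andP[sr se] sT.
have := hr (s - t); rewrite distrC [t + _]addrC subrK => /(_ sr sT).
rewrite enormB; set z := s - t => H.
have -> : xi s - xi t = (xi s - xi t - z *: a (xi t)) + z *: a (xi t) by rewrite subrK.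
apply: le_trans (enormD _ _) _; rewrite enormZ.
apply: le_trans (lerD H (lexx _)) _.
rewrite mul1r distrC -/z -[X in X + _]mulr1 -mulrDr -ler_pdivlMr//.
by rewrite /z distrC ltW.
Qed.

Lemma ode_off_flow xi s0 T bad s : ode_off xi s0 T bad -> s0 <= s <= T ->
  (forall t, s0 < t <= s -> t \notin bad) -> xi s = flow a (s - s0) (xi s0).
Proof.
move=> xo /andP[]; rewrite le_eqVlt => /orP[/eqP <- _ _|s0s sT nb].
  by rewrite subrr (flow0 D0 aL).
have cont := ode_off_cont xo.
apply: (ode_unique D0 aL); first exact: ltW.
  suff H : forall t : R, t \in `[s0, s] -> xi x @[x --> within `[s0, s] (nbhs t)] --> xi t.
    by apply/subspace_continuousP => t /= tI; exact: H.
  move=> t; rewrite in_itv/= => /andP[]; rewrite le_eqVlt => /orP[/eqP <- _|s0t ts].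
    have := xo.1 s0; rewrite lexx (lt_le_trans s0s)// => /(_ isT) H.
    apply: cvg_enorm => e e0; have := cvg_enormP H e0; case=> r /= r0 hr.
    exists r => //= s' sr; rewrite in_itv/= => /andP[].
    rewrite le_eqVlt => /orP[/eqP <- _|s0s' _]; first by rewrite subrr enorm0 ltW.
    exact: hr.
  apply: cvg_enorm => e e0.
  have [| |r r0 hr] := cont t _ _ e e0; first by rewrite s0t (le_trans ts).
    by apply: nb; rewrite s0t.
  exists r => //= s' sr; rewrite in_itv/= => /andP[s0s' s's].
  by apply: hr => //; rewrite s0s' (le_trans s's).
move=> t /andP[s0t ts] e e0.
have [| |r r0 hr] := xo.2 t _ _ e e0; first by rewrite s0t (le_trans (ltW ts)).
  by apply: nb; rewrite s0t ltW.
exists (Num.min r (Num.min (t - s0) (s - t))) => /=.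
  by rewrite !lt_min r0 !subr_gt0 s0t.
move=> h /=; rewrite sub0r normrN !lt_min => /and3P[h1 h2 h3] _.
apply: hr => //.
move: h2 h3; rewrite !ltr_norml => /andP[h21 h22] /andP[h31 h32].
apply/andP; split; lra.
Qed.

(** Up to the first jump time the path is a flow line by [ode_off_flow]; this gives its left limit
    there, hence the value after the jump, from which the induction restarts. *)
Lemma pflow_unique T (xi : R -> 'cV[R]_m) s0 u js : path <%R s0 (times js) ->
  all (fun t => t <= T) (times js) -> xi s0 = u -> ode_off xi s0 T (times js) ->
  (forall p, p \in js -> xi p.1 = jump_map (left_limit xi p.1 + p.2.2) p.2.1) ->
  forall s, s0 <= s <= T -> xi s = pflow s0 u js s.
Proof.
elim: js s0 u => [|[t [w v]] js IH] s0 u /=.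
  by move=> _ _ <- xo _ s sT; apply: (ode_off_flow xo sT).
move=> /andP[s0t pt] /andP[tT jT] xu xo xj s /andP[s0s sT].
have piece s' : s0 <= s' < t -> xi s' = flow a (s' - s0) u.
  move=> /andP[s0s' s't]; rewrite -xu; apply: (ode_off_flow xo).
    by rewrite s0s' (le_trans (ltW s't)).
  move=> t' /andP[_ t's']; rewrite inE negb_or lt_eqF ?(le_lt_trans t's')//=.
  apply/negP => t'js; move: pt; rewrite lt_path_sortedE => /andP[/allP /(_ _ t'js) + _].
  by move=> /(lt_trans s't) /(le_lt_trans t's'); rewrite ltxx.
have [st|ts] := ltP s t; first by apply: piece; rewrite s0s.
have lE : left_limit xi t = flow a (t - s0) u.
  apply: cvg_lim => //.
  have := @pflow_leftP s0 u [::] t isT s0t; apply: cvg_trans; apply: near_eq_cvg.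
  near=> s' => /=; rewrite piece//; apply/andP; split.
    by near: s'; exact: nbhs_left_ge.
  by near: s'; exact: nbhs_left_lt.
apply: IH => //; last by rewrite ts.
- by have /= := xj (t, (w, v)) (mem_head _ _); rewrite lE.
- apply: ode_off_sub xo; first exact: ltW.
  by move=> s' /andP[ts' _] s'js; rewrite inE negb_or s'js gt_eqF.
- by move=> p pjs; apply: xj; rewrite inE pjs orbT.
Unshelve. all: by end_near. Qed.

Definition cut T (f : R -> 'cV[R]_m) t := if t \in `[0, T] then f t else 0.

Lemma cut_pflow_cadlag T s0 u js : s0 <= 0 -> path <%R s0 (times js) ->
  cadlag T (cut T (pflow s0 u js)).
Proof.
move=> s00 pj; split=> t /andP[t1 t2].
  rewrite {2}/cut in_itv/= t1 (ltW t2)/=.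
  apply: cvg_trans (pflow_right (u := u) pj (le_trans s00 t1)); apply: near_eq_cvg; near=> s'.
  rewrite /cut ifT// in_itv/=; apply/andP; split.
    by rewrite (le_trans t1)//; near: s'; exact: nbhs_right_ge.
  by near: s'; exact: nbhs_right_le.
apply: (cvgP (pflow_left s0 u js t)).
apply: cvg_trans (pflow_leftP (u := u) pj (le_lt_trans s00 t1)); apply: near_eq_cvg; near=> s'.
rewrite /cut ifT// in_itv/=; apply/andP; split.
  by near: s'; exact: nbhs_left_ge.
by rewrite (le_trans _ t2)//; near: s'; exact: nbhs_left_le.
Unshelve. all: by end_near. Qed.

Lemma cut_out T f t : t \notin `[0, T] -> cut T f t = 0.
Proof. by rewrite /cut => /negbTE ->. Qed.

Definition jumps k (W : k.-tuple 'cV[R]_d) (V : k.-tuple 'cV[R]_m) (t : k.-tuple R) :=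
  zip t (zip W V).

Lemma jumps_times k (W : k.-tuple 'cV[R]_d) (V : k.-tuple 'cV[R]_m) (t : k.-tuple R) :
  times (jumps W V t) = t.
Proof. by rewrite /times -/unzip1 unzip1_zip// size_zip !size_tuple minnn. Qed.

Lemma jumpsP k (W : k.-tuple 'cV[R]_d) (V : k.-tuple 'cV[R]_m) (t : k.-tuple R) p :
  p \in jumps W V t <-> exists j, p = (tnth t j, (tnth W j, tnth V j)).
Proof.
pose p0 := ((0 : R), ((0 : 'cV[R]_d), (0 : 'cV[R]_m))).
have sz : size (jumps W V t) = k by rewrite !size_zip !size_tuple !minnn.
have nthj (j : 'I_k) : nth p0 (jumps W V t) j = (tnth t j, (tnth W j, tnth V j)).
  by rewrite /jumps !nth_zip ?size_zip ?size_tuple ?minnn// -!tnth_nth.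
split=> [/(nthP p0)[j]|[j ->]].
  by rewrite sz => jk <-; exists (Ordinal jk); rewrite -nthj.
by rewrite -nthj mem_nth// sz.
Qed.

Lemma increasing_path T k (t : k.-tuple R) : increasing_times `]0, T] t ->
  path <%R 0 t /\ all (fun s => s <= T) t.
Proof.
move=> [st tI]; split; last first.
  by apply/allP => s /(allP tI); rewrite in_itv/= => /andP[].
rewrite lt_path_sortedE st andbT; apply/allP => s /(allP tI).
by rewrite in_itv/= => /andP[].
Qed.

Definition pflow_path T x k (W : k.-tuple 'cV[R]_d) (V : k.-tuple 'cV[R]_m) (t : k.-tuple R)
    (tI : increasing_times `]0, T] t) : skorokhod T m :=
  Skorokhod (@cut_pflow_cadlag T 0 x (jumps W V t) (lexx 0)
    (eq_ind_r (path <%R 0) (increasing_path tI).1 (jumps_times W V t)))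
    (@cut_out T (pflow 0 x (jumps W V t))).

Lemma pflow_perturbed_ode T x k (W : k.-tuple 'cV[R]_d) (V : k.-tuple 'cV[R]_m)
    (t : k.-tuple R) (tI : increasing_times `]0, T] t) : 0 < T ->
  perturbed_ode a sigma b x W V t (pflow_path x W V tI).
Proof.
move=> T0; have [pt tT] := increasing_path tI.
have pj : path <%R 0 (times (jumps W V t)) by rewrite jumps_times.
split.
- by rewrite /= /cut in_itv/= lexx ltW// pflow_start.
- move=> s sT st; have [s0 s_T] : 0 <= s /\ s <= T by move: sT; rewrite in_itv/= => /andP[].
  apply: cvg_enorm => e e0.
  have st' : s \notin times (jumps W V t) by rewrite jumps_times.
  have /near_ballP[r r0 hr] := pflow_deriv x pj s0 st' e0.
  exists r => //= h; rewrite /ball/= => hh h0 /= shT.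
  rewrite /= /cut sT shT enormB.
  move: shT; rewrite in_itv/= => /andP[sh0 _].
  have := hr h hh sh0.
  set y := pflow _ _ _ s; set z := pflow _ _ _ (s + h) => H.
  have -> : h^-1 *: (z - y) - a y = h^-1 *: (z - y - h *: a y).
    by rewrite [RHS]scalerBr scalerA mulVf// scale1r.
  by rewrite enormZ normfV ler_pdivrMl ?normr_gt0// mulrC.
- move=> j; have tj : (tnth t j, (tnth W j, tnth V j)) \in jumps W V t by apply/jumpsP; exists j.
  have /(allP (tI.2)) := mem_tnth j t; rewrite in_itv/= => /andP[tj0 tjT].
  have -> : lim (pflow_path x W V tI s @[s --> (tnth t j)^'-]) =
      pflow_left 0 x (jumps W V t) (tnth t j).
    apply: cvg_lim => //; apply: cvg_trans (pflow_leftP (u := x) pj tj0); apply: near_eq_cvg; near=> s'.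
    rewrite /= /cut ifT// in_itv/=; apply/andP; split.
      by near: s'; exact: nbhs_left_ge.
    by rewrite (le_trans _ tjT)//; near: s'; exact: nbhs_left_le.
  by rewrite /= /cut in_itv/= (ltW tj0) tjT/= (pflow_jump x pj tj).
Unshelve. all: by end_near. Qed.

Lemma perturbed_ode_unique T x k (W : k.-tuple 'cV[R]_d) (V : k.-tuple 'cV[R]_m)
    (t : k.-tuple R) (xi : skorokhod T m) : 0 < T -> increasing_times `]0, T] t ->
  perturbed_ode a sigma b x W V t xi ->
  {in `[0, T], xi =1 pflow 0 x (jumps W V t)}.
Proof.
move=> T0 tI [x0 xd xj] s; rewrite in_itv/= => sT.
have [pt tT] := increasing_path tI.
apply: (@pflow_unique T) sT; rewrite ?jumps_times//; last first.
  by move=> _ /jumpsP[j ->] /=; exact: xj.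
split=> [t' tT'|s' /andP[s0 s'T] s't e e0]; first exact: (path_cadlag xi).1.
have sI : s' \in `[0, T] by rewrite in_itv/= (ltW s0).
have := cvg_enormP (xd s' sI s't) e0; case=> r /= r0 hr.
exists r => // h hh shT; have [->|h0] := eqVneq h 0.
  by rewrite addr0 subrr scale0r subrr enorm0 normr0 mulr0.
have := hr h; rewrite /ball/= sub0r normrN => /(_ hh h0); rewrite in_itv/= => /(_ shT).
set y := xi s'; set z := xi (s' + h) => H.
have -> : z - y - h *: a y = - h *: (a y - h^-1 *: (z - y)).
  by rewrite scaleNr -scalerN opprB [RHS]scalerBr scalerA mulfV// scale1r.
by rewrite enormZ normrN mulrC ler_wpM2r.
Qed.

(** The explicit path witnesses existence, so [xget] returns a solution, and uniqueness identifies
    it. *)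
Lemma hbarE T x k (W : k.-tuple 'cV[R]_d) (V : k.-tuple 'cV[R]_m) (t : k.-tuple R) :
  0 < T -> increasing_times `]0, T] t ->
  {in `[0, T], hbar a sigma b T x W V t =1 pflow 0 x (jumps W V t)}.
Proof.
move=> T0 tI; apply: perturbed_ode_unique => //.
apply: (@xgetPex _ point (perturbed_ode a sigma b x W V t)).
by exists (pflow_path x W V tI); exact: pflow_perturbed_ode.
Qed.

End pflow.

(** * Stability of the perturbed ODE in its data *)

Section pflow_estimates.
Context {R : realType}.
Variables (m d : nat) (a : 'cV[R]_m -> 'cV[R]_m) (sigma : 'cV[R]_m -> 'M[R]_(m, d)).
Variables (D b T : R).
Hypothesis D0 : 0 <= D.
Hypothesis aL : forall x y, enorm (a x - a y) <= D * enorm (x - y).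
Hypothesis sL : forall x y, opnorm (sigma x - sigma y) <= D * enorm (x - y).
Hypothesis b0 : 0 < b.
Hypothesis T0 : 0 < T.
Implicit Types (h t s r M Delta rho Rg Sg delta : R) (x y u v : 'cV[R]_m) (w : 'cV[R]_d)
  (js : seq (R * ('cV[R]_d * 'cV[R]_m))).

Local Notation jumpm := (jump_map sigma b).
Local Notation pflow := (pflow a sigma b).
Let times js := [seq p.1 | p <- js].
Let E := expR (D * T).

Let E1 : 1 <= E. Proof. by rewrite -expR0 ler_expR mulr_ge0// ltW. Qed.

Lemma sigma_le x y : opnorm (sigma x) <= opnorm (sigma y) + D * enorm (x - y).
Proof. by rewrite addrC (le_trans (opnorm_le_sub _ (sigma y)))// lerD2r. Qed.

Lemma jump_lip y y' w w' :
  enorm (jumpm y w - jumpm y' w') <=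
    (1 + 2 * D * enorm w) * enorm (y - y') + 2 * opnorm (sigma y') * enorm (w - w').
Proof.
rewrite /jump_map opprD addrACA; apply: le_trans (enormD _ _) _.
rewrite mulrDl mul1r -addrA lerD2l; apply: le_trans (clip_lip b0 _ _) _.
have -> : sigma y *m w - sigma y' *m w' = (sigma y - sigma y') *m w + sigma y' *m (w - w').
  by rewrite mulmxBl mulmxBr addrA subrK.
rewrite -!mulrA -mulrDr ler_wpM2l//; apply: le_trans (enormD _ _) _; apply: lerD.
  apply: le_trans (opnormP _ _) _.
  by rewrite mulrCA mulrC ler_wpM2l ?enorm_ge0// mulrC.
exact: opnormP.
Qed.

Lemma enorm_jump y w : enorm (jumpm y w) <= enorm y + b.
Proof. by apply: le_trans (enormD _ _) _; rewrite lerD2l enorm_clip. Qed.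

Lemma flow_lipE t x y : 0 <= t <= T -> enorm (flow a t x - flow a t y) <= E * enorm (x - y).
Proof.
move=> /andP[t0 tT]; apply: le_trans (flow_lip D0 aL _ _ t0) _.
by rewrite ler_wpM2r ?enorm_ge0// ler_expR ler_wpM2l.
Qed.

Lemma flow_timeE s t x : 0 <= s <= T -> 0 <= t <= T ->
  enorm (flow a t x - flow a s x) <= `|t - s| * (E * enorm (a x)).
Proof.
wlog st : s t / s <= t.
  move=> H sT tT; have [st|ts] := leP s t; first exact: H.
  by rewrite enormB distrC H// ltW.
move=> /andP[s0 _] /andP[t0 tT]; apply: le_trans (flow_time D0 aL _ s0 st) _.
rewrite ger0_norm ?subr_ge0// ler_wpM2l ?subr_ge0//.
by rewrite ler_wpM2r ?enorm_ge0// ler_expR ler_wpM2l.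
Qed.

Definition growth (r : R) := r + T * (E * (enorm (a 0) + D * r)).

Lemma growth_ge r : 0 <= r -> r <= growth r.
Proof. by move=> r0; rewrite lerDl !mulr_ge0 ?addr_ge0 ?mulr_ge0 ?enorm_ge0 ?expR_ge0// ltW. Qed.

Lemma growth_le r r' : r <= r' -> growth r <= growth r'.
Proof.
move=> rr; rewrite lerD// ler_wpM2l ?(ltW T0)// ler_wpM2l ?expR_ge0//.
by rewrite lerD2l ler_wpM2l.
Qed.

Lemma enorm_flow t x : 0 <= t <= T -> enorm (flow a t x) <= growth (enorm x).
Proof.
move=> tT; have := @flow_timeE 0 t x; rewrite lexx (ltW T0) => /(_ isT tT).
rewrite (flow0 D0 aL) subr0 => H.
rewrite -[flow a t x](subrK x) (le_trans (enormD _ _))// addrC lerD2l.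
apply: le_trans H _; case/andP: tT => t0 tT; rewrite ger0_norm//.
apply: ler_pM; rewrite ?mulr_ge0 ?expR_ge0 ?enorm_ge0//.
rewrite ler_wpM2l ?expR_ge0//.
by have := enorm_a_le aL x 0; rewrite subr0.
Qed.

(** Radius reached after n jumps from radius r: the flow between jumps gives [growth], and a jump
    adds at most 1 by its displacement and b by its truncated size. *)
Fixpoint reach (n : nat) (r : R) :=
  if n is n'.+1 then reach n' (growth r + 1 + b) else growth r.

Lemma reach_ge n r : 0 <= r -> growth r <= reach n r.
Proof.
elim: n r => // n IH r r0 /=.
have g0 : 0 <= growth r by apply: le_trans (growth_ge r0).
have h0 : 0 <= growth r + 1 + b by apply: addr_ge0 (ltW b0); exact: addr_ge0.
apply: le_trans (IH _ h0); apply: le_trans (growth_ge h0).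
by rewrite -addrA lerDl addr_ge0// ltW.
Qed.

Lemma reach_le n r r' : r <= r' -> reach n r <= reach n r'.
Proof.
elim: n r r' => [|n IH] r r' rr /=; first exact: growth_le.
by apply: IH; rewrite !lerD2r growth_le.
Qed.

Lemma enorm_pflow s0 u js s : path <%R s0 (times js) -> 0 <= s0 <= s -> s <= T ->
  (forall p, p \in js -> enorm p.2.2 <= 1) ->
  enorm (pflow s0 u js s) <= reach (size js) (enorm u).
Proof.
elim: js s0 u => [|[t [w v]] js IH] s0 u /=.
  move=> _ /andP[s00 s0s] sT _; apply: enorm_flow; apply/andP; split; lra.
move=> /andP[s0t pt] /andP[s00 s0s] sT vs; have [st|ts] := ltP s t.
  apply: le_trans (enorm_flow _ _) _; first by apply/andP; split; lra.
  exact: (@reach_ge (size js).+1 _ (enorm_ge0 u)).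
apply: le_trans (IH t _ pt _ sT _) _.
- by rewrite ts andbT; lra.
- by move=> p pjs; apply: vs; rewrite inE pjs orbT.
apply: reach_le; apply: le_trans (enorm_jump _ _) _; rewrite lerD2r.
apply: le_trans (enormD _ _) _; apply: lerD; last exact: (vs _ (mem_head _ _)).
by apply: enorm_flow; apply/andP; split; lra.
Qed.

(** The bound M is asked of the marks of one list and the bound 1 of the displacements of the other,
    because in [jump_lip] the constant involves the mark of one path and the state of the other. *)
Fixpoint close_jumps (l : R -> R) (M Delta : R) js js' : Prop :=
  match js, js' with
  | [::], [::] => True
  | (t, (w, v)) :: js1, (t', (w', v')) :: js1' =>
    [/\ t = l t', enorm w <= M /\ enorm (w - w') <= Delta,
      enorm (v - v') <= Delta, enorm v' <= 1 & close_jumps l M Delta js1 js1']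
  | _, _ => False
  end.

Lemma close_jumps_le l M Delta Delta' js js' : Delta <= Delta' ->
  close_jumps l M Delta js js' -> close_jumps l M Delta' js js'.
Proof.
move=> dd; elim: js js' => [|[t [w v]] js IH] [|[t' [w' v']] js'] //=.
move=> [-> [wM ww] vv v1 h]; split => //; last exact: IH.
- by split => //; exact: le_trans ww dd.
- exact: le_trans vv dd.
Qed.

Lemma pflow_close n M r : 0 <= M -> 0 <= r -> exists2 C : R, 1 <= C &
  forall (l : R -> R) Delta s0 s0' u u' js js' s,
    {in `[0, T] &, {mono l : p q / p < q}} -> {homo l : p / p \in `[0, T]} ->
    (forall q : R, q \in `[0, T] -> `|l q - q| <= Delta) -> s0 = l s0' ->
    path <%R s0' (times js') -> all (fun t => t <= T) (times js') ->
    close_jumps l M Delta js js' -> size js' = n ->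
    enorm (u - u') <= Delta -> enorm u' <= r -> 0 <= s0' <= s -> s <= T ->
    enorm (pflow s0 u js (l s) - pflow s0' u' js' s) <= C * Delta.
Proof.
move=> M0; elim: n r => [|n IH] r r0.
  exists (E + 2 * (E * (enorm (a 0) + D * r))).
    by rewrite (le_trans E1)// lerDl !mulr_ge0 ?addr_ge0 ?mulr_ge0 ?enorm_ge0 ?expR_ge0.
  move=> l Delta s0 s0' u u' js js' s lmono lT lD -> pj jT cj sj uu u'r /andP[s0s' s's] sT.
  clear pj jT; case: js' sj cj => //= _; case: js => [|[? [? ?]] ?] //= _.
  have s0I : s0' \in `[0, T] by rewrite in_itv/= s0s' (le_trans s's).
  have sI : s \in `[0, T] by rewrite in_itv/= sT (le_trans s0s').
  have lmono' : l s0' <= l s by rewrite leNgt (lmono _ _ sI s0I) -leNgt.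
  have := lT _ s0I; have := lT _ sI; rewrite !in_itv/= => /andP[ls0 lsT] /andP[ls0' lsT'].
  have t1 : 0 <= l s - l s0' <= T by apply/andP; split; lra.
  have t2 : 0 <= s - s0' <= T by apply/andP; split; lra.
  apply: le_trans (enorm_dist_triangle _ (flow a (l s - l s0') u') _) _.
  rewrite mulrDl; apply: lerD.
    by apply: le_trans (flow_lipE _ _ t1) _; rewrite ler_wpM2l ?expR_ge0.
  apply: le_trans (flow_timeE _ t2 t1) _.
  have k1 : `|l s - l s0' - (s - s0')| <= 2 * Delta.
    have -> : l s - l s0' - (s - s0') = (l s - s) - (l s0' - s0') by ring.
    apply: le_trans (ler_normB _ _) _; rewrite mulr_natl mulr2n.
    by apply: lerD; exact: lD.
  rewrite mulrAC; apply: ler_pM => //; first by rewrite mulr_ge0 ?expR_ge0 ?enorm_ge0.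
  rewrite ler_wpM2l ?expR_ge0//; apply: le_trans (enorm_a_le aL u' 0) _.
  by rewrite subr0 lerD2l ler_wpM2l.
have r1 : 0 <= growth r + 1 + b.
  by apply: addr_ge0 (ltW b0); apply: addr_ge0 => //; exact: le_trans (growth_ge r0).
have [C C1 hC] := IH (growth r + 1 + b) r1.
set E2 := E + 2 * (E * (enorm (a 0) + D * r)).
have E2_1 : 1 <= E2.
  by rewrite (le_trans E1)// lerDl !mulr_ge0 ?addr_ge0 ?mulr_ge0 ?enorm_ge0 ?expR_ge0.
set Sg := opnorm (sigma 0) + D * (growth r + 1).
have Sg0 : 0 <= Sg.
  rewrite addr_ge0 ?opnorm_ge0// mulr_ge0//; apply: addr_ge0 => //.
  exact: le_trans (growth_ge r0).
(* The state error before the jump is at most (E2 + 1) Delta, the 1 coming from the displacements,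
   and the jump multiplies it by 1 + 2 D M; the error of the mark is multiplied by 2 Sg. *)
set C' := (1 + 2 * D * M) * (E2 + 1) + 2 * Sg.
have C'1 : 1 <= C'.
  have k1 : 1 <= 1 + 2 * D * M by rewrite lerDl !mulr_ge0.
  have k2 : 1 <= E2 + 1 by rewrite (le_trans E2_1)// lerDl.
  have k3 : 1 <= (1 + 2 * D * M) * (E2 + 1) by rewrite (le_trans k1)// ler_peMr// (le_trans _ k1).
  by rewrite (le_trans k3)// /C' lerDl mulr_ge0.
have C'E : E2 <= C'.
  have k1 : 1 <= 1 + 2 * D * M by rewrite lerDl !mulr_ge0.
  have k3 : E2 <= (1 + 2 * D * M) * (E2 + 1).
    rewrite -[leLHS]mul1r; apply: ler_pM => //; first exact: le_trans ler01 E2_1.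
    by rewrite lerDl.
  by rewrite (le_trans k3)// /C' lerDl mulr_ge0.
exists (C * C'); first by rewrite -[1]mulr1 ler_pM.
move=> l Delta s0 s0' u u' js js' s lmono lT lD s0E pj jT cj sj uu u'r /andP[s0s' s's] sT.
case: js' sj cj pj jT => //= -[t' [w' v']] js' [sj].
case: js => [|[t [w v]] js] //= [tE [wM ww] vv v1 cj] /andP[s0t pt] /andP[tT' jT].
have Delta0 : 0 <= Delta by exact: le_trans (enorm_ge0 _) uu.
have s0I : s0' \in `[0, T] by rewrite in_itv/= s0s' (le_trans s's).
have sI : s \in `[0, T] by rewrite in_itv/= sT (le_trans s0s').
have tI : t' \in `[0, T] by rewrite in_itv/= tT' andbT (le_trans s0s')// ltW.
have piece q : s0' <= q -> q \in `[0, T] ->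
    enorm (flow a (l q - s0) u - flow a (q - s0') u') <= E2 * Delta.
  move=> s0q qI.
  have lmono' : l s0' <= l q by rewrite leNgt (lmono _ _ qI s0I) -leNgt.
  have := lT _ s0I; have := lT _ qI; have := qI; rewrite s0E !in_itv/=.
  move=> /andP[q0 qT] /andP[ls0 lsT] /andP[ls0' lsT'].
  have t1 : 0 <= l q - l s0' <= T by apply/andP; split; lra.
  have t2 : 0 <= q - s0' <= T by apply/andP; split; lra.
  apply: le_trans (enorm_dist_triangle _ (flow a (l q - l s0') u') _) _.
  rewrite mulrDl; apply: lerD.
    by apply: le_trans (flow_lipE _ _ t1) _; rewrite ler_wpM2l ?expR_ge0.
  apply: le_trans (flow_timeE _ t2 t1) _.
  have k1 : `|l q - l s0' - (q - s0')| <= 2 * Delta.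
    have -> : l q - l s0' - (q - s0') = (l q - q) - (l s0' - s0') by ring.
    apply: le_trans (ler_normB _ _) _; rewrite mulr_natl mulr2n.
    by apply: lerD; exact: lD.
  rewrite mulrAC; apply: ler_pM => //; first by rewrite mulr_ge0 ?expR_ge0 ?enorm_ge0.
  rewrite ler_wpM2l ?expR_ge0//; apply: le_trans (enorm_a_le aL u' 0) _.
  by rewrite subr0 lerD2l ler_wpM2l.
rewrite tE (lmono _ _ sI tI); have [st|ts] := ltP s t'.
  apply: le_trans (piece s s's sI) _; rewrite ler_wpM2r//.
  by rewrite (le_trans C'E)// ler_peMl// (le_trans _ C'1).
have ylt : enorm (flow a (t' - s0') u') <= growth r.
  apply: le_trans (enorm_flow _ _) (growth_le u'r).
  by apply/andP; split; lra.
have yv : enorm (flow a (t' - s0') u' + v') <= growth r + 1.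
  by apply: le_trans (enormD _ _) _; exact: lerD.
(* The rest of the path is compared with the larger tolerance C' Delta. *)
rewrite -mulrA; apply: (hC l (C' * Delta) _ t' _ _ _ js' s) => //.
- by move=> q qI; apply: le_trans (lD _ qI) _; rewrite ler_peMl.
- by apply: close_jumps_le cj; rewrite ler_peMl.
- apply: le_trans (jump_lip _ _ _ _) _; rewrite /C' (mulrDl _ (2 * Sg)); apply: lerD; last first.
    apply: ler_pM; rewrite ?mulr_ge0 ?opnorm_ge0 ?enorm_ge0//.
    rewrite ler_wpM2l//; apply: le_trans (sigma_le _ 0) _.
    by rewrite subr0 lerD2l ler_wpM2l.
  rewrite -[leRHS]mulrA; apply: ler_pM; first by rewrite addr_ge0 ?mulr_ge0 ?enorm_ge0.
  - exact: enorm_ge0.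
  - by rewrite lerD2l ler_wpM2l ?mulr_ge0.
  rewrite opprD addrACA mulrDl mul1r; apply: le_trans (enormD _ _) _.
  by apply: lerD => //; apply: piece => //; exact: ltW.
- apply: le_trans (enorm_jump _ _) _; rewrite lerD2r//.
- by rewrite ts andbT (le_trans s0s')// ltW.
Qed.

(** Approximate solutions with marks. Between marks, y stays within rho of the flow restarted at its
    own value at the last mark, so errors do not accumulate. The point p is the state from which the
    jump starts; it need not be a value of y. *)
Fixpoint tracks (rho : R) (y : R -> 'cV[R]_m) s0 (js : seq (R * 'cV[R]_d)) : Prop :=
  if js is (t, w) :: js' then
    [/\ s0 < t <= T,
      forall s, s0 <= s < t -> enorm (y s - flow a (s - s0) (y s0)) <= rho,
      exists2 p, enorm (p - flow a (t - s0) (y s0)) <= rho & enorm (y t - jumpm p w) <= rho &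
      tracks rho y t js']
  else forall s, s0 <= s <= T -> enorm (y s - flow a (s - s0) (y s0)) <= rho.

Lemma tracks_times rho (y : R -> 'cV[R]_m) s0 (js : seq (R * 'cV[R]_d)) : tracks rho y s0 js ->
  path <%R s0 [seq p.1 | p <- js] /\ all (fun t => t <= T) [seq p.1 | p <- js].
Proof.
elim: js s0 => [|[t w] js IH] s0 //= [/andP[-> ->] _ _ /IH[-> ->]].
by [].
Qed.

(** The displacement at a mark carries the solution exactly to p, so that just after the jump it is
    again within rho of y. Hence the constant 1 + E is independent of the number and the size of the
    marks. *)
Lemma tracks_pflow rho (y : R -> 'cV[R]_m) s0 (js : seq (R * 'cV[R]_d)) u : 0 <= rho -> 0 <= s0 <= T ->
  tracks rho y s0 js -> enorm (u - y s0) <= rho ->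
  exists vs : seq 'cV[R]_m, [/\ size vs = size js,
    forall v, v \in vs -> enorm v <= (1 + E) * rho &
    forall s, s0 <= s <= T -> enorm (y s -
      pflow s0 u (zip [seq p.1 | p <- js] (zip [seq p.2 | p <- js] vs)) s) <= (1 + E) * rho].
Proof.
move=> rho0; elim: js s0 u => [|[t w] js IH] s0 u /andP[s00 s0T] /=.
  move=> ys us; exists [::]; split => // s sT /=.
  apply: le_trans (enorm_dist_triangle _ (flow a (s - s0) (y s0)) _) _.
  rewrite mulrDl mul1r; apply: lerD; first exact: ys.
  apply: le_trans (flow_lipE _ _ _) _; first by case/andP: sT => ? ?; apply/andP; split; lra.
  by rewrite ler_wpM2l ?expR_ge0// enormB.
move=> [/andP[s0t tT] ys [p pE yt] tr] us.
have tI : 0 <= t - s0 <= T by apply/andP; split; lra.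
have [||vs [vs1 vs2 vs3]] := IH t (jumpm p w) _ tr.
- by rewrite tT andbT (le_trans s00)// ltW.
- by rewrite enormB.
exists ((p - flow a (t - s0) u) :: vs); split; first by rewrite /= vs1.
  move=> v; rewrite inE => /orP[/eqP->|/vs2//].
  apply: le_trans (enorm_dist_triangle _ (flow a (t - s0) (y s0)) _) _.
  rewrite mulrDl mul1r lerD//; apply: le_trans (flow_lipE _ _ tI) _.
  by rewrite ler_wpM2l ?expR_ge0// enormB.
move=> s /andP[s0s sT] /=; rewrite [flow a (t - s0) u + _]addrC subrK.
have [st|ts] := ltP s t; last by apply: vs3; rewrite ts.
apply: le_trans (enorm_dist_triangle _ (flow a (s - s0) (y s0)) _) _.
rewrite mulrDl mul1r; apply: lerD; first by apply: ys; rewrite s0s.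
apply: le_trans (flow_lipE _ _ _) _; first by apply/andP; split; lra.
by rewrite ler_wpM2l ?expR_ge0// enormB.
Qed.

Definition null_jumps (js : seq (R * 'cV[R]_d)) : seq (R * ('cV[R]_d * 'cV[R]_m)) :=
  [seq (p.1, (p.2, 0)) | p <- js].

Lemma tracks_self rho (y : R -> 'cV[R]_m) s0 u (js : seq (R * 'cV[R]_d)) : 0 <= rho ->
  path <%R s0 [seq p.1 | p <- js] -> all (fun t => t <= T) [seq p.1 | p <- js] -> s0 <= T ->
  (forall s, s0 <= s <= T -> y s = pflow s0 u (null_jumps js) s) -> tracks rho y s0 js.
Proof.
move=> rho0; elim: js s0 u => [|[t w] js IH] s0 u /=.
  by move=> _ _ s0T yE s sT; rewrite !yE ?lexx//= subrr (flow0 D0 aL) subrr enorm0.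
move=> /andP[s0t pt] /andP[tT jT] s0T yE.
have y0 : y s0 = u by rewrite yE ?lexx// s0t subrr (flow0 D0 aL).
have ptn : path <%R t (times (null_jumps js)) by rewrite /times /null_jumps -map_comp.
have yt : y t = jumpm (flow a (t - s0) u) w.
  by rewrite yE ?tT ?(ltW s0t)// ltxx addr0 (pflow_start _ _ D0 aL).
split; first by rewrite s0t.
- move=> s /andP[s0s st]; rewrite yE ?s0s ?(le_trans (ltW st))// st y0 subrr enorm0//.
- exists (flow a (t - s0) u); first by rewrite y0 subrr enorm0.
  by rewrite yt subrr enorm0.
- apply: (IH t (jumpm (flow a (t - s0) u + 0) w)) => // s /andP[ts sT].
  by rewrite yE ?sT ?(le_trans (ltW s0t))// ltNge ts.
Qed.

(** Omitting a mark of size delta shifts the state by at most Sg delta, and the flow stretches this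
    by at most E until the next mark, where [tracks] starts afresh. *)
Lemma tracks_drop rho (y : R -> 'cV[R]_m) s0 u (js1 js2 : seq (R * 'cV[R]_d)) t w Rg Sg delta :
  path <%R s0 [seq p.1 | p <- js1 ++ (t, w) :: js2] ->
  all (fun t => t <= T) [seq p.1 | p <- js1 ++ (t, w) :: js2] -> 0 <= s0 ->
  (forall s, s0 <= s <= T -> y s = pflow s0 u (null_jumps (js1 ++ (t, w) :: js2)) s) ->
  (forall s, s0 <= s <= T -> enorm (y s) <= Rg) ->
  (forall x, enorm x <= Rg + b -> opnorm (sigma x) <= Sg) ->
  enorm w <= delta -> 0 <= delta -> E * (Sg * delta) <= rho ->
  tracks rho y s0 (js1 ++ js2).
Proof.
move=> + + + + yR sS wd delta0 hrho.
elim: js1 s0 u yR => [|[t1 w1] js1 IH] s0 u yR /=; last first.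
  move=> /andP[s0t pt] /andP[tT jT] s00 yE.
  have rho0 : 0 <= rho.
    apply: le_trans hrho; rewrite mulr_ge0 ?expR_ge0 ?mulr_ge0//.
    apply: le_trans (opnorm_ge0 (sigma 0)) (sS _ _); rewrite enorm0 addr_ge0 ?(ltW b0)//.
    by apply: le_trans (enorm_ge0 _) (yR s0 _); rewrite lexx (le_trans (ltW s0t)).
  have y0 : y s0 = u.
    by rewrite yE ?lexx ?(le_trans (ltW s0t))// s0t subrr (flow0 D0 aL).
  have ptn : path <%R t1 (times (null_jumps (js1 ++ (t, w) :: js2))).
    by rewrite /times /null_jumps -map_comp.
  have yt : y t1 = jumpm (flow a (t1 - s0) u) w1.
    by rewrite yE ?tT ?(ltW s0t)// ltxx addr0 (pflow_start _ _ D0 aL).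
  split; first by rewrite s0t.
  - move=> s /andP[s0s st]; rewrite yE ?s0s ?(le_trans (ltW st))// st y0 subrr enorm0//.
  - exists (flow a (t1 - s0) u); first by rewrite y0 subrr enorm0.
    by rewrite yt subrr enorm0.
  - apply: (IH t1 (jumpm (flow a (t1 - s0) u + 0) w1)) => //.
    + by move=> s /andP[ts sT]; apply: yR; rewrite sT (le_trans (ltW s0t)).
    + by rewrite (le_trans s00)// ltW.
    + move=> s /andP[ts sT].
      by rewrite yE ?sT ?(le_trans (ltW s0t))// ltNge ts.
move=> /andP[s0t pt] /andP[tT jT] s00 yE.
have y0 : y s0 = u.
  by rewrite yE ?lexx ?(le_trans (ltW s0t))// s0t subrr (flow0 D0 aL).
set z := flow a (t - s0) u in yE *.
have ptn : path <%R t (times (null_jumps js2)) by rewrite /times /null_jumps -map_comp.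
have yt : y t = jumpm z w.
  by rewrite yE ?tT ?(ltW s0t)// ltxx addr0 (pflow_start _ _ D0 aL).
have Rg0 : 0 <= Rg by apply: le_trans (enorm_ge0 _) (yR t _); rewrite tT ltW.
have zd : enorm (jumpm z w - z) <= Sg * delta.
  rewrite /jump_map addrC addKr; apply: le_trans (enorm_clip_le b0 _) _.
  apply: le_trans (opnormP _ _) _; apply: ler_pM; rewrite ?opnorm_ge0 ?enorm_ge0//.
  apply: sS; have -> : z = y t - clip b (sigma z *m w) by rewrite yt addrK.
  apply: le_trans (enormBl _ _) _; apply: lerD; last exact: enorm_clip.
  by apply: yR; rewrite tT ltW.
have zdE q : t <= q <= T -> enorm (flow a (q - t) (jumpm z w) - flow a (q - s0) u) <= rho.
  move=> /andP[tq qT].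
  have -> : flow a (q - s0) u = flow a (q - t) z.
    have -> : q - s0 = (t - s0) + (q - t) by ring.
    by rewrite (flowD D0 aL) ?subr_ge0// ltW.
  apply: le_trans (flow_lipE _ _ _) _; first by apply/andP; split; lra.
  by apply: le_trans hrho; rewrite ler_wpM2l ?expR_ge0.
have rho0 : 0 <= rho by apply: le_trans (zdE T _); rewrite ?enorm_ge0// tT lexx.
have early s : s0 <= s < t -> enorm (y s - flow a (s - s0) u) <= rho.
  by move=> /andP[s0s st]; rewrite yE ?s0s ?(le_trans (ltW st))// st subrr enorm0.
have yE' s : t <= s <= T -> y s = pflow t (jumpm z w) (null_jumps js2) s.
  move=> /andP[ts sT]; rewrite yE ?sT ?(le_trans (ltW s0t))//= ltNge ts /= addr0//.
case: js2 pt jT yE' {yE ptn} => [|[t2 w2] js2] /=.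
  move=> _ _ yE' s /andP[s0s sT]; rewrite y0; have [st|ts] := ltP s t.
    by apply: early; rewrite s0s.
  by rewrite yE' ?ts//; apply: zdE; rewrite ts.
move=> /andP[tt2 pt2] /andP[t2T jT] yE'; split.
- by rewrite t2T (lt_trans s0t).
- move=> s /andP[s0s st2]; rewrite y0; have [st|ts] := ltP s t.
    by apply: early; rewrite s0s.
  by rewrite yE' ?ts ?(le_trans (ltW st2))// st2; apply: zdE; rewrite ts (le_trans (ltW st2)).
(* The true state before the next jump, reached with the omitted mark. *)
- exists (flow a (t2 - t) (jumpm z w)).
    by rewrite y0; apply: zdE; rewrite t2T ltW.
  rewrite yE' ?t2T ?(ltW tt2)// ltxx addr0 (pflow_start _ _ D0 aL) ?subrr ?enorm0//.
  by rewrite -map_comp.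
- apply: (@tracks_self rho y t2 (jumpm (flow a (t2 - t) (jumpm z w) + 0) w2)) => //.
  by move=> s /andP[ts sT]; rewrite yE' ?sT ?(le_trans (ltW tt2))// ltNge ts.
Qed.

End pflow_estimates.

(** * Piecewise linear time changes *)

Section piecewise_linear.
Context {R : realType}.
Implicit Types (s t Delta : R) (l : seq (R * R)).

(** The function is constant after the last knot; evaluation at the last knot itself falls in this
    case. *)
Fixpoint pl s0 t0 l s : R :=
  if l is (s1, t1) :: l' then
    if s < s1 then t0 + (s - s0) * ((t1 - t0) / (s1 - s0)) else pl s1 t1 l' s
  else t0.

Definition knots s0 t0 l := path <%R s0 [seq p.1 | p <- l] /\ path <%R t0 [seq p.2 | p <- l].

Let first_end s0 l := last s0 [seq p.1 | p <- l].
Let second_end t0 l := last t0 [seq p.2 | p <- l].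

Lemma path_le_last s0 (r : seq R) : path <%R s0 r -> s0 <= last s0 r.
Proof.
elim: r s0 => //= s1 r IH s0 /andP[s01 pr].
by rewrite (le_trans (ltW s01))// IH.
Qed.

Lemma seg_range s0 t0 s1 t1 s : s0 <= s -> s < s1 -> t0 < t1 ->
  t0 <= t0 + (s - s0) * ((t1 - t0) / (s1 - s0)) < t1.
Proof.
move=> s0s ss1 t01; have s01 := le_lt_trans s0s ss1.
apply/andP; split.
  by rewrite lerDl mulr_ge0 ?divr_ge0 ?subr_ge0// ltW.
rewrite -ltrBrDl mulrA ltr_pdivrMr ?subr_gt0// mulrC ltr_pM2l ?subr_gt0//.
by rewrite ltrD2r.
Qed.

Lemma pl_range s0 t0 l s : knots s0 t0 l -> s0 <= s <= first_end s0 l ->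
  t0 <= pl s0 t0 l s <= second_end t0 l.
Proof.
elim: l s0 t0 => [|[s1 t1] l IH] s0 t0 /=; first by rewrite /second_end/= lexx.
move=> [/= /andP[s01 ps] /andP[t01 pt]] /andP[s0s sl]; have [ss1|s1s] := ltP s s1.
  have /andP[-> h] := seg_range s0s ss1 t01.
  by rewrite (le_trans (ltW h))// /second_end/= path_le_last.
have /andP[h1 h2] := IH s1 t1 (conj ps pt) (introT andP (conj s1s sl)).
by rewrite h2 (le_trans (ltW t01)).
Qed.

Lemma pl_mono s0 t0 l s r : knots s0 t0 l -> s0 <= s -> s < r -> r <= first_end s0 l ->
  pl s0 t0 l s < pl s0 t0 l r.
Proof.
elim: l s0 t0 => [|[s1 t1] l IH] s0 t0 /=.
  by move=> _ s0s sr; rewrite /first_end/= => /(lt_le_trans sr)/(le_lt_trans s0s); rewrite ltxx.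
move=> [/= /andP[s01 ps] /andP[t01 pt]] s0s sr rl; have [rs1|s1r] := ltP r s1.
  rewrite (lt_trans sr rs1) ltrD2l ltr_pM2r ?divr_gt0 ?subr_gt0// ltrD2r//.
have [ss1|s1s] := ltP s s1; last exact: IH.
have /andP[_ h] := seg_range s0s ss1 t01; apply: lt_le_trans h _.
by have /andP[] := pl_range (conj ps pt) (introT andP (conj s1r rl)).
Qed.

Definition swap_knots l := [seq (p.2, p.1) | p <- l].

Lemma swap_knots1 l : [seq p.1 | p <- swap_knots l] = [seq p.2 | p <- l].
Proof. by rewrite /swap_knots -map_comp. Qed.
Lemma swap_knots2 l : [seq p.2 | p <- swap_knots l] = [seq p.1 | p <- l].
Proof. by rewrite /swap_knots -map_comp. Qed.

Lemma pl_cancel s0 t0 l s : knots s0 t0 l -> s0 <= s <= first_end s0 l ->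
  pl t0 s0 (swap_knots l) (pl s0 t0 l s) = s.
Proof.
elim: l s0 t0 => [|[s1 t1] l IH] s0 t0 /=.
  by move=> _; rewrite /first_end/= => h; apply/eqP; rewrite eq_le.
move=> [/= /andP[s01 ps] /andP[t01 pt]] /andP[s0s sl]; have [ss1|s1s] := ltP s s1.
  have /andP[_ ->] := seg_range s0s ss1 t01.
  by field; rewrite !subr_eq0 !gt_eqF.
have h := introT andP (conj s1s sl).
have /andP[h1 h2] := pl_range (conj ps pt) h.
by rewrite ltNge h1/=; apply: IH.
Qed.

Lemma pl_knot s0 t0 l p : knots s0 t0 l -> p \in l -> pl s0 t0 l p.1 = p.2.
Proof.
elim: l s0 t0 => // -[s1 t1] l IH s0 t0 [/= /andP[s01 ps] /andP[t01 pt]].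
rewrite inE => /orP[/eqP->|pl0] /=.
  rewrite ltxx; case: l ps pt {IH} => [//|[s2 t2] l] /= /andP[s12 _] _.
  by rewrite s12 subrr mul0r addr0.
have : s1 < p.1 by move: ps; rewrite lt_path_sortedE => /andP[/allP + _]; apply; exact: map_f.
by move=> /ltW; rewrite ltNge => -> /=; exact: IH.
Qed.

(** On a segment the difference with the identity is a convex combination of its values at the two
    end points. *)
Lemma pl_dist Delta s0 t0 l s : knots s0 t0 l -> s0 <= s <= first_end s0 l ->
  `|t0 - s0| <= Delta -> (forall p, p \in l -> `|p.2 - p.1| <= Delta) ->
  `|pl s0 t0 l s - s| <= Delta.
Proof.
elim: l s0 t0 => [|[s1 t1] l IH] s0 t0 /=.
  by move=> _; rewrite /first_end/= => /andP[h1 h2] h _; have -> : s = s0 by apply/eqP; rewrite eq_le h2.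
move=> [/= /andP[s01 ps] /andP[t01 pt]] /andP[s0s sl] h0 hl; have [ss1|s1s] := ltP s s1; last first.
  apply: IH => //; first by rewrite s1s.
  - exact: (hl _ (mem_head _ _)).
  - by move=> p pl0; apply: hl; rewrite inE pl0 orbT.
have h1 := hl _ (mem_head _ _); rewrite /= in h1.
set th := (s - s0) / (s1 - s0).
have th0 : 0 <= th by rewrite divr_ge0 ?subr_ge0// ltW.
have th1 : th <= 1 by rewrite ler_pdivrMr ?subr_gt0// mul1r lerD2r ltW.
have -> : t0 + (s - s0) * ((t1 - t0) / (s1 - s0)) - s = (1 - th) * (t0 - s0) + th * (t1 - s1).
  by rewrite /th; field; rewrite subr_eq0 gt_eqF.
clearbody th; apply: le_trans (ler_normD _ _) _; rewrite !normrM (ger0_norm th0) (ger0_norm (_ : 0 <= 1 - th)) ?subr_ge0//.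
have -> : Delta = (1 - th) * Delta + th * Delta by ring.
by rewrite lerD// ler_wpM2l// subr_ge0.
Qed.

Lemma pl_time_change T l : 0 <= T -> knots 0 0 l -> first_end 0 l = T -> second_end 0 l = T ->
  time_change T (pl 0 0 l).
Proof.
move=> T0 kl l1 l2.
have kl' : knots 0 0 (swap_knots l).
  by case: kl => h1 h2; split; rewrite ?swap_knots1 ?swap_knots2.
have l1' : first_end 0 (swap_knots l) = T by rewrite /first_end swap_knots1.
have l2' : second_end 0 (swap_knots l) = T by rewrite /second_end swap_knots2.
have canc : {in `[0, T], cancel (pl 0 0 l) (pl 0 0 (swap_knots l))}.
  by move=> s; rewrite in_itv/= => sT; apply: pl_cancel => //; rewrite l1.
have swapK : swap_knots (swap_knots l) = l.
  by rewrite /swap_knots -map_comp -[RHS]map_id; apply: eq_map => -[].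
have canc' : {in `[0, T], cancel (pl 0 0 (swap_knots l)) (pl 0 0 l)}.
  move=> s; rewrite in_itv/= => sT; have := @pl_cancel 0 0 (swap_knots l) s kl'.
  by rewrite l1' swapK; apply.
have homo : {homo pl 0 0 l : s / s \in `[0, T]}.
  move=> s; rewrite !in_itv/= => sT; have := @pl_range 0 0 l s kl.
  by rewrite l1 l2; apply.
have homo' : {homo pl 0 0 (swap_knots l) : s / s \in `[0, T]}.
  move=> s; rewrite !in_itv/= => sT; have := @pl_range 0 0 (swap_knots l) s kl'.
  by rewrite l1' l2'; apply.
have inc k : knots 0 0 k -> first_end 0 k = T -> {in `[0, T] &, {homo pl 0 0 k : s t / s < t}}.
  move=> kk k1 s t; rewrite !in_itv/= => /andP[s0 _] /andP[_ tT] st.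
  by apply: pl_mono => //; rewrite k1.
(* Continuity of the interpolation and of its inverse comes from monotonicity and surjectivity
   rather than from the formula. *)
have cont k k' : {in `[0, T] &, {homo k : s t / s < t}} ->
   {homo k : s / s \in `[0, T]} -> {homo k' : s / s \in `[0, T]} ->
   {in `[0, T], cancel k' k} -> {in `[0, T], cancel k k'} -> {within `[0, T], continuous k}.
  move=> ki kh kh' kk kk'; apply: segment_inc_surj_continuous.
    exact: le_mono_in.
  have [z1 z2] : (0 : R) \in `[0, T] /\ (T : R) \in `[0, T] by rewrite !in_itv/= !lexx T0.
  move=> y /= yI.
  have yI2 : y \in `[0, T].
    move: yI; rewrite !in_itv/= => /andP[y1 y2].
    have := kh _ z1; have := kh _ z2; rewrite !in_itv/= => /andP[? ?] /andP[? ?].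
    apply/andP; split; lra.
  by exists (k' y); [exact: kh'|exact: kk].
split; first exact: inc.
exists (pl 0 0 (swap_knots l)); split => //.
  by apply: (cont _ (pl 0 0 (swap_knots l))) => //; exact: inc.
by apply: (cont _ (pl 0 0 l)) => //; exact: inc.
Qed.

End piecewise_linear.

Section skorokhod_dist.
Context {R : realType}.
Variables (T : R) (m : nat).
Hypothesis T0 : 0 < T.

Lemma J1_le (x y : skorokhod T m) (l : R -> R) Delta : time_change T l -> 0 <= Delta ->
  (forall t, t \in `[0, T] -> `|l t - t| <= Delta) ->
  (forall t, t \in `[0, T] -> enorm (x (l t) - y t) <= Delta) -> mdist x y <= Delta.
Proof.
move=> tl D0 h1 h2; apply: (@le_trans _ _ (J1_cost T x y l)).
  by apply: (ge_inf (proj2 (J1_has_inf T x y))); exists l.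
apply: ge_sup.
  exists (Num.max `|l 0 - 0| (enorm (x (l 0) - y 0))), 0 => //=.
  by rewrite in_itv/= lexx ltW.
by move=> _ [t tT <-]; rewrite ge_max h1 ?h2.
Qed.

Lemma J1_le_unif (x y : skorokhod T m) Delta : 0 <= Delta ->
  (forall t, t \in `[0, T] -> enorm (x t - y t) <= Delta) -> mdist x y <= Delta.
Proof.
move=> D0 h; apply: (J1_le (time_change_id T)) => // t tT.
by rewrite subrr normr0.
Qed.

End skorokhod_dist.

Ltac pos := do ?[by []|exact: ltW|exact: expR_ge0|exact: sqr_ge0|exact: enorm_ge0
  |exact: opnorm_ge0|exact: normr_ge0|apply: addr_ge0|apply: mulr_ge0|apply: exprn_ge0].

(** * The chain as a perturbed ODE *)

Section chain_tracks.
Context {R : realType}.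
Variables (m d : nat) (a : 'cV[R]_m -> 'cV[R]_m) (sigma : 'cV[R]_m -> 'M[R]_(m, d)).
Variables (D b T : R).
Hypothesis D0 : 0 <= D.
Hypothesis aL : forall x y, enorm (a x - a y) <= D * enorm (x - y).
Hypothesis b0 : 0 < b.
Hypothesis T0 : 0 < T.
Variables (z : nat -> 'cV[R]_d) (eta : R) (x : 'cV[R]_m).
Hypothesis eta0 : 0 < eta.
Local Notation X := (chain a sigma b z eta x).
Let E := expR (D * T).

Let E1 : 1 <= E. Proof. by rewrite -expR0 ler_expR mulr_ge0// ltW. Qed.

Lemma sub_chain i : X i.+1 - X i = clip b (eta *: a (X i) + eta *: (sigma (X i) *m z i.+1)).
Proof. by rewrite /= addrC addKr. Qed.

Lemma enorm_a0 y r : enorm y <= r -> enorm (a y) <= enorm (a 0) + D * r.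
Proof.
move=> yr; apply: le_trans (enorm_a_le aL y 0) _.
by rewrite subr0 lerD2l ler_wpM2l.
Qed.

(** The noise sum counts only steps at which the chain is still in the ball of radius M0, since only
    this sum is controlled by the exponential estimate. Strong induction breaks the circle: while
    the bound holds, the restriction is void. *)
Lemma chain_bound (S : pred nat) (n k : nat) (M0 rho : R) : 0 <= rho ->
  eta * n%:R <= T -> (count S (iota 0 n) <= k)%N ->
  (forall i, (i < n)%N -> ~~ S i -> enorm (X i) <= M0 ->
     enorm (eta *: a (X i) + eta *: (sigma (X i) *m z i.+1)) <= b) ->
  (forall j, (j <= n)%N -> enorm (\sum_(0 <= i < j | ~~ S i && (enorm (X i) <= M0))
     eta *: (sigma (X i) *m z i.+1)) <= rho) ->
  (enorm x + rho + k%:R * b + T * enorm (a 0)) * E <= M0 ->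
  forall j, (j <= n)%N -> enorm (X j) <= M0.
Proof.
move=> rho0 nT Sk hsmall hnoise hM.
set c := enorm x + rho + k%:R * b + T * enorm (a 0) in hM.
have c0 : 0 <= c by rewrite /c !addr_ge0 ?mulr_ge0 ?enorm_ge0// ltW.
have gM j : (j <= n)%N -> c * (1 + D * eta) ^+ j <= M0.
  move=> jn; apply: le_trans hM; rewrite ler_wpM2l//.
  apply: le_trans (expr_le_expR _ _) _; first by rewrite mulr_ge0// ltW.
  rewrite ler_expR -mulrA ler_wpM2l//; apply: le_trans nT; rewrite ler_wpM2l ?ler_nat//.
  exact: ltW.
suff H j : (j <= n)%N -> enorm (X j) <= c * (1 + D * eta) ^+ j.
  by move=> j jn; apply: le_trans (H j jn) (gM j jn).
elim/ltn_ind: j => j IH jn.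
have XM i : (i < j)%N -> enorm (X i) <= M0.
  by move=> ij; have ni := ltnW (leq_trans ij jn); apply: le_trans (IH i ij ni) (gM i ni).
(* Steps in S are kept as increments, each at most b; at the others the truncation is inactive, and
   drift and noise separate. *)
have XE : X j = x + \sum_(0 <= i < j | S i) (X i.+1 - X i) +
    \sum_(0 <= i < j | ~~ S i) eta *: a (X i) +
    \sum_(0 <= i < j | ~~ S i && (enorm (X i) <= M0)) eta *: (sigma (X i) *m z i.+1).
  have -> : \sum_(0 <= i < j | ~~ S i && (enorm (X i) <= M0)) eta *: (sigma (X i) *m z i.+1) =
      \sum_(0 <= i < j | ~~ S i) eta *: (sigma (X i) *m z i.+1).
    rewrite big_nat_cond [RHS]big_nat_cond; apply: eq_bigl => i.
    by case: (ltnP i j) => //= ij; rewrite XM// andbT.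
  rewrite -addrA -big_split/= -addrA.
  have -> : \sum_(0 <= i < j | ~~ S i) (eta *: a (X i) + eta *: (sigma (X i) *m z i.+1)) =
      \sum_(0 <= i < j | ~~ S i) (X i.+1 - X i).
    rewrite big_nat_cond [RHS]big_nat_cond; apply: eq_bigr => i /andP[/= ij nS].
    rewrite sub_chain clip_small// hsmall//; first exact: leq_trans jn.
    exact: XM.
  have tel : \sum_(0 <= i < j) (X i.+1 - X i) = X j - x by rewrite telescope_sumr.
  by rewrite -[LHS](subrK x) -tel (bigID S) addrC.
(* The geometric sum closes the discrete Gronwall argument: the drift contributes the growth from c
   to c (1 + D eta)^j. *)
have geo : eta * D * \sum_(0 <= i < j) (1 + D * eta) ^+ i = (1 + D * eta) ^+ j - 1.
  by rewrite subrX1 [1 + _ - 1]addrAC subrr add0r (mulrC D) big_mkord.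
rewrite XE; apply: le_trans (enormD _ _) _.
apply: le_trans (lerD (enormD _ _) (hnoise j jn)) _.
apply: le_trans (lerD (lerD (enormD _ _) (enorm_sum _ _ _)) (lexx _)) _.
have h1 : enorm (\sum_(0 <= i < j | S i) (X i.+1 - X i)) <= k%:R * b.
  apply: le_trans (enorm_sum _ _ _) _.
  apply: (@le_trans _ _ (\sum_(0 <= i < j | S i) b)).
    by apply: ler_sum => i _; rewrite sub_chain; exact: enorm_clip.
  rewrite big_const_seq iter_addr_0 -[b *+ _]mulr_natl ler_wpM2r ?(ltW b0)// ler_nat.
  apply: leq_trans Sk; rewrite /index_iota subn0.
  by rewrite -(subnKC jn) iotaD count_cat leq_addr.
have h2 : \sum_(0 <= i < j | ~~ S i) enorm (eta *: a (X i)) <=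
    T * enorm (a 0) + c * ((1 + D * eta) ^+ j - 1).
  apply: (@le_trans _ _ (\sum_(0 <= i < j) eta * (enorm (a 0) + D * (c * (1 + D * eta) ^+ i)))).
    rewrite [leLHS]big_mkcond/=; apply: ler_sum_nat => i /andP[_ ij].
    have ai : enorm (a (X i)) <= enorm (a 0) + D * (c * (1 + D * eta) ^+ i).
      by apply: enorm_a0; apply: IH => //; exact: ltnW (leq_trans ij jn).
    case: ifP => _; first by rewrite enormZ gtr0_norm// ler_wpM2l// ltW.
    rewrite mulr_ge0 ?(ltW eta0)//; exact: le_trans (enorm_ge0 _) ai.
  rewrite -mulr_sumr big_split/= -!mulr_sumr -geo mulrDr; apply: lerD.
    rewrite big_const_nat iter_addr_0 subn0 -[_ *+ j]mulr_natl mulrA ler_wpM2r ?enorm_ge0//.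
    by apply: le_trans nT; rewrite ler_wpM2l ?ler_nat// ltW.
  by rewrite le_eqVlt; apply/orP; left; apply/eqP; ring.
apply: le_trans (lerD (lerD (lerD (lexx _) h1) h2) (lexx _)) _.
rewrite le_eqVlt; apply/orP; left; apply/eqP; rewrite /c; ring.
Qed.

Section tracks.
Variables (S : seq nat) (n : nat) (M0 rho : R).
Hypothesis rho0 : 0 <= rho.
Hypothesis nE : n = Num.truncn (T / eta).
Hypothesis Sn : forall i, i \in S -> (i < n)%N.
Hypothesis XM : forall i, (i <= n)%N -> enorm (X i) <= M0.
Hypothesis small : forall i, (i < n)%N -> i \notin S ->
  enorm (eta *: a (X i) + eta *: (sigma (X i) *m z i.+1)) <= b.
Hypothesis noise : forall j, (j <= n)%N ->
  enorm (\sum_(0 <= i < j | i \notin S) eta *: (sigma (X i) *m z i.+1)) <= rho.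

Let Am := enorm (a 0) + D * M0.

Let aX i : (i <= n)%N -> enorm (a (X i)) <= Am.
Proof. by move=> /XM; exact: enorm_a0. Qed.

Let Am0 : 0 <= Am. Proof. exact: le_trans (enorm_ge0 _) (aX (leq0n _)). Qed.

Let nT : eta * n%:R <= T.
Proof.
have /truncn_itv/andP[+ _] : 0 <= T / eta by rewrite divr_ge0// ltW.
by rewrite -nE ler_pdivlMr// mulrC.
Qed.

Let jT j : (j <= n)%N -> eta * j%:R <= T.
Proof. by move=> jn; apply: le_trans nT; rewrite ler_wpM2l ?ler_nat// ltW. Qed.

Let rho1 := T * E * D * (2 * rho + eta * E ^+ 2 * Am) + 2 * rho.

(** The noise sum N is subtracted from X: the difference follows an Euler scheme for [a], perturbed
    by D |N| per unit of time, and is compared with the flow by a discrete Gronwall argument. *)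
Lemma chain_segment p j : (p <= j)%N -> (j <= n)%N -> (forall i, (p <= i < j)%N -> i \notin S) ->
  enorm (X j - flow a (eta * (j - p)%:R) (X p)) <= rho1.
Proof.
move=> pj jn nS.
pose N i := \sum_(p <= l < i) eta *: (sigma (X l) *m z l.+1).
have NE i : (p <= i <= j)%N -> N i = \sum_(0 <= l < i | l \notin S) eta *: (sigma (X l) *m z l.+1)
    - \sum_(0 <= l < p | l \notin S) eta *: (sigma (X l) *m z l.+1).
  move=> /andP[pi ij]; rewrite (big_cat_nat (n := p))//= [X in _ = X]addrAC subrr add0r /N.
  rewrite [RHS]big_mkcond/=; apply: eq_big_nat => l /andP[pl li].
  by rewrite nS// pl (leq_trans li).
have N2 i : (p <= i <= j)%N -> enorm (N i) <= 2 * rho.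
  move=> pij; rewrite NE//; apply: le_trans (enormBl _ _) _.
  rewrite mulr_natl mulr2n; case/andP: pij => pi ij.
  by apply: lerD; apply: noise; [exact: leq_trans jn|exact: leq_trans jn].
(* Error of one step: replacing a(X) by a(X - N), and the quadratic local error of the flow. *)
pose K := eta * (D * (2 * rho) + D * (eta * (E ^+ 2 * Am))).
have K0 : 0 <= K.
  by rewrite /K; pos.
have claim i : (p <= i <= j)%N -> enorm (X i - N i - flow a (eta * (i - p)%:R) (X p)) <=
    (i - p)%:R * K * (1 + D * eta) ^+ (i - p).
  move=> /andP[]; elim: i => [|i IH].
    rewrite leqn0 => /eqP p0 _; rewrite p0 subnn mulr0 (flow0 D0 aL) /N p0 big_nil subr0.
    by rewrite subrr enorm0 !mul0r.
  rewrite leq_eqVlt => /orP[/eqP <- _|].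
    by rewrite subnn mulr0 (flow0 D0 aL) /N big_geq// subr0 subrr enorm0 !mul0r.
  rewrite ltnS => pi ij; have {}IH := IH pi (ltnW ij).
  have i_n : (i <= n)%N by exact: leq_trans (ltnW ij) jn.
  have etaT : eta <= T.
    apply: le_trans (jT (leq_trans ij jn)); rewrite ler_peMr ?(ltW eta0)// ler1n//.
  rewrite subSn// -natr1 mulrDr mulr1; set q := (i - p)%N in IH *.
  have qT : 0 <= eta * q%:R <= T.
    rewrite mulr_ge0 ?(ltW eta0)//=; apply: jT.
    by rewrite (leq_trans (leq_subr _ _)).
  case/andP: (qT) => q0 qT'.
  rewrite (flowD D0 aL)// ?(ltW eta0)//; set f := flow a (eta * q%:R) (X p) in IH *.
  have pij : (p <= i <= j)%N by rewrite pi ltnW.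
  have -> : X i.+1 - N i.+1 - flow a eta f =
      (X i - N i - f) - (flow a eta f - f - eta *: a f)
      + eta *: ((a (X i) - a (X i - N i)) + (a (X i - N i) - a f)).
    have step : X i.+1 = X i + (eta *: a (X i) + eta *: (sigma (X i) *m z i.+1)).
      rewrite -[X i.+1](subrK (X i)) sub_chain clip_small; first by rewrite addrC.
      by apply: small; [exact: leq_trans ij jn|apply: nS; rewrite pi].
    rewrite step /N big_nat_recr//= -/(N i).
    by apply/matrixP => r s; rewrite !mxE; ring.
  have af : enorm (a f) <= E * Am.
    apply: le_trans (a_flow D0 aL _ q0) _; apply: ler_pM; rewrite ?expR_ge0 ?enorm_ge0//.
      by rewrite ler_expR ler_wpM2l.
    exact: aX (leq_trans pi i_n).
  have h1 : enorm (flow a eta f - f - eta *: a f) <= D * eta ^+ 2 * (E ^+ 2 * Am).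
    apply: le_trans (flow_step D0 aL _ (ltW eta0)) _.
    apply: ler_wpM2l; first by pos.
    rewrite expr2 -mulrA.
    by apply: ler_pM; rewrite ?expR_ge0 ?enorm_ge0// ler_expR ler_wpM2l.
  have h2 : enorm (a (X i) - a (X i - N i)) <= D * (2 * rho).
    apply: le_trans (aL _ _) _; rewrite opprB addrC subrK ler_wpM2l// N2//.
  have h3 := aL (X i - N i) f.
  apply: le_trans (enormD _ _) _; apply: le_trans (lerD (enormBl _ _) (lexx _)) _.
  rewrite enormZ gtr0_norm//.
  set g := enorm (X i - N i - f) in IH h3 *.
  have h4 : enorm (a (X i) - a (X i - N i) + (a (X i - N i) - a f)) <= D * (2 * rho) + D * g.
    by apply: le_trans (enormD _ _) _; exact: lerD.
  apply: le_trans (lerD (lerD (lexx _) h1) (ler_wpM2l (ltW eta0) h4)) _.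
  apply: (@le_trans _ _ ((1 + D * eta) * g + K)).
    by rewrite le_eqVlt; apply/orP; left; apply/eqP; rewrite /K; ring.
  have p1 : 1 <= 1 + D * eta by rewrite lerDl mulr_ge0// ltW.
  have -> : (q%:R + 1) * K * (1 + D * eta) ^+ q.+1 =
     (1 + D * eta) * (q%:R * K * (1 + D * eta) ^+ q) + K * (1 + D * eta) ^+ q.+1.
    by rewrite exprS; ring.
  apply: lerD; first by rewrite ler_wpM2l// (le_trans _ p1).
  by rewrite ler_peMr// exprn_ege1.
have jj : (p <= j <= j)%N by rewrite pj leqnn.
have -> : X j - flow a (eta * (j - p)%:R) (X p) =
    (X j - N j - flow a (eta * (j - p)%:R) (X p)) + N j.
  by rewrite addrAC subrK.
apply: le_trans (enormD _ _) _; apply: lerD; last exact: N2.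
apply: le_trans (claim j jj) _.
have h1 : (1 + D * eta) ^+ (j - p) <= E.
  apply: le_trans (expr_le_expR _ _) _; first by rewrite mulr_ge0// ltW.
  rewrite ler_expR -mulrA ler_wpM2l//; apply: jT.
  exact: leq_trans (leq_subr _ _) jn.
have h2 : (j - p)%:R * eta <= T.
  by rewrite mulrC; apply: jT; exact: leq_trans (leq_subr _ _) jn.
apply: (@le_trans _ _ ((j - p)%:R * K * E)).
  by apply: ler_wpM2l h1; exact: mulr_ge0.
have -> : (j - p)%:R * K * E = ((j - p)%:R * eta) * (E * D * (2 * rho + eta * E ^+ 2 * Am)).
  by rewrite /K; ring.
have -> : T * E * D * (2 * rho + eta * E ^+ 2 * Am) = T * (E * D * (2 * rho + eta * E ^+ 2 * Am)).
  by ring.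
by apply: ler_wpM2r h2; pos.
Qed.

Let rho2 := rho1 + eta * (E * Am) + 2 * (eta * Am).

(** The upper end of the time step is included because [tracks] also needs the flow at the time of
    the next mark, compared with the chain one step earlier. *)
Lemma chain_segment_time p j (s : R) : (p <= j)%N -> (j <= n)%N ->
  (forall i, (p <= i < j)%N -> i \notin S) -> eta * j%:R <= s <= eta * j.+1%:R -> s <= T ->
  enorm (X j - flow a (s - eta * p%:R) (X p)) <= rho1 + eta * (E * Am).
Proof.
move=> pj jn nS /andP[js sj] sT.
apply: le_trans (enorm_dist_triangle _ (flow a (eta * (j - p)%:R) (X p)) _) _.
apply: lerD; first exact: chain_segment.
have p_s : eta * p%:R <= s by apply: le_trans js; rewrite ler_wpM2l ?(ltW eta0)// ler_nat.
have p00 : 0 <= eta * p%:R by rewrite mulr_ge0// ltW.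
have sI : 0 <= s - eta * p%:R <= T by apply/andP; split; lra.
have jI : 0 <= eta * (j - p)%:R <= T.
  rewrite mulr_ge0 ?(ltW eta0)//=; apply: jT; exact: leq_trans (leq_subr _ _) jn.
apply: le_trans (flow_timeE D0 aL _ sI jI) _.
apply: ler_pM; rewrite ?mulr_ge0 ?expR_ge0 ?enorm_ge0//; last first.
  by rewrite ler_wpM2l ?expR_ge0//; apply: aX; exact: leq_trans jn.
rewrite natrB// mulrBr -natr1 in sj *; rewrite mulrDr mulr1 in sj.
by rewrite ler_norml; apply/andP; split; lra.
Qed.

(** Step i of the chain uses the noise z (i + 1) and takes effect at time eta (i + 1). *)
Definition marks (l : seq nat) : seq (R * 'cV[R]_d) := [seq (eta * i.+1%:R, eta *: z i.+1) | i <- l].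

Lemma chain_tracks : sorted ltn S -> tracks a sigma b T rho2 (chain_path a sigma b T z eta x) 0 (marks S).
Proof.
have pathE j (s : R) : (j <= n)%N -> 0 <= s <= T -> eta * j%:R <= s < eta * j.+1%:R ->
    chain_path a sigma b T z eta x s = X j.
  move=> jn sT /andP[js sj]; rewrite /= /step_path in_itv/= sT; congr chain.
  by apply: truncn_def; rewrite ler_pdivlMr// ltr_pdivrMr// mulrC js mulrC.
have pathj j : (j <= n)%N -> chain_path a sigma b T z eta x (eta * j%:R) = X j.
  move=> jn; apply: pathE => //; first by rewrite mulr_ge0 ?(ltW eta0)//= jT.
  by rewrite lexx /= ltr_pM2l// ltr_nat.
move: pathE pathj; move: (chain_path a sigma b T z eta x : R -> 'cV[R]_m) => y pathE pathj.
have ex_index p (s : R) : eta * p%:R <= s -> s <= T -> exists2 j, (p <= j <= n)%N &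
    eta * j%:R <= s < eta * j.+1%:R.
  move=> ps sT; have s0 : 0 <= s by apply: le_trans ps; rewrite mulr_ge0// ltW.
  exists (Num.truncn (s / eta)); last first.
    have /truncn_itv/andP[h1 h2] : 0 <= s / eta by rewrite divr_ge0// ltW.
    by move: h1 h2; rewrite ler_pdivlMr// ltr_pdivrMr// mulrC => -> /=; rewrite mulrC.
  apply/andP; split; last by rewrite nE le_truncn// ler_pM2r ?invr_gt0.
  by rewrite -(@natrK R p) le_truncn// ler_pdivlMr// mulrC.
have rho12 : rho1 + eta * (E * Am) <= rho2.
  by rewrite /rho2 lerDl !mulr_ge0// ltW.
(* Induction on the marks that remain, the chain being restarted at index p. *)
suff H (l : seq nat) p : {subset l <= S} -> (forall i, i \in S -> (p <= i)%N -> i \in l) ->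
    (p <= n)%N -> (forall i, i \in l -> (p <= i)%N) -> sorted ltn l ->
    tracks a sigma b T rho2 y (eta * p%:R) (marks l).
  move=> sS; have := @H S 0%N; rewrite mulr0; apply => //.
elim: l p => [|q l IH] p lS Sl pn pl sl /=.
  move=> s /andP[ps sT]; have [j /andP[pj jn] /andP[js sj]] := ex_index p s ps sT.
  have s0 : 0 <= s by apply: le_trans ps; rewrite mulr_ge0// ltW.
  rewrite (pathE j)// ?pathj ?s0 ?js//; apply: le_trans rho12.
  apply: chain_segment_time; rewrite ?js ?(ltW sj)//.
  by move=> i /andP[pi ij]; apply/negP => /Sl /(_ pi).
have qS : q \in S by apply: lS; rewrite mem_head.
have qn := Sn qS; have pq : (p <= q)%N by apply: pl; rewrite mem_head.
have lq i : i \in l -> (q < i)%N.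
  by move: sl; rewrite /= (path_sortedE ltn_trans) => /andP[/allP + _]; apply.
have nS i : (p <= i < q)%N -> i \notin S.
  move=> /andP[pi iq]; apply/negP => /Sl /(_ pi); rewrite inE => /orP[/eqP iE|/lq].
    by rewrite iE ltnn in iq.
  by rewrite ltnNge (ltnW iq).
have p00 : 0 <= eta * p%:R by rewrite mulr_ge0// ltW.
rewrite pathj//; split.
- by rewrite jT// andbT ltr_pM2l// ltr_nat ltnS.
- move=> s /andP[ps sq]; have sT : s <= T by apply: le_trans (ltW sq) (jT qn).
  have [j /andP[pj jn] /andP[js sj]] := ex_index p s ps sT.
  have jq : (j <= q)%N.
    by have := le_lt_trans js sq; rewrite ltr_pM2l// ltr_nat ltnS.
  rewrite (pathE j)// ?(le_trans p00 ps) ?js//; apply: le_trans rho12.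
  apply: chain_segment_time; rewrite ?js ?(ltW sj)//.
  by move=> i /andP[pi ij]; apply: nS; rewrite pi (leq_trans ij).
(* The jump starts from the chain before step q; the drift of that step is the only further error,
   at most 2 eta Am since truncation is 2-Lipschitz. *)
- exists (X q).
    apply: le_trans rho12; apply: chain_segment_time => //; first exact: ltnW.
      by rewrite lexx andbT ler_wpM2l ?(ltW eta0)// ler_nat.
    exact: jT.
  rewrite pathj// -[X q.+1](subrK (X q)) sub_chain /jump_map [X q + _]addrC opprD addrACA subrr addr0.
  apply: le_trans (clip_lip b0 _ _) _.
  rewrite -scalemxAr addrK enormZ gtr0_norm//.
  apply: (@le_trans _ _ (2 * (eta * Am))).
    by rewrite ler_wpM2l// ler_wpM2l ?(ltW eta0)//; apply: aX; exact: ltnW.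
  by rewrite /rho2 lerDr /rho1; pos.
- apply: IH => //.
  + by move=> i il; apply: lS; rewrite inE il orbT.
  + move=> i iS qi; have := Sl i iS (leq_trans pq (ltnW qi)).
    by rewrite inE => /orP[/eqP iE|//]; rewrite iE ltnn in qi.
  + exact: path_sorted sl.
Qed.

Lemma chain_tracks_rate : 1 <= E -> rho2 <= (T * E * D * (2 + E ^+ 2 * Am) + 2 + E * Am + 2 * Am) * (rho + eta).
Proof.
move=> _; rewrite /rho2 /rho1.
have e0 := ltW eta0.
have K1 : 0 <= T * E * D by rewrite !mulr_ge0 ?expR_ge0// ltW.
have K2 : 0 <= E ^+ 2 * Am by rewrite mulr_ge0// exprn_ge0// expR_ge0.
have K3 : 0 <= E * Am by rewrite mulr_ge0// expR_ge0.
rewrite -subr_ge0.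
have -> : (T * E * D * (2 + E ^+ 2 * Am) + 2 + E * Am + 2 * Am) * (rho + eta) -
  (T * E * D * (2 * rho + eta * E ^+ 2 * Am) + 2 * rho + eta * (E * Am) + 2 * (eta * Am)) =
  T * E * D * (2 * eta + rho * (E ^+ 2 * Am)) + 2 * eta + rho * (E * Am) + 2 * (rho * Am) by ring.
have E0 : 0 <= E by exact: expR_ge0.
by do ?[by []|exact: ltW|apply: addr_ge0|apply: mulr_ge0].
Qed.

End tracks.
End chain_tracks.

(** * Distances between jump paths *)

Section jump_path_lemmas.
Context {R : realType}.
Variables (m d : nat) (a : 'cV[R]_m -> 'cV[R]_m) (sigma : 'cV[R]_m -> 'M[R]_(m, d)).
Variables (D b T : R).
Hypothesis D0 : 0 <= D.
Hypothesis aL : forall x y, enorm (a x - a y) <= D * enorm (x - y).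
Hypothesis sL : forall x y, opnorm (sigma x - sigma y) <= D * enorm (x - y).
Hypothesis b0 : 0 < b.
Hypothesis T0 : 0 < T.
Implicit Types (rho eps delta r M Delta : R) (x : 'cV[R]_m) (js : seq (R * 'cV[R]_d)).
Local Notation pflow := (pflow a sigma b).
Let E := expR (D * T).

Lemma jumps_null k (W : k.-tuple 'cV[R]_d) (t : k.-tuple R) :
  jumps W [tuple of nseq k (0 : 'cV[R]_m)] t = null_jumps m (zip t W).
Proof.
case: W t => W sW [t st]; rewrite /jumps /null_jumps /=; move/eqP: sW; move/eqP: st.
by elim: k t W => [|k IH] [|s t] [|w W] //= [st] [sW]; rewrite IH.
Qed.

Lemma h_mapE k x (W : k.-tuple 'cV[R]_d) (t : k.-tuple R) : increasing_times `]0, T] t ->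
  {in `[0, T], h_map a sigma b T x W t =1 pflow 0 x (null_jumps m (zip t W))}.
Proof. by move=> tI s sT; rewrite -jumps_null; exact: (@hbarE _ _ _ a sigma D b D0 aL T _ _ _ _ _ T0 tI s sT). Qed.

Lemma times_null js : [seq p.1 | p <- null_jumps m js] = [seq p.1 | p <- js].
Proof. by rewrite /null_jumps -map_comp. Qed.

Lemma zip_times k (W : k.-tuple 'cV[R]_d) (t : k.-tuple R) : [seq p.1 | p <- zip t W] = t.
Proof. by rewrite -/unzip1 unzip1_zip// !size_tuple. Qed.

Lemma tracks_jump_paths (y : skorokhod T m) rho js (A : set 'cV[R]_m) eps : 0 <= rho ->
  tracks a sigma b T rho y 0 js -> A (y 0) -> (1 + E) * rho <= eps ->
  exists2 zeta, jump_paths a sigma b T (size js) A eps zeta & mdist y zeta <= (1 + E) * rho.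
Proof.
move=> rho0 tr Ay re; have [pj jT] := tracks_times tr.
have [||vs [svs vsE yE]] := @tracks_pflow _ _ _ a sigma D b T D0 aL rho y 0 js (y 0) rho0 _ tr.
- by rewrite lexx ltW.
- by rewrite subrr enorm0.
pose W := [tuple of [seq p.2 | p <- in_tuple js]].
pose t := [tuple of [seq p.1 | p <- in_tuple js]].
have sV : size vs == size js by rewrite svs.
pose V := Tuple sV.
have tI : increasing_times `]0, T] t.
  split; first by rewrite /=; move: pj; rewrite lt_path_sortedE => /andP[].
  apply/allP => s /= sj; rewrite in_itv/= (allP jT _ sj) andbT.
  by move: pj; rewrite lt_path_sortedE => /andP[/allP /(_ _ sj)].
exists (hbar a sigma b T (y 0) W V t).
  exists (y 0), W, V, t; split => // j; apply: le_trans re; apply: vsE.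
  exact: (mem_tnth j V).
apply: J1_le_unif => //; first by rewrite mulr_ge0// addr_ge0// expR_ge0.
move=> s sT; rewrite (@hbarE _ _ _ a sigma D b D0 aL T _ _ _ _ _ T0 tI s sT).
by apply: yE; move: sT; rewrite in_itv.
Qed.

(** The constant does not depend on the other marks, because the k remaining jumps may be given
    displacements; [eps] bounds these. *)
Lemma h_map_drop k r (A : set 'cV[R]_m) eps : (forall x, A x -> enorm x <= r) -> 0 < eps ->
  exists2 C : R, 0 < C & forall x delta (W : k.+1.-tuple 'cV[R]_d) (t : k.+1.-tuple R),
    A x -> 0 <= delta -> C * delta <= eps -> increasing_times `]0, T] t ->
    (exists j, enorm (tnth W j) <= delta) ->
    exists2 zeta, jump_paths a sigma b T k A eps zeta &
      mdist (h_map a sigma b T x W t) zeta <= C * delta.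
Proof.
move=> Ar eps0; pose Rg := reach a D b T k.+1 r.
have Rg0 x : A x -> 0 <= Rg.
  move=> /Ar xr; have r0 := le_trans (enorm_ge0 _) xr.
  apply: le_trans (r0) (le_trans (growth_ge a D0 T0 r0) _).
  exact: reach_ge.
pose Sg := opnorm (sigma 0) + D * (`|Rg| + b).
have Sg0 : 0 <= Sg by rewrite /Sg; pos.
exists ((1 + E) * (E * Sg) + 1).
  by rewrite ltr_wpDl//; pos.
move=> x delta W t Ax delta0 Ce tI [j wj].
pose js := zip t W.
have sjs : size js = k.+1 by rewrite size_zip !size_tuple minnn.
have [pt tT] := increasing_path tI.
have tjs : [seq p.1 | p <- js] = t by rewrite zip_times.
have hy := h_mapE x W tI.
set y := h_map a sigma b T x W t in hy *.
have y0 : y 0 = x.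
  rewrite hy ?in_itv/= ?lexx ?ltW// (pflow_start _ _ D0 aL)//.
  by rewrite times_null tjs.
pose i := nat_of_ord j.
have p0 : R * 'cV[R]_d := (0, 0).
have ij : (i < size js)%N by rewrite sjs; exact: ltn_ord.
have jsE : js = take i js ++ nth p0 js i :: drop i.+1 js.
  by rewrite -drop_nth// cat_take_drop.
have wE : (nth p0 js i).2 = tnth W j.
  by case: p0 {jsE} => p1 p2; rewrite /js nth_zip ?size_tuple//= -tnth_nth.
have [C1 hC1] : exists2 C1, C1 = (1 + E) * (E * Sg * delta) & C1 <= ((1 + E) * (E * Sg) + 1) * delta.
  exists ((1 + E) * (E * Sg * delta)) => //.
  have -> : ((1 + E) * (E * Sg) + 1) * delta = (1 + E) * (E * Sg * delta) + delta by ring.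
  by rewrite lerDl.
move=> C1le.
have tr : tracks a sigma b T (E * Sg * delta) y 0 (take i js ++ drop i.+1 js).
  apply: (@tracks_drop _ _ _ a sigma D b T D0 aL b0 _ _ 0 x _ _ (nth p0 js i).1 (nth p0 js i).2 Rg Sg delta) => //.
  - by rewrite -surjective_pairing -jsE tjs.
  - by rewrite -surjective_pairing -jsE tjs.
  - by move=> s sT; rewrite -surjective_pairing -jsE hy// in_itv.
  - move=> s sT; rewrite hy ?in_itv//; apply: le_trans (@enorm_pflow _ _ _ a sigma D b T D0 aL b0 T0 0 x (null_jumps m (zip t W)) s _ _ _ _) _ => //.
    + by rewrite times_null tjs.
    + by case/andP: sT => -> _; rewrite lexx.
    + by case/andP: sT.
    + by move=> p /mapP[q _ ->] /=; rewrite enorm0.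
    + by rewrite size_map sjs; apply: reach_le => //; exact: Ar.
  - move=> u ur; apply: le_trans (sigma_le sL _ 0) _.
    rewrite subr0 lerD2l ler_wpM2l// (le_trans ur)// lerD2r ler_norm//.
  - by rewrite wE.
  - by rewrite mulrA.
have rho0 : 0 <= E * Sg * delta by pos.
have [||zeta z1 z2] := tracks_jump_paths rho0 tr (A := A) (eps := eps).
- by rewrite y0.
- by rewrite -hC1 (le_trans C1le).
exists zeta; last by rewrite (le_trans z2)// -hC1.
move: z1; rewrite size_cat size_takel ?(ltnW ij)// size_drop sjs.
by have -> : (i + (k.+1 - i.+1))%N = k by rewrite subSS subnKC// -ltnS -sjs.
Qed.

Lemma close_null_jumps l M Delta js js' : 0 <= Delta ->
  [seq p.1 | p <- js] = [seq l p.1 | p <- js'] ->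
  (forall p, p \in js -> enorm p.2 <= M) ->
  (forall i, enorm ((nth (0, 0) js i).2 - (nth (0, 0) js' i).2) <= Delta) ->
  close_jumps l M Delta (null_jumps m js) (null_jumps m js').
Proof.
move=> De; elim: js js' => [|[t w] js IH] [|[t' w'] js'] //= [tt tl] jM jD.
split => //; rewrite ?subrr ?enorm0//.
  by split; [exact: (jM _ (mem_head _ _))|exact: (jD 0%N)].
apply: IH => //; first by move=> p pj; apply: jM; rewrite inE pj orbT.
by move=> i; exact: (jD i.+1).
Qed.

(** Jump times are matched by the piecewise linear time change with knots (t'_j, t_j), which must
    fix T; hence times in the open interval. *)
Lemma h_map_lip k M r : 0 <= M -> 0 <= r -> exists2 C : R, 0 < C &
  forall x x' (W W' : k.-tuple 'cV[R]_d) (t t' : k.-tuple R) Delta,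
    enorm x' <= r -> (forall j, enorm (tnth W j) <= M) ->
    increasing_times `]0, T[ t -> increasing_times `]0, T[ t' ->
    enorm (x - x') <= Delta -> (forall j, enorm (tnth W j - tnth W' j) <= Delta) ->
    (forall j, `|tnth t j - tnth t' j| <= Delta) ->
    mdist (h_map a sigma b T x W t) (h_map a sigma b T x' W' t') <= C * Delta.
Proof.
move=> M0 r0.
have [C C1 hC] := @pflow_close _ _ _ a sigma D b T D0 aL sL b0 T0 k M r M0 r0.
exists C; first exact: lt_le_trans C1.
move=> x x' W W' t t' Delta x'r WM tI tI' xx WW tt.
have De0 : 0 <= Delta by exact: le_trans (enorm_ge0 _) xx.
have sub (u : k.-tuple R) : increasing_times `]0, T[ u -> increasing_times `]0, T] u.
  move=> [h1 h2]; split => //; apply/allP => s /(allP h2); rewrite !in_itv/= => /andP[-> /ltW ->].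
  by [].
have [pt tT] := increasing_path (sub _ tI); have [pt' tT'] := increasing_path (sub _ tI').
pose kn := rcons (zip (t' : seq R) (t : seq R)) (T, T).
have endT (u : k.-tuple R) : increasing_times `]0, T[ u -> path <%R 0 u -> path <%R 0 (rcons u T).
  move=> uI pu; rewrite rcons_path pu /=.
  have : last 0 u \in 0 :: (u : seq R) by exact: mem_last.
  rewrite inE => /orP[/eqP->//|]; by move=> /(allP uI.2); rewrite in_itv/= => /andP[].
have kn1 : [seq p.1 | p <- kn] = rcons t' T.
  by rewrite map_rcons -/unzip1 unzip1_zip ?size_tuple.
have kn2 : [seq p.2 | p <- kn] = rcons t T.
  by rewrite map_rcons -/unzip2 unzip2_zip ?size_tuple.
have kk : knots 0 0 kn by split; rewrite ?kn1 ?kn2; apply: endT.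
have e1 : last 0 [seq p.1 | p <- kn] = T by rewrite kn1 last_rcons.
have e2 : last 0 [seq p.2 | p <- kn] = T by rewrite kn2 last_rcons.
have tc := pl_time_change (ltW T0) kk e1 e2.
set l := pl 0 0 kn in tc.
have ld (q : R) : q \in `[0, T] -> `|l q - q| <= Delta.
  rewrite in_itv/= => qT; apply: pl_dist => //; rewrite ?e1//.
    by rewrite subrr normr0.
  move=> p; rewrite mem_rcons inE => /orP[/eqP->|]; first by rewrite subrr normr0.
  move=> /(nthP (0, 0))[i]; rewrite size_zip !size_tuple minnn => ik <-.
  rewrite nth_zip ?size_tuple//=.
  by have := tt (Ordinal ik); rewrite !(tnth_nth 0).
have lmono : {in `[0, T] &, {mono l : p q / p < q}}.
  by apply: leW_mono_in; apply: le_mono_in; exact: tc.1.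
have lT : {homo l : p / p \in `[0, T]}.
  by have [_ _ [h _ _ _]] := time_change_inv tc.
apply: (J1_le T0 tc) => //; first by rewrite mulr_ge0// (le_trans _ C1).
  by move=> q qT; apply: le_trans (ld q qT) _; rewrite ler_peMl.
move=> s sT; rewrite h_mapE//; [|exact: sub|exact: lT].
rewrite h_mapE//; last exact: sub.
have l0 : l 0 = 0.
  move: kk; rewrite /l /kn; case: (zip _ _) => [|[s1 t1] z] /= [/= /andP[-> _] _];
    by rewrite subrr mul0r addr0.
have tl : [seq p.1 | p <- zip t W] = [seq l p.1 | p <- zip t' W'].
  rewrite zip_times (map_comp l fst) zip_times.
  apply: (@eq_from_nth _ 0); rewrite ?size_map ?size_tuple// => i ik.
  rewrite (nth_map 0) ?size_tuple//.
  have pin : (nth 0 t' i, nth 0 t i) \in kn.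
    rewrite mem_rcons inE -nth_zip ?size_tuple// mem_nth ?orbT// size_zip !size_tuple minnn//.
  by rewrite /l (pl_knot kk pin).
apply: (hC l Delta 0 0) => //.
- by rewrite times_null zip_times.
- by rewrite times_null zip_times.
- apply: close_null_jumps => //.
    move=> p /(nthP (0, 0))[i]; rewrite size_zip !size_tuple minnn => ik <-.
    rewrite nth_zip ?size_tuple//=.
    by have := WM (Ordinal ik); rewrite !(tnth_nth 0).
  move=> i; have [ik|ki] := ltnP i k.
    rewrite !nth_zip ?size_tuple//=.
    by have := WW (Ordinal ik); rewrite !(tnth_nth 0).
  by rewrite !nth_default ?size_zip ?size_tuple ?minnn//= subrr enorm0.
- by rewrite size_map size_zip !size_tuple minnn.
- by move: sT; rewrite in_itv/= lexx => /andP[].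
- by move: sT; rewrite in_itv/= => /andP[].
Qed.

(** Unlike in [tracks_jump_paths] the displacements are then removed, by [pflow_close] with the
    identity as time change; this makes the constant depend on the bound M of the marks. *)
Lemma tracks_h_map k M r : 0 <= M -> 0 <= r -> exists2 C : R, 0 < C &
  forall (y : skorokhod T m) rho x' (W : k.-tuple 'cV[R]_d) (t : k.-tuple R) Delta,
    0 <= rho -> tracks a sigma b T rho y 0 (zip t W) ->
    enorm x' <= r -> (forall j, enorm (tnth W j) <= M) ->
    enorm (y 0 - x') <= Delta -> rho <= Delta ->
    mdist y (h_map a sigma b T x' W t) <= C * Delta.
Proof.
move=> M0 r0.
have [C C1 hC] := @pflow_close _ _ _ a sigma D b T D0 aL sL b0 T0 k M r M0 r0.
exists ((C + 1) * (1 + E)).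
  by rewrite mulr_gt0 ?ltr_wpDl ?expR_ge0// ?ltr_pwDr ?expR_gt0// (le_trans _ C1).
move=> y rho x' W t Delta rho0 tr x'r WM yx rD.
have [pj jT] := tracks_times tr; rewrite zip_times in pj jT.
have tI : increasing_times `]0, T] t.
  split; first by move: pj; rewrite lt_path_sortedE => /andP[].
  apply/allP => s /= sj; rewrite in_itv/= (allP jT _ sj) andbT.
  by move: pj; rewrite lt_path_sortedE => /andP[/allP /(_ _ sj)].
have E0 : 0 <= E by exact: expR_ge0.
have [||vs [svs vsE yE]] := @tracks_pflow _ _ _ a sigma D b T D0 aL rho y 0 _ (y 0) rho0 _ tr.
- by rewrite lexx ltW.
- by rewrite subrr enorm0.
have De0 : 0 <= Delta by exact: le_trans rD.
have De1 : Delta <= (1 + E) * Delta by rewrite ler_peMl// lerDl.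
apply: J1_le_unif => //; first by pos; exact: le_trans C1.
move=> s sT; rewrite h_mapE//.
have sT' : 0 <= s <= T by move: sT; rewrite in_itv.
have h1 := yE s sT'.
set q := pflow _ _ _ _ in h1 *.
suff h2 : enorm (q - pflow 0 x' (null_jumps m (zip t W)) s) <= C * ((1 + E) * Delta).
  apply: le_trans (enorm_dist_triangle _ q _) (le_trans (lerD h1 h2) _).
  have h3 : (1 + E) * rho <= (1 + E) * Delta by rewrite ler_wpM2l// addr_ge0.
  apply: le_trans (lerD h3 (lexx _)) _.
  by rewrite le_eqVlt; apply/orP; left; apply/eqP; ring.
rewrite /q {q h1}.
have z1 : [seq p.1 | p <- zip t W] = t by rewrite zip_times.
have z2 : [seq p.2 | p <- zip t W] = W by rewrite -/unzip2 unzip2_zip ?size_tuple.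
rewrite z1 z2; rewrite size_zip !size_tuple minnn in svs.
apply: (hC id ((1 + E) * Delta) 0 0) => //.
- by move=> q _; rewrite subrr normr0; pos.
- by rewrite times_null z1.
- by rewrite times_null z1.
- have Ww w : w \in (W : seq _) -> enorm w <= M by move=> /tnthP[j ->].
  have vsE' v : v \in vs -> enorm v <= (1 + E) * Delta.
    by move=> /vsE /le_trans; apply; rewrite ler_wpM2l// addr_ge0.
  clear - Ww vsE' svs De0 E0 E.
  case: W t Ww => W /= /eqP sW [t /= /eqP st] Ww.
  elim: k W t vs sW st svs Ww vsE' => [|k IH] [|w W] [|s t] [|v vs] //= [sW] [st] [sv] Ww vsE'.
  split => //; rewrite ?subr0 ?subrr ?enorm0//.
  + by split; [apply: Ww; rewrite mem_head|pos].
  + by apply: vsE'; rewrite mem_head.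
  + apply: IH => //; first by move=> u uW; apply: Ww; rewrite inE uW orbT.
    by move=> u uW; apply: vsE'; rewrite inE uW orbT.
- by rewrite size_map size_zip !size_tuple minnn.
- exact: le_trans yx De1.
- by case/andP: sT' => -> _; rewrite lexx.
- by case/andP: sT'.
Qed.

End jump_path_lemmas.

(** * Measures and product powers *)

Section borel.
Context {R : realType}.

(** A set that is open in terms of finitely many measurable coordinates is the union of the
    countably many grid cells that it contains. This yields measurability into the Borel sets of
    path space without any appeal to separability. *)
Lemma measurable_cells disp (Y : measurableType disp) (I : finType) (c : I -> Y -> R) (D O : set Y) :
  measurable D -> (forall i, measurable_fun D (c i)) -> O `<=` D ->
  (forall y, O y -> exists2 e : R, 0 < e &
     forall y', D y' -> (forall i, `|c i y - c i y'| < e) -> O y') ->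
  measurable O.
Proof.
move=> mD mc OD hO.
pose cell (nv : nat * {ffun I -> int}) : set Y :=
  [set y | D y /\ forall i, Num.floor (c i y * nv.1.+1%:R) = nv.2 i].
have mcell nv : measurable (cell nv).
  have -> : cell nv = D `&` \bigcap_(i in [set: I])
      (D `&` c i @^-1` `[(nv.2 i)%:~R / nv.1.+1%:R, (nv.2 i + 1)%:~R / nv.1.+1%:R[).
    apply/seteqP; split => y.
      move=> [Dy h]; split => // i _; split => //=; rewrite in_itv/=.
      by rewrite ler_pdivrMr// ltr_pdivlMr// -(h i) floor_le_tmp floorD1_gt.
    move=> [Dy h]; split => // i; have [_ /=] := h i Logic.I.
    rewrite in_itv/= ler_pdivrMr// ltr_pdivlMr// => /andP[h1 h2].
    by apply: floor_def; rewrite h1.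
  apply: measurableI => //; apply: fin_bigcap_measurable => // i _.
  exact: mc.
have -> : O = \bigcup_nv (if `[< cell nv `<=` O >] then cell nv else set0).
  apply/seteqP; split => [y Oy|y [nv _]]; last by case: ifPn => // /asboolP h /h.
  have [e e0 he] := hO _ Oy.
  pose n := Num.truncn e^-1; have ne : n.+1%:R^-1 < e.
    by rewrite invf_plt ?posrE//; apply: truncnS_gt.
  pose v := [ffun i => Num.floor (c i y * n.+1%:R)].
  exists (n, v) => //; rewrite ifT; first by split => [|i]; [exact: OD|rewrite ffunE].
  apply/asboolP => y' [Dy' h']; apply: he => // i; apply: le_lt_trans ne.
  rewrite -(@ler_pM2r _ n.+1%:R)// mulVf// -[X in _ * X]gtr0_norm// -normrM mulrBl.
  have := h' i; rewrite ffunE /= => h.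
  have := floor_le_tmp (c i y * n.+1%:R); have := floor_le_tmp (c i y' * n.+1%:R).
  have := floorD1_gt (c i y * n.+1%:R); have := floorD1_gt (c i y' * n.+1%:R).
  rewrite h intrD ler_norml; lra.
apply: countable_bigcupT_measurable; first exact: countableP.
by move=> nv; case: ifPn.
Qed.

Lemma measurable_fun_cells disp (Y : measurableType disp) (T : ptopologicalType) (I : finType)
    (c : I -> Y -> R) (D : set Y) (f : Y -> borel_space T) :
  measurable D -> (forall i, measurable_fun D (c i)) ->
  (forall y, D y -> forall U, nbhs (f y : T) U -> exists2 del : R, 0 < del &
     forall y', D y' -> (forall i, `|c i y - c i y'| < del) -> U (f y')) ->
  measurable_fun D f.
Proof.
move=> mD mc hf; apply: (@measurability _ _ Y (borel_space T) D f (@open T)); first by [].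
move=> _ [U oU <-].
apply: (@measurable_cells _ _ _ c D) => // y [Dy Uy]; rewrite /preimage /= in Uy.
have /(hf _ Dy)[del del0 h] : nbhs (f y : T) U by apply: open_nbhs_nbhs.
by exists del => // y' Dy' cy'; split => //; exact: h.
Qed.

Lemma measurable_metric_cells disp (Y : measurableType disp) (T : pmetricType R) (I : finType)
    (c : I -> Y -> R) (D : set Y) (f : Y -> borel_space T) :
  measurable D -> (forall i, measurable_fun D (c i)) ->
  (forall y, D y -> forall e : R, 0 < e -> exists2 del : R, 0 < del &
     forall y', D y' -> (forall i, `|c i y - c i y'| < del) -> mdist (f y : T) (f y') < e) ->
  measurable_fun D f.
Proof.
move=> mD mc hf; apply: (measurable_fun_cells mD mc) => y Dy U /nbhs_ballP[e /= e0 he].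
have [del del0 h] := hf _ Dy _ e0; exists del => // y' Dy' cy'.
by apply: he; rewrite ballEmdist; exact: h.
Qed.

Lemma measurable_col_cells disp (Y : measurableType disp) n (I : finType)
    (c : I -> Y -> R) (D : set Y) (f : Y -> borel_space 'cV[R]_n.+1) :
  measurable D -> (forall i, measurable_fun D (c i)) ->
  (forall y, D y -> forall e : R, 0 < e -> exists2 del : R, 0 < del &
     forall y', D y' -> (forall i, `|c i y - c i y'| < del) ->
       enorm ((f y : 'cV[R]_n.+1) - f y') < e) ->
  measurable_fun D f.
Proof.
move=> mD mc hf; apply: (measurable_fun_cells mD mc) => y Dy U /nbhs_ballP[e /= e0 he].
have [del del0 h] := hf _ Dy _ e0; exists del => // y' Dy' cy'.
apply: he; rewrite -ball_normE /=; apply: le_lt_trans (h _ Dy' cy'); exact: norm_le_enorm.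
Qed.

Lemma metric_continuous (T : pmetricType R) (f : T -> R) :
  (forall x (e : R), 0 < e -> exists2 del : R, 0 < del &
     forall y, mdist x y < del -> `|f x - f y| <= e) -> continuous f.
Proof.
move=> h x; apply/cvgrPdist_le => e e0; have [del del0 hd] := h x e e0.
by apply/nbhs_ballP; exists del => //= y; rewrite ballEmdist; exact: hd.
Qed.

Lemma measurable_real_cells disp (Y : measurableType disp) (I : finType)
    (c : I -> Y -> R) (D : set Y) (f : Y -> R) :
  measurable D -> (forall i, measurable_fun D (c i)) ->
  (forall y, D y -> forall e : R, 0 < e -> exists2 del : R, 0 < del &
     forall y', D y' -> (forall i, `|c i y - c i y'| < del) -> `|f y - f y'| < e) ->
  measurable_fun D f.
Proof.
move=> mD mc hf; apply: (measurability _ (RGenOInfty.measurableE R)).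
move=> _ [_ [x ->] <-]; apply: (@measurable_cells _ _ _ c D) => // y [Dy /=].
rewrite in_itv/= andbT => xy; have fx : 0 < f y - x by rewrite subr_gt0.
have [del del0 h] := hf _ Dy _ fx; exists del => // y' Dy' cy'; split => //=.
by have := h _ Dy' cy'; rewrite in_itv/= andbT ltr_norml => /andP[_]; lra.
Qed.

Lemma continuous_borel (T : ptopologicalType) (f : T -> R) :
  continuous f -> measurable_fun setT (f : borel_space T -> R).
Proof.
move=> cf; apply: (measurability _ (RGenOInfty.measurableE R)).
move=> _ [_ [x ->] <-]; rewrite setTI; apply: sub_sigma_algebra.
by apply: open_comp => [y _|]; [exact: cf|exact: interval_open].
Qed.

Lemma open_borel (T : ptopologicalType) (O : set T) : open O -> measurable (O : set (borel_space T)).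
Proof. exact: sub_sigma_algebra. Qed.

Lemma closed_borel (T : ptopologicalType) (O : set T) : closed O -> measurable (O : set (borel_space T)).
Proof.
move=> cO; rewrite -(setCK O).
by apply: (@measurableC _ (borel_space T)); apply: open_borel; exact: closed_openC.
Qed.

Lemma enorm_continuous n (f : 'cV[R]_n -> R) :
  (forall x (e : R), 0 < e -> exists2 del : R, 0 < del &
     forall y, enorm (x - y) <= del -> `|f x - f y| <= e) -> continuous f.
Proof.
move=> h x; apply/(@cvgrPdist_le _ _ _ (nbhs x) (nbhs_filter x)) => e e0.
have [del del0 hd] := h x e e0.
have xx : y @[y --> x] --> x by [].
by apply: filterS (@cvg_enormP _ _ _ _ (nbhs_filter x) id x xx _ del0) => y; exact: hd.
Qed.

Lemma measurable_enorm n : measurable_fun setT (fun w : borel_space 'cV[R]_n.+1 => enorm w).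
Proof.
apply: (@continuous_borel 'cV[R]_n.+1) => w; move: w; apply: enorm_continuous => w e e0.
by exists e => // v; apply: le_trans; exact: enorm_dist.
Qed.

Lemma measurable_coord n i : measurable_fun setT (fun w : borel_space 'cV[R]_n.+1 => w i 0).
Proof. by apply: (@continuous_borel 'cV[R]_n.+1); exact: coord_continuous. Qed.

End borel.

Section measure_agnostic.
Local Open Scope ereal_scope.
Context {R : realType}.
Import HBNNSimple.

(* [integral] evaluates its set function on measurable sets only, so that the
   set function need not be a measure. *)
Lemma eq_set_integral d (X : measurableType d) (mu nu : set X -> \bar R) (D : set X) (f : X -> \bar R) :
  (forall A, measurable A -> mu A = nu A) ->
  \int[mu]_(x in D) f x = \int[nu]_(x in D) f x.
Proof.
move=> mn; have e (h : {nnsfun X >-> R}) : sintegral mu h = sintegral nu h.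
  by rewrite /sintegral; apply: eq_fsbigr => r _; rewrite mn.
by rewrite /integral; congr (ereal_sup _ - ereal_sup _); apply/seteqP; split => _ [h hf <-];
  exists h => //.
Qed.

(** Both integrals are suprema over simple functions below the integrand; this covers integrands
    that are not measurable. *)
Lemma ge0_le_integral_set d (X : measurableType d) (mu : {measure set X -> \bar R}) (f g : X -> \bar R) :
  (forall x, 0 <= f x) -> (forall x, f x <= g x) -> \int[mu]_x f x <= \int[mu]_x g x.
Proof.
move=> f0 fg; have g0 x : 0 <= g x := le_trans (f0 x) (fg x).
rewrite !ge0_integralTE//; apply: ereal_sup_le => _ [h hf <-].
exists h => // x; exact: le_trans (hf x) (fg x).
Qed.

Lemma eq_set_product d1 d2 (X : measurableType d1) (Y : measurableType d2)
    (m1 n1 : set X -> \bar R) (m2 n2 : set Y -> \bar R) :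
  (forall A, measurable A -> m1 A = n1 A) -> (forall A, measurable A -> m2 A = n2 A) ->
  forall A, measurable A -> (m1 \x m2) A = (n1 \x n2) A.
Proof.
move=> e1 e2 A mA; rewrite /product_measure1 (eq_set_integral _ _ e1).
congr (integral _ _ _); apply/funext => x /=; apply: e2; exact: measurable_xsection.
Qed.

Lemma measurable_cons_pair d (X : measurableType d) k :
  measurable_fun setT (fun p : X * k.-tuple X => cons_tuple p.1 p.2).
Proof. exact: (measurable_cons measurable_fst measurable_snd). Qed.

Lemma eq_product_power d (X : measurableType d) (mu nu : set X -> \bar R) k :
  (forall A, measurable A -> mu A = nu A) ->
  forall A, measurable A -> product_power mu (k:=k) A = product_power nu (k:=k) A.
Proof.
move=> e; elim: k => [//|k IH] A mA /=; apply: eq_set_product => //.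
by rewrite -[X in measurable X]setTI; exact: measurable_cons_pair.
Qed.

Section sf_measure.
Context d (X : measurableType d) (mu : {measure set X -> \bar R}).
Hypothesis sf : sigma_finite setT mu.

(** A copy of [mu] that depends on a proof of sigma-finiteness, so that the structure can be
    declared from that proof. *)
Definition sf_measure of sigma_finite setT mu : set X -> \bar R := mu.

HB.instance Definition _ := Measure.on (sf_measure sf).
HB.instance Definition _ := Measure_isSigmaFinite.Build _ _ _ (sf_measure sf) sf.

End sf_measure.

(** The exhausting sequences are taken nondecreasing, so that products of members with the same
    index cover the product space. *)
Lemma product_measure_sigma_finite d1 d2 (X : measurableType d1) (Y : measurableType d2)
    (m1 : {sigma_finite_measure set X -> \bar R}) (m2 : {sigma_finite_measure set Y -> \bar R}) :
  sigma_finite setT (m1 \x m2).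
Proof.
have /sigma_finiteP[F [FT ndF Ff]] := sigma_finiteT m1.
have /sigma_finiteP[G [GT ndG Gf]] := sigma_finiteT m2.
exists (fun n => F n `*` G n) => [|n]; last first.
  have [mF Fn] := Ff n; have [mG Gn] := Gf n; split; first exact: measurableX.
  by rewrite product_measure1E// lte_mul_pinfty// ge0_fin_numE.
apply/esym; rewrite -subTset => -[x y] _.
have : (\bigcup_n F n) x by rewrite -FT.
have : (\bigcup_n G n) y by rewrite -GT.
move=> [j _ Gy] [i _ Fx]; exists (maxn i j) => //; split => /=.
  by have /subsetPset := ndF _ _ (leq_maxl i j); exact.
by have /subsetPset := ndG _ _ (leq_maxr i j); exact.
Qed.

HB.instance Definition _ d1 d2 (X : measurableType d1) (Y : measurableType d2)
    (m1 : {sigma_finite_measure set X -> \bar R}) (m2 : {sigma_finite_measure set Y -> \bar R}) :=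
  Measure_isSigmaFinite.Build _ _ _ (m1 \x m2) (product_measure_sigma_finite m1 m2).

Section product_power.
Context d (X : measurableType d) (mu : {sigma_finite_measure set X -> \bar R}).

Let product_power_ge0 k A : 0 <= product_power mu (k:=k) A.
Proof. by elim: k A => [|k IH] A //=; apply: integral_ge0 => x _ /=; exact: IH. Qed.

(** [product_power] is built from set functions. On measurable sets it is the image under
    [cons_tuple] of a product of measures, and the structure of a measure is carried over from
    there. *)
Lemma product_power_sf k :
  exists nu : {sigma_finite_measure set (k.-tuple X) -> \bar R},
    forall A, measurable A -> product_power mu (k:=k) A = nu A.
Proof.
elim: k => [|k [nu IH]].
  exists (\d_([tuple] : 0.-tuple X)); first by [].
pose cons (p : X * k.-tuple X) := cons_tuple p.1 p.2.
have mc : measurable_fun setT cons := @measurable_cons_pair _ X k.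
have mcA A : measurable A -> measurable (cons @^-1` A).
  by move=> mA; rewrite -[X in measurable X]setTI; exact: mc.
have E A : measurable A -> product_power mu (k:=k.+1) A = pushforward (mu \x nu) cons A.
  by move=> mA /=; apply: eq_set_product => //; exact: mcA.
have sf : sigma_finite setT (pushforward (mu \x nu) cons).
  have [F FT Ff] := product_measure_sigma_finite mu nu.
  pose uncons (t : k.+1.-tuple X) := (thead t, [tuple of behead t]).
  have mun : measurable_fun setT uncons.
    apply/measurable_fun_pair; first exact: measurable_tnth.
    exact: measurable_behead.
  have uc : cancel uncons cons by move=> t; rewrite [RHS]tuple_eta; exact: val_inj.
  have cu : cancel cons uncons.
    by move=> [x v]; congr (_, _); exact: val_inj.
  exists (fun n => uncons @^-1` F n); first by rewrite -preimage_bigcup -FT preimage_setT.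
  move=> n; have [mF Fn] := Ff n; split.
    by rewrite -[X in measurable X]setTI; exact: mun.
  rewrite /pushforward; apply: le_lt_trans Fn; rewrite le_eqVlt; apply/orP; left.
  by apply/eqP; congr (_ _); apply/seteqP; split => p /=; rewrite cu.
by exists (@sf_measure _ _ (measure_function_pushforward__canonical__measure_function_Measure (mu \x nu) mc) sf).
Qed.

Let product_power0 k : product_power mu (k:=k) set0 = 0.
Proof. by have [nu ->//] := product_power_sf k; rewrite measure0. Qed.

Let product_power_additive k : semi_sigma_additive (product_power mu (k:=k)).
Proof.
have [nu E] := product_power_sf k; move=> F mF tF mUF.
rewrite E//; under eq_fun do under eq_bigr do rewrite E//.
exact: measure_semi_sigma_additive.
Qed.

HB.instance Definition _ k := isMeasure.Build _ _ _ (product_power mu (k:=k))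
  (product_power0 k) (@product_power_ge0 k) (@product_power_additive k).

Let product_power_sigma_finite k : sigma_finite setT (product_power mu (k:=k)).
Proof.
have [nu E] := product_power_sf k; have [F FT Ff] := sigma_finiteT nu.
by exists F => // n; have [mF Fn] := Ff n; split=> //; rewrite E.
Qed.

HB.instance Definition _ k := Measure_isSigmaFinite.Build _ _ _ (product_power mu (k:=k))
  (@product_power_sigma_finite k).

Lemma integral_product_power0 (f : 0.-tuple X -> \bar R) : measurable_fun [set: 0.-tuple X] f ->
  \int[product_power mu (k:=0)]_t f t = f [tuple].
Proof.
move=> mf; rewrite (@eq_set_integral _ _ _ (\d_([tuple] : 0.-tuple X)))//.
by rewrite integral_dirac// diracT mul1e.
Qed.

Lemma integral_product_powerS k (f : k.+1.-tuple X -> \bar R) :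
  measurable_fun [set: k.+1.-tuple X] f -> (forall t, 0 <= f t) ->
  \int[product_power mu (k:=k.+1)]_t f t =
  \int[mu]_x \int[product_power mu (k:=k)]_t f (cons_tuple x t).
Proof.
move=> mf f0; pose cons (p : X * k.-tuple X) := cons_tuple p.1 p.2.
have mc : measurable_fun setT cons := @measurable_cons_pair _ X k.
rewrite (@eq_set_integral _ _ _ (pushforward (mu \x product_power mu (k:=k)) cons))//.
rewrite ge0_integral_pushforward// preimage_setT.
have mfc : measurable_fun setT (f \o cons) := measurableT_comp mf mc.
exact: (fubini_tonelli1 (f \o cons) mfc (fun p => f0 _)).
Qed.

Lemma product_power_prod k (B : k.-tuple (set X)) : (forall i, measurable (tnth B i)) ->
  product_power mu [set t : k.-tuple X | forall i, tnth B i (tnth t i)] = \prod_i mu (tnth B i).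
Proof.
elim: k B => [|k IH] B mB.
  by rewrite big_ord0 /= diracE mem_set// => -[].
case/tupleP: B mB => B0 B mB.
have mB0 : measurable B0 by have := mB ord0; rewrite tnth0.
have mB' i : measurable (tnth B i) by have := mB (lift ord0 i); rewrite tnthS.
rewrite big_ord_recl tnth0; under eq_bigr do rewrite tnthS.
rewrite -IH// -product_measure1E//; last first.
  rewrite (_ : [set _ | _] = \bigcap_(i in [set: 'I_k]) ((fun t => tnth t i) @^-1` tnth B i)).
    apply: fin_bigcap_measurable => // i _; rewrite -[X in measurable X]setTI.
    exact: measurable_tnth.
  by apply/seteqP; split => t ht i; [move=> _|]; exact: ht.
rewrite /=; congr (_ _); apply/seteqP; split => -[x t] /=.
  by move=> h; split; [have := h ord0; rewrite !tnth0|move=> i; have := h (lift ord0 i); rewrite !tnthS].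
by move=> [h1 h2] i; case: (unliftP ord0 i) => [j|] ->; rewrite ?tnth0 ?tnthS.
Qed.

Lemma measurable_rect k (B : k.-tuple (set X)) : (forall i, measurable (tnth B i)) ->
  measurable [set t : k.-tuple X | forall i, tnth B i (tnth t i)].
Proof.
move=> mB.
rewrite (_ : [set _ | _] = \bigcap_(i in [set: 'I_k]) ((fun t => tnth t i) @^-1` tnth B i)).
  apply: fin_bigcap_measurable => // i _; rewrite -[X in measurable X]setTI.
  exact: measurable_tnth.
by apply/seteqP; split => t ht i; [move=> _|]; exact: ht.
Qed.

End product_power.
End measure_agnostic.

(** * The joint law of finitely many noise vectors *)

Section law.
Context {R : realType} disp (Omega : measurableType disp) (P : probability Omega R) (d : nat).
Variable Z : nat -> {RV P >-> borel_space 'cV[R]_d.+1}.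
Hypothesis Ziid : iid Z.

Definition sample k (s : k.-tuple nat) (w : Omega) : k.-tuple (borel_space 'cV[R]_d.+1) :=
  [tuple Z (tnth s i) w | i < k].

Lemma measurable_sample k (s : k.-tuple nat) : measurable_fun setT (sample s).
Proof.
apply/measurable_fun_tnthP => i.
rewrite (_ : _ \o _ = Z (tnth s i)); last by apply/funext => w /=; rewrite tnth_mktuple.
exact: measurable_funP.
Qed.

(** Both measures agree on rectangles, by independence and equality of laws, and rectangles are a
    generating class stable under intersection. *)
Lemma law_sample k (s : k.-tuple nat) : uniq s -> forall A, measurable A ->
  P (sample s @^-1` A) = product_power (distribution P (Z 0%N)) A.
Proof.
move=> us; set X := borel_space _.
pose G := [set A | exists2 B : k.-tuple (set X), (forall i, measurable (tnth B i)) &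
  A = [set t : k.-tuple X | forall i, tnth B i (tnth t i)]].
have rect B : (forall i, measurable (tnth B i)) ->
    P (sample s @^-1` [set t : k.-tuple X | forall i, tnth B i (tnth t i)]) =
    product_power (distribution P (Z 0%N)) [set t : k.-tuple X | forall i, tnth B i (tnth t i)].
  move=> mB; rewrite product_power_prod//.
  (* The sides of the rectangle are re-indexed by all natural numbers: at an index outside [s],
     [nth] returns its default [setT]. *)
  have [ind idd] := Ziid; pose B' n := nth setT B (index n s).
  have mB' n : measurable (B' n).
    rewrite /B'; have [ns|ns] := ltnP (index n s) k; last by rewrite nth_default// size_tuple.
    by have := mB (Ordinal ns); rewrite (tnth_nth setT).
  have B'E i : B' (tnth s i) = tnth B i.
    by rewrite /B' (tnth_nth setT) (tnth_nth 0%N) index_uniq// size_tuple.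
  have := ind [fset x in (s : seq nat)]%fset B' mB'.
  have -> : \bigcap_(i in [set` [fset x in (s : seq nat)]%fset]) (Z i @^-1` B' i) =
      sample s @^-1` [set t : k.-tuple X | forall i, tnth B i (tnth t i)].
    apply/seteqP; split => w h.
      move=> i; rewrite tnth_mktuple -B'E; apply: h => /=.
      by rewrite !inE/= mem_tnth.
    move=> n /=; rewrite !inE/= => /tnthP[i ->]; have := h i.
    by rewrite tnth_mktuple B'E.
  move=> ->; rewrite (perm_big (s : seq nat)); last first.
    by apply: uniq_perm => [|//|n]; rewrite ?fset_uniq// !inE.
  by rewrite big_tuple; apply: eq_bigr => i _; rewrite B'E idd.
move=> A mA; have mf := measurable_sample s.
have -> : P (sample s @^-1` A) = pushforward P (sample s) A by [].
apply: (measure_unique G (fun=> setT)) => //.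
(* The product sigma-algebra is generated by preimages under one coordinate, which are rectangles
   with a single side different from the whole space. *)
- apply/seteqP; split.
    apply: smallest_sub; first exact: smallest_sigma_algebra.
    elim/big_ind: _ => [C []//|U V hU hV C [/hU//|/hV//]|i _ C [B mB <-]].
    apply: sub_sigma_algebra.
    exists [tuple (if j == i then B else setT) | j < k] => [j|]; rewrite ?tnth_mktuple.
      by case: ifP.
    rewrite setTI; apply/seteqP; split => t /=.
      by move=> Bt j; rewrite tnth_mktuple; case: eqP => // ->.
    by move=> /(_ i); rewrite tnth_mktuple eqxx.
  apply: smallest_sub; first exact: sigma_algebra_measurable.
  by move=> _ [B mB ->]; exact: measurable_rect.
- move=> _ _ [B mB ->] [C mC ->].
  exists [tuple tnth B i `&` tnth C i | i < k] => [i|].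
    by rewrite tnth_mktuple; exact: measurableI.
  apply/seteqP; split => t /=.
    by move=> [h1 h2] i; rewrite tnth_mktuple; split.
  by move=> h; split => i; have := h i; rewrite tnth_mktuple => -[].
- move=> _; exists [tuple setT | i < k] => [i|]; first by rewrite tnth_mktuple.
  by apply/esym; rewrite -subTset => t _ i; rewrite tnth_mktuple.
- by rewrite bigcup_const.
- by move=> _ [B mB ->]; exact: rect.
- by move=> n; have : (P setT < +oo)%E by rewrite probability_setT ltry.
Qed.

Lemma expect_sample k (s : k.-tuple nat) (f : k.-tuple (borel_space 'cV[R]_d.+1) -> \bar R) :
  uniq s -> measurable_fun [set: k.-tuple _] f -> (forall t, 0 <= f t)%E ->
  (\int[P]_w f (sample s w) = \int[product_power (distribution P (Z 0%N)) (k:=k)]_t f t)%E.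
Proof.
move=> us mf f0; rewrite -(eq_set_integral _ _ (law_sample us)).
have ms := measurable_sample s.
by rewrite (ge0_integral_pushforward ms)// preimage_setT.
Qed.

End law.

(** * Regular variation *)

Section jump_measure.
Context {R : realType} (d : nat) (alpha : R) (S : probability (borel_space (sphere R d)) R).
Hypothesis alpha0 : 0 < alpha.
Local Open Scope ereal_scope.

(** [nu_alpha] indexed by the proof that alpha is positive, on which its structure of sigma-finite
    measure rests. *)
Definition tail_measure of (0 < alpha)%R := nu_alpha alpha.
Let nu := tail_measure alpha0.

Let density (r : R) : \bar R := (alpha * r `^ (- alpha - 1))%:E.

Let density_ge0 r : 0 <= density r.
Proof. by rewrite lee_fin mulr_ge0 ?powR_ge0// ltW. Qed.

Let measurable_density (D : set R) : measurable_fun D density.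
Proof.
apply: measurable_funTS; apply/measurable_EFinP; exact: measurable_funM.
Qed.

Let nu0 : nu set0 = 0.
Proof. by rewrite /nu /tail_measure /nu_alpha set0I integral_set0. Qed.

Let nu_ge0 A : 0 <= nu A.
Proof. by apply: integral_ge0 => r _; exact: density_ge0. Qed.

Let nu_additive : semi_sigma_additive nu.
Proof.
move=> F mF tF mUF; rewrite /nu /tail_measure /nu_alpha setI_bigcupl.
rewrite ge0_integral_bigcup//.
- by apply: is_cvg_ereal_nneg_natsum_cond => n _ _; apply: integral_ge0 => r _; exact: density_ge0.
- by move=> k; exact: (measurableI _ _ (mF k) (measurable_itv _)).
- exact: measurable_density.
- by move=> r _; exact: density_ge0.
- exact: trivIset_setIr.
Qed.

HB.instance Definition _ := isMeasure.Build _ _ _ nu nu0 nu_ge0 nu_additive.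

Let nuE (r : R) : (0 < r)%R -> nu `[r, +oo[ = (r `^ (- alpha))%:E.
Proof. exact: nu_alpha_tail. Qed.

Lemma tail_measure_le0 : nu `]-oo, 0%R] = 0.
Proof.
rewrite /nu /tail_measure /nu_alpha (_ : _ `&` _ = set0) ?integral_set0//.
by apply/seteqP; split => r //= []; rewrite !in_itv/= andbT => /le_lt_trans/[apply]; rewrite ltxx.
Qed.

Let nu_sf : sigma_finite setT nu.
Proof.
exists (fun n => `]-oo, 0%R] `|` `[(n.+1%:R^-1)%R, +oo[) => [|n].
  apply/esym; rewrite -subTset => r _; have [r0|r0] := leP r 0%R.
    by exists 0%N => //; left; rewrite /= in_itv.
  exists (Num.truncn r^-1) => //; right; rewrite /= in_itv/= andbT.
  by rewrite invf_ple ?posrE// ltW// truncnS_gt.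
split; first exact: measurableU.
have := measureU2 nu (measurable_itv `]-oo, 0%R]) (measurable_itv `[(n.+1%:R^-1)%R, +oo[).
move=> /le_lt_trans; apply.
by rewrite [X in X + _]tail_measure_le0 add0e [ltLHS]nuE ?ltry// invr_gt0.
Qed.

HB.instance Definition _ := Measure_isSigmaFinite.Build _ _ _ nu nu_sf.

(** Inverse of [Phi] away from 0; the maximum makes it total on the line, where the radial measure
    lives. *)
Definition polar_mul (p : R * borel_space (sphere R d)) : borel_space 'cV[R]_d.+1 :=
  (Num.max p.1 0 *: val p.2)%R.

Lemma sphere_coord_measurable i : measurable_fun setT (fun u : borel_space (sphere R d) => val u i 0%R).
Proof.
apply: (@continuous_borel _ (sphere R d)) ; apply: metric_continuous => u e e0.
exists e => // v /ltW uv; apply: le_trans uv.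
by have := entry_le_enorm (val u - val v) i; rewrite !mxE.
Qed.

Let pc (i : option 'I_d.+1) (p : R * borel_space (sphere R d)) : R :=
  if i is Some j then val p.2 j 0%R else p.1.

Let measurable_pc i : measurable_fun setT (pc i).
Proof.
case: i => [j|] /=; last exact: measurable_fst.
by apply: (measurableT_comp (sphere_coord_measurable j)); exact: measurable_snd.
Qed.

Let dist_max0 (r r' : R) : (`|Num.max r 0 - Num.max r' 0| <= `|r - r'|)%R.
Proof.
rewrite ler_norml; have := ler_norm (r - r'); have := ler_norm (r' - r); rewrite distrC => h1 h2.
rewrite !maxEle; case: (leP r 0%R) => h3; case: (leP r' 0%R) => h4; apply/andP; split; lra.
Qed.

Lemma measurable_polar_mul : measurable_fun setT polar_mul.
Proof.
apply: (@measurable_col_cells _ _ _ _ _ pc) => // -[r u] _ e e0 /=.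
set mr := Num.max r 0%R.
have K0 : (0 < 2 + `|mr| * d.+1%:R)%R by rewrite ltr_pwDl// mulr_ge0.
exists (e / (2 + `|mr| * d.+1%:R))%R; first by rewrite divr_gt0.
move=> [r' u'] _ h; rewrite /polar_mul /=; set del := (e / _)%R in h.
have -> : (mr *: val u - Num.max r' 0 *: val u' =
    mr *: (val u - val u') + (mr - Num.max r' 0) *: val u')%R.
  by rewrite scalerBr scalerBl addrA subrK.
have d1 : (enorm (mr *: (val u - val u')) <= `|mr| * (d.+1%:R * del))%R.
  rewrite enormZ ler_wpM2l//; apply: enorm_le_sum => i.
  by have := h (Some i); rewrite /= !mxE => /ltW.
have d2 : (enorm ((mr - Num.max r' 0) *: val u') < del)%R.
  rewrite enormZ (eqP (valP u')) mulr1; apply: le_lt_trans (h None).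
  exact: dist_max0.
apply: le_lt_trans (enormD _ _) _.
have : ((2 + `|mr| * d.+1%:R) * del = e)%R by rewrite mulrC divfK// gt_eqF.
have del0 : (0 < del)%R by rewrite divr_gt0.
nra.
Qed.

Let N := nu \x S.
Let pos : set (R * borel_space (sphere R d)) := [set p | (0 < p.1)%R].

Let mpos : measurable pos.
Proof.
rewrite (_ : pos = `]0%R, +oo[%classic `*` setT); first exact: measurableX.
by apply/seteqP; split => -[r u] /=; rewrite /pos /= in_itv/= andbT// => -[].
Qed.

Let restr := mrestr N mpos.

(** [jump_measure] is defined through images of sets under [Phi]; as an image measure under the
    inverse map it is visibly a measure. The two agree on Borel sets by [jump_lawE]. *)
Definition jump_law := pushforward restr polar_mul.

HB.instance Definition _ := Measure.copy jump_law
  (measure_function_pushforward__canonical__measure_function_Measure restr measurable_polar_mul).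

Lemma enorm_polar_mul p : pos p -> enorm (polar_mul p) = p.1.
Proof.
by move=> p0; rewrite /polar_mul enormZ (eqP (valP p.2)) mulr1 max_l ?gtr0_norm// ltW.
Qed.

Lemma jump_lawE E : measurable E -> jump_measure alpha S E = jump_law E.
Proof.
move=> mE; rewrite /jump_law /pushforward /restr /mrestr /jump_measure.
congr (_ _); apply/seteqP; split => [_ [w [Ew w0] <-]|[r u] [/= Eru r0]].
  have nw : (0 < enorm w)%R by rewrite enorm_gt0; apply/eqP.
  split => //=; rewrite /polar_mul Phi_neq0 /=; last exact/eqP.
  by rewrite max_l ?enorm_ge0// scalerA mulfV ?scale1r// gt_eqF.
rewrite /polar_mul /= max_l ?(ltW r0)// in Eru.
exists (r *: val u).
  split => //= /eqP; rewrite scaler_eq0 gt_eqF//= => /eqP u0.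
  by have := valP u; rewrite /= u0 enorm0 eq_sym oner_eq0.
have nru : enorm (r *: val u) = r by rewrite enormZ (eqP (valP u)) mulr1 gtr0_norm.
rewrite /Phi nru; congr (_, _); apply: val_inj.
by rewrite insubdK scalerA mulVf ?gt_eqF// scale1r//; exact: (valP u).
Qed.

Lemma jump_law_tail (r : R) : (0 < r)%R -> jump_law [set w | (r <= enorm w)%R] < +oo.
Proof.
move=> r0; rewrite /jump_law /pushforward /restr /mrestr.
apply: (@le_lt_trans _ _ (N (`[r, +oo[ `*` setT))); last first.
  by rewrite /N product_measure1E// [X in X * _]nuE// [X in _ * X]probability_setT mule1 ltry.
apply: le_measure; rewrite ?inE.
- apply: measurableI => //; rewrite -[X in measurable X]setTI.
  apply: measurable_polar_mul => //.
  rewrite (_ : [set _ | _] = (fun w => enorm w) @^-1` `[r, +oo[).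
    by rewrite -[X in measurable X]setTI; apply: measurable_enorm.
  by apply/seteqP; split => w /=; rewrite in_itv/= andbT.
- exact: measurableX.
by move=> p [/= rp p0]; split => //=; rewrite in_itv/= andbT -enorm_polar_mul.
Qed.

Lemma jump_law0 : jump_law [set 0%R] = 0.
Proof.
rewrite /jump_law /pushforward /restr /mrestr (_ : _ `&` _ = set0) ?measure0//.
apply/seteqP; split => // p [/= p0 pp]; have := enorm_polar_mul pp.
by rewrite p0 enorm0 => p1; move: pp; rewrite /pos /= -p1 ltxx.
Qed.

Let jump_law_sf : sigma_finite setT jump_law.
Proof.
have mtail (r : R) : measurable ([set w | (r <= enorm w)%R] : set (borel_space 'cV[R]_d.+1)).
  rewrite (_ : [set _ | _] = (fun w => enorm w) @^-1` `[r, +oo[).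
    by rewrite -[X in measurable X]setTI; apply: measurable_enorm.
  by apply/seteqP; split => w /=; rewrite in_itv/= andbT.
have m0 : measurable ([set 0%R] : set (borel_space 'cV[R]_d.+1)).
  rewrite (_ : [set _] = (fun w => enorm w) @^-1` `]-oo, 0%R]).
    by rewrite -[X in measurable X]setTI; apply: measurable_enorm.
  apply/seteqP; split => w /=; rewrite in_itv/=; first by move=> ->; rewrite enorm0.
  by move=> w0; apply: enorm0_eq0; apply/eqP; rewrite eq_le w0 enorm_ge0.
exists (fun n => [set 0%R] `|` [set w | (n.+1%:R^-1 <= enorm w)%R]) => [|n].
  apply/esym; rewrite -subTset => w _; have [->|w0] := eqVneq w 0%R.
    by exists 0%N => //; left.
  have nw : (0 < enorm w)%R by rewrite enorm_gt0.
  exists (Num.truncn (enorm w)^-1) => //; right => /=.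
  by rewrite invf_ple ?posrE// ltW// truncnS_gt.
split; first exact: measurableU.
apply: le_lt_trans (measureU2 _ m0 (mtail _)) _.
by rewrite [X in X + _]jump_law0 add0e; exact: jump_law_tail.
Qed.

HB.instance Definition _ := Measure_isSigmaFinite.Build _ _ _ jump_law jump_law_sf.

Definition to_ray (r : R) : ray R := insubd (exist (fun r => 0 <= r)%R 0%R (lexx 0%R)) r.

Lemma val_to_ray r : val (to_ray r) = Num.max r 0%R.
Proof.
by rewrite /to_ray val_insubd /=; rewrite maxC; case: leP.
Qed.

Definition polar_point (p : R * borel_space (sphere R d)) : borel_space (ray R * sphere R d)%type :=
  (to_ray p.1, p.2).

Lemma measurable_polar_point : measurable_fun setT polar_point.
Proof.
apply: (@measurable_metric_cells _ _ _ _ _ pc) => // -[r u] _ e e0 /=.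
exists (e / (d.+2%:R))%R; first by rewrite divr_gt0.
move=> [r' u'] _ h; rewrite /mdist /= gt_max; apply/andP; split.
  rewrite /mdist /= !val_to_ray; apply: le_lt_trans (dist_max0 _ _) _.
  apply: lt_le_trans (h None) _; rewrite ler_pdivrMr// ler_peMr// ?ltW//.
  by rewrite ltr1n.
rewrite /mdist /=; apply: (@le_lt_trans _ _ (d.+1%:R * (e / d.+2%:R))%R).
  by apply: enorm_le_sum => i; have := h (Some i); rewrite /= !mxE => /ltW.
by rewrite mulrCA gtr_pMr// ltr_pdivrMr// mul1r ltr_nat.
Qed.

(** The image under [polar_val] may contain points with r = 0; they do not count, since the radial
    measure gives ]-oo, 0] mass 0. *)
Lemma polar_measureE E : measurable (E : set (borel_space (ray R * sphere R d)%type)) ->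
  polar_measure alpha S E = pushforward restr polar_point E.
Proof.
move=> mE; rewrite /pushforward /restr /mrestr /polar_measure -/(tail_measure alpha0) -/N.
set F := polar_point @^-1` E `&` pos.
have mF : measurable F.
  by apply: measurableI => //; rewrite -[X in measurable X]setTI; exact: measurable_polar_point.
have -> : polar_val (d:=d) @` E = (polar_point @^-1` E) `&` ([set r | 0 <= r]%R `*` setT).
  apply/seteqP; split => [_ [[r u] /= Eru <-]|[r u] [/= Eru [/= r0 _]]].
    split => /=; last by split => //; exact: (valP r).
    rewrite /polar_point /= (_ : to_ray _ = r)//; apply: val_inj.
    by rewrite val_to_ray max_l//; exact: (valP r).
  exists (to_ray r, u) => //; rewrite /polar_val /= val_to_ray max_l//.
set G := _ `&` _.
have mI : measurable ([set r | 0 <= r]%R : set R).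
  rewrite (_ : [set _ | _] = `[0%R, +oo[%classic)//.
  by apply/seteqP; split => r /=; rewrite in_itv/= andbT.
have mG : measurable G.
  apply: measurableI; last exact: measurableX.
  by rewrite -[X in measurable X]setTI; exact: measurable_polar_point.
have mL : measurable (`]-oo, 0%R] `*` setT : set (R * borel_space (sphere R d))).
  exact: measurableX.
have NL : N (`]-oo, 0%R] `*` setT) = 0.
  by rewrite /N product_measure1E// [X in X * _]tail_measure_le0 mul0e.
apply/eqP; rewrite eq_le; apply/andP; split; last first.
  apply: le_measure; rewrite ?inE// => p [h1 h2]; split => //; split => //=; exact: ltW.
apply: (@le_trans _ _ (N (F `|` (`]-oo, 0%R] `*` setT)))).
  apply: le_measure; rewrite ?inE//; first exact: measurableU.
  move=> [r u] [h1 [/= h2 _]]; have [r0|r0] := leP r 0%R; last by left.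
  by right; split => //=; rewrite in_itv.
apply: le_trans (measureU2 _ mF mL) _.
by rewrite [X in _ + X]NL adde0.
Qed.

(** Both sides are integrals against images of the same restricted product measure, under
    [polar_point] and under [polar_mul]. *)
Lemma polar_integral (g : 'cV[R]_d.+1 -> R) :
  measurable_fun setT (g : borel_space 'cV[R]_d.+1 -> R) -> (forall w, 0 <= g w)%R ->
  measurable_fun setT (fun p : borel_space (ray R * sphere R d)%type => g (val p.1 *: val p.2)) ->
  \int[polar_measure alpha S : set (borel_space (ray R * sphere R d)%type) -> \bar R]_p (g (val p.1 *: val p.2))%:E =
  \int[jump_law]_w (g w)%:E.
Proof.
move=> mg g0 mf; rewrite (eq_set_integral _ _ polar_measureE).
rewrite (ge0_integral_pushforward measurable_polar_point)//; last 2 first.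
- exact/measurable_EFinP.
- by move=> p _; rewrite lee_fin.
rewrite [RHS](ge0_integral_pushforward measurable_polar_mul)//; last 2 first.
- exact/measurable_EFinP.
- by move=> p _; rewrite lee_fin.
by rewrite !preimage_setT; apply: eq_integral => -[r u] _ /=; rewrite /polar_mul /= val_to_ray.
Qed.

End jump_measure.

Lemma inv_cvg_pinfty {R : realType} : (fun eta : R => eta^-1) @ 0^'+ --> +oo.
Proof.
apply/cvgryPgt => M; near=> x.
have x0 : 0 < x by [].
have xM : x < (`|M| + 1)^-1 by near: x; apply: nbhs_right_lt; rewrite invr_gt0 ltr_wpDl.
apply: le_lt_trans (ler_norm M) _; apply: (@lt_trans _ _ (`|M| + 1)); first by rewrite ltrDl.
by rewrite -[X in X < _]invrK ltf_pV2 ?posrE ?invr_gt0 ?ltr_wpDl.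
Unshelve. all: by end_near. Qed.

Section noise_limit.
Context {R : realType} disp (Omega : measurableType disp) (P : probability Omega R) (d : nat).
Variables (Y : {RV P >-> borel_space 'cV[R]_d.+1}) (alpha : R).
Variable S : probability (borel_space (sphere R d)) R.
Hypothesis alpha0 : 0 < alpha.
Hypothesis RV : mv_regularly_varying P Y alpha S.
Let H : R -> R := norm_tail P Y.
Let J : set (borel_space 'cV[R]_d.+1) -> \bar R := jump_law S alpha0.

Let mY : measurable_fun setT Y. Proof. exact: measurable_funP. Qed.

Lemma measurable_enormY : measurable_fun setT (fun w => enorm (Y w : 'cV[R]_d.+1)).
Proof. exact: (measurableT_comp (@measurable_enorm _ _) mY). Qed.

Lemma measurable_norm_gt (x : R) : measurable [set w | x < enorm (Y w : 'cV[R]_d.+1)].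
Proof.
rewrite (_ : [set _ | _] = (fun w => enorm (Y w : 'cV[R]_d.+1)) @^-1` `]x, +oo[).
  by rewrite -[X in measurable X]setTI; exact: measurable_enormY.
by apply/seteqP; split => w /=; rewrite in_itv/= andbT.
Qed.

Lemma norm_tailE x : P [set w | x < enorm (Y w : 'cV[R]_d.+1)] = (H x)%:E.
Proof. by rewrite /H /norm_tail fineK// fin_num_measure//; exact: measurable_norm_gt. Qed.

Lemma norm_tail_ge0 x : 0 <= H x.
Proof. by rewrite -lee_fin -norm_tailE. Qed.

Lemma norm_tail_le (x y : R) : x <= y -> H y <= H x.
Proof.
move=> xy; rewrite -lee_fin -!norm_tailE; apply: le_measure; rewrite ?inE;
  [exact: measurable_norm_gt..|by move=> w /=; exact: le_lt_trans].
Qed.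

Lemma norm_tail_le1 x : H x <= 1.
Proof. by rewrite -lee_fin -norm_tailE; apply: probability_le1; exact: measurable_norm_gt. Qed.

Lemma norm_tail_gt0 x : 0 < H x.
Proof.
rewrite lt_neqAle norm_tail_ge0 andbT; apply/negP => /eqP Hx.
have [/(_ 1 ltr01) + _] := RV; rewrite powR1 => /cvgrPdist_lt/(_ 1 ltr01)[M [_ hM]].
have := hM (Num.max (M + 1) x); rewrite lt_max ltrDl ltr01 => /(_ isT).
suff -> : norm_tail P Y (Num.max (M + 1) x) = 0 by rewrite invr0 mulr0 subr0 normr1 ltxx.
apply/eqP; rewrite eq_le norm_tail_ge0 andbT [leRHS]Hx.
by apply: norm_tail_le; rewrite le_max lexx orbT.
Qed.

Lemma norm_tail_ratio (t : R) : 0 < t -> H (t * x) / H x @[x --> +oo] --> t `^ (- alpha).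
Proof. by move: t; case: RV. Qed.

Let theta (x : R) (v : borel_space 'cV[R]_d.+1) : borel_space (ray R * sphere R d)%type :=
  (to_ray (x^-1 * enorm v), (Phi v).2).

Let measurable_theta (x : R) : 0 < x -> measurable_fun setT (theta x).
Proof.
move=> x0; have xi : 0 < x^-1 by rewrite invr_gt0.
have mn0 : measurable ([set v | 0 < enorm v] : set (borel_space 'cV[R]_d.+1)).
  rewrite (_ : [set _ | _] = (fun w => enorm w) @^-1` `]0, +oo[).
    by rewrite -[X in measurable X]setTI; apply: measurable_enorm.
  by apply/seteqP; split => w /=; rewrite in_itv/= andbT.
(* [Phi] is continuous off 0 but not at 0; the nonzero vectors and the singleton 0 are treated
   apart. *)
rewrite -(setUv [set v : 'cV[R]_d.+1 | 0 < enorm v]).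
apply/measurable_funU => //; first exact: measurableC.
pose c (i : 'I_d.+1) (v : borel_space 'cV[R]_d.+1) : R := v i 0.
have mc i D : measurable_fun D (c i).
  by apply: measurable_funTS; exact: measurable_coord.
split.
  apply: (@measurable_metric_cells _ _ _ _ _ c) => // v /= v0 e e0.
  pose del := Num.min (e * x) (e * enorm v / 2) / d.+2%:R.
  have m0 : 0 < Num.min (e * x) (e * enorm v / 2) by rewrite lt_min !mulr_gt0// invr_gt0.
  exists del; first by rewrite divr_gt0.
  move=> v' v'0 h; have vv : enorm (v - v') < Num.min (e * x) (e * enorm v / 2).
    apply: (@le_lt_trans _ _ (d.+1%:R * del)).
      by apply: enorm_le_sum => i; have := h i; rewrite /c !mxE => /ltW.
    by rewrite mulrCA gtr_pMr// ltr_pdivrMr// mul1r ltr_nat.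
  move: vv; rewrite lt_min => /andP[vv1 vv2].
  rewrite /mdist /= gt_max; apply/andP; split.
    rewrite /mdist /= !val_to_ray !max_l ?mulr_ge0 ?enorm_ge0 ?(ltW xi)//.
    rewrite -mulrBr normrM gtr0_norm// mulrC ltr_pdivrMr//.
    by apply: le_lt_trans vv1; exact: enorm_dist.
  have nz u : 0 < enorm u -> u != 0 :> 'cV[R]_d.+1.
    by move=> u0; apply/eqP => u0'; rewrite u0' enorm0 ltxx in u0.
  rewrite /mdist /= !insubdK; last 2 first.
  - by rewrite /in_mem/= enormZ gtr0_norm ?invr_gt0// mulVf// gt_eqF.
  - by rewrite /in_mem/= enormZ gtr0_norm ?invr_gt0// mulVf// gt_eqF.
  have -> : (enorm v)^-1 *: v - (enorm v')^-1 *: v' =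
      (enorm v)^-1 *: ((v - v') + (1 - enorm v / enorm v') *: v').
    rewrite scalerBl scale1r addrA subrK scalerBr scalerA mulrA mulVf ?gt_eqF//.
    by rewrite mul1r.
  rewrite enormZ gtr0_norm ?invr_gt0// mulrC ltr_pdivrMr//.
  apply: le_lt_trans (enormD _ _) _; rewrite enormZ.
  rewrite -[X in `|X| * _](_ : (enorm v' - enorm v) / enorm v' = _); last first.
    by rewrite mulrBl divff// gt_eqF.
  rewrite normrM (gtr0_norm (x := (enorm v')^-1)) ?invr_gt0// mulfVK ?gt_eqF//.
  have := enorm_dist v v'; rewrite distrC.
  lra.
apply: (@measurable_metric_cells _ _ _ _ _ c) => //; first exact: measurableC.
move=> v /= /negP; rewrite -leNgt => v0 e e0; exists 1 => // v' /negP; rewrite -leNgt => v'0 _.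
have z u : enorm u <= 0 -> u = 0 :> 'cV[R]_d.+1.
  by move=> u0; apply: enorm0_eq0; apply/eqP; rewrite eq_le u0 enorm_ge0.
by rewrite (z _ v0) (z _ v'0) mdistxx.
Qed.

Variable g : 'cV[R]_d.+1 -> R.
Hypothesis cg : continuous g.
Hypothesis g0 : forall w, 0 <= g w.
Variable M : R.
Hypothesis gM : forall w, g w <= M.
Variable del : R.
Hypothesis del0 : 0 < del.
Hypothesis gdel : forall w, enorm w <= del -> g w = 0.

Let f (p : ray R * sphere R d) : R := g (val p.1 *: val p.2).

Let cf : continuous f.
Proof.
apply: metric_continuous => -[r u] e e0.
have /(@cvgrPdist_le _ _ _ _ (nbhs_filter _)) /(_ _ e0) := @cg (val r *: val u).
move=> /nbhs_ballP[eta /= eta0 he].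
have r0 : 0 <= val r := valP r.
have K0 : 0 < 2 + val r by lra.
exists (eta / (2 + val r)); first by rewrite divr_gt0.
move=> [r' u']; rewrite /mdist /= gt_max => /andP[]; rewrite /mdist /= => h1 h2.
apply: he; rewrite -ball_normE /=; apply: le_lt_trans (norm_le_enorm _) _.
have -> : val r *: val u - val r' *: val u' = val r *: (val u - val u') + (val r - val r') *: val u'.
  by rewrite scalerBr scalerBl addrA subrK.
apply: le_lt_trans (enormD _ _) _; rewrite !enormZ (eqP (valP u')) mulr1 (ger0_norm r0).
have : (2 + val r) * (eta / (2 + val r)) = eta by rewrite mulrC divfK// gt_eqF.
have : 0 < eta / (2 + val r) by rewrite divr_gt0.
move: (eta / _) h1 h2 => del1 h1 h2 d1 <-.
have := enorm_ge0 (val u - val u').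
nra.
Qed.

Let C : set (ray R * sphere R d) := [set p | val p.1 = 0].

Let f_out p : C p -> f p = 0.
Proof. by move=> p0; apply: gdel; rewrite enormZ p0 normr0 mul0r ltW. Qed.

Let M_integral_f (nu : set (ray R * sphere R d) -> \bar R) :
  M_integral C nu f = (\int[nu : set (borel_space (ray R * sphere R d)%type) -> \bar R]_p (f p)%:E)%E.
Proof.
rewrite /M_integral /integral.
have -> : ((fun p => (f p)%:E) \_ (~` C)) = ((fun p => (f p)%:E) \_ setT).
  apply/funext => p; rewrite !patchE mem_setT; case: ifPn => // /negP pC.
  by rewrite f_out//; apply: contrapT => nCp; apply: pC; rewrite inE.
by [].
Qed.

Let test_f : test_function C f.
Proof.
split.
- exact: continuous_subspaceT.
- by move=> p _; exact: g0.
- by exists M => p _; exact: gM.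
- exists del => // p _ fp; apply: gdel; rewrite enormZ (eqP (valP p.2)) mulr1 ger0_norm; last exact: (valP p.1).
  rewrite -lee_fin; apply: le_trans fp; apply: le_ereal_inf_tmp => _ [c Cc <-].
  rewrite lee_fin /mdist /= le_max; apply/orP; left; rewrite /mdist /= Cc sub0r normrN ger0_norm//.
  exact: (valP p.1).
Qed.

Let mg : measurable_fun setT (g : borel_space 'cV[R]_d.+1 -> R).
Proof. exact: (@continuous_borel _ 'cV[R]_d.+1). Qed.

Let mf : measurable_fun setT (f : borel_space (ray R * sphere R d)%type -> R).
Proof. exact: (@continuous_borel _ (ray R * sphere R d)%type). Qed.

(** The prelimit set function in the definition of regular variation is, on Borel sets, the scaled
    image of P under [theta x] composed with [Y]. *)
Lemma noise_integral (x : R) : 0 < x ->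
  M_integral C (fun E : set (ray R * sphere R d) => P [set w | (@polar_val R d @` E) (x^-1 * (Phi (Y w)).1, (Phi (Y w)).2)%R]
                * ((H x)^-1)%:E)%E f =
  (\int[P]_w (g (x^-1 *: (Y w : 'cV[R]_d.+1))%R)%:E * ((H x)^-1)%:E)%E.
Proof.
move=> x0; rewrite M_integral_f.
have mt : measurable_fun setT (theta x \o Y) by apply: measurableT_comp => //; exact: measurable_theta.
have Hx0 : 0 <= (H x)^-1 by rewrite invr_ge0 norm_tail_ge0.
rewrite (@eq_set_integral _ _ _ _ (mscale (NngNum Hx0)
  (measure_function_pushforward__canonical__measure_function_Measure P mt))); last first.
  move=> E mE; rewrite /mscale /= muleC /pushforward; congr (_ * P _)%E; apply/seteqP; split => w /=.
    move=> [[r u] /= Eru [rE uE]]; rewrite (_ : theta x (Y w) = (r, u))//.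
    congr (_, _); last exact: esym.
    by apply: val_inj; rewrite val_to_ray -rE max_l//; exact: (valP r).
  move=> Ew; exists (theta x (Y w)) => //; rewrite /polar_val /theta /= val_to_ray max_l//.
  by rewrite mulr_ge0 ?enorm_ge0// invr_ge0 ltW.
rewrite ge0_integral_mscale//; last 2 first.
- exact/measurable_EFinP.
- by move=> p _; rewrite lee_fin; exact: g0.
rewrite (ge0_integral_pushforward mt)//; last 2 first.
- exact/measurable_EFinP.
- by move=> p _; rewrite lee_fin; exact: g0.
rewrite muleC preimage_setT; congr (_ * _)%E; apply: eq_integral => w _ /=; congr (_%:E).
rewrite /f /theta /= val_to_ray max_l ?mulr_ge0 ?enorm_ge0 ?invr_ge0 ?(ltW x0)//.
have [->|Y0] := eqVneq (Y w : 'cV[R]_d.+1) 0; first by rewrite enorm0 mulr0 scale0r scaler0.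
rewrite -[sval _]/(val (Phi (Y w)).2) Phi_neq0// scalerA mulfK//.
by apply: contra Y0 => /eqP/enorm0_eq0 ->.
Qed.

Lemma noise_limit :
  (\int[P]_w (g (eta *: (Y w : 'cV[R]_d.+1))%R)%:E * ((H eta^-1)^-1)%:E)%E @[eta --> 0^'+] -->
  (\int[J]_w (g w)%:E)%E.
Proof.
have [_ [_ _ /(_ _ test_f)]] := RV.
rewrite M_integral_f (polar_integral S alpha0 mg)// => h.
apply: cvg_trans (cvg_comp (fun eta : R => eta^-1) _ inv_cvg_pinfty h).
apply: near_eq_cvg; near=> eta.
have eta0 : 0 < eta by [].
by rewrite /comp noise_integral ?invr_gt0 ?invrK.
Unshelve. all: by end_near. Qed.

End noise_limit.

(** * Bounds on the tail and on the truncated second moment *)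

Section moments.
Context {R : realType} disp (Omega : measurableType disp) (P : probability Omega R) (d : nat).
Variables (Y : {RV P >-> borel_space 'cV[R]_d.+1}) (alpha : R).
Variable S : probability (borel_space (sphere R d)) R.
Hypothesis alpha1 : 1 < alpha.
Hypothesis RV : mv_regularly_varying P Y alpha S.
Hypothesis Yc : centered P Y.
Let alpha0 : 0 < alpha := lt_trans ltr01 alpha1.
Let H : R -> R := norm_tail P Y.
Local Notation nY w := (enorm (Y w : 'cV[R]_d.+1)).

Let H0 x : 0 < H x := norm_tail_gt0 RV x.
Let HT (t : R) : 0 < t -> H (t * x) / H x @[x --> +oo] --> t `^ (- alpha) := @norm_tail_ratio _ _ _ _ _ _ _ _ RV t.

(** Potter's bound along a dyadic sequence: far out, doubling the argument multiplies the tail by at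
    most th. *)
Lemma norm_tail_double_le (th : R) : 2 `^ (- alpha) < th ->
  exists2 s : R, 0 < s & forall i, H (2 ^+ i * s) <= th ^+ i.
Proof.
move=> h; have th0 : 0 < th by apply: lt_trans h; rewrite powR_gt0.
have e0 : 0 < th - 2 `^ (- alpha) by rewrite subr_gt0.
have /cvgrPdist_lt/(_ _ e0)[M [_ hM]] := HT (ltr0Sn R 1).
pose s := Num.max (M + 1) 1; exists s; first by rewrite lt_max ltr01 orbT.
have step x : s <= x -> H (2 * x) <= th * H x.
  move=> sx; have /hM : M < x by apply: lt_le_trans sx; rewrite lt_max ltrDl ltr01.
  rewrite distrC => /(le_lt_trans (ler_norm _)); rewrite ltrD2r ltr_pdivrMr//.
  exact: ltW.
elim => [|i IH]; first by rewrite !expr0; exact: norm_tail_le1.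
rewrite !exprS -mulrA; apply: le_trans (step _ _) _; last by rewrite ler_wpM2l// ltW.
have s0 : 0 <= s by rewrite le_max ler01 orbT.
by rewrite ler_peMl// exprn_ege1// ler1n.
Qed.

Lemma norm_tail_double_ge (th : R) : 0 < th -> th < 2 `^ (- alpha) ->
  exists2 s : R, 0 < s & forall i, th ^+ i * H s <= H (2 ^+ i * s).
Proof.
move=> th0 h; have e0 : 0 < 2 `^ (- alpha) - th by rewrite subr_gt0.
have /cvgrPdist_lt/(_ _ e0)[M [_ hM]] := HT (ltr0Sn R 1).
pose s := Num.max (M + 1) 1; exists s; first by rewrite lt_max ltr01 orbT.
have step x : s <= x -> th * H x <= H (2 * x).
  move=> sx; have /hM : M < x by apply: lt_le_trans sx; rewrite lt_max ltrDl ltr01.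
  move=> /(le_lt_trans (ler_norm _)); rewrite ltrD2l ltrN2 ltr_pdivlMr//.
  exact: ltW.
elim => [|i IH]; first by rewrite !expr0 !mul1r.
rewrite !exprS -!mulrA; apply: le_trans (step _ _); first by rewrite ler_wpM2l// ltW.
have s0 : 0 <= s by rewrite le_max ler01 orbT.
by rewrite ler_peMl// exprn_ege1// ler1n.
Qed.

Lemma dyadic (s x : R) : 0 < s -> s <= x -> exists j, x <= 2 ^+ j * s /\ 2 ^+ j * s <= 2 * x.
Proof.
move=> s0 sx; have ex : exists j, x <= 2 ^+ j * s.
  exists (Num.truncn (x / s)).+1; rewrite -ler_pdivrMr//.
  apply: le_trans (ltW (truncnS_gt _)) _.
  by rewrite -natrX ler_nat ltnW// ltn_expl.
have := ex_minnP ex; case=> j hj jmin; exists j; split => //.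
case: j hj jmin => [|j] hj jmin; first by rewrite expr0 mul1r; lra.
rewrite exprS -mulrA ler_pM2l// ltW// ltNge; apply/negP => /jmin.
by rewrite ltnn.
Qed.

(** A polynomial lower bound on the tail: it makes a sufficiently high power of eta negligible
    against lambda^k. *)
Lemma norm_tail_lower : exists N : nat, \forall eta \near 0^'+, eta ^+ N <= H eta^-1.
Proof.
have p0 : 0 < (2 : R) `^ (- alpha) by rewrite powR_gt0.
pose N := Num.truncn (2 `^ (- alpha))^-1.
have hN : (2 : R) ^- N < 2 `^ (- alpha).
  rewrite invf_plt ?posrE ?exprn_gt0//; apply: lt_le_trans (truncnS_gt _) _.
  by rewrite -natrX ler_nat ltn_expl.
have q0 : 0 < (2 : R) ^- N by rewrite invr_gt0 exprn_gt0.
have [s s0 hs] := norm_tail_double_ge q0 hN.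
(* The dyadic bound gives H(1 / eta) >= c eta^N; one more power of eta absorbs c. *)
have [c c0 cE] : exists2 c : R, 0 < c & c = (s / 2) ^+ N * H s.
  by exists ((s / 2) ^+ N * H s) => //; rewrite mulr_gt0// exprn_gt0// divr_gt0.
exists N.+1; near=> eta.
have eta0 : 0 < eta by [].
have es : s <= eta^-1.
  rewrite -[s]invrK lef_pV2 ?posrE ?invr_gt0// ltW//.
  by near: eta; apply: nbhs_right_lt; rewrite invr_gt0.
have [j [j1 j2]] := dyadic s0 es.
have hj : H (2 ^+ j * s) <= H eta^-1 by exact: norm_tail_le.
apply: le_trans hj; apply: le_trans (hs j).
apply: (@le_trans _ _ (eta ^+ N * ((s / 2) ^+ N * H s))).
  rewrite exprS mulrC ler_pM2l ?exprn_gt0// ltW//.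
  by rewrite -cE; near: eta; exact: nbhs_right_lt.
rewrite mulrA ler_pM2r// -exprMn exprVn -exprM mulnC exprM -exprVn.
rewrite lerXn2r ?nnegrE ?invr_ge0 ?exprn_ge0 ?mulr_ge0 ?(ltW eta0) ?(ltW s0)//.
rewrite -[leRHS]div1r ler_pdivlMr ?exprn_gt0//.
move: j2; rewrite ler_pdivlMr// => j2; have -> : eta * (s / 2) * 2 ^+ j = 2 ^+ j * s * eta / 2 by field.
by rewrite ler_pdivrMr// mul1r.
Unshelve. all: by end_near. Qed.

Let mnY : measurable_fun setT (fun w => nY w) := measurable_enormY Y.

Let measurable_nY_le (x : R) : measurable [set w | nY w <= x].
Proof.
rewrite (_ : [set _ | _] = ~` [set w | x < nY w]).
  by apply: measurableC; exact: measurable_norm_gt.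
by apply/seteqP; split => w /=; rewrite leNgt => /negP.
Qed.

Lemma measurable_trunc (x : R) : measurable_fun setT (fun w => nY w ^+ 2 * \1_[set w | nY w <= x] w).
Proof.
apply: measurable_funM; first exact: measurable_funX.
by apply: measurable_indic; exact: measurable_nY_le.
Qed.

Let int_gt x : (\int[P]_w (\1_[set w | x < nY w] w)%:E = (H x)%:E)%E.
Proof. by have m := measurable_norm_gt Y x; rewrite integral_indic// setIT; exact: norm_tailE. Qed.

(** The second moment may be infinite. Truncated at x = exp L it grows at most like x^(2 - q) with q
    in ]1, 2[, because the dyadic shells contribute terms of a geometric progression. *)
Lemma truncated_moment : exists q C : R, [/\ 1 < q, q < 2, 0 < C & forall L : R, 0 <= L ->
  (\int[P]_w (nY w ^+ 2 * \1_[set w | nY w <= expR L] w)%:E <= (C * expR ((2 - q) * L))%:E)%E].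
Proof.
pose q := (1 + Num.min alpha 2) / 2.
have m1 : 1 < Num.min alpha 2 by rewrite lt_min alpha1 ltr1n.
have m2 : Num.min alpha 2 <= 2 by rewrite ge_min lexx orbT.
have ma : Num.min alpha 2 <= alpha by rewrite ge_min lexx.
have [q1 q2 qa] : [/\ 1 < q, q < 2 & q < alpha] by rewrite /q; split; lra.
have ln20 : 0 < ln (2 : R) by rewrite ln_gt0// ltr1n.
pose th := expR (- q * ln 2).
have [|s s0 hs] := @norm_tail_double_le th.
  by rewrite /powR pnatr_eq0/= /th ltr_expR ltr_pM2r// ltrN2.
pose r := expR ((2 - q) * ln 2).
have r4 : r = 4 * th.
  rewrite /r /th mulrBl mulNr expRD; congr (_ * _).
  by rewrite expRM_natl lnK ?posrE//; ring.
have r1 : 1 < r by rewrite expR_gt1 mulr_gt0// subr_gt0.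
(* Chosen so that C1 r = C1 + s^2 (r - 1) + 4 s^2: the contribution 4 s^2 r^j of the next shell then
   fits into the induction. *)
pose C1 := s ^+ 2 * (1 + 4 / (r - 1)).
have s20 : 0 < s ^+ 2 by rewrite exprn_gt0.
have C10 : 0 < C1 by rewrite mulr_gt0// ltr_pwDl// divr_ge0// ltW// subr_gt0.
have Vj j : (\int[P]_w (nY w ^+ 2 * \1_[set w | nY w <= 2 ^+ j * s] w)%:E <= (C1 * r ^+ j)%:E)%E.
  elim: j => [|j IH].
    rewrite expr0 mulr1 mul1r; apply: (@le_trans _ _ (\int[P]_w (s ^+ 2)%:E)%E).
      apply: ge0_le_integral_set => w; first by rewrite lee_fin mulr_ge0// sqr_ge0.
      rewrite lee_fin indicE; have [h|h] := boolP (w \in _); last by rewrite mulr0 ltW.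
      by rewrite mulr1; apply: lerXn2r; rewrite ?nnegrE ?enorm_ge0 ?(ltW s0)//; move: h; rewrite inE.
    rewrite integral_cst// [X in (_ * X)%E]probability_setT mule1 lee_fin /C1 ler_peMr ?(ltW s20)// lerDl.
    by rewrite divr_ge0// subr_ge0 ltW.
  pose u w := nY w ^+ 2 * \1_[set w | nY w <= 2 ^+ j * s] w.
  pose v w := 4 ^+ j.+1 * s ^+ 2 * \1_[set w | 2 ^+ j * s < nY w] w.
  have mI : measurable_fun setT (\1_[set w | 2 ^+ j * s < nY w] : Omega -> R).
    by apply: measurable_indic; exact: measurable_norm_gt.
  apply: (@le_trans _ _ (\int[P]_w ((u w)%:E + (v w)%:E))%E).
    apply: ge0_le_integral_set => w; first by rewrite lee_fin mulr_ge0// sqr_ge0.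
    rewrite -EFinD lee_fin /u /v !indicE.
    have [h1|h1] := leP (nY w) (2 ^+ j * s).
      rewrite (mem_set (A := [set w | nY w <= 2 ^+ j * s]))// mulr1.
      rewrite (memNset (A := [set w | 2 ^+ j * s < nY w])) ?mulr0 ?addr0; last first.
        by move=> /= /lt_geF; rewrite h1.
      by case: (_ \in _); rewrite ?mulr1// mulr0 sqr_ge0.
    rewrite (memNset (A := [set w | nY w <= 2 ^+ j * s])) ?mulr0 ?add0r; last first.
      by move=> /= /le_gtF; rewrite h1.
    rewrite (mem_set (A := [set w | 2 ^+ j * s < nY w]))// mulr1.
    have [h|h] := boolP (w \in _); last by rewrite mulr0 mulr_ge0// ?(ltW s20)// exprn_ge0.
    rewrite mulr1 (_ : 4 ^+ j.+1 * s ^+ 2 = (2 ^+ j.+1 * s) ^+ 2); last first.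
      rewrite exprMn -exprM mulnC exprM; congr (_ ^+ _ * _); ring.
    apply: lerXn2r; rewrite ?nnegrE ?enorm_ge0 ?mulr_ge0 ?exprn_ge0 ?(ltW s0)//.
    by move: h; rewrite inE.
  rewrite ge0_integralD//=; last 4 first.
  - by move=> w _; rewrite lee_fin mulr_ge0// sqr_ge0.
  - by apply/measurable_EFinP; exact: measurable_trunc.
  - by move=> w _; rewrite lee_fin !mulr_ge0// ?exprn_ge0// ltW.
  - by apply/measurable_EFinP; apply: measurable_funM.
  have -> : (\int[P]_w (v w)%:E = (4 ^+ j.+1 * s ^+ 2 * H (2 ^+ j * s))%:E)%E.
    under eq_integral do rewrite /v EFinM.
    rewrite ge0_integralZl_EFin//; last 2 first.
    - exact/measurable_EFinP.
    - by rewrite !mulr_ge0// ?exprn_ge0// ltW.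
    by rewrite int_gt.
  apply: (@le_trans _ _ (C1 * r ^+ j + 4 ^+ j.+1 * s ^+ 2 * th ^+ j)%:E).
    by rewrite EFinD leeD// lee_fin ler_wpM2l// !mulr_ge0// ?exprn_ge0// ltW.
  have e : C1 * r = C1 + s ^+ 2 * (r - 1) + 4 * s ^+ 2.
    by rewrite /C1; field; rewrite subr_eq0 gt_eqF.
  rewrite lee_fin [r ^+ j.+1]exprS mulrA e.
  have -> : 4 ^+ j.+1 * s ^+ 2 * th ^+ j = 4 * s ^+ 2 * r ^+ j by rewrite r4 exprMn exprS; ring.
  have rj : 0 <= r ^+ j by rewrite exprn_ge0// ltW// (lt_trans ltr01).
  by rewrite !mulrDl lerD2r lerDl mulr_ge0// mulr_ge0 ?subr_ge0 ?(ltW r1)// ltW.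
(* Converts the dyadic level into the truncation level: 2^j is at most K exp L. *)
pose K := 2 * Num.max 1 s / s.
have K0 : 0 < K by rewrite divr_gt0// mulr_gt0// lt_max ltr01.
exists q, (C1 * expR ((2 - q) * ln K)); split => //; first by rewrite mulr_gt0// expR_gt0.
move=> L L0; pose x := Num.max (expR L) s.
have [j [j1 j2]] : exists j, x <= 2 ^+ j * s /\ 2 ^+ j * s <= 2 * x.
  by apply: dyadic => //; rewrite le_max lexx orbT.
apply: (@le_trans _ _ (\int[P]_w (nY w ^+ 2 * \1_[set w | nY w <= 2 ^+ j * s] w)%:E)%E).
  apply: ge0_le_integral_set => w; first by rewrite lee_fin mulr_ge0// sqr_ge0.
  rewrite lee_fin ler_wpM2l ?sqr_ge0// !indicE ler_nat; case: (boolP (w \in _)) => // h.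
  rewrite mem_set//=; move: h; rewrite inE/= => h; apply: le_trans h (le_trans _ j1).
  by rewrite le_max lexx.
apply: le_trans (Vj j) _; rewrite lee_fin -mulrA ler_pM2l// -expRD -mulrDr.
rewrite /r -expRM_natr ler_expR -mulrA ler_pM2l ?subr_gt0//.
rewrite -ler_expR expRM_natr lnK ?posrE// expRD lnK ?posrE//.
rewrite -(ler_pM2r s0); apply: le_trans j2 _.
rewrite /K mulrAC divfK ?gt_eqF// -mulrA ler_pM2l// /x ge_max; apply/andP; split.
  by rewrite ler_peMl ?expR_ge0// le_max lexx.
rewrite -[leLHS]mulr1; apply: ler_pM; rewrite ?(ltW s0)//; first by rewrite le_max lexx orbT.
by rewrite -expR0 ler_expR.
Qed.

End moments.

Lemma expR_le_quad {R : realType} (s : R) : expR s <= 1 + s + s ^+ 2 * expR `|s|.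
Proof.
have [s0|s0] := leP 0 s.
  rewrite ger0_norm//; have h := expR_ge1Dx (- s); have e0 := expR_gt0 s.
  have h1 : expR s - 1 <= s * expR s.
    have : expR (- s) * expR s = 1 by rewrite -expRD addNr expR0.
    nra.
  have : s * (expR s - 1) <= s * (s * expR s) by rewrite ler_wpM2l.
  nra.
rewrite ltr0_norm//; have h := expR_ge1Dx (- s); have e0 := expR_gt0 s.
have ee : expR (- s) * expR s = 1 by rewrite -expRD addNr expR0.
have h1 : expR s * (1 - s) <= 1 by nra.
have h2 : 1 <= expR (- s) by lra.
have h3 : expR s <= 1 + s + s ^+ 2 by nra.
by apply: le_trans h3 _; rewrite lerD2l ler_peMr// sqr_ge0.
Qed.

(** * Functionals of several marks and times *)

Section chernoff.
Context {R : realType} disp (Omega : measurableType disp) (P : probability Omega R) (d : nat).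
Variables (Y : {RV P >-> borel_space 'cV[R]_d.+1}) (alpha : R).
Variable S : probability (borel_space (sphere R d)) R.
Hypothesis alpha1 : 1 < alpha.
Hypothesis RV : mv_regularly_varying P Y alpha S.
Hypothesis Yc : centered P Y.
Local Notation nY w := (enorm (Y w : 'cV[R]_d.+1)).

Let Yl (l : 'I_d.+1) (w : Omega) : R := (Y w : 'cV[R]_d.+1) l 0.

Let mYl l : measurable_fun setT (Yl l).
Proof. by apply: (measurableT_comp (@measurable_coord _ _ l)); exact: measurable_funP. Qed.

(** In the extended reals oo - oo is -oo, so a mean equal to 0 leaves only finite positive and
    negative parts. *)
Lemma coord_integrable l : P.-integrable setT (EFin \o Yl l).
Proof.
have mE : measurable_fun setT (EFin \o Yl l) by exact/measurable_EFinP.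
apply/integrableP; split => //; have := Yc l; rewrite unlock.
have -> : (\int[P]_w ((Y w : 'cV[R]_d.+1) l 0)%:E = \int[P]_w (EFin \o Yl l) w)%E by [].
rewrite integralE.
have mp : measurable_fun setT (EFin \o Yl l)^\+%E by exact: measurable_funepos.
have mn : measurable_fun setT (EFin \o Yl l)^\-%E by exact: measurable_funeneg.
have -> : (\int[P]_w `|(EFin \o Yl l) w| =
    \int[P]_w (EFin \o Yl l)^\+ w + \int[P]_w (EFin \o Yl l)^\- w)%E.
  by rewrite -ge0_integralD//; apply: eq_integral => w _; rewrite -[LHS]/((abse \o (EFin \o Yl l)) w) fune_abse.
have : (0 <= \int[P]_w (EFin \o Yl l)^\+ w)%E by exact: integral_ge0.
have : (0 <= \int[P]_w (EFin \o Yl l)^\- w)%E by exact: integral_ge0.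
case: (integral P _ _) => [n| |] //; case: (integral P _ _) => [p| |] //.
by rewrite -EFinD ltry.
Qed.

Lemma norm_integrable : P.-integrable setT (fun w => (nY w)%:E).
Proof.
have mn : measurable_fun setT (fun w => (nY w)%:E) by apply/measurable_EFinP; exact: measurable_enormY.
apply: (@le_integrable _ _ _ _ _ _ _ (fun w => (d.+1%:R%:E * \sum_l `|(Yl l w)%:E|)%E)) => //.
  move=> w _; have -> : (\sum_l `|(Yl l w)%:E| = (\sum_l `|Yl l w|)%:E)%E by rewrite -sumEFin.
  rewrite -EFinM /= lee_fin ger0_norm ?enorm_ge0// ger0_norm; last first.
    by rewrite mulr_ge0// sumr_ge0.
  by apply: enorm_le_sum => i; rewrite (bigD1 i)//= lerDl; exact: sumr_ge0.
apply: integrableZl => //; apply: integrable_sum => // l _.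
exact: (integrable_abse (coord_integrable l)).
Qed.

Let linear_integral (u : 'cV[R]_d.+1) :
  P.-integrable setT (fun w => (\sum_l u l 0 * Yl l w)%:E) /\
  (\int[P]_w (\sum_l u l 0 * Yl l w)%:E = 0)%E.
Proof.
have e w : ((\sum_l u l 0 * Yl l w)%:E = \sum_l ((u l 0)%:E * (Yl l w)%:E))%E by rewrite -sumEFin.
have il l : P.-integrable setT (fun w => ((u l 0)%:E * (Yl l w)%:E)%E).
  by apply: integrableZl => //; exact: coord_integrable.
under [X in P.-integrable _ X]eq_fun do rewrite e.
under [X in _ /\ X = _]eq_integral do rewrite e.
split; first exact: integrable_sum.
rewrite integral_sum// big1// => l _; rewrite integralZl//; last exact: coord_integrable.
by have := Yc l; rewrite unlock => ->; rewrite mule0.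
Qed.

Let linear_le (u : 'cV[R]_d.+1) Cs w : enorm u <= Cs -> `|\sum_l u l 0 * Yl l w| <= Cs * nY w.
Proof.
move=> uC; apply: (@le_trans _ _ (enorm u * nY w)); last by rewrite ler_wpM2r ?enorm_ge0.
have h := cauchy_schwarz (- u) (Y w : 'cV[R]_d.+1).
rewrite ler_norml; apply/andP; split; last exact: (cauchy_schwarz u).
rewrite lerNl; apply: le_trans (le_trans h _); last by rewrite enormN.
by rewrite -sumrN le_eqVlt; apply/orP; left; apply/eqP/eq_bigr => l _; rewrite mxE mulNr.
Qed.

(** Dominated convergence. It bounds the mean of the truncated noise, which is minus that of the
    discarded part, and later shows that lambda tends to 0. *)
Lemma tail_moment (e : R) : 0 < e -> exists y0 : R, forall y, y0 <= y ->
  (\int[P]_w (nY w * \1_[set w | y < nY w] w)%:E <= e%:E)%E.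
Proof.
move=> e0; pose f (n : nat) w := (nY w * \1_[set w | n%:R < nY w] w)%:E.
have mf n : measurable_fun setT (f n).
  apply/measurable_EFinP; apply: measurable_funM; first exact: measurable_enormY.
  by apply: measurable_indic; exact: measurable_norm_gt.
have [] := @dominated_convergence _ _ _ P setT measurableT f (cst 0%E) (fun w => (nY w)%:E) mf.
- exact: measurable_cst.
- apply: aeW => w _; apply: cvg_near_cst; near=> n.
  rewrite /f indicE memNset ?mulr0//= => h.
  have : nY w < n%:R by near: n; exact: nbhs_infty_gtr.
  by move=> /(lt_trans h); rewrite ltxx.
- exact: norm_integrable.
- apply: aeW => w n _; rewrite /f /= lee_fin normrM ger0_norm ?enorm_ge0// ler_piMr ?enorm_ge0//.
  by rewrite indicE; case: (_ \in _); rewrite ?normr1 ?normr0.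
move=> _ _; rewrite integral0 => /fine_cvgP[[n1 _ hn1] /cvgrPdist_le/(_ _ e0)[n _ hn]].
pose n2 := maxn n1 n; exists n2%:R => y hy.
apply: (@le_trans _ _ (\int[P]_w f n2 w)%E).
  apply: ge0_le_integral_set => w; first by rewrite lee_fin mulr_ge0// enorm_ge0.
  rewrite lee_fin ler_wpM2l ?enorm_ge0// !indicE ler_nat; case: (boolP (w \in _)) => //.
  by rewrite inE/= => h; rewrite mem_set//=; exact: le_lt_trans hy h.
have := hn n2 (leq_maxr _ _); have := hn1 n2 (leq_maxl _ _) => /= fin.
by rewrite sub0r normrN -[X in (X <= _)%E](fineK fin) lee_fin; apply: le_trans; exact: ler_norm.
Unshelve. all: by end_near. Qed.

(** The parameter th = kap ln(1 / eta) grows, so that exceeding rho costs a power of eta. When the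
    exponential is expanded to second order, the linear term has mean 0 up to the discarded tail,
    and the quadratic one is controlled by the truncated second moment. *)
Lemma chernoff_step (Cs T rho : R) (N : nat) : 0 < Cs -> 0 < T -> 0 < rho ->
  exists2 del0 : R, 0 < del0 & forall del, 0 < del -> del <= del0 ->
    \forall eta \near 0^'+, exists th tau : R,
    [/\ 0 <= th, 0 <= tau, forall u : 'cV[R]_d.+1, enorm u <= Cs ->
        (\int[P]_w (expR (th * (\1_[set w | eta * nY w <= del] w * \sum_l (u l 0 * (eta * Yl l w)))))%:E
           <= (1 + eta * tau)%:E)%E &
      expR (T * tau - th * rho) <= eta ^+ N].
Proof.
move=> Cs0 T0 rho0.
have [q [C [q1 q2 C0 hC]]] := truncated_moment alpha1 RV.
(* With tau = th rho / (2 T), half of th rho survives in the exponent: the bound is eta to the power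
   kap rho / 2 = N + rho / 2. *)
pose kap := 2 * N%:R / rho + 1.
have kap0 : 0 < kap by rewrite ltr_wpDl// divr_ge0 ?mulr_ge0// ltW.
pose gam := q - 1; have gam0 : 0 < gam by rewrite subr_gt0.
pose ep := rho / (2 * T); have ep0 : 0 < ep by rewrite divr_gt0// mulr_gt0.
(* Below [del0] the exponent s satisfies |s| <= (gam / 2) L, so the factor exp |s| costs eta^(- gam
   / 2), half of the gain eta^gam left by the truncated second moment. *)
pose del0 := Num.min 1 (gam / (2 * kap * Cs)).
have d1 : del0 <= 1 by rewrite ge_min lexx.
have d2 : kap * Cs * del0 <= gam / 2.
  apply: (@le_trans _ _ (kap * Cs * (gam / (2 * kap * Cs)))).
    by rewrite ler_wpM2l ?mulr_ge0 ?(ltW kap0) ?(ltW Cs0)// ge_min lexx orbT.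
  by rewrite le_eqVlt; apply/orP; left; apply/eqP; field; rewrite !gt_eqF.
exists del0; first by rewrite lt_min ltr01 divr_gt0// !mulr_gt0.
move=> del del_gt0 deld.
have [y0 hy0] := @tail_moment (ep / (2 * Cs)) (divr_gt0 ep0 (mulr_gt0 (ltr0Sn R 1) Cs0)).
have [L1 L1gt hL1] : exists2 L1 : R, 0 < L1 & forall L, L1 <= L ->
    kap * L * (Cs ^+ 2 * C) * expR (- (gam / 2 * L)) <= ep / 2.
  pose K := Cs ^+ 2 * C; have K0 : 0 < K by rewrite mulr_gt0// exprn_gt0.
  pose g := gam / 2; have g0 : 0 < g by rewrite divr_gt0.
  have g20 : 0 < g ^+ 2 * ep by rewrite mulr_gt0// exprn_gt0.
  exists (4 * kap * K / (g ^+ 2 * ep)); first by rewrite divr_gt0// !mulr_gt0.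
  move=> L; rewrite ler_pdivrMr// => hL.
  have L0 : 0 < L.
    have : 0 < L * (g ^+ 2 * ep) by apply: lt_le_trans hL; rewrite !mulr_gt0.
    by rewrite pmulr_lgt0.
  rewrite expRN ler_pdivrMr ?expR_gt0// -/K -/g.
  have h := @expR_ge1Dxn R (g * L) 1 (ltW (mulr_gt0 g0 L0)).
  have h2 : (g * L) ^+ 2 / 2 <= expR (g * L) by apply: le_trans h; rewrite lerDr.
  apply: le_trans (ler_wpM2l (ltW (divr_gt0 ep0 (ltr0Sn R 1))) h2).
  have -> : ep / 2 * ((g * L) ^+ 2 / 2) = L * (g ^+ 2 * ep) * L / 4 by field.
  have -> : kap * L * K = 4 * kap * K * L / 4 by field.
  by rewrite ler_pM2r// ler_pM2r.
near=> eta.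
have eta0 : 0 < eta by [].
pose L := - ln eta.
have etaE : eta = expR (- L) by rewrite opprK lnK// posrE.
have LL1 : L1 <= L.
  rewrite lerNr -[leRHS](expRK); rewrite ler_ln ?posrE ?expR_gt0//.
  by near: eta; apply: nbhs_right_le; rewrite expR_gt0.
have L0 : 0 < L by exact: lt_le_trans LL1.
have dy0 : y0 <= del / eta.
  rewrite ler_pdivlMr// mulrC; apply: (@le_trans _ _ (eta * (`|y0| + 1))).
    by rewrite ler_wpM2l ?(ltW eta0)// (le_trans (ler_norm _))// lerDl.
  rewrite -ler_pdivlMr ?ltr_wpDl//.
  by near: eta; apply: nbhs_right_le; rewrite divr_gt0// ltr_wpDl.
pose th := kap * L; pose tau := kap * L * ep.
have th0 : 0 < th by rewrite mulr_gt0.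
exists th, tau; split.
- exact: ltW.
- by rewrite mulr_ge0// ltW.
- move=> u uC.
  have [iT T0'] := linear_integral u; pose lin w := \sum_l u l 0 * Yl l w.
  pose y := del / eta.
  (* [A] pays for adding the linear term where the mark is discarded, [B] for the quadratic
     remainder elsewhere. *)
  pose A w := th * eta * Cs * (nY w * \1_[set w | y < nY w] w).
  pose E2 := th ^+ 2 * Cs ^+ 2 * eta ^+ 2 * expR (gam / 2 * L).
  have E20 : 0 <= E2.
    by apply: mulr_ge0; [apply: mulr_ge0; [apply: mulr_ge0|]|]; rewrite ?sqr_ge0 ?expR_ge0.
  pose B w := E2 * (nY w ^+ 2 * \1_[set w | nY w <= expR L] w).
  have mA : measurable_fun setT A.
    apply: measurable_funM => //; apply: measurable_funM; first exact: measurable_enormY.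
    by apply: measurable_indic; exact: measurable_norm_gt.
  have mB : measurable_fun setT B.
    apply: measurable_funM => //; exact: measurable_trunc.
  have yE : y0 <= y by [].
  have IA : (\int[P]_w (A w)%:E <= (eta * th * (ep / 2))%:E)%E.
    under eq_integral do rewrite /A EFinM.
    rewrite ge0_integralZl_EFin//; last 3 first.
    - by move=> w _; rewrite lee_fin mulr_ge0// enorm_ge0.
    - apply/measurable_EFinP; apply: measurable_funM; first exact: measurable_enormY.
      by apply: measurable_indic; exact: measurable_norm_gt.
    - by rewrite !mulr_ge0// ltW.
    apply: (@le_trans _ _ ((th * eta * Cs)%:E * (ep / (2 * Cs))%:E)%E).
      by apply: lee_wpmul2l; [rewrite lee_fin !mulr_ge0// ltW|exact: hy0].
    rewrite -EFinM lee_fin le_eqVlt; apply/orP; left; apply/eqP; field; exact/lt0r_neq0.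
  have IB : (\int[P]_w (B w)%:E <= (eta * th * (ep / 2))%:E)%E.
    under eq_integral do rewrite /B EFinM.
    rewrite ge0_integralZl_EFin//; last 2 first.
    - by move=> w _; rewrite lee_fin mulr_ge0// sqr_ge0.
    - by apply/measurable_EFinP; exact: measurable_trunc.
    apply: (@le_trans _ _ (E2%:E * (C * expR ((2 - q) * L))%:E)%E).
      by apply: lee_wpmul2l; rewrite ?lee_fin//; apply: hC; exact: ltW.
    rewrite -EFinM lee_fin.
    have -> : E2 * (C * expR ((2 - q) * L)) =
        eta * th * (kap * L * (Cs ^+ 2 * C) * expR (- (gam / 2 * L))).
      rewrite /E2 -/th; have -> : eta ^+ 2 = eta * expR (- L) by rewrite expr2 -etaE.
      have -> : expR (- (gam / 2 * L)) = expR (- L) * expR (gam / 2 * L) * expR ((2 - q) * L).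
        by rewrite -!expRD; congr expR; rewrite /gam; field.
      ring.
    by rewrite ler_wpM2l ?hL1// mulr_ge0// ltW.
  have A0 w : 0 <= A w.
    by apply: mulr_ge0; [rewrite !mulr_ge0// ltW|rewrite mulr_ge0// enorm_ge0].
  have B0 w : 0 <= B w by rewrite mulr_ge0// mulr_ge0// sqr_ge0.
  pose G w := 1 + A w + B w + th * eta * lin w.
  apply: (@le_trans _ _ (\int[P]_w ((1 + A w + B w)%:E + (th * eta)%:E * (lin w)%:E))%E).
    apply: ge0_le_integral_set => w; first by rewrite lee_fin expR_ge0.
    rewrite -EFinM -EFinD lee_fin.
    have -> : \sum_l u l 0 * (eta * Yl l w) = eta * lin w.
      by rewrite /lin mulr_sumr; apply: eq_bigr => l _; rewrite mulrCA.
    have lw : `|lin w| <= Cs * nY w by exact: linear_le.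
    have tn : 0 <= th * eta by rewrite mulr_ge0// ltW.
    apply: le_trans (expR_le_quad _) _; rewrite indicE.
    have [h|h] := boolP (w \in _); last first.
      rewrite !mul0r mulr0 expr0n/= mul0r !addr0.
      have yw : y < nY w.
        by move: h; rewrite notin_setE/= => /negP; rewrite -ltNge /y ltr_pdivrMr// mulrC.
      rewrite /A indicE mem_set// mulr1.
      have : - (th * eta * Cs * nY w) <= th * eta * lin w.
        by rewrite -mulrA -mulrN ler_wpM2l// lerNl; apply: le_trans lw; rewrite -normrN ler_norm.
      have := B0 w; lra.
    rewrite mul1r; set s := th * (eta * lin w).
    have hw : eta * nY w <= del by move: h; rewrite inE.
    have sC : `|s| <= gam / 2 * L.
      rewrite /s mulrA normrM (ger0_norm tn); apply: (@le_trans _ _ (th * eta * (Cs * nY w))).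
        by rewrite ler_wpM2l.
      have -> : th * eta * (Cs * nY w) = L * (kap * Cs * (eta * nY w)) by rewrite /th; ring.
      rewrite [leRHS]mulrC ler_wpM2l ?(ltW L0)//; apply: le_trans d2.
      by rewrite ler_wpM2l ?mulr_ge0 ?(ltW kap0) ?(ltW Cs0)// (le_trans hw).
    have s2 : s ^+ 2 <= th ^+ 2 * Cs ^+ 2 * eta ^+ 2 * nY w ^+ 2.
      have -> : s ^+ 2 = (th * eta) ^+ 2 * `|lin w| ^+ 2 by rewrite real_normK ?num_real// /s; ring.
      have -> : th ^+ 2 * Cs ^+ 2 * eta ^+ 2 * nY w ^+ 2 = (th * eta) ^+ 2 * (Cs * nY w) ^+ 2 by ring.
      by rewrite ler_wpM2l ?sqr_ge0// lerXn2r ?nnegrE ?mulr_ge0 ?enorm_ge0 ?(ltW Cs0).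
    have nL : nY w <= expR L.
      rewrite -(ler_pM2l eta0) [X in _ <= X * _]etaE -expRD addNr expR0.
      exact: le_trans hw (le_trans deld d1).
    have -> : B w = th ^+ 2 * Cs ^+ 2 * eta ^+ 2 * nY w ^+ 2 * expR (gam / 2 * L).
      by rewrite /B indicE mem_set// mulr1 /E2; ring.
    have -> : th * eta * lin w = s by rewrite /s mulrA.
    have : s ^+ 2 * expR `|s| <= th ^+ 2 * Cs ^+ 2 * eta ^+ 2 * nY w ^+ 2 * expR (gam / 2 * L).
      by apply: ler_pM; rewrite ?sqr_ge0 ?expR_ge0// ler_expR.
    move=> h2; rewrite -addrA [s + _]addrC addrA lerD2r -[leRHS]addrA lerD2l.
    by apply: le_trans h2 _; rewrite lerDr.
  have I1 : (\int[P]_w (1 + A w + B w)%:E <= (1 + eta * tau)%:E)%E.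
    under eq_integral do rewrite 2!EFinD.
    rewrite ge0_integralD//=; last 4 first.
    - by move=> w _; rewrite -EFinD lee_fin addr_ge0.
    - by apply: emeasurable_funD; [exact: measurable_cst|exact/measurable_EFinP].
    - by move=> w _; rewrite lee_fin.
    - exact/measurable_EFinP.
    rewrite ge0_integralD//=; last 2 first.
    - by move=> w _; rewrite lee_fin.
    - exact/measurable_EFinP.
    rewrite integral_cst// [X in (_ * X)%E]probability_setT mule1.
    have -> : 1 + eta * tau = 1 + eta * th * (ep / 2) + eta * th * (ep / 2).
      by rewrite /tau -/th; field.
    by rewrite 2!EFinD; apply: leeD => //; apply: leeD.
  have iG : P.-integrable setT (fun w => (1 + A w + B w)%:E).
    apply/integrableP; split.
      by apply/measurable_EFinP; apply: measurable_funD => //; apply: measurable_funD.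
    apply: le_lt_trans (ltry (1 + eta * tau)); apply: le_trans I1.
    by apply: ge0_le_integral_set => w //=; rewrite ger0_norm// !addr_ge0.
  rewrite integralD//; last exact: integrableZl.
  by rewrite integralZl// T0' mule0 adde0.
- rewrite etaE -expRM_natr ler_expR /tau /th /ep.
  have -> : T * (kap * L * (rho / (2 * T))) - kap * L * rho = - (L * (kap * rho / 2)).
    by field; rewrite gt_eqF.
  rewrite [leRHS]mulNr lerN2 ler_wpM2l ?(ltW L0)// /kap.
  have -> : (2 * N%:R / rho + 1) * rho / 2 = N%:R + rho / 2 by field; rewrite gt_eqF.
  by rewrite lerDl divr_ge0// ltW.
Unshelve. all: by end_near. Qed.

End chernoff.

(** * Iterated functionals on Lipschitz functions of tuples *)

Section iterate.
Context {R : realType}.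

(** One operator for k-fold sums, Riemann sums, noise integrals and Lebesgue integrals. *)
Fixpoint iterate (E : Type) (I : (E -> R) -> R) k : (k.-tuple E -> R) -> R :=
  if k is j.+1 then fun F => I (fun u => iterate I (fun v : j.-tuple E => F (cons_tuple u v)))
  else fun F => F [tuple].

Lemma iterate_sum (E : finType) k (F : k.-tuple E -> R) :
  \sum_(J : k.-tuple E) F J = iterate (fun g => \sum_i g i) F.
Proof.
elim: k F => [|k IH] F /=.
  rewrite (bigD1 [tuple])//= big1 ?addr0// => t; rewrite (tuple0 t).
  by move=> /negP; case; apply/eqP/val_inj.
under [RHS]eq_bigr do rewrite -IH.
rewrite pair_big/= (reindex (fun p : E * k.-tuple E => cons_tuple p.1 p.2)) //=.
exists (fun t : k.+1.-tuple E => (thead t, [tuple of behead t])) => [[u v] _|t _] /=.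
  by congr (_, _); exact: val_inj.
by rewrite [RHS]tuple_eta; exact: val_inj.
Qed.

Lemma iterate0 (E : Type) (I : (E -> R) -> R) k : I (fun=> 0) = 0 ->
  iterate I (fun _ : k.-tuple E => 0) = 0.
Proof.
move=> I0; elim: k => [//|k IH] /=.
by rewrite -[RHS]I0; congr I; apply/funext => u; rewrite IH.
Qed.

Section lipschitz.
Context {E : normedModType R} (K : set E).

Definition admissible (L : R) (g : E -> R) := [/\ forall u, 0 <= g u <= L,
  forall u v, `|g u - g v| <= L * `|u - v| & forall u, ~ K u -> g u = 0].

Definition tuple_admissible (L : R) k (F : k.-tuple E -> R) := [/\ forall v, 0 <= F v <= L,
  forall v v' Delta, 0 <= Delta -> (forall j, `|tnth v j - tnth v' j| <= Delta) ->
    `|F v - F v'| <= L * Delta &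
  forall v j, ~ K (tnth v j) -> F v = 0].

(** What the limit theorem uses of an integral over a set of mass at most C: positivity, and
    differences bounded in sup norm for functions supported in K. *)
Definition bounded_functional (C : R) (I : (E -> R) -> R) := [/\ I (fun=> 0) = 0,
  forall L g, admissible L g -> 0 <= I g &
  forall L g h e, admissible L g -> admissible L h -> (forall u, `|g u - h u| <= e) ->
    `|I g - I h| <= C * e].

Lemma tuple_admissible_cons L k (F : k.+1.-tuple E -> R) u :
  tuple_admissible L F -> tuple_admissible L (fun v => F (cons_tuple u v)).
Proof.
move=> [F0 FL FK]; split => //.
- move=> v v' Delta D0 h; apply: FL => // j; case: (unliftP ord0 j) => [i|] ->.
    by rewrite !tnthS.
  by rewrite !tnth0 subrr normr0.
- by move=> v j Kj; apply: (FK _ (lift ord0 j)); rewrite tnthS.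
Qed.

Lemma tuple_admissible0 L k : 0 <= L -> tuple_admissible L (fun _ : k.-tuple E => 0).
Proof.
by move=> L0; split => // [v|v v' D D0 _]; rewrite ?lexx// subrr normr0 mulr_ge0.
Qed.

(** The two claims are proved together: applying I to the first entry requires the inner iterate to
    be admissible, which is what both say for k. *)
Lemma iterate_lipschitz C I k : 1 <= C -> bounded_functional C I ->
  (forall L (F F' : k.-tuple E -> R) e, tuple_admissible L F -> tuple_admissible L F' ->
    (forall v, `|F v - F' v| <= e) -> `|iterate I F - iterate I F'| <= C ^+ k * e) /\
  (forall L (F : k.-tuple E -> R), tuple_admissible L F -> 0 <= iterate I F <= C ^+ k * L).
Proof.
move=> C1 [I0 Ip IC]; have C0 : 0 <= C by exact: le_trans C1.
elim: k => [|k [IH1 IH2]].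
  split => [L F F' e _ _ h|L F [F0 _ _]] /=; rewrite expr0 mul1r; first exact: h.
  exact: F0.
have adm L (F : k.+1.-tuple E -> R) : tuple_admissible L F ->
    admissible (C ^+ k * L) (fun u => iterate I (fun v : k.-tuple E => F (cons_tuple u v))).
  move=> FA; split.
  - by move=> u; apply: IH2; exact: tuple_admissible_cons.
  - move=> u v; rewrite -mulrA; apply: (IH1 L); try exact: tuple_admissible_cons.
    move=> w; case: FA => _ FL _; apply: FL => // j.
    by case: (unliftP ord0 j) => [i|] ->; rewrite ?tnthS ?tnth0// subrr normr0.
  - move=> u Ku; rewrite (_ : (fun v => _) = fun=> 0) ?iterate0//.
    by apply/funext => v; case: FA => _ _ FK; apply: (FK _ ord0); rewrite tnth0.
have step L (F F' : k.+1.-tuple E -> R) e : tuple_admissible L F -> tuple_admissible L F' ->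
    (forall v, `|F v - F' v| <= e) -> `|iterate I F - iterate I F'| <= C ^+ k.+1 * e.
  move=> FA FA' h /=; rewrite exprS -mulrA; apply: (IC (C ^+ k * L)); try exact: adm.
  by move=> u; apply: (IH1 L); try exact: tuple_admissible_cons.
split => // L F FA; have [F0 _ _] := FA.
have L0 : 0 <= L by have /andP[h1 h2] := F0 [tuple of nseq k.+1 0]; exact: le_trans h2.
have p : 0 <= iterate I F by rewrite /=; apply: Ip; exact: (adm L).
have := step L F (fun=> 0) L FA (tuple_admissible0 _ L0).
rewrite iterate0// subr0 ger0_norm// p => -> // v.
by rewrite subr0 ger0_norm; have /andP[] := F0 v.
Qed.

Lemma iterate_admissible C I k L (F : k.+1.-tuple E -> R) : 1 <= C -> bounded_functional C I ->
  tuple_admissible L F ->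
  admissible (C ^+ k * L) (fun u => iterate I (fun v : k.-tuple E => F (cons_tuple u v))).
Proof.
move=> C1 IB FA; have [IH1 IH2] := @iterate_lipschitz C I k C1 IB; split.
- by move=> u; apply: IH2; exact: tuple_admissible_cons.
- move=> u v; rewrite -mulrA; apply: (IH1 L); try exact: tuple_admissible_cons.
  move=> w; case: FA => _ FL _; apply: FL => // j.
  by case: (unliftP ord0 j) => [i|] ->; rewrite ?tnthS ?tnth0// subrr normr0.
- move=> u Ku; rewrite (_ : (fun v => _) = fun=> 0) ?iterate0//; first by case: IB.
  by apply/funext => v; case: FA => _ _ FK; apply: (FK _ ord0); rewrite tnth0.
Qed.

Hypothesis cK : compact K.
Context {T : Type} (Fl : set_system T) {FF : ProperFilter Fl}.

(** Equicontinuity and a common compact support turn pointwise into uniform convergence. *)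
Lemma uniform_of_pointwise L (G_ : T -> E -> R) (G : E -> R) :
  (\forall t \near Fl, admissible L (G_ t)) -> admissible L G ->
  (forall u, G_ t u @[t --> Fl] --> G u) ->
  forall e : R, 0 < e -> \forall t \near Fl, forall u, `|G_ t u - G u| <= e.
Proof.
move=> GA [G0 GL GK] h e e0.
have L0 : 0 <= L by have /andP[h1 h2] := G0 0; exact: le_trans h2.
have K0 : 0 < L + L + 1 by lra.
have /compact_near_coveringP/(_ T Fl (fun t u => `|G_ t u - G u| <= e) _) cov := cK.
have : \forall t \near Fl, K `<=` (fun u => `|G_ t u - G u| <= e).
  apply: cov => u Ku; have e2 : 0 < e / 2 by rewrite divr_gt0.
  have /cvgrPdist_le/(_ _ e2) hu := h u.
  have r0 : 0 < e / 2 / (L + L + 1) by rewrite divr_gt0.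
  exists (ball u (e / 2 / (L + L + 1)),
    [set t | `|G u - G_ t u| <= e / 2 /\ admissible L (G_ t)]) => /=.
    split; last by apply: filterI.
    exact: nbhsx_ballx.
  move=> [v t] /=; rewrite -ball_normE /= => -[uv [ht [_ GtL _]]].
  have -> : G_ t v - G v = (G_ t v - G_ t u) - (G v - G u) - (G u - G_ t u) by ring.
  apply: le_trans (ler_normB _ _) _; apply: le_trans (lerD (ler_normB _ _) ht) _.
  have d1 := GtL v u; have d2 := GL v u; rewrite distrC in uv.
  have d3 : (L + L + 1) * `|v - u| <= e / 2 by rewrite mulrC -ler_pdivlMr// ltW.
  have := normr_ge0 (v - u); lra.
apply: filterS2 GA => t [Gt0 _ GtK] ht u.
have [Ku|Ku] := pselect (K u); first exact: ht.
by rewrite GK// GtK// subrr normr0 ltW.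
Qed.

(** The inner iterates converge pointwise by induction, hence uniformly. The outer functionals are
    bounded uniformly, so this error is harmless, and they converge on the fixed limit function. *)
Lemma iterate_cvg C (I_ : T -> (E -> R) -> R) (I : (E -> R) -> R) : 1 <= C ->
  (\forall t \near Fl, bounded_functional C (I_ t)) -> bounded_functional C I ->
  (forall L g, admissible L g -> I_ t g @[t --> Fl] --> I g) ->
  forall k L (F_ : T -> k.-tuple E -> R) (F : k.-tuple E -> R),
    (\forall t \near Fl, tuple_admissible L (F_ t)) -> tuple_admissible L F ->
    (forall v, F_ t v @[t --> Fl] --> F v) ->
    iterate (I_ t) (F_ t) @[t --> Fl] --> iterate I F.
Proof.
move=> C1 IB_ IB Icvg; elim=> [|k IH] L F_ F FA_ FA Fcvg /=; first exact: Fcvg.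
set G_ := fun t u => iterate (I_ t) (fun v : k.-tuple E => F_ t (cons_tuple u v)).
set G := fun u => iterate I (fun v : k.-tuple E => F (cons_tuple u v)).
have GA : admissible (C ^+ k * L) G by exact: iterate_admissible.
have GA_ : \forall t \near Fl, admissible (C ^+ k * L) (G_ t).
  by apply: filterS2 IB_ FA_ => t IBt FAt; exact: iterate_admissible.
have Gcvg u : G_ t u @[t --> Fl] --> G u.
  apply: (IH L) => [||v]; last exact: Fcvg.
  - by apply: filterS FA_ => t; exact: tuple_admissible_cons.
  - exact: tuple_admissible_cons.
have C0 : 0 < C by exact: lt_le_trans C1.
apply/cvgrPdist_le => e e0; have e2 : 0 < e / 2 by rewrite divr_gt0.
have eC : 0 < e / 2 / C by rewrite divr_gt0.
have hu := uniform_of_pointwise GA_ GA Gcvg eC.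
have /cvgrPdist_le/(_ _ e2) hI := Icvg _ _ GA.
apply: filterS3 hI (filterI IB_ GA_) hu => t h1 [[_ _ h2] GAt] h3.
rewrite -(subrKA (I_ t G)); apply: le_trans (ler_normD _ _) _; rewrite (splitr e); apply: lerD => //.
rewrite distrC; apply: le_trans (h2 _ _ _ _ GAt GA h3) _.
by rewrite mulrC divfK// gt_eqF.
Qed.

End lipschitz.

(** [A] is a class of functions stable under fixing the first entry; it supplies the measurability
    and finiteness that Tonelli's theorem and [fine] require. *)
Lemma integral_iterate d (X : measurableType d) (mu : {sigma_finite_measure set X -> \bar R})
    (A : forall k, (k.-tuple X -> R) -> Prop) :
  (forall k F, A k F -> measurable_fun [set: k.-tuple X] F /\ forall t, 0 <= F t) ->
  (forall k (F : k.+1.-tuple X -> R) x, A k.+1 F -> A k (fun v => F (cons_tuple x v))) ->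
  let I (g : X -> R) := fine (\int[mu]_x (g x)%:E)%E in
  (forall k (F : k.+1.-tuple X -> R), A k.+1 F ->
     (\int[mu]_x (iterate I (fun v => F (cons_tuple x v)))%:E < +oo)%E) ->
  forall k F, A k F -> (\int[product_power mu (k:=k)]_t (F t)%:E = (iterate I F)%:E)%E.
Proof.
move=> Am Ac I Af; elim=> [|k IH] F AF; have [mF F0] := Am _ _ AF.
  by rewrite integral_product_power0//; exact/measurable_EFinP.
rewrite integral_product_powerS//; last exact/measurable_EFinP.
rewrite (eq_integral (fun x => (iterate I (fun v => F (cons_tuple x v)))%:E)); last first.
  by move=> x _; apply: IH; exact: Ac.
rewrite /= {2}/I fineK// ge0_fin_numE ?Af//.
apply: integral_ge0 => x _; rewrite -IH; last exact: Ac.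
by apply: integral_ge0 => v _; rewrite lee_fin.
Qed.

Lemma iterate_scale (E : normedModType R) (K : set E) (C c : R) (I : (E -> R) -> R) k L
    (F : k.-tuple E -> R) : 1 <= C -> bounded_functional K C I ->
  (forall L g e, admissible K L g -> 0 <= e -> I (fun u => e * g u) = e * I g) -> 0 <= c ->
  tuple_admissible K L F -> iterate (fun g => c * I g) F = c ^+ k * iterate I F.
Proof.
move=> C1 IB Ih c0; elim: k F => [|k IH] F FA; first by rewrite expr0 mul1r.
have GA := iterate_admissible C1 IB FA.
rewrite /= exprS -mulrA -(Ih _ _ _ GA) ?exprn_ge0//.
by congr (_ * I _); apply/funext => u; apply: IH; exact: tuple_admissible_cons.
Qed.

Lemma iterate_riemann (eta : R) n k (F : k.-tuple R -> R) :
  iterate (fun g : R -> R => eta * \sum_(i < n) g (eta * i.+1%:R)) F =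
  eta ^+ k * \sum_(J : k.-tuple 'I_n) F [tuple eta * (tnth J j).+1%:R | j < k].
Proof.
rewrite iterate_sum; elim: k F => [|k IH] F /=.
  by rewrite expr0 mul1r; congr F; apply: eq_from_tnth => -[].
rewrite exprS -mulrA; congr (_ * _); rewrite mulr_sumr; apply: eq_bigr => i _.
rewrite IH; congr (_ * iterate _ _); apply/funext => J; congr F; apply: eq_from_tnth => j.
rewrite tnth_mktuple; case: (unliftP ord0 j) => [l|] ->; rewrite ?tnthS ?tnth0//.
by rewrite tnth_mktuple.
Qed.

Lemma riemann_sum_cvg (T L : R) (g : R -> R) : 0 < T ->
  admissible `[0, T]%classic L g ->
  (eta * \sum_(i < Num.truncn (T / eta)) g (eta * i.+1%:R)) @[eta --> 0^'+] -->
  fine (\int[lebesgue_measure]_t (g t)%:E)%E.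
Proof.
move=> T0 [g0 gL gK].
have L0 : 0 <= L by have /andP[h1 h2] := g0 0; exact: le_trans h2.
have cg : continuous g.
  move=> x; apply/cvgrPdist_le => e e0; have K0 : 0 < L + 1 by rewrite ltr_wpDl.
  near=> y; apply: le_trans (gL _ _) _.
  have : `|x - y| <= e / (L + 1) by near: y; apply: cvgr_dist_le => //; rewrite divr_gt0.
  by rewrite ler_pdivlMr// => h; apply: le_trans h; rewrite mulrC ler_wpM2l// lerDl.
pose mu := @lebesgue_measure R.
have ig (b : R) : mu.-integrable `[0, b] (EFin \o g).
  apply: continuous_compact_integrable; first exact: segment_compact.
  exact: continuous_subspaceT.
pose A (b : R) := \int[mu]_(t in `[0, b]) g t.
(* Error of the rectangle rule with right end point on one interval. *)
have step x y : 0 <= x -> x <= y -> `|A y - A x - (y - x) * g y| <= L * (y - x) ^+ 2.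
  move=> x0 xy.
  have i1 : mu.-integrable `]x, y] (EFin \o g).
    apply: integrableS (ig y) => //; apply: subset_itvr; by rewrite bnd_simp.
  have -> : A y - A x = \int[mu]_(t in `]x, y]) g t.
    by rewrite /A (@Rintegral_itvB _ g (BLeft 0) (BRight y) x)// ?bnd_simp.
  have len : fine (mu `]x, y]%classic) = y - x.
    rewrite /mu lebesgue_measure_itv/= lte_fin; case: ltP => [//|yx].
    by rewrite (_ : y = x) ?subrr//; apply/eqP; rewrite eq_le yx xy.
  have ic (c : R -> R) : continuous c -> mu.-integrable `]x, y] (EFin \o c).
    move=> cc.
    apply: integrableS (_ : mu.-integrable `[x, y] _) => //.
      by apply: subset_itvr; rewrite bnd_simp.
    apply: continuous_compact_integrable; first exact: segment_compact.
    exact: continuous_subspaceT.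
  have icst (c : R) : mu.-integrable `]x, y] (EFin \o cst c) by apply: ic => t; exact: cvg_cst.
  have -> : (y - x) * g y = \int[mu]_(t in `]x, y]) (cst (g y) t).
    by rewrite Rintegral_cst// len mulrC.
  rewrite -RintegralB//.
  have iB : mu.-integrable `]x, y] (EFin \o (fun t => g t - cst (g y) t)).
    by apply: ic => t; apply: cvgB; [exact: cg|exact: cvg_cst].
  apply: le_trans (le_normr_Rintegral _ iB) _ => //.
  apply: (@le_trans _ _ (\int[mu]_(t in `]x, y]) (cst (L * (y - x)) t))).
    apply: le_Rintegral => //; first exact: (integrable_norm iB).
    move=> t /=; rewrite in_itv/= => /andP[xt ty]; apply: le_trans (gL _ _) _.
    by rewrite ler_wpM2l// distrC ger0_norm ?subr_ge0// lerD2l lerN2 ltW.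
  by rewrite Rintegral_cst// len expr2 mulrA.
have A0 : A 0 = 0.
  by rewrite /A set_itv1 Rintegral_set1.
have sum eta n : 0 < eta -> `|A (eta * n%:R) - eta * \sum_(i < n) g (eta * i.+1%:R)| <= n%:R * (L * eta ^+ 2).
  move=> eta0; elim: n => [|n IH]; first by rewrite mulr0 A0 big_ord0 mulr0 subr0 normr0 mul0r.
  rewrite big_ord_recr/= mulrDr.
  have -> : A (eta * n.+1%:R) - (eta * \sum_(i < n) g (eta * i.+1%:R) + eta * g (eta * n.+1%:R)) =
    (A (eta * n%:R) - eta * \sum_(i < n) g (eta * i.+1%:R)) +
    (A (eta * n.+1%:R) - A (eta * n%:R) - (eta * n.+1%:R - eta * n%:R) * g (eta * n.+1%:R)).
    rewrite -natr1 mulrDr mulr1; ring.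
  apply: le_trans (ler_normD _ _) _; rewrite (_ : n.+1%:R * (L * eta ^+ 2) = n%:R * (L * eta ^+ 2) + L * eta ^+ 2); last first.
    by rewrite -natr1 mulrDl mul1r.
  apply: lerD => //.
  apply: le_trans (step _ _ _ _) _; first by rewrite mulr_ge0// ltW.
    by rewrite ler_wpM2l ?(ltW eta0)// ler_nat.
  by rewrite -mulrBr -natr1 addrAC subrr add0r mulr1.
have AT : fine (\int[mu]_t (g t)%:E)%E = A T.
  rewrite /A /Rintegral [in RHS]integral_mkcond; congr fine; apply: eq_integral => t _.
  by rewrite patchE; case: ifPn => // /negP tT; rewrite gK// => h; apply: tT; rewrite inE.
rewrite AT; apply/cvgrPdist_le => e e0.
have K0 : 0 < (T + 2) * L + 1 by rewrite ltr_wpDl// mulr_ge0//; lra.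
near=> eta; have eta0 : 0 < eta by [].
set n := Num.truncn _; have Te : 0 <= T / eta by rewrite divr_ge0// ltW.
have /andP[n1 n2] := truncn_itv Te.
have {}n1 : eta * n%:R <= T by move: n1; rewrite -/n ler_pdivlMr// mulrC.
have {}n2 : T < eta * n%:R + eta by move: n2; rewrite -/n ltr_pdivrMr// -natr1 mulrDl mul1r mulrC.
have h1 := sum eta n eta0.
have h2 : `|A T - A (eta * n%:R) - (T - eta * n%:R) * g T| <= L * (T - eta * n%:R) ^+ 2.
  by apply: step => //; rewrite mulr_ge0// ltW.
(* The grid ends less than one step before T; the remaining interval contributes O(eta). *)
have -> : A T - eta * \sum_(i < n) g (eta * i.+1%:R) =
    (A (eta * n%:R) - eta * \sum_(i < n) g (eta * i.+1%:R)) +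
    (A T - A (eta * n%:R) - (T - eta * n%:R) * g T) + (T - eta * n%:R) * g T by ring.
have /andP[gT0 gTL] := g0 T.
have h3 : `|(T - eta * n%:R) * g T| <= eta * L.
  rewrite ger0_norm; last by rewrite mulr_ge0// subr_ge0.
  by apply: ler_pM => //; [rewrite subr_ge0|lra].
have h4 : L * (T - eta * n%:R) ^+ 2 <= L * eta.
  rewrite ler_wpM2l//; apply: (@le_trans _ _ (eta ^+ 2)).
    by rewrite lerXn2r ?nnegrE ?subr_ge0 ?(ltW eta0)//; lra.
  rewrite expr2 ger_pMr//; near: eta; exact: nbhs_right_le.
have h5 : n%:R * (L * eta ^+ 2) <= T * (L * eta).
  have -> : n%:R * (L * eta ^+ 2) = (eta * n%:R) * (L * eta) by ring.
  by rewrite ler_wpM2r// mulr_ge0// ltW.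
have h6 : (T + 2) * L * eta <= e.
  apply: (@le_trans _ _ (((T + 2) * L + 1) * eta)); first by rewrite ler_wpM2r ?(ltW eta0)// lerDl.
  rewrite -ler_pdivlMl//; near: eta; by apply: nbhs_right_le; rewrite mulr_gt0// invr_gt0.
apply: le_trans (ler_normD _ _) _; apply: le_trans (lerD (ler_normD _ _) h3) _.
have := lerD (le_trans h1 h5) (le_trans h2 h4); move: h6; rewrite mulrDl; lra.
Unshelve. all: by end_near. Qed.

End iterate.

(** * Noise, jump and time integrals as bounded functionals *)

Section noise_functional.
Context {R : realType} (d : nat).
Local Notation V := 'cV[R]_d.+1.

Definition shell (r M : R) : set V := [set w | r <= enorm w <= M].

(** A closed subset of the transpose of a compact box of row vectors. *)
Lemma compact_shell r M : compact (shell r M).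
Proof.
pose B : set 'rV[R]_d.+1 := [set v | forall i, `[- M, M]%classic (v ord0 i)].
have cB : compact B by apply: (@rV_compact R d.+1 (fun=> `[- M, M]%classic)) => i; exact: segment_compact.
have cBT : compact ((fun v : 'rV[R]_d.+1 => v^T) @` B).
  apply: continuous_compact cB; apply: continuous_subspaceT => v.
  apply/(@cvgrPdist_lt _ _ _ (nbhs v) (nbhs_filter v)) => e e0; near=> u.
  have : `|v - u| < e by near: u; apply: cvgr_dist_lt.
  apply: le_lt_trans; rewrite -linearB /= [leLHS]/normr/= mx_normrE; apply: bigmax_le => // -[i j] _ /=.
  rewrite mxE; move: (v - u) => x.
  by rewrite [leRHS]/normr/= mx_normrE; apply: (le_bigmax _ _ (j, i)).
have ce (a : R) : continuous (fun w : V => enorm w).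
  by apply: enorm_continuous => w e e0; exists e => // v; apply: le_trans; exact: enorm_dist.
apply: (subclosed_compact _ cBT).
  rewrite (_ : shell r M = (fun w => enorm w) @^-1` `[r, M]%classic); last first.
    by apply/seteqP; split => w /=; rewrite /shell /= in_itv.
  apply: closed_comp; last exact: itv_closed.
  by move=> w _; exact: ce.
move=> w /andP[_ wM]; exists w^T; last by rewrite trmxK.
move=> i /=; rewrite in_itv/= mxE -ler_norml; apply: le_trans wM; exact: entry_le_enorm.
Unshelve. all: by end_near. Qed.

Lemma norm_le_coord (w : V) (c : R) : 0 <= c -> (forall i, `|w i 0| <= c) -> `|w| <= c.
Proof.
move=> c0 h; rewrite [leLHS]/normr/= mx_normrE; apply: bigmax_le => // -[i j] _ /=.
by rewrite (ord1 j).
Qed.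

Lemma admissible_continuous (K : set V) L g : admissible K L g -> continuous g.
Proof.
move=> [g0 gL _]; have L0 : 0 <= L by have /andP[h1 h2] := g0 0; exact: le_trans h2.
apply: enorm_continuous => w e e0; have K0 : 0 < L + 1 by rewrite ltr_wpDl.
exists (e / (L + 1)); first by rewrite divr_gt0.
move=> v; rewrite ler_pdivlMr// => h; apply: le_trans (gL _ _) _; apply: le_trans h.
rewrite mulrC; apply: ler_pM => //; [exact: norm_le_enorm|by rewrite lerDl].
Qed.

Lemma admissible_measurable (K : set V) L g : admissible K L g ->
  measurable_fun setT (g : borel_space V -> R).
Proof. by move=> /admissible_continuous; exact: (@continuous_borel _ V). Qed.

Lemma tuple_admissible_measurable (K : set V) L k (F : k.-tuple V -> R) : tuple_admissible K L F ->
  measurable_fun setT (F : k.-tuple (borel_space V) -> R).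
Proof.
move=> [F0 FL _]; have L0 : 0 <= L by have /andP[h1 h2] := F0 [tuple of nseq k 0]; exact: le_trans h2.
pose c (p : 'I_k * 'I_d.+1) (t : k.-tuple (borel_space V)) : R := (tnth t p.1 : V) p.2 0.
apply: (@measurable_real_cells _ _ _ _ c) => //.
  by move=> p; apply: (measurableT_comp (@measurable_coord _ _ p.2)); exact: measurable_tnth.
move=> t _ e e0; have K0 : 0 < L + 1 by rewrite ltr_wpDl.
exists (e / (L + 1)); first by rewrite divr_gt0.
move=> t' _ h; have q0 : 0 < e / (L + 1) by rewrite divr_gt0.
apply: le_lt_trans (FL t t' _ (ltW q0) _) _.
  move=> j; apply: norm_le_coord; first exact: ltW.
  by move=> i; have := h (j, i); rewrite /c /= !mxE => /ltW.
by rewrite mulrA ltr_pdivrMr// mulrC ltr_pM2l// ltrDl.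
Qed.

End noise_functional.

Section integral_functional.
Context {R : realType} {E : normedModType R} (K : set E).
Context d' (X : measurableType d') (mu : {measure set X -> \bar R}) (s : X -> E).
Variables (c C : R) (B : set X).
Hypothesis c0 : 0 <= c.
Hypothesis mB : measurable B.
Hypothesis KB : forall x, K (s x) -> B x.
Hypothesis Boo : (mu B < +oo)%E.
Hypothesis BC : c * fine (mu B) <= C.
Hypothesis ms : forall L g, admissible K L g -> measurable_fun setT (fun x => g (s x)).

Lemma admissible_integral_lt L g : admissible K L g -> (\int[mu]_x (g (s x))%:E < +oo)%E.
Proof.
move=> ga; have [g01 _ gK] := ga.
have L0 : 0 <= L by have /andP[h1 h2] := g01 0; exact: le_trans h2.
apply: (@le_lt_trans _ _ (\int[mu]_x (L * \1_B x)%:E)%E).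
  apply: ge0_le_integral_set => x; first by rewrite lee_fin; have /andP[] := g01 (s x).
  rewrite lee_fin indicE; have [xB|xB] := boolP (x \in B).
    by rewrite mulr1; have /andP[] := g01 (s x).
  by rewrite mulr0 gK// => /KB; move: xB; rewrite notin_setE.
under eq_integral do rewrite EFinM.
rewrite ge0_integralZl_EFin//; last by apply/measurable_EFinP; exact: measurable_indic.
rewrite integral_indic// setIT; apply: lte_mul_pinfty => //; exact: measure_ge0.
Qed.

(** The factor c is the normalisation, such as 1 / H; the integral sees only points of B, whose mass
    times c is at most C. *)
Lemma integral_functional_bounded :
  bounded_functional K C (fun g => c * fine (\int[mu]_x (g (s x))%:E)%E).
Proof.
have fin L g : admissible K L g -> (\int[mu]_x (g (s x))%:E \is a fin_num)%E.
  move=> ga; rewrite ge0_fin_numE; first exact: admissible_integral_lt ga.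
  by apply: integral_ge0 => x _; rewrite lee_fin; have [g0 _ _] := ga; have /andP[] := g0 (s x).
split.
- by under eq_integral do rewrite ?lexx; rewrite integral0_eq ?mulr0.
- move=> L g [g0 _ _]; apply: mulr_ge0 => //; apply: fine_ge0; apply: integral_ge0 => x _.
  by rewrite lee_fin; have /andP[] := g0 (s x).
have step L g h (e : R) : admissible K L g -> admissible K L h -> (forall u, `|g u - h u| <= e) ->
    c * fine (\int[mu]_x (g (s x))%:E)%E <= c * fine (\int[mu]_x (h (s x))%:E)%E + C * e.
  move=> ga ha gh; have e0 : 0 <= e by apply: le_trans (gh 0).
  have [g0 _ gK] := ga; have [h0 _ hK] := ha.
  have gp x : 0 <= g (s x) by have /andP[] := g0 (s x).
  have hp x : 0 <= h (s x) by have /andP[] := h0 (s x).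
  have fB : (mu B \is a fin_num)%E by rewrite ge0_fin_numE.
  have : (\int[mu]_x (g (s x))%:E <= \int[mu]_x (h (s x))%:E + e%:E * mu B)%E.
    have -> : (e%:E * mu B = \int[mu]_x (e * \1_B x)%:E)%E.
      under eq_integral do rewrite EFinM.
      rewrite ge0_integralZl_EFin//; last by apply/measurable_EFinP; exact: measurable_indic.
      by rewrite integral_indic// setIT.
    rewrite -ge0_integralD//; first last.
    - by apply/measurable_EFinP; apply: measurable_funM => //; exact: measurable_indic.
    - by move=> x _; rewrite lee_fin mulr_ge0.
    - by apply/measurable_EFinP; exact: ms ha.
    - by move=> x _; rewrite lee_fin.
    apply: ge0_le_integral_set => x; rewrite -?EFinD lee_fin//.
    rewrite indicE; have [xB|xB] := boolP (x \in B).
      by rewrite mulr1 -lerBlDl; apply: le_trans (gh (s x)); exact: ler_norm.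
    by rewrite mulr0 addr0 gK// => /KB; move: xB; rewrite notin_setE.
  rewrite -(fineK (fin _ _ ga)) -(fineK (fin _ _ ha)) -(fineK fB) -EFinM -EFinD lee_fin => le1.
  apply: le_trans (ler_wpM2l c0 le1) _; rewrite mulrDr lerD2l.
  by rewrite mulrCA [leLHS]mulrC ler_wpM2r.
move=> L g h e ga ha gh; rewrite ler_norml; apply/andP; split; last first.
  by rewrite lerBlDl; apply: step ga ha gh.
rewrite lerNl opprB lerBlDl; apply: step ha ga _ => u; rewrite distrC; exact: gh.
Qed.

Lemma integral_functionalZ L g e : admissible K L g -> 0 <= e ->
  fine (\int[mu]_x (e * g (s x))%:E)%E = e * fine (\int[mu]_x (g (s x))%:E)%E.
Proof.
move=> ga e0; have [g0 _ _] := ga.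
under eq_integral do rewrite EFinM.
rewrite ge0_integralZl_EFin//.
- by rewrite fineM//= ge0_fin_numE ?(admissible_integral_lt ga)//; apply: integral_ge0 => x _;
    rewrite lee_fin; have /andP[] := g0 (s x).
- by move=> x _; rewrite lee_fin; have /andP[] := g0 (s x).
- by apply/measurable_EFinP; exact: ms ga.
Qed.

End integral_functional.

Lemma iterate_comp {R : realType} (E E' : Type) (I : (E' -> R) -> R) (s : E' -> E) k (F : k.-tuple E -> R) :
  iterate I (fun v => F [tuple of map s v]) = iterate (fun g => I (fun x => g (s x))) F.
Proof.
elim: k F => [|k IH] F /=; first by congr F; exact: val_inj.
congr I; apply/funext => u; rewrite -(IH (fun v => F (cons_tuple (s u) v))).
by congr iterate; apply/funext => v; congr F; exact: val_inj.
Qed.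

Section jump_functional.
Context {R : realType} (d : nat) (alpha : R) (S : probability (borel_space (sphere R d)) R).
Hypothesis alpha0 : 0 < alpha.
Local Notation V := 'cV[R]_d.+1.
Local Notation J := (jump_law S alpha0).
Implicit Types (r M : R).

Definition jump_fun (g : V -> R) : R := fine (\int[J]_w (g w)%:E)%E.

Lemma measurable_norm_ge r : measurable [set w : borel_space V | r <= enorm (w : V)].
Proof.
rewrite -[X in measurable X]setTI; have := @measurable_enorm R d.
by move=> /(_ measurableT `[r, +oo[%classic (measurable_itv _)); rewrite set_itvE.
Qed.

Lemma jump_fun_bounded r M : 0 < r ->
  exists2 C : R, 1 <= C & bounded_functional (shell r M) C jump_fun.
Proof.
move=> r0; pose B := [set w : borel_space V | r <= enorm (w : V)].
exists (1 + fine (J B)); first by rewrite lerDl fine_ge0//; exact: measure_ge0.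
have := @integral_functional_bounded R V (shell r M) _ (borel_space V) J id 1 (1 + fine (J B)) B
  ler01 (measurable_norm_ge r).
rewrite (_ : (fun g => _) = jump_fun); last by apply/funext => g; rewrite mul1r.
apply.
- by move=> w /andP[].
- exact: jump_law_tail.
- by rewrite mul1r lerDr.
- by move=> L g; exact: admissible_measurable.
Qed.

Lemma jump_fun_lt r M L g : 0 < r -> admissible (shell r M) L g ->
  (\int[J]_w (g w)%:E < +oo)%E.
Proof.
move=> r0; apply: (@admissible_integral_lt R V (shell r M) _ (borel_space V) J id _
  (measurable_norm_ge r)) => [w /andP[]//|].
exact: jump_law_tail.
Qed.

Lemma jump_iterate r M L k (F : k.-tuple V -> R) : 0 < r -> tuple_admissible (shell r M) L F ->
  (\int[product_power J (k:=k)]_t (F t)%:E = (iterate jump_fun F)%:E)%E.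
Proof.
move=> r0; have [C C1 bC] := jump_fun_bounded M r0.
apply: (@integral_iterate R _ (borel_space V) J
  (fun k F => @tuple_admissible R V (shell r M) L k F)).
- move=> j G GA; split; first exact: tuple_admissible_measurable GA.
  by move=> t; have [G0 _ _] := GA; have /andP[] := G0 t.
- by move=> j G x; exact: tuple_admissible_cons.
- by move=> j G GA; apply: (jump_fun_lt (M := M) r0); exact: iterate_admissible C1 bC GA.
Qed.

End jump_functional.

Section noise_sample.
Context {R : realType} disp (Omega : measurableType disp) (P : probability Omega R) (d : nat).
Variables (Z : nat -> {RV P >-> borel_space 'cV[R]_d.+1}) (alpha : R).
Variable S : probability (borel_space (sphere R d)) R.
Hypothesis alpha0 : 0 < alpha.
Hypothesis RV : mv_regularly_varying P (Z 0%N) alpha S.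
Hypothesis Ziid : iid Z.
Local Notation V := 'cV[R]_d.+1.
Let H : R -> R := norm_tail P (Z 0%N).
Let law : {sigma_finite_measure set (borel_space V) -> \bar R} := distribution P (Z 0%N).
Implicit Types (r M eta : R).

Definition noise_fun eta (g : V -> R) : R :=
  fine (\int[distribution P (Z 0%N)]_z (g (eta *: (z : V)))%:E)%E.

Lemma measurable_scale eta : measurable_fun setT
  (fun z : borel_space V => (eta *: (z : V) : borel_space V)).
Proof.
apply: (@measurable_col_cells _ _ _ d 'I_d.+1 (fun i (z : borel_space V) => (z : V) i 0)) => //.
  by move=> i; exact: measurable_coord.
move=> z _ e e0; pose K := d.+1%:R * (`|eta| + 1).
have K0 : 0 < K by rewrite mulr_gt0// ltr_wpDl.
exists (e / (2 * K)); first by rewrite divr_gt0// mulr_gt0.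
move=> z' _ h; rewrite -scalerBr enormZ.
apply: (@le_lt_trans _ _ (`|eta| * (d.+1%:R * (e / (2 * K))))).
  apply: ler_wpM2l => //; apply: enorm_le_sum => i; rewrite !mxE; exact/ltW/h.
rewrite mulrCA mulrA; rewrite [e / _]mulrC mulrA -[ltRHS]mul1r ltr_pM2r//.
rewrite ltr_pdivrMr ?mulr_gt0// mul1r; apply: (@lt_le_trans _ _ K); last lra.
by rewrite /K ltr_pM2l// ltrDl.
Qed.

Lemma norm_gt_scale r eta : 0 < r -> 0 < eta ->
  measurable [set z : borel_space V | r / 2 / eta < enorm (z : V)] /\
  distribution P (Z 0%N) [set z : borel_space V | r / 2 / eta < enorm (z : V)] = (H (r / 2 / eta))%:E.
Proof.
move=> r0 eta0; split; last exact: norm_tailE.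
rewrite -[X in measurable X]setTI; have := @measurable_enorm R d.
by move=> /(_ measurableT `]r / 2 / eta, +oo[%classic (measurable_itv _)); rewrite set_itvE.
Qed.

(** Half of r trades the weak inequality of the shell for the strict one in [norm_tail]. *)
Lemma scale_shell r M eta (z : V) : 0 < r -> 0 < eta -> shell r M (eta *: z) ->
  r / 2 / eta < enorm z.
Proof.
move=> r0 eta0 /andP[h _]; rewrite ltr_pdivrMr//; move: h.
by rewrite enormZ gtr0_norm// mulrC [enorm z * _]mulrC => /(lt_le_trans _); apply; lra.
Qed.

(** Without normalisation the bound 1 holds for every eta > 0 and serves integrability and Tonelli's
    theorem; the bound after division by H, with one constant for all small eta, is
    [noise_fun_bounded]. *)
Lemma noise_fun_bounded1 r M eta : 0 < r -> 0 < eta ->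
  bounded_functional (shell r M) 1 (noise_fun eta) /\
  (forall L g, admissible (shell r M) L g -> measurable_fun setT (fun z : borel_space V => g (eta *: (z : V))) /\
     (\int[distribution P (Z 0%N)]_z (g (eta *: (z : V)))%:E < +oo)%E).
Proof.
move=> r0 eta0; have [mB BE] := norm_gt_scale r0 eta0.
have ms L g : admissible (shell r M) L g ->
    measurable_fun setT (fun z : borel_space V => g (eta *: (z : V))).
  move=> /admissible_measurable mg; exact: (measurableT_comp mg (measurable_scale eta)).
have Boo : (distribution P (Z 0%N) [set z : borel_space V | (r / 2 / eta < enorm (z : V))%R] < +oo)%E.
  by rewrite BE ltry.
split.
  have := @integral_functional_bounded R V (shell r M) _ (borel_space V)
    (distribution P (Z 0%N)) (fun z => eta *: (z : V)) 1 1 _ ler01 mB.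
  rewrite (_ : (fun g => _) = noise_fun eta); last by apply/funext => g; rewrite mul1r.
  apply => //; first by move=> z; exact: scale_shell.
  rewrite mul1r; apply: le_trans (norm_tail_le1 (Z 0%N) (r / 2 / eta)).
  by rewrite le_eqVlt; apply/orP; left; apply/eqP; exact: (congr1 fine BE).
move=> L g ga; split; first exact: ms ga.
apply: (@admissible_integral_lt R V (shell r M) _ (borel_space V) (distribution P (Z 0%N)) (fun z => eta *: (z : V)) _ mB _ Boo L g ga) => z; exact: scale_shell.
Qed.

Lemma norm_tail_near (t c : R) : 0 < t -> t `^ (- alpha) < c ->
  \forall eta \near 0^'+, H (t / eta) <= c * H eta^-1.
Proof.
move=> t0 tc; have h1 := cvgr_le _ (norm_tail_ratio RV t0) _ tc.
have h2 : \forall eta \near 0^'+, H (t / eta) / H eta^-1 <= c by exact: (inv_cvg_pinfty (h1 _)).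
near=> eta; rewrite -ler_pdivrMr ?(norm_tail_gt0 RV)//; near: eta; exact: h2.
Unshelve. all: by end_near. Qed.

Lemma noise_fun_bounded r M : 0 < r ->
  exists2 C : R, 1 <= C & \forall eta \near 0^'+,
    bounded_functional (shell r M) C (fun g => (H eta^-1)^-1 * noise_fun eta g).
Proof.
move=> r0; exists (1 + (r / 2) `^ (- alpha)); first by rewrite lerDl powR_ge0.
have r20 : 0 < r / 2 by rewrite divr_gt0.
have h2 : \forall eta \near 0^'+, H (r / 2 / eta) <= (1 + (r / 2) `^ (- alpha)) * H eta^-1.
  by apply: norm_tail_near => //; rewrite ltrDr.
near=> eta.
have eta0 : 0 < eta by near: eta; exact: nbhs_right_gt.
have [mB BE] := norm_gt_scale r0 eta0.
apply: (@integral_functional_bounded R V (shell r M) _ (borel_space V)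
    (distribution P (Z 0%N)) (fun z => eta *: (z : V)) _ _ _ _ mB).
- by rewrite invr_ge0; exact: (norm_tail_ge0 (Z 0%N)).
- by move=> z; exact: scale_shell.
- by rewrite [X in (X < _)%E](_ : _ = (H (r / 2 / eta))%:E) ?ltry.
- rewrite (_ : fine _ = H (r / 2 / eta)); last exact: (congr1 fine BE).
  rewrite mulrC ler_pdivrMr ?(norm_tail_gt0 RV)//; near: eta; exact: h2.
- by move=> L g ga; have [_ h] := noise_fun_bounded1 M r0 eta0; have [] := h _ _ ga.
Unshelve. all: by end_near. Qed.

Lemma noise_fun_cvg r M L g : 0 < r -> admissible (shell r M) L g ->
  (H eta^-1)^-1 * noise_fun eta g @[eta --> 0^'+] --> jump_fun S alpha0 g.
Proof.
move=> r0 ga; have [g01 _ gK] := ga.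
have g0 w : 0 <= g w by have /andP[] := g01 w.
have gL w : g w <= L by have /andP[] := g01 w.
have r20 : 0 < r / 2 by rewrite divr_gt0.
have gr w : enorm w <= r / 2 -> g w = 0.
  by move=> h; apply: gK => /andP[h1 _]; have := le_trans h1 h; lra.
have := @noise_limit _ _ _ _ _ _ _ _ alpha0 RV _ (admissible_continuous ga) g0 _ gL _ r20 gr.
have Jf : (\int[jump_law S alpha0]_w (g w)%:E)%E \is a fin_num.
  rewrite ge0_fin_numE; first exact: jump_fun_lt ga.
  by apply: integral_ge0 => w _; rewrite lee_fin.
rewrite -(fineK Jf) => /fine_cvg; apply: cvg_trans; apply: near_eq_cvg; near=> eta.
have eta0 : 0 < eta by near: eta; exact: nbhs_right_gt.
have [_ h] := noise_fun_bounded1 M r0 eta0; have [mg goo] := h _ _ ga.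
have E : (\int[distribution P (Z 0%N)]_z (g (eta *: (z : V)))%:E =
    \int[P]_w (g (eta *: (Z 0%N w : V)))%:E)%E.
  have h0 : {in [set: borel_space V], forall z, (0 <= (g (eta *: (z : V)))%:E)%E}.
    by move=> z _; rewrite lee_fin.
  have mg' : measurable_fun setT (fun z : borel_space V => (g (eta *: (z : V)))%:E).
    by apply/measurable_EFinP.
  exact: (ge0_integral_pushforward (measurable_funPT (Z 0%N)) P measurableT mg' h0).
rewrite /= /noise_fun E fineM// 1?mulrC// -E ge0_fin_numE//.
by apply: integral_ge0 => w _; rewrite lee_fin.
Unshelve. all: by end_near. Qed.

Lemma noise_iterate r M L k (F : k.-tuple V -> R) eta (s : k.-tuple nat) : 0 < r -> 0 < eta ->
  uniq s -> tuple_admissible (shell r M) L F ->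
  (\int[P]_w (F [tuple eta *: (Z (tnth s j) w : V) | j < k])%:E =
   (iterate (noise_fun eta) F)%:E)%E.
Proof.
move=> r0 eta0 us FA.
have [b1 h1] := noise_fun_bounded1 M r0 eta0.
(* Admissible functions composed with scaling by eta: this class is stable under fixing the first
   entry. *)
pose A j (G' : j.-tuple (borel_space V) -> R) := exists2 G, tuple_admissible (shell r M) L G &
  G' = (fun v => G [tuple of map (fun z : V => eta *: z) v]).
have mA j G' : A j G' -> measurable_fun [set: j.-tuple _] G' /\ forall t, 0 <= G' t.
  move=> [G GA ->]; split; last by move=> t; have [G0 _ _] := GA; have /andP[] := G0 [tuple of map (fun z : V => eta *: z) t].
  apply: (measurableT_comp (tuple_admissible_measurable GA)).
  apply/measurable_fun_tnthP => i.
  rewrite (_ : _ \o _ = fun t : j.-tuple (borel_space V) => eta *: (tnth t i : V)); last first.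
    by apply/funext => t /=; rewrite tnth_map.
  by apply: (measurableT_comp (measurable_scale eta)); exact: measurable_tnth.
transitivity (\int[P]_w ((fun t : k.-tuple (borel_space V) => F [tuple of map (fun z : V => eta *: z) t]) (sample Z s w))%:E)%E.
  apply: eq_integral => w _; congr (F _)%:E; apply: eq_from_tnth => i.
  by rewrite tnth_mktuple tnth_map tnth_mktuple.
have AF : A k (fun v => F [tuple of map (fun z : V => eta *: z) v]) by exists F.
have [mF F0] := mA _ _ AF.
rewrite (expect_sample Ziid (f := fun t => (F [tuple of map (fun z : V => eta *: z) t])%:E) us)//; last first.
  by apply/measurable_EFinP.
rewrite (@integral_iterate R _ (borel_space V) (distribution P (Z 0%N)) A mA _ _ k _ AF).
- by rewrite iterate_comp.
- move=> j _ x [G GA ->]; exists (fun v => G (cons_tuple (eta *: (x : V)) v)).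
    exact: tuple_admissible_cons.
  by apply/funext => v; congr G; exact: val_inj.
- move=> j _ [G GA ->].
  have := h1 _ _ (iterate_admissible (lexx 1) b1 GA) => -[_].
  apply: le_lt_trans; apply: ge0_le_integral_set => z; last first.
    rewrite lee_fin (_ : (fun v : j.-tuple _ => _) = (fun v => (fun v' => G (cons_tuple (eta *: (z : V)) v')) [tuple of map (fun z : V => eta *: z) v])).
      by rewrite (iterate_comp _ (fun z : V => eta *: z) (fun v' => G (cons_tuple (eta *: (z : V)) v'))).
    by apply/funext => v; congr G; exact: val_inj.
  rewrite lee_fin (_ : (fun v : j.-tuple _ => _) = (fun v => (fun v' => G (cons_tuple (eta *: (z : V)) v')) [tuple of map (fun z : V => eta *: z) v])).
    rewrite (iterate_comp _ (fun z : V => eta *: z) (fun v' => G (cons_tuple (eta *: (z : V)) v'))).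
    have [h _ _] := iterate_admissible (lexx 1) b1 GA.
    by have /andP[] := h (eta *: (z : V)).
  by apply/funext => v; congr G; exact: val_inj.
Qed.

End noise_sample.

Section time_functional.
Context {R : realType}.
Variable T : R.
Hypothesis T0 : 0 < T.

Definition riemann_fun (eta : R) (g : R -> R) : R :=
  eta * \sum_(i < Num.truncn (T / eta)) g (eta * i.+1%:R).

Definition lebesgue_fun (g : R -> R) : R := fine (\int[lebesgue_measure]_t (g t)%:E)%E.

Lemma riemann_fun_bounded eta : 0 < eta ->
  bounded_functional `[0, T]%classic (1 + T) (riemann_fun eta).
Proof.
move=> eta0; have nT : eta * (Num.truncn (T / eta))%:R <= T.
  rewrite mulrC -ler_pdivlMr//; have /truncn_itv/andP[] // : 0 <= T / eta by rewrite divr_ge0// ltW.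
split.
- by rewrite /riemann_fun big1 ?mulr0.
- by move=> L g [g0 _ _]; rewrite mulr_ge0 ?sumr_ge0// 1?ltW// => i _; have /andP[] := g0 (eta * i.+1%:R).
move=> L g h e _ _ gh; have e0 : 0 <= e := le_trans (normr_ge0 _) (gh 0).
rewrite -mulrBr normrM (gtr0_norm eta0) -sumrB.
apply: (@le_trans _ _ (eta * ((Num.truncn (T / eta))%:R * e))).
  apply: ler_wpM2l; first exact: ltW.
  apply: le_trans (ler_norm_sum _ _ _) _.
  rewrite mulr_natl -[X in _ *+ X](card_ord) -sumr_const.
  by apply: ler_sum => i _; exact: gh.
by rewrite mulrA ler_wpM2r//; apply: le_trans nT _; rewrite lerDr.
Qed.

Lemma admissible_time_measurable L (g : R -> R) : admissible `[0, T]%classic L g ->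
  measurable_fun setT g.
Proof.
move=> [g0 gL _]; apply: continuous_measurable_fun => x.
have L0 : 0 <= L by have /andP[h1 h2] := g0 0; exact: le_trans h2.
apply/cvgrPdist_le => e e0; have K0 : 0 < L + 1 by rewrite ltr_wpDl.
apply: (@near_ball _ _ (e / (L + 1))); first exact: divr_gt0.
move=> y /ltW h; apply: le_trans (gL x y) _.
apply: (@le_trans _ _ ((L + 1) * `|x - y|)); first by rewrite ler_wpM2r// lerDl.
by rewrite mulrC -ler_pdivlMr.
Qed.

Lemma lebesgue_fun_bounded : bounded_functional `[0, T]%classic (1 + T) lebesgue_fun.
Proof.
have lT : lebesgue_measure `[0, T]%classic = T%:E :> \bar R.
  by rewrite lebesgue_measure_itv/= lte_fin T0 sube0.
have := @integral_functional_bounded R R `[0, T]%classic _ _ lebesgue_measure id 1 (1 + T)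
  `[0, T]%classic ler01 (measurable_itv _).
rewrite (_ : (fun g => _) = lebesgue_fun); last by apply/funext => g; rewrite mul1r.
apply => //.
- by rewrite [X in (X < _)%E](_ : _ = T%:E)// ltry.
- by rewrite (_ : fine _ = T) ?mul1r ?lerDr//; exact: (congr1 fine lT).
- by move=> L g; exact: admissible_time_measurable.
Qed.

Lemma lebesgue_fun_lt L g : admissible `[0, T]%classic L g ->
  (\int[lebesgue_measure]_t (g t)%:E < +oo)%E.
Proof.
have lT : lebesgue_measure `[0, T]%classic = T%:E :> \bar R.
  by rewrite lebesgue_measure_itv/= lte_fin T0 sube0.
apply: (@admissible_integral_lt R R `[0, T]%classic _ _ lebesgue_measure id
  `[0, T]%classic (measurable_itv _)) => //.
by rewrite [X in (X < _)%E](_ : _ = T%:E)// ltry.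
Qed.

Lemma time_tuple_measurable L k (F : k.-tuple R -> R) : tuple_admissible `[0, T]%classic L F ->
  measurable_fun [set: k.-tuple R] F.
Proof.
move=> [F0 FL _]; have L0 : 0 <= L by have /andP[h1 h2] := F0 [tuple of nseq k 0]; exact: le_trans h2.
apply: (@measurable_real_cells _ _ _ 'I_k (fun i t => tnth t i)) => //.
  by move=> i; exact: measurable_tnth.
move=> t _ e e0; have K0 : 0 < L + 1 by rewrite ltr_wpDl.
exists (e / (L + 1)); first by rewrite divr_gt0.
move=> t' _ h; have q0 : 0 < e / (L + 1) by rewrite divr_gt0.
apply: le_lt_trans (FL t t' _ (ltW q0) _) _; first by move=> j; exact/ltW/h.
by rewrite mulrA ltr_pdivrMr// mulrC ltr_pM2l// ltrDl.
Qed.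

Lemma lebesgue_iterate L k (F : k.-tuple R -> R) : tuple_admissible `[0, T]%classic L F ->
  (\int[product_power lebesgue_measure (k:=k)]_t (F t)%:E = (iterate lebesgue_fun F)%:E)%E.
Proof.
have C1 : 1 <= 1 + T by rewrite lerDl ltW.
apply: (@integral_iterate R _ _ lebesgue_measure
  (fun k F => @tuple_admissible R R `[0, T]%classic L k F)).
- move=> j G GA; split; first exact: time_tuple_measurable GA.
  by move=> t; have [G0 _ _] := GA; have /andP[] := G0 t.
- by move=> j G x; exact: tuple_admissible_cons.
- by move=> j G GA; exact: (lebesgue_fun_lt (iterate_admissible C1 lebesgue_fun_bounded GA)).
Qed.

End time_functional.

(** Integrating out the marks leaves an admissible function of the times, with a constant that
    depends on the functional through C only. *)
Lemma iterate_parameter {R : realType} (E E' : normedModType R) (K : set E) (K' : set E') C I L k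
    (F : k.-tuple E -> k.-tuple E' -> R) : 1 <= C -> bounded_functional K C I ->
  (forall t, tuple_admissible K L (F^~ t)) -> (forall W, tuple_admissible K' L (F W)) ->
  tuple_admissible K' (C ^+ k * L) (fun t => iterate I (F^~ t)).
Proof.
move=> C1 bI FE FE'; have [h1 h2] := iterate_lipschitz k C1 bI; split.
- by move=> t; exact: h2.
- move=> t t' Delta D0 h; rewrite -mulrA; apply: (h1 L) => // W.
  by have [_ FL _] := FE' W; exact: FL.
- move=> t j nK; rewrite (_ : F^~ t = fun=> 0); first by apply: iterate0; case: bI.
  by apply/funext => W; have [_ _ FK] := FE' W; exact: FK nK.
Qed.

Section sum_limit.
Context {R : realType} disp (Omega : measurableType disp) (P : probability Omega R) (d : nat).
Variables (Z : nat -> {RV P >-> borel_space 'cV[R]_d.+1}) (alpha : R).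
Variable S : probability (borel_space (sphere R d)) R.
Hypothesis alpha0 : 0 < alpha.
Hypothesis RV : mv_regularly_varying P (Z 0%N) alpha S.
Local Notation V := 'cV[R]_d.+1.
Local Notation J := (jump_law S alpha0).
Variables (r M T L : R) (k : nat) (F : k.-tuple V -> k.-tuple R -> R).
Hypothesis r0 : 0 < r.
Hypothesis T0 : 0 < T.
Hypothesis FW : forall t, tuple_admissible (shell r M) L (F^~ t).
Hypothesis Ft : forall W, tuple_admissible `[0, T]%classic L (F W).

Lemma noise_funZ eta L' g e : 0 < eta -> admissible (shell r M) L' g -> 0 <= e ->
  noise_fun Z eta (fun u => e * g u) = e * noise_fun Z eta g.
Proof.
move=> eta0 ga e0; have [mB BE] := norm_gt_scale Z r0 eta0.
apply: (@integral_functionalZ R V (shell r M) _ (borel_space V) (distribution P (Z 0%N))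
  (fun z => eta *: (z : V)) _ mB _ _ _ L' g e ga e0).
- by move=> z; exact: scale_shell.
- by rewrite [X in (X < _)%E](_ : _ = (norm_tail P (Z 0%N) (r / 2 / eta))%:E) ?ltry.
- by move=> L1 g1 g1a; have [_ h] := noise_fun_bounded1 Z M r0 eta0; have [] := h _ _ g1a.
Qed.

(** Since 1 / lambda = eta / H, the factor lambda^-k splits into H^-k, which normalises the k noise
    integrals, and eta^k, which makes the sum over indices a k-fold Riemann sum. *)
Lemma sum_limit :
  lambda P (Z 0%N) eta ^- k * \sum_(I : k.-tuple 'I_(Num.truncn (T / eta)))
    iterate (noise_fun Z eta) (F^~ [tuple eta * (tnth I j).+1%:R | j < k])
  @[eta --> 0^'+] --> iterate lebesgue_fun (fun t => iterate (jump_fun S alpha0) (F^~ t)).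
Proof.
have [C1 C11 b1] := noise_fun_bounded RV M r0.
have [C2 C21 b2] := jump_fun_bounded S alpha0 M r0.
have T1 : 1 <= 1 + T by rewrite lerDl ltW.
pose C := Num.max C1 C2; have CC : 1 <= C by rewrite le_max C11.
have bw (I : (V -> R) -> R) C' : C' <= C -> bounded_functional (shell r M) C' I ->
    bounded_functional (shell r M) C I.
  move=> C'C [h1 h2 h3]; split=> // L' g h e ga ha gh; apply: le_trans (h3 _ _ _ _ ga ha gh) _.
  by rewrite ler_wpM2r//; exact: le_trans (gh 0).
have b1C : \forall eta \near 0^'+, bounded_functional (shell r M) C
    (fun g => (norm_tail P (Z 0%N) eta^-1)^-1 * noise_fun Z eta g).
  near=> eta; apply: (bw _ C1); first by rewrite le_max lexx.
  near: eta; exact: b1.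
have b2C : bounded_functional (shell r M) C (jump_fun S alpha0).
  by apply: bw b2; rewrite le_max lexx orbT.
pose I_ (eta : R) g := (norm_tail P (Z 0%N) eta^-1)^-1 * noise_fun Z eta g.
have lim : iterate (riemann_fun T eta) (fun t => iterate (I_ eta) (F^~ t)) @[eta --> 0^'+] -->
    iterate lebesgue_fun (fun t => iterate (jump_fun S alpha0) (F^~ t)).
  apply: (@iterate_cvg R R `[0, T]%classic (@segment_compact _ _ _) R 0^'+ _ (1 + T)
    (riemann_fun T) lebesgue_fun T1 _ (lebesgue_fun_bounded T0) _ k (C ^+ k * L)).
  - near=> eta; apply: riemann_fun_bounded => //; near: eta; exact: nbhs_right_gt.
  - by move=> L' g; exact: riemann_sum_cvg.
  - near=> eta; apply: (iterate_parameter CC _ FW Ft); near: eta; exact: b1C.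
  - exact: (iterate_parameter CC b2C FW Ft).
  move=> t; apply: (@iterate_cvg R V (shell r M) (@compact_shell _ _ _ _) R 0^'+ _ C
    I_ (jump_fun S alpha0) CC b1C b2C _ k L) => //.
  - by move=> L' g; exact: noise_fun_cvg.
  - by near=> eta.
  - by move=> v; exact: cvg_cst.
move: lim; apply: cvg_trans; apply: near_eq_cvg; near=> eta.
have eta0 : 0 < eta by near: eta; exact: nbhs_right_gt.
have [bn _] := noise_fun_bounded1 Z M r0 eta0.
rewrite iterate_riemann /lambda exprMn invfM -!exprVn invrK -mulrA; congr (_ * _).
rewrite mulr_sumr; apply: eq_bigr => I _.
have V0 : 0 <= (norm_tail P (Z 0%N) eta^-1)^-1 by rewrite invr_ge0 ltW// (norm_tail_gt0 RV).
rewrite -(iterate_scale (lexx 1) bn _ V0 (FW _)) => // L' g e; exact: noise_funZ.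
Unshelve. all: by end_near. Qed.

End sum_limit.

(** * Integration over ordered jump times *)

Section simplex.
Context {R : realType} (T : R) (k : nat).
Local Open Scope ereal_scope.
Notation simplex := (@increasing_times R k `]0%R, T[).

Lemma increasing_timesP (I : interval R) (t : k.-tuple R) : increasing_times I t <->
  (forall i j : 'I_k, (i < j)%N -> (tnth t i < tnth t j)%R) /\ (forall i : 'I_k, tnth t i \in I).
Proof.
split=> [[st /all_tnthP h]|[st h]]; split => //.
- move=> i j ij; rewrite !(tnth_nth 0%R); by apply: (sorted_ltn_nth lt_trans) => //; rewrite inE size_tuple ltn_ord.
- apply/(sortedP (0%R : R)) => i; rewrite size_tuple => ik.
  by have := st (Ordinal (ltnW ik)) (Ordinal ik) (ltnSn i); rewrite !(tnth_nth 0%R).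
- by apply/all_tnthP.
Qed.

Lemma measurable_simplex : measurable simplex.
Proof.
rewrite (_ : simplex = (\bigcap_(p in [set: 'I_k * 'I_k])
    [set t : k.-tuple R | (p.1 < p.2)%N ==> (tnth t p.1 < tnth t p.2)%R]) `&`
    \bigcap_(i in [set: 'I_k]) (fun t : k.-tuple R => tnth t i) @^-1` `]0%R, T[%classic); last first.
  apply/seteqP; split => t.
    move=> /increasing_timesP[h1 h2]; split => [p _|i _] /=; last exact: h2.
    by apply/implyP; exact: h1.
  move=> [h1 h2]; apply/increasing_timesP; split => [i j|i]; last exact: h2.
  by have /implyP := h1 (i, j) I.
apply: measurableI; apply: fin_bigcap_measurable; try exact: finite_finset.
  move=> p _; case: (p.1 < p.2)%N; last by rewrite [X in measurable X](_ : _ = setT)//; apply/seteqP; split.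
  rewrite -[X in measurable X]setTI; apply: (measurable_fun_ltr (measurable_tnth p.1) (measurable_tnth p.2) measurableT (Y := [set true])) => //.
move=> i _; rewrite -[X in measurable X]setTI.
by apply: (measurable_tnth i) => //; exact: measurable_itv.
Qed.

Local Notation Rl := (g_sigma_algebraType (@measurable (ocitv_display R) (ocitv_type R))).

Lemma measurable_simplex_lebesgue : measurable (simplex : set (k.-tuple Rl)).
Proof. exact: measurable_simplex. Qed.

Let restricted := mrestr (product_power lebesgue_measure (k:=k)) measurable_simplex_lebesgue.
Let lt0 : @lebesgue_times R T k set0 = 0.
Proof. exact: (measure0 restricted). Qed.
Let lt_ge0 E : 0 <= @lebesgue_times R T k E.
Proof. exact: (measure_ge0 restricted E). Qed.
Let lt_additive : semi_sigma_additive (@lebesgue_times R T k).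
Proof. exact: (@measure_semi_sigma_additive _ _ _ restricted). Qed.

HB.instance Definition _ := isMeasure.Build _ _ _ (@lebesgue_times R T k) lt0 lt_ge0 lt_additive.

Lemma lebesgue_times_setT : lebesgue_times T [set: k.-tuple R] <= (Num.max T 0 ^+ k)%:E.
Proof.
pose B : k.-tuple (set R) := [tuple `]0%R, T[%classic | i < k].
have mB i : measurable (tnth B i) by rewrite tnth_mktuple; exact: measurable_itv.
rewrite /lebesgue_times; apply: (@le_trans _ _ (product_power lebesgue_measure
  [set t : k.-tuple Rl | forall i, tnth B i (tnth t i)])).
  apply: le_measure; rewrite ?inE.
  - by rewrite setTI; exact: measurable_simplex.
  - exact: measurable_rect.
  - by move=> t [_ /increasing_timesP[_ h]] i; rewrite tnth_mktuple; exact: h.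
rewrite product_power_prod// (eq_bigr (fun=> (Num.max T 0)%:E)); last first.
  move=> i _; rewrite tnth_mktuple; transitivity (lebesgue_measure `]0%R, T[%classic : \bar R) => //.
  rewrite lebesgue_measure_itv/= lte_fin; case: ifPn => [T0|]; first by rewrite sube0 max_l// ltW.
  by rewrite -leNgt => T0; rewrite max_r.
rewrite big_const_ord; elim: k => [|j IH]; first by rewrite /= expr0.
by rewrite iterS exprS EFinM; apply: lee_wpmul2l => //; rewrite lee_fin le_max lexx orbT.
Qed.

Let lt_fin : fin_num_fun (@lebesgue_times R T k).
Proof.
apply: lty_fin_num_fun; apply: le_lt_trans lebesgue_times_setT _; exact: ltry.
Qed.

HB.instance Definition _ := Measure_isFinite.Build _ _ _ (@lebesgue_times R T k) lt_fin.

End simplex.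

(* The Lebesgue measure lives on a copy of R whose canonical sigma-algebra is only
   provably the one of R: hence the identity as a measurable map. *)
Lemma integral_lebesgue_times {R : realType} (T : R) k (f : k.-tuple R -> \bar R) :
  measurable_fun setT f -> (forall t, 0 <= f t)%E ->
  (\int[@lebesgue_times R T k]_t f t =
   \int[mrestr (product_power lebesgue_measure (k:=k)) (@measurable_simplex_lebesgue R T k)]_t f t)%E.
Proof.
move=> mf f0.
pose Rl := (g_sigma_algebraType (@measurable (ocitv_display R) (ocitv_type R))).
have mid : measurable_fun [set: k.-tuple Rl] (fun t : k.-tuple Rl => t : k.-tuple R).
  by move=> _ B mB; rewrite setTI; exact: mB.
pose m := mrestr (product_power lebesgue_measure (k:=k)) (@measurable_simplex_lebesgue R T k).
rewrite (@eq_set_integral _ _ _ (@lebesgue_times R T k) (pushforward m (fun t : k.-tuple Rl => t : k.-tuple R)))//.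
by rewrite (ge0_integral_pushforward mid)// preimage_setT.
Qed.

Section restricted_integral.
Context {R : realType} d (X : measurableType d) (mu : {measure set X -> \bar R}).
Local Open Scope ereal_scope.

Lemma integral_mrestr (D : set X) (mD : measurable D) (f : X -> \bar R) :
  measurable_fun setT f -> (forall x, 0 <= f x) -> (forall x, ~ D x -> f x = 0) ->
  \int[mrestr mu mD]_x f x = \int[mu]_x f x.
Proof.
move=> mf f0 fD; have mDc := measurableC mD.
have E A : measurable A -> mu A = measure_add (mrestr mu mD) (mrestr mu mDc) A.
  move=> mA; rewrite measure_addE /= /mrestr -(measureU mu)//; try exact: measurableI.
    by rewrite -setIUr setUv setIT.
  by rewrite setIACA setICr setI0.
rewrite [RHS](eq_set_integral _ _ E) ge0_integral_measure_add//.
suff -> : \int[mrestr mu mDc]_x f x = 0 by rewrite adde0.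
rewrite (_ : (fun x => f x) = f \_ D); last first.
  by apply/funext => x; rewrite patchE; case: ifPn => // /negP xD; apply: fD => /mem_set.
rewrite -integral_mkcond; apply: null_set_integral => //.
  by apply: measurable_funS mf.
by rewrite /= /mrestr setICr measure0.
Qed.

End restricted_integral.

Section limit_integral.
Context {R : realType} (d : nat) (alpha : R) (S : probability (borel_space (sphere R d)) R).
Hypothesis alpha0 : 0 < alpha.
Local Notation V := 'cV[R]_d.+1.
Local Notation J := (jump_law S alpha0).
Variables (r M T L : R) (k : nat) (F : k.-tuple V -> k.-tuple R -> R).
Hypothesis r0 : 0 < r.
Hypothesis T0 : 0 < T.
Hypothesis FW : forall t, tuple_admissible (shell r M) L (F^~ t).
Hypothesis Ft : forall W, tuple_admissible `[0, T]%classic L (F W).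
Hypothesis Fs : forall W t, ~ increasing_times `]0, T[ t -> F W t = 0.

Lemma measurable_pair_admissible :
  measurable_fun setT (fun p : k.-tuple (borel_space V) * k.-tuple R => F p.1 p.2).
Proof.
have [F0 _ _] := FW [tuple of nseq k 0].
have L0 : 0 <= L by have /andP[h1 h2] := F0 [tuple of nseq k 0]; exact: le_trans h2.
pose c (i : 'I_k * 'I_d.+1 + 'I_k) (p : k.-tuple (borel_space V) * k.-tuple R) : R :=
  match i with inl q => (tnth p.1 q.1 : V) q.2 0 | inr j => tnth p.2 j end.
apply: (@measurable_real_cells _ _ _ _ c) => //.
  case=> [q|j].
    apply: (measurableT_comp (@measurable_coord _ _ q.2)).
    by apply: (measurableT_comp (measurable_tnth q.1)); exact: measurable_fst.
  by apply: (measurableT_comp (measurable_tnth j)); exact: measurable_snd.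
move=> p _ e e0; have K0 : 0 < 2 * (L + 1) by rewrite mulr_gt0// ltr_wpDl.
have q0 : 0 < e / (2 * (L + 1)) by rewrite divr_gt0.
exists (e / (2 * (L + 1))) => // p' _ h.
have h1 : `|F p.1 p.2 - F p'.1 p.2| <= L * (e / (2 * (L + 1))).
  have [_ FL _] := FW p.2; apply: FL => [|j]; first exact: ltW.
  apply: norm_le_coord; first exact: ltW.
  by move=> i; have := h (inl (j, i)); rewrite /c /= !mxE => /ltW.
have h2 : `|F p'.1 p.2 - F p'.1 p'.2| <= L * (e / (2 * (L + 1))).
  have [_ FL _] := Ft p'.1; apply: FL => [|j]; first exact: ltW.
  by have := h (inr j); rewrite /c /= => /ltW.
apply: le_lt_trans (ler_distD (F p'.1 p.2) _ _) _.
apply: le_lt_trans (lerD h1 h2) _; rewrite -mulrDl mulrA ltr_pdivrMr// mulrC.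
by rewrite ltr_pM2l//; lra.
Qed.

(** Tonelli's theorem with the marks integrated first, so that the iterated integral is the limit in
    [sum_limit]. *)
Lemma limit_product :
  (\int[product_power J (k:=k) \x @lebesgue_times R T k]_p (F p.1 p.2)%:E =
   (iterate lebesgue_fun (fun t => iterate (jump_fun S alpha0) (F^~ t)))%:E)%E.
Proof.
have F0 W t : 0 <= F W t by have [h _ _] := FW t; have /andP[] := h W.
rewrite fubini_tonelli2//; first last.
- by move=> p; rewrite lee_fin.
- by apply/measurable_EFinP; exact: measurable_pair_admissible.
have [C C1 bC] := jump_fun_bounded S alpha0 M r0.
have GA := iterate_parameter C1 bC FW Ft.
rewrite -(lebesgue_iterate T0 GA) /fubini_G /=.
under eq_integral do rewrite (jump_iterate S alpha0 r0 (FW _)).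
rewrite -[RHS](@integral_mrestr R _ _ _ _ (@measurable_simplex_lebesgue R T k)).
- rewrite integral_lebesgue_times//.
    by apply/measurable_EFinP; exact: (time_tuple_measurable GA).
  by move=> t; rewrite lee_fin; have [h _ _] := GA; have /andP[] := h t.
- by apply/measurable_EFinP; exact: (time_tuple_measurable GA).
- by move=> t; have [h _ _] := GA; have /andP[] := h t.
- move=> t nt; congr EFin; rewrite (_ : F^~ t = fun=> 0); first by apply: iterate0; case: bC.
  by apply/funext => W; exact: Fs.
Qed.

End limit_integral.

(** * Reduction to the large jumps *)

Section small_noise.
Context {R : realType}.
Variables (m d : nat) (a : 'cV[R]_m -> 'cV[R]_m) (sigma : 'cV[R]_m -> 'M[R]_(m, d)).
Variables (D b T : R).
Hypothesis D0 : 0 <= D.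
Hypothesis aL : forall x y, enorm (a x - a y) <= D * enorm (x - y).
Hypothesis sL : forall x y, opnorm (sigma x - sigma y) <= D * enorm (x - y).
Hypothesis b0 : 0 < b.
Hypothesis T0 : 0 < T.
Variables (k : nat) (r : R).
Hypothesis r0 : 0 <= r.
Let E := expR (D * T).
Let E1 : 1 <= E. Proof. by rewrite -[leLHS]expR0 ler_expR mulr_ge0// ltW. Qed.

(** The radius M0 of [chain_bound] for starting points of norm at most r, at most k large marks and
    noise sums of norm at most 1. *)
Definition confine := (r + 1 + k%:R * b + T * enorm (a 0)) * E.

(** Noise is summed only while the chain is in the ball of radius M0, which keeps the coefficients
    bounded in the exponential estimate. *)
Definition small_noise (z : nat -> 'cV[R]_d) eta x M0 del rho n := forall j, (j <= n)%N ->
  enorm (\sum_(0 <= i < j | (enorm (eta *: z i.+1) <= del) &&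
                            (enorm (chain a sigma b z eta x i) <= M0))
     eta *: (sigma (chain a sigma b z eta x i) *m z i.+1)) <= rho.

Lemma enorm_sum_count (v : nat -> 'cV[R]_m) (p : pred nat) j q (c : R) : 0 <= c ->
  (count p (iota 0 j) <= q)%N -> (forall i, (i < j)%N -> p i -> enorm (v i) <= c) ->
  enorm (\sum_(0 <= i < j | p i) v i) <= q%:R * c.
Proof.
move=> c0 pq vc; apply: le_trans (enorm_sum _ _ _) _.
apply: (@le_trans _ _ (\sum_(0 <= i < j | p i) c)).
  rewrite big_nat_cond [leRHS]big_nat_cond; apply: ler_sum => i /andP[/andP[_ ij] pi].
  exact: vc.
by rewrite big_const_seq iter_addr_0 -[leLHS]mulr_natl /index_iota subn0 ler_wpM2r// ler_nat.
Qed.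

Lemma tracks_le rho rho' (y : R -> 'cV[R]_m) s0 (js : seq (R * 'cV[R]_d)) : rho <= rho' ->
  tracks a sigma b T rho y s0 js -> tracks a sigma b T rho' y s0 js.
Proof.
move=> rr; elim: js s0 => [|[t w] js IH] s0 /=.
  by move=> h s /h hs; exact: le_trans rr.
move=> [h1 h2 [p h3 h4] h5]; split => //.
- by move=> s /h2 hs; exact: le_trans rr.
- by exists p; [exact: le_trans rr|exact: le_trans rr].
- exact: IH.
Qed.

(** S need not be the set of steps above del: it may omit marks between del and delbar and contain
    smaller ones, at most k of each kind, which costs 2 k Sg delbar. The case of few large marks
    uses a set of k - 1 steps, the case of exactly k marks uses delbar = del. *)
Lemma small_noise_tracks : exists2 C : R, 1 <= C &
  forall z (eta del delbar rho : R) x (S : seq nat), 0 < eta -> enorm x <= r -> 0 <= rho -> rho <= 1 ->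
    0 <= del -> del <= delbar -> C * (eta + delbar) <= b ->
    let n := Num.truncn (T / eta) in
    (count (fun i => (del < enorm (eta *: z i.+1))%R) (iota 0 n) <= k)%N ->
    small_noise z eta x confine del rho n ->
    sorted ltn S -> (forall i, i \in S -> (i < n)%N) -> (size S <= k)%N ->
    (forall i, (i < n)%N -> i \notin S -> enorm (eta *: z i.+1) <= delbar) ->
    tracks a sigma b T (C * (rho + delbar + eta)) (chain_path a sigma b T z eta x) 0
      (marks z eta S).
Proof.
have M00 : 0 <= confine by rewrite /confine; pos.
pose Sg := opnorm (sigma 0) + D * confine.
pose Am := enorm (a 0) + D * confine.
have Sg0 : 0 <= Sg by rewrite /Sg; pos.
have Am0 : 0 <= Am by rewrite /Am; pos.
have T0' := ltW T0; have E0 : 0 <= E by apply: le_trans E1.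
pose C1 := T * E * D * (2 + E ^+ 2 * Am) + 2 + E * Am + 2 * Am.
have C10 : 0 <= C1 by rewrite /C1; pos.
pose C2 := 1 + 2 * k%:R * Sg; have C20 : 1 <= C2 by rewrite lerDl; pos.
exists (1 + Am + Sg + C1 * C2); first by rewrite -!addrA lerDl; pos; exact: le_trans C20.
move=> z eta del delbar rho x S eta0 xr rho0 rho1 del0 dd Cb n cnt ns sS Sn sk Ssmall.
have db0 : 0 <= delbar := le_trans del0 dd.
have nT : eta * n%:R <= T.
  by rewrite mulrC -ler_pdivlMr//; have /truncn_itv/andP[] // : 0 <= T / eta by rewrite divr_ge0// ltW.
have C1C2 : 0 <= C1 * C2 by rewrite mulr_ge0//; exact: le_trans C20.
have Cb' : eta * Am + Sg * delbar <= b.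
  apply: le_trans Cb; apply: (@le_trans _ _ ((Am + Sg) * (eta + delbar))).
    by have := mulr_ge0 (ltW eta0) Sg0; have := mulr_ge0 Am0 db0; lra.
  by rewrite ler_wpM2r ?addr_ge0// 1?ltW//; lra.
set X := chain a sigma b z eta x.
have sX i : enorm (X i) <= confine -> opnorm (sigma (X i)) <= Sg.
  by move=> h; apply: le_trans (sigma_le sL _ 0) _; rewrite subr0 lerD2l ler_wpM2l.
have vX i (c : R) : enorm (X i) <= confine -> enorm (eta *: z i.+1) <= c ->
    enorm (eta *: (sigma (X i) *m z i.+1)) <= Sg * c.
  move=> h1 h2; rewrite scalemxAr; apply: le_trans (opnormP _ _) _.
  by apply: ler_pM => //; [exact: opnorm_ge0|exact: enorm_ge0|exact: sX].
have stepX i (c : R) : c <= delbar -> enorm (X i) <= confine -> enorm (eta *: z i.+1) <= c ->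
    enorm (eta *: a (X i) + eta *: (sigma (X i) *m z i.+1)) <= b.
  move=> cd h1 h2; apply: le_trans (enormD _ _) _; apply: le_trans Cb'; apply: lerD.
    by rewrite enormZ gtr0_norm// ler_wpM2l ?(ltW eta0)//; exact: (enorm_a0 D0 aL h1).
  by apply: le_trans (vX _ _ h1 h2) _; rewrite ler_wpM2l.
have XM : forall j, (j <= n)%N -> enorm (X j) <= confine.
  apply: (chain_bound (S := fun i => del < enorm (eta *: z i.+1)) (rho := rho) D0 aL b0 T0 eta0 rho0 nT cnt).
  - by move=> i _; rewrite -leNgt => h1 h2; apply: stepX h2 h1.
  - move=> j jn; have := ns j jn; rewrite /small_noise.
    by under eq_bigl do rewrite leNgt.
  - rewrite /confine ler_wpM2r// lerD2r lerD2r; exact: lerD.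
have noise j : (j <= n)%N ->
    enorm (\sum_(0 <= i < j | i \notin S) eta *: (sigma (X i) *m z i.+1)) <= rho + 2 * k%:R * Sg * delbar.
  move=> jn; pose v i := eta *: (sigma (X i) *m z i.+1).
  pose bg i := del < enorm (eta *: z i.+1).
  (* Passing from the steps below del to those outside S adds at most k terms and removes at most
     k. *)
  have -> : \sum_(0 <= i < j | i \notin S) v i =
      \sum_(0 <= i < j | ~~ bg i) v i + \sum_(0 <= i < j | bg i && (i \notin S)) v i
      - \sum_(0 <= i < j | ~~ bg i && (i \in S)) v i.
    rewrite (bigID bg) /= addrAC [X in _ = X + _](_ : _ = \sum_(0 <= i < j | (i \notin S) && ~~ bg i) v i).
      by rewrite addrC; congr (_ + _); apply: eq_bigl => i; rewrite andbC.
    rewrite [X in X - _](bigID (fun i => i \in S)) /= addrAC subrr add0r.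
    by apply: eq_bigl => i; rewrite andbC.
  have iX i : (i < j)%N -> enorm (X i) <= confine.
    by move=> ij; apply: XM; exact: ltnW (leq_trans ij jn).
  apply: le_trans (enormBl _ _) _; apply: le_trans (lerD (enormD _ _) (lexx _)) _.
  rewrite -addrA; apply: lerD.
    have := ns j jn; apply: le_trans; rewrite le_eqVlt; apply/orP; left; apply/eqP; congr enorm.
    rewrite big_nat_cond [RHS]big_nat_cond; apply: eq_bigl => i.
    have [/andP[_ ij]|//] := boolP (0 <= i < j)%N; rewrite /= -leNgt; symmetry.
    by rewrite [X in _ && X](_ : _ = true) ?andbT//; exact: iX.
  rewrite -!mulrA mulrDl mul1r; apply: lerD; apply: enorm_sum_count; rewrite ?mulr_ge0//.
  - apply: leq_trans cnt; apply: (@leq_trans (count bg (iota 0 j))).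
      by apply: sub_count => i /andP[].
    by rewrite -(subnKC jn) iotaD count_cat leq_addr.
  - move=> i ij /andP[_ iS]; apply: vX; first exact: iX.
    exact: Ssmall (leq_trans ij jn) iS.
  - apply: leq_trans sk; rewrite -size_filter; apply: uniq_leq_size; first by rewrite filter_uniq// iota_uniq.
    by move=> i; rewrite mem_filter => /andP[/andP[]].
  - move=> i ij /andP[]; rewrite -leNgt => h _; apply: le_trans (vX _ _ (iX _ ij) h) _.
    by rewrite ler_wpM2l.
have rho'0 : 0 <= rho + 2 * k%:R * Sg * delbar by pos.
have tr := chain_tracks D0 aL b0 T0 eta0 rho'0 erefl Sn XM
  (fun i h1 h2 => stepX i _ (lexx _) (XM _ (ltnW h1)) (Ssmall i h1 h2)) noise sS.
have rate := chain_tracks_rate D0 aL T0 eta0 rho'0 XM E1.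
apply: tracks_le tr; apply: le_trans rate _.
rewrite -/E -/Am -/C1; apply: (@le_trans _ _ (C1 * (C2 * (rho + delbar + eta)))).
  apply: ler_wpM2l => //; rewrite /C2 mulrDl mul1r.
  have q0 : 0 <= 2 * k%:R * Sg by pos.
  have := mulr_ge0 q0 rho0; have := mulr_ge0 q0 (ltW eta0); rewrite !mulrDr; lra.
have e0 := ltW eta0; rewrite mulrA; apply: ler_wpM2r; first by pos.
by rewrite lerDr; pos.
Qed.

End small_noise.

(** * Lipschitz cutoffs for times and marks *)

Section cutoff.
Context {R : realType} (T : R) (d : nat).
Local Notation V := 'cV[R]_d.
Implicit Types (N u : R) (js : seq (R * V)).

Definition ramp u : R := Num.max 0 (Num.min 1 u).

Lemma ramp_itv u : 0 <= ramp u <= 1.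
Proof. by rewrite /ramp le_max lexx /= ge_max ler01 ge_min lexx. Qed.

Lemma ramp_le0 u : u <= 0 -> ramp u = 0.
Proof. by move=> u0; rewrite /ramp max_l// ge_min u0 orbT. Qed.

Lemma ramp_ge1 u : 1 <= u -> ramp u = 1.
Proof. by move=> u1; rewrite /ramp min_l// max_r. Qed.

Lemma ramp_le u v : u <= v -> ramp u <= ramp v.
Proof.
move=> uv; rewrite /ramp ge_max le_max lexx /= le_max; apply/orP; right.
by rewrite le_min !ge_min lexx uv /= orbT.
Qed.

Lemma ramp_lip u v : `|ramp u - ramp v| <= `|u - v|.
Proof.
wlog uv : u v / u <= v.
  by move=> h; have [/h//|/ltW/h] := leP u v; rewrite distrC (distrC u).
rewrite ler0_norm ?subr_le0 ?ramp_le// ler0_norm ?subr_le0// !opprB.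
have [v1|v1] := leP v 1; last first.
  have -> : ramp v = 1 by rewrite ramp_ge1// ltW.
  have [u1|u1] := leP 1 u; first by have := ramp_ge1 u1; lra.
  have : u <= ramp u by rewrite /ramp le_max min_r ?lexx ?orbT// ltW.
  lra.
have [v0|v0] := leP v 0; first by rewrite !ramp_le0// ?subrr ?subr_ge0//; exact: le_trans v0.
have -> : ramp v = v by rewrite /ramp min_r// max_r// ltW.
have : u <= ramp u by rewrite /ramp le_max min_r ?lexx ?orbT//; exact: le_trans v1.
lra.
Qed.

(** A Lipschitz stand-in for the indicator of ordered times and bounded marks. It is 1 when
    successive times, s0 included, keep distance 1 / N, all times keep this distance from T, and
    marks have norm at most N; it vanishes for unordered times and for a mark beyond 2 N. *)
Fixpoint cutoff N s0 js : R :=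
  if js is (t, w) :: js' then
    ramp (N * (t - s0)) * ramp (N * (T - t)) * ramp (2 - enorm w / N) * cutoff N t js'
  else 1.

Lemma cutoff_itv N s0 js : 0 <= cutoff N s0 js <= 1.
Proof.
elim: js s0 => [|[t w] js IH] s0 /=; first by rewrite ler01 lexx.
have /andP[a0 a1] := ramp_itv (N * (t - s0)); have /andP[b0 b1] := ramp_itv (N * (T - t)).
have /andP[c0 c1] := ramp_itv (2 - enorm w / N); have /andP[e0 e1] := IH t.
by rewrite !mulr_ge0//= !mulr_ile1// ?mulr_ge0.
Qed.

Lemma mul_unit_lip (p p' q q' : R) : 0 <= p' <= 1 -> 0 <= q <= 1 ->
  `|p * q - p' * q'| <= `|p - p'| + `|q - q'|.
Proof.
move=> /andP[p0 p1] /andP[q0 q1].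
rewrite (_ : p * q - p' * q' = (p - p') * q + p' * (q - q')); last ring.
apply: le_trans (ler_normD _ _) _; rewrite !normrM (ger0_norm q0) (ger0_norm p0).
by apply: lerD; [rewrite ler_piMr|rewrite ler_piMl].
Qed.

Lemma cutoff_lip N s0 s0' js js' Delta : 1 <= N -> size js = size js' -> `|s0 - s0'| <= Delta ->
  (forall i, `|(nth (0, 0) js i).1 - (nth (0, 0) js' i).1| <= Delta) ->
  (forall i, enorm ((nth (0, 0) js i).2 - (nth (0, 0) js' i).2) <= Delta) ->
  `|cutoff N s0 js - cutoff N s0' js'| <= (size js)%:R * (4 * N) * Delta.
Proof.
move=> N1; have N0 : 0 < N := lt_le_trans ltr01 N1.
elim: js js' s0 s0' => [|[t w] js IH] [|[t' w'] js'] s0 s0' //= ss h0 ht hw.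
  by rewrite subrr normr0 !mul0r.
have D0 : 0 <= Delta := le_trans (normr_ge0 _) h0.
have tt := ht 0%N; have ww := hw 0%N; rewrite /= in tt ww.
have := IH js' t t' (succn_inj ss) tt (fun i => ht i.+1) (fun i => hw i.+1) => IH'.
apply: le_trans (mul_unit_lip _ _ _ _) _.
- have /andP[a0 a1] := ramp_itv (N * (t' - s0')); have /andP[b0 b1] := ramp_itv (N * (T - t')).
  by have /andP[c0 c1] := ramp_itv (2 - enorm w' / N); rewrite !mulr_ge0//= !mulr_ile1// ?mulr_ge0.
- exact: cutoff_itv.
rewrite (_ : (size js).+1%:R * (4 * N) * Delta = 4 * N * Delta + (size js)%:R * (4 * N) * Delta); last first.
  by rewrite -natr1; ring.
apply: lerD => //.
apply: le_trans (mul_unit_lip _ _ _ _) _.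
- have /andP[a0 a1] := ramp_itv (N * (t' - s0')); have /andP[b0 b1] := ramp_itv (N * (T - t')).
  by rewrite !mulr_ge0//= !mulr_ile1.
- exact: ramp_itv.
apply: (@le_trans _ _ ((N * (2 * Delta) + N * Delta) + N * Delta)); last lra.
apply: lerD.
  apply: le_trans (mul_unit_lip _ _ _ _) _; try exact: ramp_itv.
  apply: lerD; apply: le_trans (ramp_lip _ _) _; rewrite -mulrBr normrM gtr0_norm// ler_pM2l//.
    rewrite (_ : t - s0 - (t' - s0') = (t - t') - (s0 - s0')); last ring.
    by apply: le_trans (ler_normB _ _) _; lra.
  by rewrite (_ : T - t - (T - t') = - (t - t')) ?normrN//; ring.
apply: le_trans (ramp_lip _ _) _.
rewrite (_ : 2 - enorm w / N - (2 - enorm w' / N) = - ((enorm w - enorm w') / N)); last by field; lra.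
rewrite normrN normrM normfV (gtr0_norm N0); apply: (@le_trans _ _ (Delta / N)).
  by rewrite ler_pM2r ?invr_gt0//; apply: le_trans (enorm_dist _ _) ww.
apply: (@le_trans _ _ Delta); first by rewrite ler_pdivrMr// ler_peMr.
by rewrite ler_peMl.
Qed.

Lemma cutoff_neq0 N s0 js : 1 <= N -> cutoff N s0 js != 0 ->
  [/\ path <%R s0 [seq p.1 | p <- js], all (fun t => t < T) [seq p.1 | p <- js] &
      all (fun w => enorm w <= 2 * N) [seq p.2 | p <- js]].
Proof.
move=> N1; have N0 : 0 < N := lt_le_trans ltr01 N1.
elim: js s0 => [//|[t w] js IH] s0 /=; rewrite !mulf_eq0 !negb_or => /andP[/andP[/andP[h1 h2] h3] /IH[-> -> ->]].
split; rewrite andbT.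
- by rewrite ltNge; apply: contra h1 => h; apply/eqP/ramp_le0; rewrite pmulr_rle0// subr_le0.
- by rewrite ltNge; apply: contra h2 => h; apply/eqP/ramp_le0; rewrite pmulr_rle0// subr_le0.
- rewrite leNgt; apply: contra h3 => /ltW h; apply/eqP/ramp_le0.
  by rewrite subr_le0 ler_pdivlMr.
Qed.

Fixpoint separated (g s0 : R) (ts : seq R) : bool :=
  if ts is t :: ts' then [&& g <= t - s0, g <= T - t & separated g t ts'] else true.

Lemma cutoff_eq1 N s0 js : 1 <= N -> separated N^-1 s0 [seq p.1 | p <- js] ->
  all (fun w => enorm w <= N) [seq p.2 | p <- js] -> cutoff N s0 js = 1.
Proof.
move=> N1; have N0 : 0 < N := lt_le_trans ltr01 N1.
elim: js s0 => [//|[t w] js IH] s0 /= /and3P[h1 h2 /IH{}IH] /andP[h3 /IH ->].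
rewrite !ramp_ge1 ?mulr1//.
- have : enorm w / N <= 1 by rewrite ler_pdivrMr ?mul1r.
  lra.
- by rewrite mulrC -ler_pdivrMr// mul1r.
- by rewrite mulrC -ler_pdivrMr// mul1r.
Qed.

(** Prepares the monotone convergence that removes the cutoff. *)
Lemma cutoff_le N N' s0 js : 1 <= N -> N <= N' -> path <%R s0 [seq p.1 | p <- js] ->
  all (fun t => t < T) [seq p.1 | p <- js] -> cutoff N s0 js <= cutoff N' s0 js.
Proof.
move=> N1 NN; have N0 : 0 < N := lt_le_trans ltr01 N1; have N'0 := lt_le_trans N0 NN.
elim: js s0 => [//|[t w] js IH] s0 /= /andP[h1 h2] /andP[h3 h4].
have /andP[c0 _] := cutoff_itv N t js.
have r0 u : 0 <= ramp u by have /andP[] := ramp_itv u.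
apply: ler_pM => //; [by rewrite !mulr_ge0| |exact: IH].
apply: ler_pM => //; [by rewrite !mulr_ge0| |].
  by apply: ler_pM => //; apply: ramp_le; rewrite ler_wpM2r// subr_ge0 ltW.
apply: ramp_le; rewrite lerD2l lerN2 ler_wpM2l ?enorm_ge0// lef_pV2//.
Qed.

Lemma separated_exists s0 (ts : seq R) : path <%R s0 ts -> all (fun t => t < T) ts ->
  exists2 g, 0 < g & separated g s0 ts.
Proof.
have mono g g' s1 us : g' <= g -> separated g s1 us -> separated g' s1 us.
  move=> gg; elim: us s1 => [//|u us IH] s1 /= /and3P[h1 h2 h3].
  by rewrite (le_trans gg h1) (le_trans gg h2) IH.
elim: ts s0 => [|t ts IH] s0 /=; first by exists 1.
move=> /andP[h1 h2] /andP[h3 h4]; have [g g0 sg] := IH t h2 h4.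
exists (Num.min g (Num.min (t - s0) (T - t))); first by rewrite !lt_min g0 !subr_gt0 h1.
by rewrite !ge_min !lexx !orbT /=; apply: mono sg; rewrite ge_min lexx.
Qed.

End cutoff.

Lemma mktuple_map (E E' : Type) k (g : E -> E') (I : k.-tuple E) :
  [tuple g (tnth I j) | j < k] = [tuple of map g I].
Proof. by apply: eq_from_tnth => j; rewrite tnth_mktuple tnth_map. Qed.

Lemma sum_nat_bool (E : finType) (p : pred E) : (\sum_i p i)%N = #|[set i | p i]%SET|.
Proof.
by rewrite -sum1_card [RHS]big_mkcond; apply: eq_bigr => i _; rewrite inE; case: (p i).
Qed.

(** Completes the set of large steps to exactly k - 1 steps, as [jump_paths] has a fixed number of
    jumps. *)
Lemma exists_superset (E : finType) (S : {set E}) q : (#|S| <= q <= #|E|)%N ->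
  exists S' : {set E}, S \subset S' /\ #|S'| = q.
Proof.
move=> /andP[Sq qE]; elim: q Sq qE => [|q IH].
  by rewrite leqn0 => S0 _; exists S; split => //; exact/eqP.
rewrite leq_eqVlt => /orP[/eqP SE _|Sq qE]; first by exists S.
have [S' [SS' cS']] := IH Sq (ltnW qE).
have /set0Pn[x] : ~: S' != finset.set0.
  by rewrite -card_gt0 -(ltn_add2l #|S'|) cardsC addn0 cS'.
rewrite inE => xS'; exists (x |: S')%SET; split; last by rewrite cardsU1 xS' cS'.
apply: (fintype.subset_trans SS'); exact: subsetU1.
Qed.

Lemma sorted_enum_val n (S : {set 'I_n}) : sorted ltn [seq val i | i <- enum S].
Proof.
rewrite sorted_map; apply: (@subseq_sorted _ _ _ _ (enum 'I_n)).
- by move=> i j l /=; exact: ltn_trans.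
- by rewrite enumT; exact: filter_subseq.
- by have := iota_ltn_sorted 0 n; rewrite -val_enum_ord sorted_map.
Qed.

Lemma count_ord n (p : pred nat) : count p (iota 0 n) = #|[set i : 'I_n | p i]%SET|.
Proof.
rewrite -val_enum_ord count_map -size_filter cardE; congr size.
by rewrite enumT /enum_mem; apply: eq_filter => i; rewrite /= inE.
Qed.

(** * The test function as a sum over index tuples *)

Section truncated_functional.
Context {R : realType}.
Variables (m d : nat) (a : 'cV[R]_m -> 'cV[R]_m) (sigma : 'cV[R]_m -> 'M[R]_(m, d.+1)).
Variables (D b T : R).
Hypothesis D0 : 0 <= D.
Hypothesis aL : forall x y, enorm (a x - a y) <= D * enorm (x - y).
Hypothesis sL : forall x y, opnorm (sigma x - sigma y) <= D * enorm (x - y).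
Hypothesis b0 : 0 < b.
Hypothesis T0 : 0 < T.
Variables (k : nat) (r eps rd : R) (A : set 'cV[R]_m).
Hypothesis r0 : 0 <= r.
Hypothesis Ar : forall x, A x -> enorm x <= r.
Hypothesis eps0 : 0 < eps.
Hypothesis rd0 : 0 < rd.
Variables (f : skorokhod T m -> R) (B Lf : R).
Hypothesis fB : forall y, 0 <= f y <= B.
Hypothesis fL : forall y y', `|f y - f y'| <= Lf * mdist y y'.
Hypothesis f_off : forall zeta y, jump_paths_pred a sigma b T k A eps zeta ->
  mdist zeta y <= rd -> f y = 0.
Local Notation V := 'cV[R]_d.+1.
Local Notation h := (h_map a sigma b T).

Let B0 : 0 <= B. Proof. by have /andP[h1 h2] := fB point; exact: le_trans h2. Qed.
(** By [h_map_drop] a path with a small mark is close to a path with k - 1 jumps, where f vanishes;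
    for k = 0 there is no mark. *)
Lemma small_mark_vanish : exists2 del : R, 0 < del &
  forall x (W : k.-tuple V) (t : k.-tuple R) j, A x -> increasing_times `]0, T] t ->
    enorm (tnth W j) <= del -> f (h x W t) = 0.
Proof.
move: f_off; case: k => [|j] foff; first by exists 1 => // x W t [].
have e0 : 0 < Num.min eps rd by rewrite lt_min eps0.
have [C C0 hC] := h_map_drop D0 aL sL b0 T0 j Ar eps0.
exists (Num.min eps rd / C); first by rewrite divr_gt0.
move=> x W t i Ax tI Wi.
have CE : C * (Num.min eps rd / C) = Num.min eps rd by field; rewrite gt_eqF.
have [|||zeta z1 z2] := hC x (Num.min eps rd / C) W t Ax _ _ tI.
- by rewrite divr_ge0// ltW.
- by rewrite CE ge_min lexx.
- by exists i.
apply: (foff zeta) => //; rewrite metric_sym; apply: le_trans z2 _.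
by rewrite CE ge_min lexx orbT.
Qed.

Definition trunc_fun N x (W : k.-tuple V) (t : k.-tuple R) : R :=
  f (h x W t) * cutoff T N 0 (zip t W).

Lemma zip_marks (W : k.-tuple V) (t : k.-tuple R) : [seq p.2 | p <- zip t W] = W.
Proof. by rewrite -/(unzip2 _) unzip2_zip// !size_tuple. Qed.

Lemma nth_zip_tuple (W : k.-tuple V) (t : k.-tuple R) (i : nat) :
  nth (0, 0) (zip t W) i = if insub i is Some j then (tnth t j, tnth W j) else (0, 0).
Proof.
case: insubP => [j ij <-|].
  by rewrite nth_zip ?size_tuple// -!tnth_nth.
by rewrite -leqNgt => ki; rewrite nth_default// size_zip !size_tuple minnn.
Qed.

Lemma cutoff_simplex N (W : k.-tuple V) (t : k.-tuple R) : 1 <= N -> cutoff T N 0 (zip t W) != 0 ->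
  increasing_times `]0, T[ t /\ forall j, enorm (tnth W j) <= 2 * N.
Proof.
move=> N1 /(cutoff_neq0 N1); rewrite zip_times zip_marks => -[h1 h2 h3]; split; last by move=> j; have /all_tnthP := h3; apply.
split; first exact: path_sorted h1.
apply/allP => s st; rewrite in_itv/= (allP h2 _ st) andbT.
by have /allP := order_path_min lt_trans h1; apply.
Qed.

Lemma simplex_closed (t : k.-tuple R) : increasing_times `]0, T[ t -> increasing_times `]0, T] t.
Proof.
move=> [h1 h2]; split => //; apply: sub_all h2 => s; rewrite !in_itv/= => /andP[-> /ltW].
by [].
Qed.

Lemma trunc_fun_itv N x W t : 0 <= trunc_fun N x W t <= B.
Proof.
have /andP[f0 f1] := fB (h x W t); have /andP[c0 c1] := cutoff_itv T N 0 (zip t W).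
by rewrite /trunc_fun mulr_ge0//=; apply: le_trans f1; rewrite ler_piMr.
Qed.

Lemma trunc_fun_lip N : 1 <= N -> exists2 L : R, B <= L & forall x x' W W' t t' Delta,
  A x' -> enorm (x - x') <= Delta -> (forall j, enorm (tnth W j - tnth W' j) <= Delta) ->
  (forall j, `|tnth t j - tnth t' j| <= Delta) ->
  `|trunc_fun N x W t - trunc_fun N x' W' t'| <= L * Delta.
Proof.
move=> N1; have N20 : 0 <= 2 * N by lra.
have [C C0 hC] := h_map_lip D0 aL sL b0 T0 k N20 r0.
exists (B + `|Lf| * C + B * (k%:R * (4 * N))).
  by rewrite -addrA lerDl addr_ge0// !mulr_ge0// ?(ltW C0)//; lra.
move=> x x' W W' t t' Delta Ax' hx hW ht.
have De0 : 0 <= Delta by apply: le_trans (enorm_ge0 _) hx.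
have cut : `|cutoff T N 0 (zip t W) - cutoff T N 0 (zip t' W')| <= k%:R * (4 * N) * Delta.
  have := @cutoff_lip R T _ N 0 0 (zip t W) (zip t' W') Delta N1.
  rewrite !size_zip !size_tuple minnn subrr normr0 => /(_ erefl De0); apply.
    by move=> i; rewrite !nth_zip_tuple; case: insubP => [j _ _|_] /=; rewrite ?ht// subrr normr0.
  by move=> i; rewrite !nth_zip_tuple; case: insubP => [j _ _|_] /=; rewrite ?hW// subrr enorm0.
have fB1 y : `|f y| <= B by have /andP[f0 f1] := fB y; rewrite ger0_norm.
have K0 : 0 <= B * (k%:R * (4 * N)) * Delta by rewrite !mulr_ge0//; lra.
have K1 : 0 <= `|Lf| * C * Delta by rewrite !mulr_ge0// ltW.
have K2 : 0 <= B * Delta by rewrite mulr_ge0.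
have kc : B * `|cutoff T N 0 (zip t W) - cutoff T N 0 (zip t' W')| <= B * (k%:R * (4 * N)) * Delta.
  by rewrite -mulrA ler_wpM2l.
rewrite 2!mulrDl /trunc_fun.
(* [h_map_lip] needs both time tuples in the open simplex. When one cutoff vanishes, the bound on f
   and the Lipschitz bound on the cutoff are used instead. *)
have [c0|c0] := eqVneq (cutoff T N 0 (zip t W)) 0.
  rewrite c0 mulr0 sub0r normrN normrM.
  have := ler_wpM2r (normr_ge0 (cutoff T N 0 (zip t' W'))) (fB1 (h x' W' t')).
  move: kc; rewrite c0 sub0r normrN; lra.
have [c0'|c0'] := eqVneq (cutoff T N 0 (zip t' W')) 0.
  rewrite c0' mulr0 subr0 normrM.
  have := ler_wpM2r (normr_ge0 (cutoff T N 0 (zip t W))) (fB1 (h x W t)).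
  move: kc; rewrite c0' subr0; lra.
have [ti WN] := cutoff_simplex N1 c0; have [ti' _] := cutoff_simplex N1 c0'.
set c := cutoff _ _ _ _; set c' := cutoff _ _ _ _.
rewrite (_ : f (h x W t) * c - f (h x' W' t') * c' =
  (f (h x W t) - f (h x' W' t')) * c + f (h x' W' t') * (c - c')); last ring.
apply: le_trans (ler_normD _ _) _; rewrite !normrM; apply: lerD.
  apply: (@le_trans _ _ (`|Lf| * C * Delta)); last by rewrite lerDr.
  have /andP[cc0 cc1] := cutoff_itv T N 0 (zip t W); rewrite -/c in cc0 cc1.
  rewrite (ger0_norm cc0); apply: le_trans (ler_piMr (normr_ge0 _) cc1) _.
  apply: le_trans (fL _ _) _; apply: le_trans (ler_wpM2r (mdist_ge0 _ _) (ler_norm Lf)) _.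
  by rewrite -mulrA ler_wpM2l//; apply: hC => //; exact: Ar.
by apply: le_trans kc; rewrite ler_wpM2r.
Qed.

(** Marks are confined to a shell because f vanishes for small ones and the cutoff for large ones.
    The factor d + 1 converts the sup norm of the abstract functionals to the Euclidean norm. *)
Lemma trunc_fun_admissible N delbar x : 1 <= N -> 0 <= delbar -> A x ->
  (forall x (W : k.-tuple V) (t : k.-tuple R) j, A x -> increasing_times `]0, T] t ->
     enorm (tnth W j) <= delbar -> f (h x W t) = 0) ->
  exists L : R, (forall t, tuple_admissible (shell delbar (2 * N)) L (trunc_fun N x ^~ t)) /\
    (forall W, tuple_admissible `[0, T]%classic L (trunc_fun N x W)).
Proof.
move=> N1 db0 Ax van; have [L BL hL] := trunc_fun_lip N1.
have L0 : 0 <= L := le_trans B0 BL.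
have itv W t : 0 <= trunc_fun N x W t <= L * d.+1%:R.
  have /andP[-> h1] := trunc_fun_itv N x W t; apply: le_trans h1 _.
  by apply: le_trans BL _; rewrite ler_peMr// ler1n.
exists (L * d.+1%:R); split=> [t|W]; split => //.
- move=> W W' Delta De0 hW; rewrite -mulrA; apply: hL => //.
  + by rewrite subrr enorm0 mulr_ge0.
  + move=> j; apply: le_trans (enorm_le_norm _) _; rewrite ler_wpM2l//; exact: hW.
  + by move=> j; rewrite subrr normr0 mulr_ge0.
- move=> W j nK; rewrite /trunc_fun.
  have [->|c0] := eqVneq (cutoff T N 0 (zip t W)) 0; first by rewrite mulr0.
  have [ti WN] := cutoff_simplex N1 c0.
  rewrite (van x W t j) ?mul0r//; first exact: simplex_closed.
  by rewrite leNgt; apply/negP => h1; apply: nK; rewrite /shell /= (ltW h1) WN.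
- move=> t t' Delta De0 ht; apply: (@le_trans _ _ (L * Delta)); last first.
    by rewrite ler_wpM2r// ler_peMr// ler1n.
  apply: hL => //; first by rewrite subrr enorm0.
  by move=> j; rewrite subrr enorm0.
- move=> t j nK; rewrite /trunc_fun.
  have [->|c0] := eqVneq (cutoff T N 0 (zip t W)) 0; first by rewrite mulr0.
  have [[_ /all_tnthP ti] _] := cutoff_simplex N1 c0.
  by case: nK; have := ti j; rewrite /= !in_itv/= => /andP[/ltW -> /ltW ->].
Qed.


Definition large c (z : nat -> V) eta (i : nat) := c < enorm (eta *: z i.+1).

Definition mark_vals n z eta (I : k.-tuple 'I_n) : k.-tuple V := [tuple eta *: z (tnth I j).+1 | j < k].

Definition mark_times n eta (I : k.-tuple 'I_n) : k.-tuple R := [tuple eta * (tnth I j).+1%:R | j < k].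

(** Index tuples on which the cutoff may differ from 1. *)
Definition bad N n z eta (I : k.-tuple 'I_n) :=
  ~~ (all (fun w => enorm w <= N) (mark_vals z eta I) && separated T N^-1 0 (mark_times eta I)).

Definition ord_sorted n (I : seq 'I_n) := sorted (fun i j => (val i < val j)%N) I.

Lemma increasing_mark_times n eta (I : k.-tuple 'I_n) (J : interval R) : 0 < eta ->
  increasing_times J (mark_times eta I) -> ord_sorted I.
Proof.
move=> eta0 [+ _]; rewrite /mark_times (mktuple_map (fun i : 'I_n => eta * i.+1%:R)) /= sorted_map.
by apply: sub_sorted => i j /=; rewrite ltr_pM2l// ltr_nat.
Qed.

Lemma trunc_fun_neq0 N delbar x n z eta (I : k.-tuple 'I_n) : 1 <= N -> A x -> 0 < eta ->
  (forall x (W : k.-tuple V) (t : k.-tuple R) j, A x -> increasing_times `]0, T] t ->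
     enorm (tnth W j) <= delbar -> f (h x W t) = 0) ->
  trunc_fun N x (mark_vals z eta I) (mark_times eta I) != 0 ->
  ord_sorted I /\ all (fun i : 'I_n => large delbar z eta i) I.
Proof.
move=> N1 Ax eta0 van; rewrite mulf_eq0 negb_or => /andP[f0 c0].
have [ti _] := cutoff_simplex N1 c0; split; first exact: increasing_mark_times ti.
apply/all_tnthP => j; rewrite /large ltNge; apply: contra f0 => h1.
by apply/eqP; apply: (van _ _ _ j) => //; [exact: simplex_closed|rewrite tnth_mktuple].
Qed.

Lemma zip_mark n z eta (I : k.-tuple 'I_n) :
  zip (mark_times eta I) (mark_vals z eta I) = marks z eta [seq val i | i <- I].
Proof.
rewrite /mark_times /mark_vals (mktuple_map (fun i : 'I_n => eta * i.+1%:R)).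
rewrite (mktuple_map (fun i : 'I_n => eta *: z i.+1)) /= /marks -map_comp.
by elim: (val I) => //= i s ->.
Qed.

Lemma chain_path0 z eta x : chain_path a sigma b T z eta x 0 = x.
Proof.
rewrite /chain_path /= /step_path in_itv/= lexx (ltW T0) mul0r.
by rewrite (_ : Num.truncn 0 = 0%N)// truncn0.
Qed.

(** The first error sum counts (k + 1)-tuples of marks above del, hence pays for the event of more
    than k such marks. In the second, each candidate k-tuple carries the Lipschitz error and, if it
    is bad, the bound B. *)
Lemma pointwise_reduction : exists2 C0 : R, 1 <= C0 & forall delbar : R,
  (forall x (W : k.-tuple V) (t : k.-tuple R) j, A x -> increasing_times `]0, T] t ->
     enorm (tnth W j) <= delbar -> f (h x W t) = 0) ->
  forall N x', 1 <= N -> A x' -> exists2 C : R, 0 <= C &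
  forall z (eta del rho : R) x, 0 < eta -> A x -> 0 <= rho -> rho <= 1 -> 0 <= del -> del <= delbar ->
    (1 + expR (D * T)) * (C0 * (rho + delbar + eta)) <= Num.min b (Num.min eps rd) ->
    let n := Num.truncn (T / eta) in (k <= n)%N ->
    small_noise a sigma b z eta x (confine a D b T k r) del rho n ->
  `|f (chain_path a sigma b T z eta x) -
    \sum_(I : k.-tuple 'I_n) trunc_fun N x' (mark_vals z eta I) (mark_times eta I)| <=
  \sum_(Q : k.+1.-tuple 'I_n) 2 * B * (uniq Q && all (fun i : 'I_n => large del z eta i) Q)%:R +
  \sum_(I : k.-tuple 'I_n) (C * (rho + del + eta + enorm (x - x')) + B * (bad N z eta I)%:R) *
      (ord_sorted I && all (fun i : 'I_n => large delbar z eta i) I)%:R.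
Proof.
have [C0 C01 trk] := small_noise_tracks D0 aL sL b0 T0 k r0; exists C0 => //.
move=> delbar van N x' N1 Ax'; have N0 : 0 <= N by exact: le_trans N1.
have [C1 C10 hC1] := tracks_h_map D0 aL sL b0 T0 k N0 r0.
have C00 : 0 <= C0 by exact: le_trans C01.
exists (`|Lf| * (C1 * C0)); first by rewrite !mulr_ge0// ltW.
move=> z eta del rho x eta0 Ax rho0 rho1 del0 dd small n kn ns.
have E0 : 0 <= expR (D * T) by exact: expR_ge0.
set q := C0 * (rho + delbar + eta) in small.
have db0 : 0 <= delbar := le_trans del0 dd.
have q0 : 0 <= q by rewrite /q mulr_ge0// !addr_ge0// ltW.
have qE : q <= (1 + expR (D * T)) * q by rewrite ler_peMl// lerDl.
have small_b : C0 * (eta + delbar) <= b.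
  apply: le_trans (_ : q <= _); first by rewrite /q ler_wpM2l//; lra.
  by apply: le_trans qE _; apply: le_trans small _; rewrite ge_min lexx.
pose X := chain_path a sigma b T z eta x.
pose F (I : k.-tuple 'I_n) := trunc_fun N x' (mark_vals z eta I) (mark_times eta I).
have F01 I : 0 <= F I <= B := trunc_fun_itv N x' _ _.
have /andP[fX0 fXB] := fB X.
pose Bg : {set 'I_n} := [set i : 'I_n | large del z eta i]%SET.
pose Bb : {set 'I_n} := [set i : 'I_n | large delbar z eta i]%SET.
have Bbg : Bb \subset Bg.
  by apply/fintype.subsetP => i; rewrite !inE /large; exact: le_lt_trans.
have F_off I : F I != 0 -> ord_sorted I /\ all (fun i : 'I_n => large delbar z eta i) I.
  exact: trunc_fun_neq0.
have sorted_uniq (s : seq 'I_n) : ord_sorted s -> uniq s.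
  move=> ss; apply: (sorted_uniq _ _ ss) => [i j l|i] /=; first exact: ltn_trans.
  by rewrite ltnn.
have R10 : 0 <= \sum_(Q : k.+1.-tuple 'I_n) 2 * B * (uniq Q && all (fun i : 'I_n => large del z eta i) Q)%:R.
  by apply: sumr_ge0 => Q _; rewrite !mulr_ge0.
have t0 I : 0 <= (`|Lf| * (C1 * C0) * (rho + del + eta + enorm (x - x')) + B * (bad N z eta I)%:R) *
      (ord_sorted I && all (fun i : 'I_n => large delbar z eta i) I)%:R.
  by rewrite mulr_ge0// addr_ge0 ?mulr_ge0 ?addr_ge0 ?enorm_ge0// ltW.
have cu j : #|[set t : j.-tuple 'I_n | all (mem Bg) t & uniq t]%SET| = #|Bg| ^_ j.
  exact: (card_uniq_tuples j (mem Bg)).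
(* With more than k marks above del both terms are bounded crudely: the sum by B times the number of
   injective k-tuples in [Bg], which is at most that of injective (k + 1)-tuples. *)
have [big|small_card] := ltnP k #|Bg|.
  apply: (@le_trans _ _ (B + B * (#|Bg| ^_ k)%:R)).
    apply: le_trans (ler_normB _ _) _; rewrite (ger0_norm fX0) lerD// ger0_norm; last first.
      by apply: sumr_ge0 => I _; have /andP[] := F01 I.
    apply: (@le_trans _ _ (\sum_(I : k.-tuple 'I_n) B * (all (mem Bg) I && uniq I)%:R)).
      apply: ler_sum => I _; rewrite -/(F I); have [->|/F_off[h1 h2]] := eqVneq (F I) 0; first by rewrite mulr_ge0.
      rewrite (sorted_uniq _ h1) andbT (_ : all _ _ = true) ?mulr1; first by have /andP[] := F01 I.
      apply/allP => i iI; apply: (fintype.subsetP Bbg); rewrite inE; exact: (allP h2).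
    by rewrite -mulr_sumr ler_wpM2l// -natr_sum ler_nat sum_nat_bool cu.
  apply: (@le_trans _ _ (2 * B * (#|Bg| ^_ k.+1)%:R)); last first.
    rewrite -[leLHS]addr0; apply: lerD; last exact: sumr_ge0.
    rewrite -mulr_sumr ler_wpM2l ?mulr_ge0// -natr_sum ler_nat sum_nat_bool -cu.
    apply: subset_leq_card; apply/fintype.subsetP => Q; rewrite !inE => /andP[h1 ->].
    by apply: sub_all h1 => i; rewrite /= inE.
  have N1' : (1 <= #|Bg| ^_ k)%N by rewrite ffact_gt0 ltnW.
  have N2' : (#|Bg| ^_ k <= #|Bg| ^_ k.+1)%N by rewrite ffactnSr leq_pmulr// subn_gt0.
  rewrite -[2 * B]mulrC mulrDr mulr1 mulrDl; apply: lerD.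
    by rewrite ler_peMr// ler1n (leq_trans N1').
  by rewrite ler_wpM2l// ler_nat.
have cnt : (count (fun i => (del < enorm (eta *: z i.+1))%R) (iota 0 n) <= k)%N.
  by rewrite count_ord.
(* With fewer than k marks above delbar the chain is close to a path with k - 1 jumps, so f
   vanishes, and so does every term of the sum. *)
have [few|many] := ltnP #|Bb| k.
  have -> : f X = 0.
    move: (few); case kE : k => [//|j] few'.
    have bq : (#|Bb| <= j <= #|'I_n|)%N by rewrite -ltnS few' card_ord ltnW// -kE.
    have [S0 [BS cS]] := exists_superset bq.
    have Ssort := sorted_enum_val S0.
    have sz : size [seq val i | i <- enum S0] = j by rewrite size_map -cardE.
    have := trk z eta del delbar rho x [seq val i | i <- enum S0] eta0 (Ar Ax) rho0 rho1 del0 dd small_b cnt ns Ssort.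
    move=> tr0; have tr : tracks a sigma b T q X 0 (marks z eta [seq val i | i <- enum S0]).
      apply: tr0.
      - by move=> i /mapP[i' _ ->]; exact: (ltn_ord i').
      - by rewrite sz kE.
      - move=> i ilt iS; rewrite leNgt; apply: contra iS => h1.
        apply/mapP; exists (Ordinal ilt) => //; rewrite mem_enum; apply: (fintype.subsetP BS).
        by rewrite inE.
    have [||zeta z1 z2] := tracks_jump_paths D0 aL T0 q0 tr (A := A) (eps := eps).
    - by rewrite chain_path0.
    - by apply: le_trans small _; rewrite !ge_min lexx orbT.
    apply: (f_off (zeta := zeta)); first by rewrite kE; rewrite size_map sz in z1.
    by rewrite metric_sym; apply: le_trans z2 _; apply: le_trans small _; rewrite !ge_min lexx !orbT.
  rewrite big1; first by rewrite subrr normr0 addr_ge0// sumr_ge0.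
  move=> I _; apply/eqP/negPn/negP => /F_off[h1 h2].
  move: few; rewrite ltnNge => /negP; apply; rewrite -{1}(size_tuple I) cardE.
  apply: uniq_leq_size; first exact: sorted_uniq.
  by move=> i iI; rewrite mem_enum inE; exact: (allP h2).
(* Exactly k marks, none between del and delbar: only the increasing enumeration of [Bb] can give a
   nonzero term. *)
have BE : Bb = Bg by apply/eqP; rewrite eqEcard Bbg; exact: leq_trans many.
have cB : size (enum Bb) == k by rewrite -cardE eqn_leq many BE small_card.
pose I0 : k.-tuple 'I_n := Tuple cB.
have I0s : ord_sorted I0 by have := sorted_enum_val Bb; rewrite sorted_map.
have I0b : all (fun i : 'I_n => large delbar z eta i) I0.
  by apply/allP => i; rewrite mem_enum inE.
rewrite (bigD1 I0)//= big1 ?addr0; last first.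
  move=> I /eqP II0; apply/eqP/negPn/negP => /F_off[h1 h2]; apply: II0; apply: val_inj => /=.
  have sub : {subset I <= enum Bb} by move=> i iI; rewrite mem_enum inE; exact: (allP h2).
  have sz : (size (enum Bb) <= size I)%N by rewrite (eqP cB) size_tuple.
  have [_ h3] := uniq_min_size (sorted_uniq _ h1) sub sz.
  apply: (irr_sorted_eq (leT := fun i j : 'I_n => (val i < val j)%N)) => //.
  - by move=> i j l /=; exact: ltn_trans.
  - by move=> i /=; exact: ltnn.
rewrite -[leLHS]add0r; apply: lerD => //; rewrite (bigD1 I0)//=.
rewrite -[leLHS]addr0; apply: lerD; last by apply: sumr_ge0 => I _; exact: t0.
rewrite I0s I0b mulr1.
have [isbad|good] := boolP (bad N z eta I0).
  apply: (@le_trans _ _ (B * true%:R)).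
    rewrite mulr1 ler_norml; have /andP[F0 FB] := F01 I0; move: F0 FB fX0 fXB; rewrite /F /X /n; lra.
  by rewrite lerDr !mulr_ge0 ?addr_ge0 ?enorm_ge0// ltW.
rewrite mulr0 addr0; move: good; rewrite negbK => /andP[gN gs].
rewrite /trunc_fun cutoff_eq1 ?zip_marks ?zip_times// mulr1.
apply: le_trans (fL _ _) _; apply: le_trans (ler_wpM2r (mdist_ge0 _ _) (ler_norm Lf)) _.
rewrite -mulrA ler_wpM2l// -mulrA.
have := trk z eta del del rho x [seq val i | i <- I0] eta0 (Ar Ax) rho0 rho1 del0 (lexx _) _ cnt ns.
move=> tr; have Ds : 0 <= rho + del + eta by rewrite !addr_ge0// ltW.
have tr' : tracks a sigma b T (C0 * (rho + del + eta)) X 0 (zip (mark_times eta I0) (mark_vals z eta I0)).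
  rewrite zip_mark; apply: tr.
  - by apply: le_trans small_b; rewrite ler_wpM2l// lerD2l.
  - exact: sorted_enum_val.
  - by move=> i /mapP[i' _ ->]; exact: (ltn_ord i').
  - by rewrite size_map (eqP cB).
  - move=> i ilt iS; rewrite leNgt; apply: contra iS => h1.
    by apply/mapP; exists (Ordinal ilt) => //; rewrite mem_enum BE inE.
apply: (hC1 _ _ _ _ _ _ _ tr') => //.
- by rewrite mulr_ge0.
- exact: Ar.
- by move=> j; have /all_tnthP := gN; apply.
- rewrite chain_path0; apply: (@le_trans _ _ (rho + del + eta + enorm (x - x'))); first by rewrite lerDr.
  by rewrite ler_peMl// addr_ge0// enorm_ge0.
- by rewrite ler_wpM2l// lerDl enorm_ge0.
Qed.

End truncated_functional.

(** * Concentration of the small noise *)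

Section chain_measurable.
Context {R : realType}.
Variables (m d : nat) (a : 'cV[R]_m.+1 -> 'cV[R]_m.+1) (sigma : 'cV[R]_m.+1 -> 'M[R]_(m.+1, d.+1)).
Variables (D b T : R).
Hypothesis D0 : 0 <= D.
Hypothesis aL : forall x y, enorm (a x - a y) <= D * enorm (x - y).
Hypothesis sL : forall x y, opnorm (sigma x - sigma y) <= D * enorm (x - y).
Hypothesis b0 : 0 < b.
Local Notation X := (chain a sigma b).
Local Notation V := 'cV[R]_d.+1.
Local Notation U := 'cV[R]_m.+1.

Lemma chain_shift z eta x t : X z eta x t.+1 = X (fun i => z i.+1) eta (X z eta x 1%N) t.
Proof. by elim: t => [//|t IH]; rewrite [LHS]/= -/(X z eta x t.+1) IH. Qed.

Lemma eq_chain z z' eta x t : (forall i, (0 < i <= t)%N -> z i = z' i) -> X z eta x t = X z' eta x t.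
Proof.
elim: t => [//|t IH] h /=; rewrite IH ?h ?leqnn// => i /andP[i0 it].
by apply: h; rewrite i0 ltnW.
Qed.

Lemma chain_step_close (eta : R) (x : U) (z : V) (e : R) : 0 <= eta -> 0 < e ->
  exists2 del : R, 0 < del & forall x' z', enorm (x - x') <= del -> enorm (z - z') <= del ->
    enorm ((x + clip b (eta *: a x + eta *: (sigma x *m z))) -
           (x' + clip b (eta *: a x' + eta *: (sigma x' *m z')))) < e.
Proof.
move=> eta0 e0.
pose K := 1 + 2 * eta * (D + D * enorm z + (opnorm (sigma x) + D)).
have K0 : 0 < K by rewrite ltr_pwDl// !(mulr_ge0, addr_ge0)// ?enorm_ge0 ?opnorm_ge0.
exists (Num.min 1 (e / (2 * K))); first by rewrite lt_min ltr01 divr_gt0// mulr_gt0.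
set q := Num.min 1 _ => x' z' hx hz.
have q0 : 0 <= q by rewrite le_min ler01 divr_ge0// 1?ltW// mulr_gt0.
have q1 : q <= 1 by rewrite ge_min lexx.
have qe : K * q < e.
  apply: (@le_lt_trans _ _ (K * (e / (2 * K)))); first by rewrite ler_wpM2l ?(ltW K0)// /q ge_min lexx orbT.
  rewrite (_ : K * (e / (2 * K)) = e / 2); last by field; rewrite gt_eqF.
  lra.
apply: le_lt_trans qe.
rewrite opprD addrACA; apply: le_trans (enormD _ _) _; rewrite /K mulrDl mul1r; apply: lerD => //.
apply: le_trans (clip_lip b0 _ _) _; rewrite -!mulrA ler_wpM2l//.
rewrite opprD addrACA -!scalerBr -scalerDr enormZ (ger0_norm eta0) ler_wpM2l//.
apply: le_trans (enormD _ _) _; rewrite (mulrDl _ _ q) (mulrDl D _ q) -addrA; apply: lerD.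
  by apply: le_trans (aL _ _) _; rewrite ler_wpM2l.
rewrite (_ : sigma x *m z - sigma x' *m z' = (sigma x - sigma x') *m z + sigma x' *m (z - z')); last first.
  by rewrite mulmxBl mulmxBr addrA subrK.
apply: le_trans (enormD _ _) _; apply: lerD; apply: le_trans (opnormP _ _) _.
  by rewrite mulrAC ler_wpM2r ?enorm_ge0//; apply: le_trans (sL _ _) _; rewrite ler_wpM2l.
apply: ler_pM => //; [exact: opnorm_ge0|exact: enorm_ge0|].
apply: le_trans (sigma_le sL x' x) _; rewrite lerD2l enormB ler_piMr//; exact: le_trans hx q1.
Qed.

(** One step is continuous in the current state and the noise, so [measurable_cells] applies with
    their finitely many coordinates. *)
Lemma measurable_chain disp (Y : measurableType disp) (z : nat -> Y -> V) (eta : R) x t : 0 <= eta ->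
  (forall i j, (0 < i <= t)%N -> measurable_fun setT (fun y => z i y j 0)) ->
  forall c, measurable_fun setT (fun y => X (fun i => z i y) eta x t c 0).
Proof.
move=> eta0; elim: t => [|t IH] mz c; first exact: measurable_cst.
have {}IH : forall c, measurable_fun setT (fun y => X (fun i => z i y) eta x t c 0).
  by apply: IH => i j /andP[i0 it]; apply: mz; rewrite i0 ltnW.
pose cc (q : 'I_m.+1 + 'I_d.+1) (y : Y) : R :=
  match q with inl i => X (fun i => z i y) eta x t i 0 | inr j => z t.+1 y j 0 end.
apply: (measurableT_comp (@measurable_coord _ _ c)).
apply: (@measurable_col_cells _ _ _ m _ cc) => //.
  by case=> i; [exact: IH|apply: mz; rewrite leqnn].
move=> y _ e e0 /=.
have [del del0 hd] := chain_step_close (X (fun i => z i y) eta x t) (z t.+1 y) eta0 e0.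
pose K : R := m.+1%:R + d.+1%:R; have K0 : 0 < K by rewrite addr_gt0.
exists (del / K) => [|y' _ hy]; first exact: divr_gt0.
have dK : 0 <= del / K by rewrite divr_ge0// ltW.
apply: hd.
  apply: (@le_trans _ _ (m.+1%:R * (del / K))).
    by apply: enorm_le_sum => i; have := hy (inl i); rewrite /cc !mxE => /ltW.
  by rewrite mulrCA ger_pMr// ler_pdivrMr// mul1r lerDl.
apply: (@le_trans _ _ (d.+1%:R * (del / K))).
  by apply: enorm_le_sum => i; have := hy (inr i); rewrite /cc !mxE => /ltW.
by rewrite mulrCA ger_pMr// ler_pdivrMr// mul1r lerDr.
Qed.

Hypothesis T0 : 0 < T.

(** Only finitely many values of the chain enter the path, and the Skorokhod distance is at most the
    uniform one. *)
Lemma measurable_chain_path disp (Y : measurableType disp) (z : nat -> Y -> V) (eta : R) x : 0 < eta ->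
  (forall i j, measurable_fun setT (fun y => z i y j 0)) ->
  measurable_fun setT (fun y => chain_path a sigma b T (fun i => z i y) eta x : borel_space (skorokhod T m.+1)).
Proof.
move=> eta0 mz; pose n := Num.truncn (T / eta).
pose c (q : 'I_n.+1 * 'I_m.+1) (y : Y) : R := X (fun i => z i y) eta x q.1 q.2 0.
apply: (@measurable_metric_cells _ _ _ _ _ c) => //.
  by move=> q; apply: measurable_chain => //; exact: ltW.
move=> y _ e e0; have K0 : (0 : R) < 2 * m.+1%:R by rewrite mulr_gt0.
exists (e / (2 * m.+1%:R)) => [|y' _ hy]; first exact: divr_gt0.
apply: (@le_lt_trans _ _ (e / 2)); last lra.
apply: J1_le_unif; [exact: T0|lra|move=> t tT].
rewrite /= /step_path tT.
have tn : (Num.truncn (t / eta) < n.+1)%N.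
  by rewrite ltnS; apply: le_truncn; rewrite ler_pM2r ?invr_gt0//; move: tT; rewrite in_itv/= => /andP[].
apply: (@le_trans _ _ (m.+1%:R * (e / (2 * m.+1%:R)))).
  by apply: enorm_le_sum => i; have := hy (Ordinal tn, i); rewrite /c !mxE => /ltW.
by rewrite le_eqVlt; apply/orP; left; apply/eqP; field.
Qed.

End chain_measurable.

Section exponential_functional.
Context {R : realType} disp (Omega : measurableType disp) (P : probability Omega R) (m d : nat).
Variables (Z : nat -> {RV P >-> borel_space 'cV[R]_d.+1}).
Hypothesis Ziid : iid Z.
Variables (a : 'cV[R]_m.+1 -> 'cV[R]_m.+1) (sigma : 'cV[R]_m.+1 -> 'M[R]_(m.+1, d.+1)).
Variables (D b : R).
Hypothesis D0 : 0 <= D.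
Hypothesis aL : forall x y, enorm (a x - a y) <= D * enorm (x - y).
Hypothesis sL : forall x y, opnorm (sigma x - sigma y) <= D * enorm (x - y).
Hypothesis b0 : 0 < b.
Local Notation X := (chain a sigma b).
Local Notation V := 'cV[R]_d.+1.
Local Notation U := 'cV[R]_m.+1.
Variables (u : U -> V) (th del eta tau : R).
Hypothesis eta0 : 0 <= eta.
Hypothesis tau0 : 0 <= tau.
Hypothesis mu : forall l, measurable_fun setT (fun x : borel_space U => u x l 0).

(** The factor contributed by one step; the direction u(x) depends only on the state before the
    step, of which the noise of the step is independent. *)
Definition exp_factor (x : U) (z : V) : R :=
  expR (th * (\1_[set z : V | eta * enorm z <= del] z * \sum_l (u x l 0 * (eta * z l 0)))).

Hypothesis factor_le : forall x,
  (\int[distribution P (Z 0%N)]_z (exp_factor x z)%:E <= (1 + eta * tau)%:E)%E.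

Definition exp_functional j (z : nat -> V) x : R :=
  \prod_(i < j) exp_factor (X z eta x i) (z i.+1).

(** Noise is numbered from 1 and tuples from 0; index 0 receives the value of index 1 and is never
    read by the chain. *)
Definition shift_seq (t : seq V) (i : nat) : V := nth 0 t i.-1.

Lemma measurable_col disp' (Y : measurableType disp') n (f : Y -> 'cV[R]_n.+1) :
  (forall i, measurable_fun setT (fun y => f y i 0)) ->
  measurable_fun setT (f : Y -> borel_space 'cV[R]_n.+1).
Proof.
move=> mf; apply: (@measurable_col_cells _ _ _ n 'I_n.+1 (fun i y => f y i 0)) => //.
move=> y _ e e0; have n0 : (0 : R) < 2 * n.+1%:R by rewrite mulr_gt0.
exists (e / (2 * n.+1%:R)) => [|y' _ h]; first exact: divr_gt0.
apply: (@le_lt_trans _ _ (n.+1%:R * (e / (2 * n.+1%:R)))).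
  by apply: enorm_le_sum => i; rewrite !mxE; exact/ltW/h.
rewrite (_ : _ * _ = e / 2); first lra.
by field.
Qed.

Lemma measurable_exp_factor disp' (Y : measurableType disp') (x : Y -> U) (z : Y -> V) :
  (forall i, measurable_fun setT (fun y => x y i 0)) ->
  (forall i, measurable_fun setT (fun y => z y i 0)) ->
  measurable_fun setT (fun y => exp_factor (x y) (z y)).
Proof.
move=> mx mz; apply: measurableT_comp => //; apply: measurable_funM => //.
apply: measurable_funM.
  have mzz : measurable_fun setT (fun y => enorm (z y)).
    exact: (measurableT_comp (@measurable_enorm _ d) (measurable_col mz)).
  rewrite (_ : (fun y => _) = \1_[set y | eta * enorm (z y) <= del]); last by [].
  apply: measurable_indic; rewrite -[X in measurable X]setTI.
  have := measurable_funM (measurable_cst eta) mzz.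
  move=> /(_ measurableT `]-oo, del]%classic (measurable_itv _)).
  by congr measurable; rewrite !setTI; apply/seteqP; split => y; rewrite /= in_itv.
apply: measurable_sum => l; apply: measurable_funM; last by apply: measurable_funM.
exact: (measurableT_comp (mu l) (measurable_col mx)).
Qed.

Lemma exp_functional_ge0 j z x : 0 <= exp_functional j z x.
Proof. by apply: prodr_ge0 => i _; exact: expR_ge0. Qed.

Lemma eq_exp_functional j z z' x : (forall i, (0 < i <= j)%N -> z i = z' i) ->
  exp_functional j z x = exp_functional j z' x.
Proof.
move=> h; apply: eq_bigr => i _; have -> : z i.+1 = z' i.+1 by apply: h; rewrite /= ltn_ord.
have -> // : X z eta x i = X z' eta x i.
by apply: eq_chain => l /andP[l0 li]; apply: h; rewrite l0 (leq_trans li)// ltnW.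
Qed.

Lemma exp_functionalS j z x : exp_functional j.+1 z x =
  exp_factor x (z 1%N) * exp_functional j (fun i => z i.+1) (X z eta x 1%N).
Proof.
rewrite /exp_functional big_ord_recl; congr (_ * _); apply: eq_bigr => i _.
by rewrite -chain_shift.
Qed.

Lemma measurable_exp_functional disp' (Y : measurableType disp') j (z : nat -> Y -> V) x :
  (forall i l, (0 < i <= j)%N -> measurable_fun setT (fun y => z i y l 0)) ->
  measurable_fun setT (fun y => exp_functional j (fun i => z i y) x).
Proof.
move=> mz; apply: measurable_prod => i _; apply: measurable_exp_factor => [c|l].
  apply: (measurable_chain D0 aL sL b0) => // i' j' /andP[i0 ii].
  by apply: mz; rewrite i0 (leq_trans ii)// ltnW.
by apply: mz; rewrite /= ltn_ord.
Qed.

Lemma measurable_shift_seq j i l : measurable_fun setT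
  (fun t : j.-tuple (borel_space V) => (shift_seq t i : V) l 0).
Proof.
apply: (measurableT_comp (@measurable_coord _ _ l)).
have [ij|ij] := ltnP i.-1 j.
  rewrite (_ : (fun t : j.-tuple (borel_space V) => _) = fun t => tnth t (Ordinal ij)).
    exact: measurable_tnth.
  by apply/funext => t; rewrite (tnth_nth 0).
rewrite (_ : (fun t : j.-tuple (borel_space V) => _) = cst 0).
  exact: measurable_cst.
by apply/funext => t; rewrite /shift_seq nth_default// size_tuple.
Qed.

(** The supermartingale argument as an iterated integral: with the first noise fixed, the remaining
    product is that of the chain restarted after one step, bounded by induction uniformly in the
    starting point. *)
Lemma exp_functional_power j x :
  (\int[product_power (distribution P (Z 0%N)) (k:=j)]_t (exp_functional j (shift_seq t) x)%:E
    <= ((1 + eta * tau) ^+ j)%:E)%E.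
Proof.
have mexp j' x' : measurable_fun setT (fun t : j'.-tuple (borel_space V) => (exp_functional j' (shift_seq t) x')%:E).
  apply/measurable_EFinP; apply: (measurable_exp_functional (z := fun i (t : j'.-tuple (borel_space V)) => shift_seq t i)).
  by move=> i l _; exact: measurable_shift_seq.
elim: j x => [|j IH] x.
  by rewrite integral_product_power0// /exp_functional big_ord0 expr0.
rewrite integral_product_powerS//; last by move=> t; rewrite lee_fin exp_functional_ge0.
apply: (@le_trans _ _ (\int[distribution P (Z 0%N)]_z ((1 + eta * tau) ^+ j * exp_factor x z)%:E)%E).
  apply: ge0_le_integral_set => z.
    by apply: integral_ge0 => t _; rewrite lee_fin exp_functional_ge0.
  rewrite (eq_integral (fun t : j.-tuple (borel_space V) => (exp_factor x z)%:E *
    (exp_functional j (shift_seq t) (x + clip b (eta *: a x + eta *: (sigma x *m (z : V)))))%:E)%E); last first.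
    move=> t _; rewrite -EFinM exp_functionalS /=; congr (_ * _)%:E.
    by apply: eq_exp_functional => -[|i]// _.
  rewrite ge0_integralZl_EFin.
  - by rewrite muleC EFinM; apply: lee_wpmul2r; [rewrite lee_fin expR_ge0|exact: IH].
  - exact: measurableT.
  - by move=> t _; rewrite lee_fin exp_functional_ge0.
  - exact: mexp.
  - exact: expR_ge0.
under eq_integral do rewrite EFinM.
rewrite ge0_integralZl_EFin//.
- rewrite exprSr EFinM; apply: lee_wpmul2l; last exact: factor_le.
  by rewrite lee_fin exprn_ge0// addr_ge0// mulr_ge0.
- by move=> z _; rewrite lee_fin expR_ge0.
- apply/measurable_EFinP; apply: measurable_exp_factor; first by move=> i; exact: measurable_cst.
  by move=> i; exact: measurable_coord.
- by rewrite exprn_ge0// addr_ge0// mulr_ge0.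
Qed.

Lemma exp_functional_expect j x :
  (\int[P]_w (exp_functional j (fun i => Z i w) x)%:E <= ((1 + eta * tau) ^+ j)%:E)%E.
Proof.
apply: le_trans (exp_functional_power j x).
pose s : j.-tuple nat := [tuple of iota 1 j].
have us : uniq s by rewrite iota_uniq.
rewrite -(expect_sample Ziid us).
- rewrite le_eqVlt; apply/orP; left; apply/eqP; apply: eq_integral => w _; congr EFin.
  apply: eq_exp_functional => i /andP[i0 ij]; rewrite /shift_seq.
  have ij' : (i.-1 < j)%N by rewrite prednK.
  rewrite (_ : i.-1 = Ordinal ij')// -(tnth_nth 0) tnth_mktuple (tnth_nth 0%N) /= nth_iota// add1n prednK//.
- apply/measurable_EFinP; apply: (measurable_exp_functional (z := fun i (t : j.-tuple (borel_space V)) => shift_seq t i)).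
  by move=> i l _; exact: measurable_shift_seq.
- by move=> t; rewrite lee_fin exp_functional_ge0.
Qed.

End exponential_functional.

Section concentration.
Context {R : realType} disp (Omega : measurableType disp) (P : probability Omega R) (m d : nat).
Variables (Z : nat -> {RV P >-> borel_space 'cV[R]_d.+1}) (alpha : R).
Variable S : probability (borel_space (sphere R d)) R.
Hypothesis Ziid : iid Z.
Hypothesis alpha1 : 1 < alpha.
Hypothesis RV : mv_regularly_varying P (Z 0%N) alpha S.
Hypothesis Zc : centered P (Z 0%N).
Variables (a : 'cV[R]_m.+1 -> 'cV[R]_m.+1) (sigma : 'cV[R]_m.+1 -> 'M[R]_(m.+1, d.+1)).
Variables (D b T : R).
Hypothesis D0 : 0 <= D.
Hypothesis aL : forall x y, enorm (a x - a y) <= D * enorm (x - y).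
Hypothesis sL : forall x y, opnorm (sigma x - sigma y) <= D * enorm (x - y).
Hypothesis b0 : 0 < b.
Hypothesis T0 : 0 < T.
Local Notation X := (chain a sigma b).
Local Notation V := 'cV[R]_d.+1.
Local Notation U := 'cV[R]_m.+1.
Variable M0 : R.
Hypothesis M00 : 0 <= M0.

(** The direction whose inner product with z is, up to sign, the coordinate c of sigma(x) z; it is
    set to zero outside the ball of radius M0. *)
Definition signed_row (s : bool) (c : 'I_m.+1) (x : U) : V :=
  ((-1) ^+ s * (enorm x <= M0)%R%:R) *: (row c (sigma x))^T.

Let Sg := opnorm (sigma 0) + D * M0 + 1.

Lemma signed_row_le s c x : enorm (signed_row s c x) <= Sg.
Proof.
have Sg0 : 0 <= opnorm (sigma 0) + D * M0 by rewrite addr_ge0 ?opnorm_ge0// mulr_ge0.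
rewrite /signed_row enormZ normrM normrX normrN1 expr1n mul1r.
have [xM|_] := boolP (enorm x <= M0); last by rewrite normr0 mul0r ltW// ltr_wpDl.
rewrite normr1 mul1r; apply: (@le_trans _ _ (opnorm (sigma x))); last first.
  apply: le_trans (sigma_le sL x 0) _; rewrite subr0 /Sg.
  have := ler_wpM2l D0 xM; lra.
set v := (row c (sigma x))^T.
have [v0|v0] := eqVneq v 0; first by rewrite v0 enorm0 opnorm_ge0.
rewrite -(ler_pM2r (_ : 0 < enorm v)) ?enorm_gt0//; apply: le_trans (opnormP _ _).
apply: le_trans (entry_le_enorm _ c); apply: le_trans (ler_norm _).
rewrite -expr2 enorm_sqr mxE le_eqVlt; apply/orP; left; apply/eqP.
by apply: eq_bigr => l _; rewrite /v !mxE expr2.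
Qed.

Lemma measurable_signed_row s c l :
  measurable_fun setT (fun x : borel_space U => signed_row s c x l 0).
Proof.
rewrite (_ : (fun x : borel_space U => _) = fun x : borel_space U =>
    (-1) ^+ s * \1_[set y : U | enorm y <= M0] (x : U) * sigma x c l); last first.
  apply/funext => x; rewrite /signed_row !mxE indicE; congr (_ * _ * _).
  by case: (boolP (enorm (x : U) <= M0)) => h; [rewrite mem_set|rewrite memNset//; apply/negP].
apply: measurable_funM.
  apply: measurable_funM; first exact: measurable_cst.
  apply: measurable_indic; rewrite -[X in measurable X]setTI.
  have := @measurable_enorm R m; move=> /(_ measurableT `]-oo, M0]%classic (measurable_itv _)).
  by congr measurable; rewrite !setTI; apply/seteqP; split => y; rewrite /= in_itv.
apply: (@continuous_borel R U (fun x => sigma x c l)); apply: enorm_continuous => x e e0.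
have D1 : 0 < D + 1 by rewrite ltr_wpDl.
exists (e / (D + 1)) => [|y h]; first exact: divr_gt0.
apply: (@le_trans _ _ (opnorm (sigma x - sigma y))); last first.
  apply: le_trans (sL _ _) _; apply: (@le_trans _ _ ((D + 1) * (e / (D + 1)))).
    by apply: ler_pM => //; [exact: enorm_ge0|rewrite lerDl].
  by rewrite mulrC divfK// gt_eqF.
have -> : sigma x c l - sigma y c l = ((sigma x - sigma y) *m (delta_mx l 0 : V)) c 0.
  rewrite mxE (bigD1 l)//= big1 ?addr0; first by rewrite !mxE !eqxx mulr1.
  by move=> j jl; rewrite !mxE (negbTE jl) mulr0.
apply: le_trans (entry_le_enorm _ c) _; apply: le_trans (opnormP _ _) _.
rewrite ler_piMr ?opnorm_ge0// /enorm (bigD1 l)//= big1.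
  by rewrite mxE !eqxx expr1n addr0 sqrtr1.
by move=> j jl; rewrite mxE (negbTE jl) expr0n.
Qed.

Lemma exp_functional_sum (th del eta : R) s c j (z : nat -> V) x : 0 < eta ->
  exp_functional a sigma b (signed_row s c) th del eta j z x =
  expR (th * ((-1) ^+ s * (\sum_(0 <= i < j | (enorm (eta *: z i.+1) <= del) && (enorm (X z eta x i) <= M0))
     eta *: (sigma (X z eta x i) *m z i.+1)) c 0)).
Proof.
move=> eta0; rewrite summxE mulr_sumr mulr_sumr big_mkcond big_mkord expR_sum; apply: eq_bigr => i _.
rewrite /exp_factor indicE enormZ gtr0_norm//; set A := [set z0 | _].
have -> : (z i.+1 \in A) = (eta * enorm (z i.+1) <= del).
  by apply/idP/idP => [/set_mem|h]//; exact: mem_set.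
case: ifPn => [/andP[-> h2]|]; last first.
  rewrite negb_and => /orP[/negbTE ->|/negbTE h]; first by rewrite mul0r mulr0.
  by rewrite big1 ?mulr0// => l _; rewrite /signed_row h !mxE mulr0 !mul0r.
congr (expR (th * _)); rewrite mul1r /signed_row h2 mulr1 [in RHS]mxE [in RHS]mxE !mulr_sumr.
by apply: eq_bigr => l _; rewrite !mxE; ring.
Qed.

(** A union bound over times, coordinates and signs. The exceptional event enters through a
    measurable majorant G, a sum of Chernoff exponentials, so its own measurability is never at
    stake. *)
Lemma concentration (rho : R) (N : nat) : 0 < rho -> exists2 del0 : R, 0 < del0 &
  forall del, 0 < del -> del <= del0 -> \forall eta \near 0^'+, forall x, exists G : Omega -> R,
    [/\ measurable_fun setT G, forall w, 0 <= G w,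
      forall w, ~ small_noise a sigma b (fun i => Z i w) eta x M0 del rho (Num.truncn (T / eta)) -> 1 <= G w &
      (\int[P]_w (G w)%:E <= (eta ^+ N)%:E)%E].
Proof.
move=> rho0.
have Sg0 : 0 < Sg by rewrite /Sg ltr_wpDl// addr_ge0 ?opnorm_ge0// mulr_ge0.
(* If all coordinates are at most [rho'] in absolute value, the Euclidean norm is at most rho /
   2. *)
pose rho' := rho / (2 * m.+1%:R); have rho'0 : 0 < rho' by rewrite divr_gt0// mulr_gt0.
(* Two powers of eta are spare: one for the number of terms, of order 1 / eta, the other for the
   constant [K]. *)
have [del0 del00 hdel] := chernoff_step alpha1 RV Zc N.+2 Sg0 T0 rho'0.
exists del0 => // del dl0 dd; have hc := hdel del dl0 dd.
pose K : R := 2 * m.+1%:R * (T + 1); have K0 : 0 < K by rewrite !mulr_gt0// ltr_wpDl// ltW.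
have Ki : 0 < Num.min 1 K^-1 by rewrite lt_min ltr01 invr_gt0.
near=> eta => x.
have eta0 : 0 < eta by near: eta; exact: nbhs_right_gt.
have etaK : eta <= Num.min 1 K^-1 by near: eta; exact: nbhs_right_le.
have eta1 : eta <= 1 by apply: le_trans etaK _; rewrite ge_min lexx.
have etaK1 : eta * K <= 1 by rewrite -ler_pdivlMr// div1r; apply: le_trans etaK _; rewrite ge_min lexx orbT.
have [th [tau [th0 tau0 hu ht]]] : exists th tau : R,
    [/\ 0 <= th, 0 <= tau, forall u : V, enorm u <= Sg ->
        (\int[P]_w (expR (th * (\1_[set w | eta * enorm (Z 0%N w : V) <= del] w * \sum_l (u l 0 * (eta * (Z 0%N w : V) l 0)))))%:E
           <= (1 + eta * tau)%:E)%E &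
      expR (T * tau - th * rho') <= eta ^+ N.+2] by near: eta; exact: hc.
set n := Num.truncn (T / eta).
have nT : eta * n%:R <= T.
  by rewrite mulrC -ler_pdivlMr//; have /truncn_itv/andP[] // : 0 <= T / eta by rewrite divr_ge0// ltW.
pose psi (q : 'I_n.+1 * 'I_m.+1 * bool) w :=
  exp_functional a sigma b (signed_row q.2 q.1.2) th del eta q.1.1 (fun i => Z i w) x.
have mpsi q : measurable_fun setT (psi q).
  apply: (measurable_exp_functional D0 aL sL b0 _ _ _ _ (z := fun i w => Z i w)).
  - exact: ltW.
  - by move=> l; exact: measurable_signed_row.
  - by move=> i l _; apply: (measurableT_comp (@measurable_coord _ _ l)); exact: measurable_funPT.
pose cst := expR (- (th * rho')); have cst0 : 0 <= cst by exact: expR_ge0.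
exists (fun w => \sum_q cst * psi q w); split.
- by apply: measurable_sum => q; apply: measurable_funM.
- by move=> w; apply: sumr_ge0 => q _; rewrite mulr_ge0// exp_functional_ge0.
- move=> w /existsNP[j /not_implyP[jn]] /negP; rewrite -ltNge; set v := \sum_(_ <= _ < _ | _) _ => big.
  have [c hc1] : exists c, rho' < `|v c 0|.
    apply: contrapT => /forallNP h; move: big; apply/negP; rewrite -leNgt.
    apply: le_trans (enorm_le_sum (c := rho') _) _.
      by move=> c; rewrite leNgt; apply/negP; exact: h.
    rewrite /rho' (_ : _ * _ = rho / 2); first lra.
    by field.
  pose s := v c 0 < 0.
  have hs : rho' <= (-1) ^+ s * v c 0.
    rewrite /s; have [h|h] := ltP (v c 0) 0.
      by rewrite expr1 mulN1r -(ltr0_norm h) ltW.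
    by rewrite expr0 mul1r -(ger0_norm h) ltW.
  rewrite (bigD1 (Ordinal (jn : (j < n.+1)%N), c, s))//=.
  apply: (@le_trans _ _ (cst * psi (Ordinal (jn : (j < n.+1)%N), c, s) w)); last first.
    by rewrite lerDl; apply: sumr_ge0 => q _; rewrite mulr_ge0// exp_functional_ge0.
  rewrite /psi /= exp_functional_sum// /cst -expRD -[leLHS]expR0 ler_expR.
  by rewrite addrC subr_ge0 ler_wpM2l.
rewrite (eq_integral (fun w => (\sum_q (cst * psi q w)%:E)%E)); last by move=> w _; rewrite sumEFin.
rewrite ge0_integral_sum//; last 2 first.
- by move=> q; apply/measurable_EFinP; apply: measurable_funM.
- by move=> q w _; rewrite lee_fin mulr_ge0// exp_functional_ge0.
apply: (@le_trans _ _ (\sum_(q : 'I_n.+1 * 'I_m.+1 * bool) (eta ^+ N.+2)%:E)%E).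
  apply: lee_sum => q _; under eq_integral do rewrite EFinM.
  rewrite ge0_integralZl_EFin//; last 2 first.
  - by move=> w _; rewrite lee_fin exp_functional_ge0.
  - by apply/measurable_EFinP.
  apply: (@le_trans _ _ (cst%:E * ((1 + eta * tau) ^+ q.1.1)%:E)%E).
    apply: lee_wpmul2l => //.
    apply: (exp_functional_expect Ziid D0 aL sL b0 (ltW eta0) tau0) => [l|y].
      exact: measurable_signed_row.
    have mf : measurable_fun setT (fun z : borel_space V => (exp_factor (signed_row q.2 q.1.2) th del eta y z)%:E).
      apply/measurable_EFinP; apply: measurable_exp_factor => [l|i|i].
      - exact: measurable_signed_row.
      - exact: measurable_cst.
      - exact: measurable_coord.
    have f0 : {in [set: borel_space V], forall z, (0 <= (exp_factor (signed_row q.2 q.1.2) th del eta y (z : V))%:E)%E}.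
      by move=> z _; rewrite lee_fin expR_ge0.
    rewrite (ge0_integral_pushforward (measurable_funPT (Z 0%N)) P measurableT mf f0).
    exact: (hu _ (signed_row_le q.2 q.1.2 y)).
  rewrite -EFinM lee_fin; apply: le_trans ht; rewrite [T * tau - _]addrC expRD -/cst ler_wpM2l//.
  apply: (@le_trans _ _ (expR (eta * tau * (q.1.1)%:R))); first by apply: expr_le_expR; rewrite mulr_ge0// ltW.
  rewrite ler_expR mulrAC ler_wpM2r//; apply: le_trans nT; rewrite ler_wpM2l ?(ltW eta0)// ler_nat -ltnS.
  exact: ltn_ord.
rewrite sumEFin lee_fin sumr_const !card_prod !card_ord card_bool -mulr_natl.
rewrite -[N.+2]addn2 exprD mulrCA ler_piMr ?exprn_ge0 ?(ltW eta0)//.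
rewrite !natrM; apply: le_trans etaK1.
have : eta * n.+1%:R <= T + 1 by rewrite -natr1 mulrDr mulr1 lerD.
move=> h; rewrite expr2 [leLHS](_ : _ = eta * (2 * m.+1%:R) * (eta * n.+1%:R)); last ring.
by rewrite /K [leRHS]mulrA ler_wpM2l// mulr_ge0// ltW.
Unshelve. all: by end_near. Qed.

End concentration.

(** * Expectation bounds, probabilities of large marks and counting of times *)

Section expectation_bounds.
Context {R : realType} disp (Omega : measurableType disp) (P : {measure set Omega -> \bar R}).
Implicit Types (u v : Omega -> R) (c e : R).

Definition expect_le u c :=
  [/\ measurable_fun setT u, forall w, 0 <= u w & (\int[P]_w (u w)%:E <= c%:E)%E].

Lemma expect_leD u v c e : expect_le u c -> expect_le v e -> expect_le (fun w => u w + v w) (c + e).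
Proof.
move=> [mu u0 uc] [mv v0 ve]; split; first exact: measurable_funD.
  by move=> w; exact: addr_ge0.
under eq_integral do rewrite EFinD.
rewrite ge0_integralD//.
- by rewrite EFinD; exact: leeD.
- by move=> w _; rewrite lee_fin.
- by apply/measurable_EFinP.
- by move=> w _; rewrite lee_fin.
- by apply/measurable_EFinP.
Qed.

Lemma expect_leZ u c e : 0 <= e -> expect_le u c -> expect_le (fun w => e * u w) (e * c).
Proof.
move=> e0 [mu u0 uc]; split; first exact: measurable_funM.
  by move=> w; exact: mulr_ge0.
under eq_integral do rewrite EFinM.
rewrite ge0_integralZl_EFin//; first by rewrite EFinM; exact: lee_wpmul2l.
- by move=> w _; rewrite lee_fin.
- by apply/measurable_EFinP.
Qed.

Lemma expect_le0 : expect_le (fun=> 0) 0.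
Proof. by split => //; rewrite integral0. Qed.

Lemma expect_le_sum (I : Type) (s : seq I) (p : pred I) (F : I -> Omega -> R) (c : I -> R) :
  (forall i, p i -> expect_le (F i) (c i)) ->
  expect_le (fun w => \sum_(i <- s | p i) F i w) (\sum_(i <- s | p i) c i).
Proof.
move=> h; elim: s => [|i s IH].
  by under eq_fun do rewrite big_nil; rewrite big_nil; exact: expect_le0.
under eq_fun do rewrite big_cons; rewrite big_cons.
by case: ifP => // pi; apply: expect_leD => //; exact: h.
Qed.

Lemma expect_le_indic (E : set Omega) c : measurable E -> (P E <= c%:E)%E -> expect_le (\1_E) c.
Proof. by move=> mE Ec; split => //; rewrite integral_indic// setIT. Qed.

Lemma expect_dist u v g c : measurable_fun setT u -> measurable_fun setT v ->
  (forall w, 0 <= u w) -> (forall w, 0 <= v w) ->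
  (\int[P]_w (u w)%:E < +oo)%E -> (\int[P]_w (v w)%:E < +oo)%E ->
  expect_le g c -> (forall w, `|u w - v w| <= g w) ->
  `|fine (\int[P]_w (u w)%:E)%E - fine (\int[P]_w (v w)%:E)%E| <= c.
Proof.
have step u1 v1 : measurable_fun setT v1 ->
    (forall w, 0 <= u1 w) -> (forall w, 0 <= v1 w) ->
    (\int[P]_w (u1 w)%:E < +oo)%E -> (\int[P]_w (v1 w)%:E < +oo)%E ->
    expect_le g c -> (forall w, `|u1 w - v1 w| <= g w) ->
    fine (\int[P]_w (u1 w)%:E)%E <= fine (\int[P]_w (v1 w)%:E)%E + c.
  move=> mv u0 v0 uoo voo [mg g0 gc] uv.
  have fu : (\int[P]_w (u1 w)%:E)%E \is a fin_num.
    by rewrite ge0_fin_numE// integral_ge0// => w _; rewrite lee_fin.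
  have fv : (\int[P]_w (v1 w)%:E)%E \is a fin_num.
    by rewrite ge0_fin_numE// integral_ge0// => w _; rewrite lee_fin.
  rewrite -lee_fin EFinD !fineK//; apply: le_trans (leeD (lexx _) gc).
  rewrite -ge0_integralD//.
  - apply: ge0_le_integral_set => w; rewrite -?EFinD lee_fin//.
    by have := uv w; rewrite ler_norml => /andP[_]; rewrite lerBlDl.
  - by move=> w _; rewrite lee_fin.
  - by apply/measurable_EFinP.
  - by move=> w _; rewrite lee_fin.
  - by apply/measurable_EFinP.
move=> mu mv u0 v0 uoo voo hg uv; rewrite ler_norml lerBlDl step// andbT.
by rewrite lerNl opprB lerBlDl step// => w; rewrite distrC.
Qed.

End expectation_bounds.

Section rectangle_law.
Context {R : realType} disp (Omega : measurableType disp) (P : probability Omega R) (d : nat).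
Variable Z : nat -> {RV P >-> borel_space 'cV[R]_d.+1}.
Hypothesis Ziid : iid Z.

Lemma prob_rect k (s : k.-tuple nat) (B : k.-tuple (set (borel_space 'cV[R]_d.+1))) : uniq s ->
  (forall j, measurable (tnth B j)) ->
  measurable [set w | forall j, tnth B j (Z (tnth s j) w)] /\
  P [set w | forall j, tnth B j (Z (tnth s j) w)] = (\prod_j P (Z 0%N @^-1` tnth B j))%E.
Proof.
move=> us mB.
have -> : [set w | forall j, tnth B j (Z (tnth s j) w)] =
    sample Z s @^-1` [set t : k.-tuple (borel_space 'cV[R]_d.+1) | forall i, tnth B i (tnth t i)].
  by apply/seteqP; split => w /= h j; have := h j; rewrite tnth_mktuple.
split.
  rewrite -[X in measurable X]setTI; apply: (measurable_sample Z s) => //; exact: measurable_rect.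
by rewrite (law_sample Ziid us) ?product_power_prod//; exact: measurable_rect.
Qed.

Lemma prob_large k (s : k.-tuple nat) (eta : R) (c : 'I_k -> R) : uniq s -> 0 < eta ->
  measurable [set w | forall j, c j < enorm (eta *: (Z (tnth s j) w : 'cV[R]_d.+1))] /\
  P [set w | forall j, c j < enorm (eta *: (Z (tnth s j) w : 'cV[R]_d.+1))] =
  (\prod_j norm_tail P (Z 0%N) (c j / eta))%:E.
Proof.
move=> us eta0.
pose B : k.-tuple (set (borel_space 'cV[R]_d.+1)) :=
  [tuple [set z : borel_space 'cV[R]_d.+1 | c j / eta < enorm (z : 'cV[R]_d.+1)] | j < k].
have mB j : measurable (tnth B j).
  rewrite tnth_mktuple -[X in measurable X]setTI; have := @measurable_enorm R d.
  by move=> /(_ measurableT `]c j / eta, +oo[%classic (measurable_itv _)); rewrite set_itvE.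
have -> : [set w | forall j, c j < enorm (eta *: (Z (tnth s j) w : 'cV[R]_d.+1))] =
    [set w | forall j, tnth B j (Z (tnth s j) w)].
  by apply/seteqP; split => w /= h j; have := h j; rewrite tnth_mktuple /= ltr_pdivrMr// enormZ gtr0_norm// mulrC.
have [h1 h2] := prob_rect us mB; split => //; rewrite h2 -prodEFin.
by apply: eq_bigr => j _; rewrite tnth_mktuple; exact: norm_tailE.
Qed.

End rectangle_law.

Section time_count.
Context {R : realType} (T : R).
Implicit Types (eta l g s : R).

Lemma grid_count eta l g n : 0 < eta -> 0 <= g ->
  eta * \sum_(i < n) ((l < eta * i.+1%:R) && (eta * i.+1%:R <= l + g))%:R <= g + eta.
Proof.
(* Clamping to [l - eta, l + g] turns the count into a telescoping sum: each counted index increases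
   [phi] by eta. *)
move=> eta0 g0; pose phi (t : R) := Num.max (l - eta) (Num.min (l + g) t).
have phi_le s t : s <= t -> phi s <= phi t.
  move=> st; rewrite /phi ge_max le_max lexx /= le_max; apply/orP; right.
  by rewrite le_min !ge_min lexx st orbT.
rewrite mulr_sumr; apply: (@le_trans _ _ (\sum_(0 <= i < n) (phi (eta * i.+1%:R) - phi (eta * i%:R)))).
  rewrite big_mkord; apply: ler_sum => i _; case: (boolP (_ && _)) => [/andP[h1 h2]|_].
    rewrite mulr1 /phi.
    have e : eta * i.+1%:R = eta * i%:R + eta by rewrite -natr1 mulrDr mulr1.
    have p1 : Num.min (l + g) (eta * i.+1%:R) = eta * i.+1%:R by rewrite min_r.
    have p2 : Num.min (l + g) (eta * i%:R) = eta * i%:R by rewrite min_r//; lra.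
    rewrite p1 p2 !max_r; lra.
  by rewrite mulr0 subr_ge0 phi_le// ler_wpM2l ?(ltW eta0)// ler_nat.
rewrite telescope_sumr//.
have : phi (eta * n%:R) <= l + g by rewrite /phi ge_max ge_min lexx andbT; lra.
have : l - eta <= phi (eta * 0%:R) by rewrite /phi le_max lexx.
lra.
Qed.

(** A tuple that is not separated has its first time near s0 or near T, which has density O(g +
    eta), or fails to be separated in its later times, to which the induction applies. *)
Lemma clustered_count eta g n k (s0 : R) : 0 < T -> 0 < eta -> 0 <= g -> eta * n%:R <= T ->
  eta ^+ k * \sum_(I : k.-tuple 'I_n)
    (path <%R s0 [seq eta * (val i).+1%:R | i <- I] &&
     ~~ separated T g s0 [seq eta * (val i).+1%:R | i <- I])%:R <= k%:R * (2 * (g + eta)) * (1 + T) ^+ k.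
Proof.
move=> T0 eta0 g0 nT; elim: k s0 => [|k IH] s0.
  rewrite big1 ?mulr0 ?mul0r// => I _; rewrite (tuple0 I) /=.
  by [].
pose sep s (I : seq 'I_n) := path <%R s [seq eta * (val i).+1%:R | i <- I] &&
     ~~ separated T g s [seq eta * (val i).+1%:R | i <- I].
pose c1 (i : 'I_n) : R := ((s0 < eta * i.+1%:R) && (eta * i.+1%:R <= s0 + g))%:R.
pose c2 (i : 'I_n) : R := ((T - g < eta * i.+1%:R) && (eta * i.+1%:R <= T - g + g))%:R.
have -> : \sum_(I : k.+1.-tuple 'I_n) (sep s0 I)%:R =
    \sum_(i < n) \sum_(I : k.-tuple 'I_n) (sep s0 (cons_tuple i I))%:R :> R.
  by rewrite (iterate_sum (fun I : k.+1.-tuple 'I_n => (sep s0 I)%:R)) /=; apply: eq_bigr => i _; rewrite -iterate_sum.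
apply: (@le_trans _ _ (eta ^+ k.+1 * \sum_(i < n) ((c1 i + c2 i) * n%:R ^+ k +
    \sum_(I : k.-tuple 'I_n) (sep (eta * i.+1%:R) I)%:R))).
  rewrite ler_wpM2l ?exprn_ge0 ?(ltW eta0)//; apply: ler_sum => i _.
  have -> : (c1 i + c2 i) * n%:R ^+ k = \sum_(I : k.-tuple 'I_n) (c1 i + c2 i).
    by rewrite sumr_const card_tuple card_ord -[RHS]mulr_natr natrX.
  rewrite -big_split; apply: ler_sum => I _ /=; rewrite /sep /= !negb_and.
  case: (boolP (s0 < eta * i.+1%:R)) => [h1|]; last by rewrite /= !addr_ge0.
  case: (boolP (path _ _ _)) => [h2|]; last by rewrite /= !addr_ge0.
  rewrite !andTb.
  have iT : eta * i.+1%:R <= T by apply: le_trans nT; rewrite ler_wpM2l ?(ltW eta0)// ler_nat.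
  have [h3|h3] := leP g (eta * i.+1%:R - s0); last first.
    rewrite (_ : c1 i = 1); last by rewrite /c1 (_ : (_ && _) = true)//; apply/andP; split; lra.
    rewrite /=.
    by rewrite -addrA lerDl addr_ge0.
  have [h4|h4] := leP g (T - eta * i.+1%:R); last first.
    rewrite (_ : c2 i = 1); last by rewrite /c2 (_ : (_ && _) = true)//; apply/andP; split; lra.
    by rewrite /= addrAC lerDr addr_ge0.
  by rewrite /= lerDr addr_ge0.
rewrite big_split /= -mulr_suml big_split /= mulrDr.
rewrite (_ : k.+1%:R * (2 * (g + eta)) * (1 + T) ^+ k.+1 =
  2 * (g + eta) * (1 + T) ^+ k.+1 + k%:R * (2 * (g + eta)) * (1 + T) ^+ k.+1); last first.
  by rewrite -natr1; ring.
apply: lerD.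
  have := lerD (grid_count s0 n eta0 g0) (grid_count (T - g) n eta0 g0); rewrite -/c1 -/c2 -mulrDr => h.
  rewrite exprS [leLHS](_ : _ = (eta * (\sum_(i < n) c1 i + \sum_(i < n) c2 i)) * (eta * n%:R) ^+ k); last first.
    by rewrite exprMn; ring.
  have nT0 : 0 <= eta * n%:R by rewrite mulr_ge0// ltW.
  apply: ler_pM.
  - by rewrite mulr_ge0 ?(ltW eta0)// addr_ge0// sumr_ge0.
  - exact: exprn_ge0.
  - by apply: le_trans h _; lra.
  - rewrite exprS; apply: (@le_trans _ _ ((1 + T) ^+ k)).
      by apply: lerXn2r; rewrite ?nnegrE//; lra.
    by rewrite ler_peMl ?exprn_ge0//; lra.
rewrite exprS -mulrA mulr_sumr.
apply: (@le_trans _ _ (eta * \sum_(i < n) (k%:R * (2 * (g + eta)) * (1 + T) ^+ k))).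
  by rewrite ler_wpM2l ?(ltW eta0)//; apply: ler_sum => i _; exact: IH.
rewrite sumr_const card_ord -[_ *+ n]mulr_natl mulrA exprS [leRHS]mulrCA; apply: ler_wpM2r; last lra.
by rewrite !mulr_ge0 ?exprn_ge0//; lra.
Qed.

End time_count.

Lemma sum4_le {R : realType} (a b c d s : R) : a <= s -> b <= s -> c <= s -> d <= s -> a + b + c + d <= 4 * s.
Proof. lra. Qed.

Lemma five_eighths {R : realType} (e : R) : e / 8 + e / 8 + (e / 8 + (e / 8 + e / 8)) <= 5 * (e / 8).
Proof. lra. Qed.

Lemma seven_eighths {R : realType} (e : R) : 0 < e -> 5 * (e / 8) + e / 8 + e / 8 <= e.
Proof. lra. Qed.

Lemma separated_le {R : realType} (T g g' s : R) us : g' <= g -> separated T g s us -> separated T g' s us.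
Proof.
move=> gg; elim: us s => [//|u us IH] s /= /and3P[h1 h2 h3].
by rewrite (le_trans gg h1) (le_trans gg h2) IH.
Qed.

(** * The limit for Lipschitz functionals *)

Section lipschitz_limit.
Context {R : realType} disp (Omega : measurableType disp) (P : probability Omega R) (m d : nat).
Variables (Z : nat -> {RV P >-> borel_space 'cV[R]_d.+1}) (alpha : R).
Variable S : probability (borel_space (sphere R d)) R.
Hypothesis Ziid : iid Z.
Hypothesis alpha1 : 1 < alpha.
Hypothesis RV : mv_regularly_varying P (Z 0%N) alpha S.
Hypothesis Zc : centered P (Z 0%N).
Variables (a : 'cV[R]_m.+1 -> 'cV[R]_m.+1) (sigma : 'cV[R]_m.+1 -> 'M[R]_(m.+1, d.+1)).
Variables (D b T : R).
Hypothesis D0 : 0 <= D.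
Hypothesis aL : forall x y, enorm (a x - a y) <= D * enorm (x - y).
Hypothesis sL : forall x y, opnorm (sigma x - sigma y) <= D * enorm (x - y).
Hypothesis b0 : 0 < b.
Hypothesis T0 : 0 < T.
Variables (k : nat) (r eps rd : R) (A : set 'cV[R]_m.+1).
Hypothesis r0 : 0 <= r.
Hypothesis Ar : forall x, A x -> enorm x <= r.
Hypothesis eps0 : 0 < eps.
Hypothesis rd0 : 0 < rd.
Variables (f : skorokhod T m.+1 -> R) (B Lf : R).
Hypothesis fB : forall y, 0 <= f y <= B.
Hypothesis fL : forall y y', `|f y - f y'| <= Lf * mdist y y'.
Hypothesis f_off : forall zeta y, jump_paths_pred a sigma b T k A eps zeta ->
  mdist zeta y <= rd -> f y = 0.
Local Notation V := 'cV[R]_d.+1.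
Local Notation H := (norm_tail P (Z 0%N)).
Local Notation h := (h_map a sigma b T).
Local Notation Xp eta x := (fun w => chain_path a sigma b T (fun i => Z i w) eta x).
Local Notation F_ := (@trunc_fun R m.+1 d a sigma b T k f).

Let B0 : 0 <= B. Proof. by have /andP[h1 h2] := fB point; exact: le_trans h2. Qed.
Let H0 x : 0 <= H x. Proof. exact: norm_tail_ge0. Qed.

Definition noise_index n (I : k.-tuple 'I_n) : k.-tuple nat := [tuple (tnth I j).+1 | j < k].

Lemma mark_vals_noise n eta (I : k.-tuple 'I_n) w :
  mark_vals (fun i => Z i w) eta I = [tuple eta *: (Z (tnth (noise_index I) j) w : V) | j < k].
Proof. by apply: eq_from_tnth => j; rewrite !tnth_mktuple. Qed.

Lemma uniq_succ n q (I : q.-tuple 'I_n) : uniq I -> uniq [tuple (tnth I j).+1 | j < q].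
Proof.
rewrite (mktuple_map (fun i : 'I_n => i.+1)) /= map_inj_uniq// => i j /succn_inj; exact: val_inj.
Qed.

Lemma ord_sorted_uniq n (s : seq 'I_n) : ord_sorted s -> uniq s.
Proof.
move=> ss; apply: (sorted_uniq _ _ ss) => [i j l|i] /=; first exact: ltn_trans.
by rewrite ltnn.
Qed.

Lemma measurable_path eta x : 0 < eta ->
  measurable_fun setT (Xp eta x : Omega -> borel_space (skorokhod T m.+1)).
Proof.
move=> eta0; have mZ (i : nat) (j : 'I_d.+1) : measurable_fun setT (fun w => (Z i w : V) j 0).
  by apply: (measurableT_comp (@measurable_coord _ _ j)); exact: measurable_funPT.
exact: (@measurable_chain_path R m d a sigma D b T D0 aL sL b0 T0 _ Omega (fun i w => Z i w) eta x eta0 mZ).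
Qed.

Lemma lipschitz_measurable : measurable_fun setT (f : borel_space (skorokhod T m.+1) -> R).
Proof.
apply: (@continuous_borel R); apply: metric_continuous => y e e0.
have K0 : 0 < `|Lf| + 1 by rewrite ltr_wpDl.
exists (e / (`|Lf| + 1)) => [|y' yy']; first exact: divr_gt0.
apply: le_trans (fL _ _) _; apply: (@le_trans _ _ ((`|Lf| + 1) * (e / (`|Lf| + 1)))).
  apply: (@le_trans _ _ ((`|Lf| + 1) * mdist y y')).
    by rewrite ler_wpM2r ?mdist_ge0//; apply: le_trans (ler_norm _) _; rewrite lerDl.
  by rewrite ler_wpM2l// 1?ltW.
by rewrite mulrC divfK// gt_eqF.
Qed.

Lemma measurable_functional eta x : 0 < eta -> measurable_fun setT (fun w => f (Xp eta x w)).
Proof. by move=> eta0; exact: (measurableT_comp lipschitz_measurable (measurable_path x eta0)). Qed.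

Section truncated.
Variables (N delbar : R) (x' : 'cV[R]_m.+1).
Hypothesis N1 : 1 <= N.
Hypothesis db0 : 0 < delbar.
Hypothesis Ax' : A x'.
Hypothesis van : forall x (W : k.-tuple V) (t : k.-tuple R) j, A x -> increasing_times `]0, T] t ->
  enorm (tnth W j) <= delbar -> f (h x W t) = 0.

Lemma measurable_mark_functional n eta (I : k.-tuple 'I_n) : 0 < eta ->
  measurable_fun setT (fun w => F_ N x' (mark_vals (fun i => Z i w) eta I) (mark_times eta I)).
Proof.
move=> eta0; have [L [FW _]] := trunc_fun_admissible D0 aL sL b0 T0 r0 Ar fB fL N1 (ltW db0) Ax' van.
apply: (measurableT_comp (tuple_admissible_measurable (FW (mark_times eta I)))).
apply/measurable_fun_tnthP => j; rewrite (_ : _ \o _ = fun w => eta *: (Z (tnth I j).+1 w : V)).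
  by apply: (measurableT_comp (measurable_scale eta)); exact: measurable_funPT.
by apply/funext => w /=; rewrite tnth_mktuple.
Qed.

Lemma expect_mark_functional n eta (I : k.-tuple 'I_n) : 0 < eta ->
  (\int[P]_w (F_ N x' (mark_vals (fun i => Z i w) eta I) (mark_times eta I))%:E =
   (iterate (noise_fun Z eta) ((F_ N x') ^~ (mark_times eta I)))%:E)%E.
Proof.
move=> eta0; have [L [FW _]] := trunc_fun_admissible D0 aL sL b0 T0 r0 Ar fB fL N1 (ltW db0) Ax' van.
have [uI|nuI] := boolP (uniq I).
  under eq_integral do rewrite mark_vals_noise.
  exact: (noise_iterate Ziid db0 eta0 (uniq_succ uI) (FW _)).
have E : (F_ N x') ^~ (mark_times eta I) = fun=> 0.
  apply/funext => W; rewrite /trunc_fun.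
  have [->|c0] := eqVneq (cutoff T N 0 (zip (mark_times eta I) W)) 0; first by rewrite mulr0.
  have [ti _] := cutoff_simplex N1 c0.
  by move: nuI; rewrite (ord_sorted_uniq (increasing_mark_times eta0 ti)).
have [[z0 _ _] _] := noise_fun_bounded1 Z (2 * N) db0 eta0.
rewrite E iterate0// integral0_eq// => w _.
by rewrite -[F_ _ _ _ _]/(((F_ N x') ^~ (mark_times eta I)) _) E.
Qed.

(** The levels may differ between entries, so that one mark can be required to exceed N and the
    others delbar. *)
Let LN n (eta : R) q (s : q.-tuple 'I_n) (c : 'I_q -> R) : set Omega :=
  [set w | forall j, c j < enorm (eta *: (Z (tnth s j).+1 w : V))].

Let LN_expect n eta q (s : q.-tuple 'I_n) (c : 'I_q -> R) : uniq s -> 0 < eta ->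
  expect_le P (\1_(LN eta s c)) (\prod_j H (c j / eta)).
Proof.
move=> us eta0; have [h1 h2] := prob_large Ziid c (uniq_succ us) eta0.
have E : LN eta s c = [set w | forall j, c j < enorm (eta *: (Z (tnth [tuple (tnth s j0).+1 | j0 < q] j) w : V))].
  by apply/seteqP; split => w /= hw j; have := hw j; rewrite tnth_mktuple.
apply: expect_le_indic; rewrite E//.
by rewrite le_eqVlt; apply/orP; left; apply/eqP; exact: h2.
Qed.

Let LN_all n (eta : R) q (s : q.-tuple 'I_n) (c : R) w :
  (all (fun i : 'I_n => large c (fun i => Z i w) eta i) s)%:R = \1_(LN eta s (fun=> c)) w :> R.
Proof.
rewrite indicE; congr (nat_of_bool _)%:R; apply/idP/idP => [/all_tnthP hw|/set_mem hw].
  by apply: mem_set => j; exact: hw.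
by apply/all_tnthP => j; exact: hw.
Qed.

(** On the exceptional event the difference is at most B + B n^k, whence the factor of g. A bad
    tuple has either a mark above N or times that are not separated. *)
Lemma expected_reduction eta del x (C : R) (G : Omega -> R) g : 0 < eta -> 0 <= C -> expect_le P G g ->
  let n := Num.truncn (T / eta) in
  (forall w, let z := fun i => Z i w in 1 <= G w \/
  `|f (chain_path a sigma b T z eta x) -
    \sum_(I : k.-tuple 'I_n) F_ N x' (mark_vals z eta I) (mark_times eta I)| <=
  \sum_(Q : k.+1.-tuple 'I_n) 2 * B * (uniq Q && all (fun i : 'I_n => large del z eta i) Q)%:R +
  \sum_(I : k.-tuple 'I_n) (C + B * (bad T N z eta I)%:R) *
      (ord_sorted I && all (fun i : 'I_n => large delbar z eta i) I)%:R) ->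
  measurable_fun setT (fun w => f (Xp eta x w)) ->
  `|fine (\int[P]_w (f (Xp eta x w))%:E)%E -
    \sum_(I : k.-tuple 'I_n) iterate (noise_fun Z eta) ((F_ N x') ^~ (mark_times eta I))| <=
  (B + B * n%:R ^+ k) * g + (\sum_(Q : k.+1.-tuple 'I_n | uniq Q) 2 * B * \prod_(j < k.+1) H (del / eta) +
  \sum_(I : k.-tuple 'I_n | ord_sorted I) (C * \prod_(j < k) H (delbar / eta) +
    B * (\sum_(j0 < k) \prod_(j < k) H ((if j == j0 then N else delbar) / eta) +
      (~~ separated T N^-1 0 (mark_times eta I))%:R * \prod_(j < k) H (delbar / eta)))).
Proof.
move=> eta0 C0 [mG G0 Gg] n hw mf.
pose v w := \sum_(I : k.-tuple 'I_n) F_ N x' (mark_vals (fun i => Z i w) eta I) (mark_times eta I).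
have F01 W t : 0 <= F_ N x' W t <= B := trunc_fun_itv a sigma b fB N x' W t.
have v0 w : 0 <= v w by apply: sumr_ge0 => I _; have /andP[] := F01 (mark_vals (fun i => Z i w) eta I) (mark_times eta I).
have vB w : v w <= B * n%:R ^+ k.
  apply: (@le_trans _ _ (\sum_(I : k.-tuple 'I_n) B)).
    by apply: ler_sum => I _; have /andP[] := F01 (mark_vals (fun i => Z i w) eta I) (mark_times eta I).
  by rewrite sumr_const card_tuple card_ord -[leLHS]mulr_natr natrX.
have mv : measurable_fun setT v by apply: measurable_sum => I; exact: measurable_mark_functional.
have vE : (\int[P]_w (v w)%:E = (\sum_(I : k.-tuple 'I_n) iterate (noise_fun Z eta) ((F_ N x') ^~ (mark_times eta I)))%:E)%E.
  rewrite (eq_integral (fun w => (\sum_(I : k.-tuple 'I_n) (F_ N x' (mark_vals (fun i => Z i w) eta I) (mark_times eta I))%:E)%E)); last first.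
    by move=> w _; rewrite sumEFin.
  rewrite ge0_integral_sum//.
  - by rewrite -sumEFin; apply: eq_bigr => I _; exact: expect_mark_functional.
  - by move=> I; apply/measurable_EFinP; exact: measurable_mark_functional.
  - by move=> I w _; rewrite lee_fin; have /andP[] := F01 (mark_vals (fun i => Z i w) eta I) (mark_times eta I).
have fin (u : Omega -> R) (c : R) : (forall w, 0 <= u w) -> (forall w, u w <= c) -> (\int[P]_w (u w)%:E < +oo)%E.
  move=> u0 uc; apply: (@le_lt_trans _ _ (\int[P]_w (cst c%:E) w)%E).
    by apply: ge0_le_integral_set => w; rewrite lee_fin.
  by rewrite integral_cst// [X in (_ * X)%E]probability_setT mule1 ltry.
rewrite -[X in `|_ - X|]/(fine (_%:E)) -vE.
pose Err w := (B + B * n%:R ^+ k) * G w + (\sum_(Q : k.+1.-tuple 'I_n | uniq Q) 2 * B * \1_(LN eta Q (fun=> del)) w +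
  \sum_(I : k.-tuple 'I_n | ord_sorted I) (C * \1_(LN eta I (fun=> delbar)) w +
    B * (\sum_(j0 < k) \1_(LN eta I (fun j => if j == j0 then N else delbar)) w +
      (~~ separated T N^-1 0 (mark_times eta I))%:R * \1_(LN eta I (fun=> delbar)) w))).
apply: (expect_dist (g := Err)) => //.
- by move=> w; have /andP[] := fB (Xp eta x w).
- apply: (fin _ B) => w; have /andP[] := fB (Xp eta x w) => //.
- exact: fin vB.
- apply: expect_leD; first by apply: expect_leZ => //; rewrite addr_ge0// mulr_ge0// exprn_ge0.
  apply: expect_leD; apply: expect_le_sum.
    by move=> Q uQ; apply: expect_leZ; [rewrite mulr_ge0|exact: LN_expect].
  move=> I /ord_sorted_uniq uI; apply: expect_leD; first by apply: expect_leZ => //; exact: LN_expect.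
  apply: expect_leZ => //; apply: expect_leD; first by apply: expect_le_sum => j0 _; exact: LN_expect.
  by apply: expect_leZ => //; exact: LN_expect.
move=> w; have ind0 (E : set Omega) w' : 0 <= \1_E w' :> R by rewrite indicE.
have e2 : 0 <= \sum_(Q : k.+1.-tuple 'I_n | uniq Q) 2 * B * \1_(LN eta Q (fun=> del)) w.
  by apply: sumr_ge0 => Q _; rewrite !mulr_ge0.
have e3 : 0 <= \sum_(I : k.-tuple 'I_n | ord_sorted I) (C * \1_(LN eta I (fun=> delbar)) w +
    B * (\sum_(j0 < k) \1_(LN eta I (fun j => if j == j0 then N else delbar)) w +
      (~~ separated T N^-1 0 (mark_times eta I))%:R * \1_(LN eta I (fun=> delbar)) w)).
  by apply: sumr_ge0 => I _; rewrite addr_ge0 ?mulr_ge0// addr_ge0 ?mulr_ge0// sumr_ge0.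
have K0 : 0 <= B + B * n%:R ^+ k by rewrite addr_ge0// mulr_ge0// exprn_ge0.
have [G1|le1] := hw w.
  apply: (@le_trans _ _ ((B + B * n%:R ^+ k) * G w)); last by rewrite /Err lerDl addr_ge0.
  apply: (@le_trans _ _ (B + B * n%:R ^+ k)); last by rewrite ler_peMr.
  apply: le_trans (ler_normB _ _) _; have /andP[f0 f1] := fB (Xp eta x w).
  by rewrite (ger0_norm f0) (ger0_norm (v0 w)) lerD.
apply: le_trans le1 _; rewrite /Err -[leLHS]add0r; apply: lerD; first by rewrite mulr_ge0.
apply: lerD.
  rewrite [leRHS]big_mkcond /=; apply: ler_sum => Q _; case: (uniq Q); last by rewrite mulr0.
  by rewrite andTb LN_all.
rewrite [leRHS]big_mkcond /=; apply: ler_sum => I _; case: (ord_sorted I); last by rewrite mulr0.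
rewrite andTb LN_all; have [|nL] := boolP (w \in LN eta I (fun=> delbar)); last first.
  rewrite indicE (negbTE nL) !mulr0 add0r addr0 mulr_ge0// sumr_ge0//.
move=> wL; rewrite !indicE wL !mulr1 lerD2l ler_wpM2l//.
rewrite /bad negb_and; have [|hb] := boolP (all _ _) => /=; first by rewrite lerDr sumr_ge0.
move: hb; rewrite -has_predC => /hasP[u /tnthP[j0 ->]]; rewrite tnth_mktuple /= -ltNge => hj0.
apply: (@le_trans _ _ (\1_(LN eta I (fun j => if j == j0 then N else delbar)) w)).
  rewrite indicE mem_set// => j; case: eqP => [->//|_].
  by move/set_mem : wL; exact.
by rewrite (bigD1 j0)//= -addrA lerDl addr_ge0// sumr_ge0.
Qed.

End truncated.

(** After division by lambda^k the exceptional event leaves a factor eta, the event of more than k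
    marks a factor lambda, and the candidate tuples the Lipschitz error C plus multiples of q and of
    1 / N + eta. *)
Lemma error_bound (eta del delbar N C Cd Cb q : R) (N1 n : nat) : 0 < eta -> eta <= 1 -> 1 <= N ->
  0 <= C -> 0 <= Cd -> 1 <= Cb -> 0 <= q ->
  eta ^+ N1 <= H eta^-1 -> H (del / eta) <= Cd * H eta^-1 -> H (delbar / eta) <= Cb * H eta^-1 ->
  H (N / eta) <= q * H eta^-1 -> eta * n%:R <= T ->
  lambda P (Z 0%N) eta ^- k *
  ((B + B * n%:R ^+ k) * eta ^+ (N1 * k).+1 + (\sum_(Q : k.+1.-tuple 'I_n | uniq Q) 2 * B * \prod_(j < k.+1) H (del / eta) +
  \sum_(I : k.-tuple 'I_n | ord_sorted I) (C * \prod_(j < k) H (delbar / eta) +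
    B * (\sum_(j0 < k) \prod_(j < k) H ((if j == j0 then N else delbar) / eta) +
      (~~ separated T N^-1 0 (mark_times eta I))%:R * \prod_(j < k) H (delbar / eta))))) <=
  B * (1 + T ^+ k) * eta + (2 * B * (Cd * T) ^+ k.+1) * lambda P (Z 0%N) eta +
  (Cb * (1 + T)) ^+ k * (C + B * (k%:R * q + k%:R * (2 * (N^-1 + eta)))).
Proof.
move=> eta0 eta1 N1' C0 Cd0 Cb1 q0 hN1 hd hb hN nT.
have h0 : 0 < H eta^-1 := norm_tail_gt0 RV _.
set hh := H eta^-1 in h0 hN1 hd hb hN *.
have Cb0 : 0 <= Cb by exact: le_trans Cb1.
have nT0 : 0 <= eta * n%:R by rewrite mulr_ge0// ltW.
have T0' := ltW T0; have eta0' := ltW eta0; have h0' := ltW h0.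
have N0 : 0 < N := lt_le_trans ltr01 N1'.
have lamE : lambda P (Z 0%N) eta ^- k = eta ^+ k * hh ^- k.
  by rewrite /lambda -/hh exprMn invfM -!exprVn invrK.
have hk0 : 0 < hh ^+ k by rewrite exprn_gt0.
have hb0 : 0 <= Cb * hh by rewrite mulr_ge0.
have TT j : (eta * n%:R) ^+ j <= (1 + T) ^+ j by apply: lerXn2r; rewrite ?nnegrE//; lra.
have Tk j : (eta * n%:R) ^+ j <= T ^+ j by apply: lerXn2r; rewrite ?nnegrE.
rewrite lamE mulrDr [X in _ + X <= _]mulrDr -[leRHS]addrA.
apply: lerD; last apply: lerD.
(* Here (eta n)^k is at most T^k and (eta^N1)^k at most H^k; one factor eta remains. *)
- rewrite [leLHS](_ : _ = B * (eta ^+ k + (eta * n%:R) ^+ k) * eta * ((eta ^+ N1) ^+ k / hh ^+ k)); last first.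
    by rewrite exprS exprM exprMn; ring.
  rewrite -[leRHS]mulr1; apply: ler_pM.
  + by rewrite !mulr_ge0// addr_ge0// exprn_ge0.
  + by rewrite mulr_ge0 ?invr_ge0// ?exprn_ge0// ?exprn_ge0// ltW.
  + by rewrite ler_wpM2r// ler_wpM2l//; apply: lerD => //; rewrite exprn_ile1.
  + by rewrite ler_pdivrMr// mul1r; apply: lerXn2r => //; rewrite nnegrE ?exprn_ge0.
- apply: (@le_trans _ _ (eta ^+ k / hh ^+ k * (n%:R ^+ k.+1 * (2 * B * (Cd * hh) ^+ k.+1)))).
    rewrite ler_wpM2l ?mulr_ge0 ?invr_ge0 ?exprn_ge0//.
    apply: (@le_trans _ _ (\sum_(Q : k.+1.-tuple 'I_n) 2 * B * (Cd * hh) ^+ k.+1)).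
      rewrite big_mkcond; apply: ler_sum => Q _; case: ifP => _; last by rewrite !mulr_ge0// exprn_ge0// mulr_ge0.
      rewrite ler_wpM2l ?mulr_ge0// prodr_const card_ord; apply: lerXn2r => //; rewrite nnegrE ?mulr_ge0//.
    by rewrite sumr_const card_tuple card_ord -[leLHS]mulr_natl natrX.
  rewrite [leLHS](_ : _ = 2 * B * (Cd ^+ k.+1 * (eta * n%:R) ^+ k.+1) * lambda P (Z 0%N) eta); last first.
    by rewrite /lambda -/hh !exprS !exprMn; field; rewrite !gt_eqF// exprn_gt0.
  apply: ler_wpM2r; first by rewrite /lambda mulr_ge0// invr_ge0.
  rewrite [(Cd * T) ^+ _]exprMn; apply: ler_wpM2l; first by rewrite mulr_ge0.
  by apply: ler_wpM2l => //; exact: exprn_ge0.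
pose nsep (I : k.-tuple 'I_n) : R := (ord_sorted I && ~~ separated T N^-1 0 (mark_times eta I))%:R.
have hbk : \prod_(j < k) H (delbar / eta) <= (Cb * hh) ^+ k.
  by rewrite prodr_const card_ord; apply: lerXn2r => //; rewrite nnegrE.
apply: (@le_trans _ _ (eta ^+ k / hh ^+ k * \sum_(I : k.-tuple 'I_n)
    ((C + B * (k%:R * q)) * (Cb * hh) ^+ k + B * (Cb * hh) ^+ k * nsep I))).
  rewrite ler_wpM2l ?mulr_ge0 ?invr_ge0 ?exprn_ge0//.
  rewrite big_mkcond; apply: ler_sum => I _; rewrite /nsep; case: (ord_sorted I); last first.
    by rewrite mulr0 addr0 !mulr_ge0 ?exprn_ge0// addr_ge0// !mulr_ge0.
  rewrite andTb mulrDl -addrA; apply: lerD; first by rewrite ler_wpM2l.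
  have ss0 : 0 <= (~~ separated T N^-1 0 (mark_times eta I))%:R :> R by [].
  move: ss0; set ss := (~~ _)%:R => ss0.
  rewrite [leRHS](_ : _ = B * (k%:R * (q * (Cb * hh) ^+ k) + ss * (Cb * hh) ^+ k)); last by ring.
  apply: ler_wpM2l => //; apply: lerD; last by rewrite ler_wpM2l.
  apply: (@le_trans _ _ (\sum_(j0 < k) q * (Cb * hh) ^+ k)); last first.
    by rewrite sumr_const card_ord -[leLHS]mulr_natl.
  apply: ler_sum => j0 _; rewrite (bigD1 j0)//= eqxx.
  rewrite [in leRHS](_ : (Cb * hh) ^+ k = \prod_(j < k) (Cb * hh)); last by rewrite prodr_const card_ord.
  rewrite [in leRHS](bigD1 j0)//= mulrA; apply: ler_pM => //.
  - by apply: prodr_ge0 => j _.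
  - by apply: le_trans hN _; rewrite ler_wpM2l// ler_peMl.
  - by apply: ler_prod => j jj0; rewrite (negbTE jj0) H0.
rewrite big_split /= -!mulr_sumr sumr_const card_tuple card_ord -[_ *+ (n ^ k)]mulr_natl natrX.
have cc := clustered_count k 0 T0 eta0 (_ : 0 <= N^-1) nT.
have ns : eta ^+ k * \sum_(I : k.-tuple 'I_n) nsep I <= k%:R * (2 * (N^-1 + eta)) * (1 + T) ^+ k.
  apply: le_trans (cc _); last by rewrite invr_ge0 ltW.
  rewrite ler_wpM2l ?exprn_ge0//; apply: ler_sum => I _; rewrite /nsep ler_nat.
  rewrite /mark_times (mktuple_map (fun i : 'I_n => eta * i.+1%:R)) /=.
  case: (boolP (ord_sorted I)) => // sI; case: (separated _ _ _ _) => //=; rewrite ?andbF// andbT lt0b.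
  rewrite path_sortedE; last exact: lt_trans.
  rewrite all_map sorted_map; apply/andP; split; first by apply/allP => i _ /=; rewrite mulr_gt0.
  by apply: sub_sorted sI => i j /=; rewrite ltr_pM2l// ltr_nat.
rewrite [leLHS](_ : _ = Cb ^+ k * ((C + B * (k%:R * q)) * (eta * n%:R) ^+ k +
    B * (eta ^+ k * \sum_(I : k.-tuple 'I_n) nsep I))); last first.
  by rewrite !exprMn; field; rewrite gt_eqF.
rewrite [(Cb * (1 + T)) ^+ k]exprMn -[leRHS]mulrA; apply: ler_wpM2l; first exact: exprn_ge0.
rewrite [leRHS](_ : _ = (C + B * (k%:R * q)) * (1 + T) ^+ k + B * (k%:R * (2 * (N^-1 + eta)) * (1 + T) ^+ k)); last by ring.
apply: lerD; apply: ler_wpM2l => //.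
by rewrite addr_ge0// !mulr_ge0.
Qed.


(** Where |Z| exceeds 1 / eta, the constant 1 / eta is below |Z|; hence lambda is at most the tail
    of the first moment. *)
Lemma lambda_small e : 0 < e -> \forall eta \near 0^'+, lambda P (Z 0%N) eta <= e.
Proof.
move=> e0; have [y0 hy] := tail_moment Zc e0.
have ey0 : 0 < (Num.max y0 1)^-1 by rewrite invr_gt0 lt_max ltr01 orbT.
near=> eta; have eta0 : 0 < eta by near: eta; exact: nbhs_right_gt.
have : eta <= (Num.max y0 1)^-1 by near: eta; exact: nbhs_right_le.
rewrite -[leLHS]invrK lef_pV2 ?posrE ?invr_gt0// ?lt_max ?ltr01 ?orbT// ge_max => /andP[h1 _].
rewrite -lee_fin; apply: le_trans (hy _ h1).
have mE := measurable_norm_gt (Z 0%N) eta^-1.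
rewrite /lambda EFinM -norm_tailE -[X in (_ * X)%E](_ : (\int[P]_w (\1_[set w | eta^-1 < enorm (Z 0%N w : V)] w)%:E)%E = _); last first.
  by rewrite integral_indic// setIT.
rewrite -ge0_integralZl_EFin//.
- apply: ge0_le_integral_set => w; rewrite -EFinM lee_fin; first by rewrite mulr_ge0// invr_ge0 ltW.
  rewrite indicE; have [/set_mem/= hw|] := boolP (w \in _); last by rewrite !mulr0.
  by rewrite !mulr1 ltW.
- by apply/measurable_EFinP; exact: measurable_indic.
- by rewrite invr_ge0 ltW.
Unshelve. all: by end_near. Qed.

Lemma near_scale (c e : R) : 0 < e -> \forall eta \near 0^'+, c * eta <= e.
Proof.
move=> e0; have K0 : 0 < `|c| + 1 by rewrite ltr_wpDl.
have q0 : 0 < e / (`|c| + 1) by rewrite divr_gt0.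
near=> eta; have eta0 : 0 < eta by near: eta; exact: nbhs_right_gt.
have h1 : eta <= e / (`|c| + 1) by near: eta; exact: nbhs_right_le.
apply: (@le_trans _ _ ((`|c| + 1) * eta)).
  by rewrite ler_wpM2r ?(ltW eta0)//; apply: le_trans (ler_norm _) _; rewrite lerDl.
by rewrite mulrC -ler_pdivlMr.
Unshelve. all: by end_near. Qed.


Let alpha0 : 0 < alpha := lt_trans ltr01 alpha1.
Local Notation J := (jump_law S alpha0).
Local Notation Q := (product_power J (k:=k) \x @lebesgue_times R T k)%E.

Definition limit_fun x (p : k.-tuple (borel_space V) * k.-tuple R) : R :=
  f (h x p.1 p.2) * \1_(@increasing_times R k `]0, T[) p.2.

Definition trunc_integral N x := iterate lebesgue_fun (fun t => iterate (jump_fun S alpha0) ((F_ N x) ^~ t)).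

Section limit.
Variables (delbar : R) (x' : 'cV[R]_m.+1).
Hypothesis db0 : 0 < delbar.
Hypothesis Ax' : A x'.
Hypothesis van : forall x (W : k.-tuple V) (t : k.-tuple R) j, A x -> increasing_times `]0, T] t ->
  enorm (tnth W j) <= delbar -> f (h x W t) = 0.

Lemma limit_fun_ge0 p : 0 <= limit_fun x' p.
Proof. by rewrite mulr_ge0//; have /andP[] := fB (h x' p.1 p.2). Qed.

(** The integrand vanishes unless every mark has norm at least delbar, a set of finite mass, and the
    simplex has finite volume. *)
Lemma limit_fun_lt : (\int[Q]_p (limit_fun x' p)%:E < +oo)%E.
Proof.
pose Bt : k.-tuple (set (borel_space V)) := [tuple [set w : borel_space V | delbar <= enorm (w : V)] | j < k].
have mB j : measurable (tnth Bt j) by rewrite tnth_mktuple; exact: measurable_norm_ge.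
pose E := [set W : k.-tuple (borel_space V) | forall j, tnth Bt j (tnth W j)].
have mE : measurable E by exact: measurable_rect.
apply: (@le_lt_trans _ _ (\int[Q]_p (B * \1_(E `*` [set: k.-tuple R]) p)%:E)%E).
  apply: ge0_le_integral_set => p; rewrite lee_fin; first exact: limit_fun_ge0.
  have /andP[f0 f1] := fB (h x' p.1 p.2); rewrite /limit_fun [\1__ p.2]indicE.
  have [/set_mem ti|] := boolP (p.2 \in _); last by rewrite mulr0 mulr_ge0.
  rewrite mulr1 indicE; have [|pE] := boolP (p \in _); first by rewrite mulr1.
  rewrite mulr0 le_eqVlt; apply/orP; left; apply/eqP.
  have [j hj] : exists j, enorm (tnth p.1 j : V) < delbar.
    apply: contrapT => /forallNP hj; move: pE => /negP; apply; apply: mem_set; split => // j.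
    by rewrite tnth_mktuple /= leNgt; apply/negP; exact: hj.
  by apply: (van (j := j)) => //; [exact: simplex_closed|exact: ltW].
under eq_integral do rewrite EFinM.
have mEE : measurable (E `*` [set: k.-tuple R]) by exact: measurableX.
rewrite ge0_integralZl_EFin//; last by apply/measurable_EFinP; exact: measurable_indic.
rewrite integral_indic// setIT; apply: lte_mul_pinfty => //.
rewrite [X in (X < _)%E](_ : _ = (product_power J (k:=k) E * lebesgue_times T [set: k.-tuple R])%E); last first.
  exact: product_measure1E.
apply: lte_mul_pinfty => //.
- rewrite product_power_prod// (eq_bigr (fun=> (fine (J [set w : borel_space V | delbar <= enorm (w : V)]))%:E)) ?prodEFin//.
  by move=> j _; rewrite tnth_mktuple fineK// ge0_fin_numE//; exact: jump_law_tail.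
- by apply: le_lt_trans (lebesgue_times_setT _ _) _; exact: ltry.
Qed.

(** Monotone convergence: at each point over the open simplex the cutoff increases with N and is
    eventually 1. *)
Lemma trunc_integral_cvg : trunc_integral n.+1%:R x' @[n --> \oo] --> fine (\int[Q]_p (limit_fun x' p)%:E)%E.
Proof.
have N1 n : 1 <= n.+1%:R :> R by rewrite ler1n.
have F01 N W t : 0 <= F_ N x' W t <= B := trunc_fun_itv a sigma b fB N x' W t.
have E n : (\int[Q]_p (F_ n.+1%:R x' p.1 p.2)%:E = (trunc_integral n.+1%:R x')%:E)%E.
  have [L [FW Ft]] := trunc_fun_admissible D0 aL sL b0 T0 r0 Ar fB fL (N1 n) (ltW db0) Ax' van.
  apply: (limit_product S alpha0 db0 T0 FW Ft) => W t nt; rewrite /trunc_fun.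
  have [->|c0] := eqVneq (cutoff T n.+1%:R 0 (zip t W)) 0; first by rewrite mulr0.
  by have [] := cutoff_simplex (N1 n) c0.
have Qf : (\int[Q]_p (limit_fun x' p)%:E)%E \is a fin_num.
  rewrite ge0_fin_numE; first exact: limit_fun_lt.
  by apply: integral_ge0 => p _; rewrite lee_fin limit_fun_ge0.
suff : (trunc_integral n.+1%:R x')%:E @[n --> \oo] --> (\int[Q]_p (limit_fun x' p)%:E)%E.
  by rewrite -(fineK Qf) => /fine_cvg.
under eq_fun do rewrite -E.
have -> : (\int[Q]_p (limit_fun x' p)%:E = \int[Q]_p limn (fun n => (F_ n.+1%:R x' p.1 p.2)%:E))%E.
  apply: eq_integral => p _; apply/esym/cvg_lim => //; apply/fine_cvgP; split; first by near=> n.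
  rewrite /limit_fun indicE; have [/set_mem ti|nt] := boolP (p.2 \in _); last first.
    apply: cvg_near_cst; near=> n; rewrite /= mulr0 /trunc_fun.
    have [->|c0] := eqVneq (cutoff T n.+1%:R 0 (zip p.2 p.1)) 0; first by rewrite mulr0.
    have [ti _] := cutoff_simplex (N1 n) c0; by case/negP: nt; exact: mem_set.
  have [tp tT] := increasing_path (simplex_closed ti).
  have tT' : all (fun s => s < T) p.2.
    by move: ti => [_]; apply: sub_all => s; rewrite in_itv/= => /andP[].
  have [g g0 sg] := separated_exists tp tT'.
  apply: cvg_near_cst; near=> n; rewrite mulr1 /= /trunc_fun cutoff_eq1 ?mulr1//.
    rewrite zip_times; apply: separated_le sg.
    rewrite -[leRHS]invrK lef_pV2 ?posrE ?invr_gt0//; apply: (@le_trans _ _ n%:R); last by rewrite ler_nat.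
    near: n; exact: nbhs_infty_ger.
  rewrite zip_marks; apply/allP => u /tnthP[j ->].
  apply: (@le_trans _ _ n%:R); last by rewrite ler_nat.
  apply: (@le_trans _ _ (\sum_j (enorm (tnth p.1 j : V)))).
    by rewrite (bigD1 j)//= lerDl sumr_ge0// => i _; exact: enorm_ge0.
  near: n; exact: nbhs_infty_ger.
apply: cvg_monotone_convergence => //.
- move=> n; apply/measurable_EFinP.
  have [L [FW Ft]] := trunc_fun_admissible D0 aL sL b0 T0 r0 Ar fB fL (N1 n) (ltW db0) Ax' van.
  exact: measurable_pair_admissible FW Ft.
- by move=> n p _; rewrite lee_fin; have /andP[] := F01 n.+1%:R p.1 p.2.
- move=> p _ n n' nn; rewrite lee_fin /trunc_fun; have /andP[f0 _] := fB (h x' p.1 p.2).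
  rewrite ler_wpM2l//; have [->|c0] := eqVneq (cutoff T n.+1%:R 0 (zip p.2 p.1)) 0.
    by have /andP[] := cutoff_itv T n'.+1%:R 0 (zip p.2 p.1).
  have [h1 h2 _] := cutoff_neq0 (N1 n) c0.
  by apply: cutoff_le => //; rewrite ler_nat.
Unshelve. all: by end_near. Qed.

End limit.

Lemma lipschitz_limit x' (e : R) : A x' -> 0 < e -> exists2 rx : R, 0 < rx &
  \forall eta \near 0^'+, forall x, A x -> enorm (x - x') <= rx ->
  `|lambda P (Z 0%N) eta ^- k * fine (\int[P]_w (f (Xp eta x w))%:E)%E -
    fine (\int[Q]_p (limit_fun x' p)%:E)%E| <= e.
Proof.
move=> Ax' e0; have [C0 C01 red] := pointwise_reduction D0 aL sL b0 T0 r0 Ar fB fL f_off.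
have [d1 d10 van1] := small_mark_vanish D0 aL sL b0 T0 Ar eps0 rd0 f_off.
have T0' := ltW T0.
pose mn := Num.min b (Num.min eps rd); have mn0 : 0 < mn by rewrite !lt_min b0 eps0 rd0.
pose E1 := 1 + expR (D * T); have E10 : 0 < E1 by rewrite ltr_wpDr// expR_ge0.
have C00 : 0 < C0 := lt_le_trans ltr01 C01.
have EC0 : 0 < E1 * C0 by rewrite mulr_gt0.
pose s0 := mn / (4 * (E1 * C0)); have s00 : 0 < s0 by rewrite divr_gt0// mulr_gt0.
(* Independent of e: f vanishes when a mark is below [d1], and [s0] bounds each error in the
   smallness condition of the reduction. *)
pose delbar := Num.min d1 s0; have db0 : 0 < delbar by rewrite lt_min d10.
have van x (W : k.-tuple V) (t : k.-tuple R) j : A x -> increasing_times `]0, T] t ->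
    enorm (tnth W j) <= delbar -> f (h x W t) = 0.
  by move=> Ax ti /le_trans hj; apply: (van1 _ _ _ j) => //; apply: hj; rewrite ge_min lexx.
pose Cb := 1 + delbar `^ (- alpha); have Cb1 : 1 <= Cb by rewrite lerDl powR_ge0.
pose K := (Cb * (1 + T)) ^+ k.
have K0 : 0 <= K by rewrite exprn_ge0// mulr_ge0 ?addr_ge0 ?powR_ge0.
pose KB := K * (B * k%:R); have KB0 : 0 <= KB by rewrite !mulr_ge0.
pose I0 := fine (\int[Q]_p (limit_fun x' p)%:E)%E.
have e8 : 0 < e / 8 by rewrite divr_gt0.
(* The cutoff level is fixed before rho; it handles the limit integral and the error of the bad
   tuples. *)
have [n [hn1 hn2]] : exists n, `|I0 - trunc_integral n.+1%:R x'| <= e / 8 /\ KB * 4 / n.+1%:R <= e / 8.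
  have h1 : \forall n \near \oo, `|I0 - trunc_integral n.+1%:R x'| <= e / 8.
    by move: (trunc_integral_cvg db0 Ax' van) => /cvgrPdist_le; apply.
  have h2 : \forall n \near \oo, KB * 4 / n.+1%:R <= e / 8.
    near=> n; rewrite ler_pdivrMr// [leRHS]mulrC -ler_pdivrMr//; apply: (@le_trans _ _ n%:R); last by rewrite ler_nat.
    near: n; exact: nbhs_infty_ger.
  by have [n [? ?]] := filter_ex (filterI h1 h2); exists n.
pose N : R := n.+1%:R; have N1 : 1 <= N by rewrite ler1n.
have N0 : 0 < N := lt_le_trans ltr01 N1.
have [CN CN0 red2] := red delbar van N x' N1 Ax'.
have KCN : 0 < K * CN + 1 by rewrite ltr_wpDl// mulr_ge0.
(* The factor 32 = 4 * 8 makes four errors of size rho, multiplied by K CN, stay below e / 8. *)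
pose rho := Num.min 1 (Num.min s0 (e / (32 * (K * CN + 1)))).
have rho0 : 0 < rho by rewrite !lt_min ltr01 s00 divr_gt0// mulr_gt0.
have rho1 : rho <= 1 by rewrite ge_min lexx.
have rhos : rho <= s0 by rewrite ge_min; apply/orP; right; rewrite ge_min lexx.
have rhoe : rho <= e / (32 * (K * CN + 1)) by rewrite ge_min; apply/orP; right; rewrite ge_min lexx orbT.
have M00 : 0 <= confine a D b T k r.
  by rewrite /confine mulr_ge0 ?expR_ge0// !addr_ge0// ?mulr_ge0 ?enorm_ge0// ltW.
have [N2 hN2] := norm_tail_lower RV.
have [del0 del00 conc] := concentration Ziid alpha1 RV Zc D0 aL sL b0 T0 M00 (N2 * k).+1 rho0.
pose del := Num.min del0 (Num.min rho delbar).
have del_gt0 : 0 < del by rewrite lt_min del00 andTb lt_min rho0.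
have hconc := conc del del_gt0 (_ : del <= del0); rewrite ge_min lexx in hconc.
have {}hconc := hconc isT.
have drho : del <= rho by rewrite ge_min; apply/orP; right; rewrite ge_min lexx.
have ddb : del <= delbar by rewrite ge_min; apply/orP; right; rewrite ge_min lexx orbT.
pose Cd := 1 + del `^ (- alpha); have Cd0 : 0 <= Cd by rewrite addr_ge0// powR_ge0.
(* As alpha > 1, N^(- alpha) is at most 1 / N; the 2 leaves the strict inequality that
   [norm_tail_near] asks for. *)
pose q := 2 / N; have q0 : 0 <= q by rewrite divr_ge0// ltW.
have qN : N `^ (- alpha) < q.
  apply: (@le_lt_trans _ _ (N `^ (-1))); first by apply: ler_powR => //; rewrite lerN2 ltW.
  by rewrite powR_inv1 ?ltW// -[ltLHS]mul1r ltr_pM2r ?invr_gt0// ltr1n.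
have hb : \forall eta \near 0^'+, H (delbar / eta) <= Cb * H eta^-1.
  by apply: (norm_tail_near RV) => //; rewrite /Cb ltrDr.
have hd : \forall eta \near 0^'+, H (del / eta) <= Cd * H eta^-1.
  by apply: (norm_tail_near RV) => //; rewrite /Cd ltrDr.
have hN : \forall eta \near 0^'+, H (N / eta) <= q * H eta^-1 by apply: (norm_tail_near RV).
have [L [FW Ft]] := trunc_fun_admissible D0 aL sL b0 T0 r0 Ar fB fL N1 (ltW db0) Ax' van.
have hsum := @sum_limit _ _ _ _ _ _ _ _ alpha0 RV _ _ _ _ _ _ db0 T0 FW Ft.
have {}hsum : \forall eta \near 0^'+, `|trunc_integral N x' - lambda P (Z 0%N) eta ^- k *
   \sum_(I : k.-tuple 'I_(Num.truncn (T / eta))) iterate (noise_fun Z eta) ((F_ N x') ^~ (mark_times eta I))| <= e / 8.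
  by move: hsum => /cvgrPdist_le; apply.
have cl0 : 0 < 2 * B * (Cd * T) ^+ k.+1 + 1 by rewrite ltr_wpDl// !mulr_ge0// exprn_ge0// mulr_ge0.
have el0 : 0 < e / 8 / (2 * B * (Cd * T) ^+ k.+1 + 1) by rewrite divr_gt0.
have hl := lambda_small el0.
have hk := near_scale k%:R T0.
have ht1 := near_scale (B * (1 + T ^+ k)) e8.
have ht2 := near_scale (KB * 2) e8.
exists rho => //; near=> eta => x Ax xx.
have eta0 : 0 < eta by near: eta; exact: nbhs_right_gt.
have etar : eta <= rho by near: eta; exact: nbhs_right_le.
have eta1 : eta <= 1 := le_trans etar rho1.
have [G [mG G0 Gns GN]] : exists G : Omega -> R, [/\ measurable_fun setT G, forall w, 0 <= G w,
    forall w, ~ small_noise a sigma b (fun i => Z i w) eta x (confine a D b T k r) del rho (Num.truncn (T / eta)) -> 1 <= G w &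
    (\int[P]_w (G w)%:E <= (eta ^+ (N2 * k).+1)%:E)%E].
  by move: x {Ax xx}; near: eta; exact: hconc.
have EG : expect_le P G (eta ^+ (N2 * k).+1) by split.
have sumI0 : `|trunc_integral N x' - lambda P (Z 0%N) eta ^- k *
   \sum_(I : k.-tuple 'I_(Num.truncn (T / eta))) iterate (noise_fun Z eta) ((F_ N x') ^~ (mark_times eta I))| <= e / 8.
  by near: eta; exact: hsum.
set n0 := Num.truncn (T / eta) in Gns.
have nT : eta * n0%:R <= T.
  by rewrite mulrC -ler_pdivlMr//; have /truncn_itv/andP[] // : 0 <= T / eta by rewrite divr_ge0// ltW.
have kn : (k <= n0)%N.
  rewrite truncn_ge_nat ?divr_ge0 ?(ltW eta0)// ler_pdivlMr//; near: eta; exact: hk.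
have small : E1 * (C0 * (rho + delbar + eta)) <= mn.
  have dbs : delbar <= s0 by rewrite ge_min lexx orbT.
  have ss : rho + delbar + eta <= 4 * s0.
    by rewrite -[leLHS]addr0; apply: sum4_le => //; [exact: le_trans rhos|exact: ltW].
  rewrite mulrA; apply: le_trans (ler_wpM2l (ltW EC0) ss) _.
  by rewrite /s0 (_ : E1 * C0 * _ = mn)//; field; rewrite !gt_eqF.
pose C := CN * (rho + del + eta + enorm (x - x')).
have C_ge0 : 0 <= C by rewrite mulr_ge0// !addr_ge0// ?enorm_ge0// ltW.
have KC : K * C <= e / 8.
  have sum4 : rho + del + eta + enorm (x - x') <= 4 * rho by exact: sum4_le.
  apply: (@le_trans _ _ ((K * CN + 1) * (4 * rho))).
    rewrite /C mulrA; apply: ler_pM => //; first exact: mulr_ge0.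
      by rewrite !addr_ge0// ?enorm_ge0// ltW.
    by rewrite lerDl.
  apply: le_trans (_ : (K * CN + 1) * (4 * (e / (32 * (K * CN + 1)))) <= _).
    by rewrite ler_wpM2l ?(ltW KCN)// ler_wpM2l.
  by rewrite (_ : _ * _ = e / 8)//; field; rewrite gt_eqF.
have pw w : let z := fun i => Z i w in 1 <= G w \/
  `|f (chain_path a sigma b T z eta x) -
    \sum_(I : k.-tuple 'I_n0) F_ N x' (mark_vals z eta I) (mark_times eta I)| <=
  \sum_(Q0 : k.+1.-tuple 'I_n0) 2 * B * (uniq Q0 && all (fun i : 'I_n0 => large del z eta i) Q0)%:R +
  \sum_(I : k.-tuple 'I_n0) (C + B * (bad T N z eta I)%:R) *
      (ord_sorted I && all (fun i : 'I_n0 => large delbar z eta i) I)%:R.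
  have [ns|/Gns] := pselect (small_noise a sigma b (fun i => Z i w) eta x (confine a D b T k r) del rho n0); last by left.
  by right; exact: (red2 _ _ _ _ _ eta0 Ax (ltW rho0) rho1 (ltW del_gt0) ddb small kn ns).
have ER := expected_reduction N1 db0 Ax' van eta0 C_ge0 EG pw (measurable_functional x eta0).
have EB := error_bound (del := del) (delbar := delbar) eta0 eta1 N1 C_ge0 Cd0 Cb1 q0 _ _ _ _ nT.
have {}EB := EB N2 _ _ _ _.
have lam0 : 0 <= lambda P (Z 0%N) eta ^- k.
  by rewrite invr_ge0 exprn_ge0// mulr_ge0// ?invr_ge0 ltW// (norm_tail_gt0 RV).
set Sg := \sum_(I : k.-tuple 'I_n0) iterate (noise_fun Z eta) ((F_ N x') ^~ (mark_times eta I)) in ER *.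
set Ef := fine _ in ER *.
have main : `|lambda P (Z 0%N) eta ^- k * Ef - lambda P (Z 0%N) eta ^- k * Sg| <= 5 * (e / 8).
  rewrite -mulrBr normrM (ger0_norm lam0); apply: le_trans (ler_wpM2l lam0 ER) _.
  apply: le_trans (EB _ _ _ _) _; try by near: eta.
  rewrite -/K [K * (C + _)]mulrDr; have -> : K * (B * (k%:R * q + k%:R * (2 * (N^-1 + eta)))) = KB * 4 / N + KB * 2 * eta.
    by rewrite /KB /q; field; rewrite gt_eqF.
  have b1 : B * (1 + T ^+ k) * eta <= e / 8 by near: eta.
  have b2 : 2 * B * (Cd * T) ^+ k.+1 * lambda P (Z 0%N) eta <= e / 8.
    have : lambda P (Z 0%N) eta <= e / 8 / (2 * B * (Cd * T) ^+ k.+1 + 1) by near: eta.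
    rewrite ler_pdivlMr// mulrC mulrDl mul1r; apply: le_trans; rewrite lerDl mulr_ge0// ?invr_ge0 ltW//.
  have b3 : KB * 2 * eta <= e / 8 by near: eta.
  apply: (@le_trans _ _ (e / 8 + e / 8 + (e / 8 + (e / 8 + e / 8)))); last exact: five_eighths.
  by apply: lerD; [exact: lerD|apply: lerD => //; exact: lerD].
have sumI : `|trunc_integral N x' - lambda P (Z 0%N) eta ^- k * Sg| <= e / 8 := sumI0.
(* Three comparisons, costing 5, 1 and 1 eighths of e: chain with sum, sum with truncated integral,
   truncated with full integral. *)
rewrite -/I0 (_ : _ - I0 = (lambda P (Z 0%N) eta ^- k * Ef - lambda P (Z 0%N) eta ^- k * Sg)
  - (trunc_integral N x' - lambda P (Z 0%N) eta ^- k * Sg) - (I0 - trunc_integral N x')); last by ring.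
apply: le_trans (ler_normB _ _) _; apply: (@le_trans _ _ (5 * (e / 8) + e / 8 + e / 8)); last exact: seven_eighths.
by apply: lerD => //; apply: le_trans (ler_normB _ _) _; exact: lerD.
Unshelve. all: by end_near. Qed.

End lipschitz_limit.

(** * Portmanteau arguments *)

Section portmanteau.
Context {R : realType} {T : pmetricType R} {p : nat}.
Local Notation U := 'cV[R]_p.
Variables (C : set T) (A : set U).
Implicit Types (f g : T -> R) (r rd e c : R) (x : U) (y : T).

Definition vanishes rd f := forall z y, C z -> mdist z y <= rd -> f y = 0.

Definition away_lip f := exists B Lf rd, [/\ forall y, 0 <= f y <= B,
  forall y y', `|f y - f y'| <= Lf * mdist y y', 0 < rd & vanishes rd f].

Definition lsc f := forall y e, 0 < e -> exists2 del : R, 0 < del &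
  forall y', mdist y y' < del -> f y - e <= f y'.

Let dC y := inf [set mdist z y | z in C].

Let dC_has_inf y : C !=set0 -> has_inf [set mdist z y | z in C].
Proof.
move=> [z Cz]; split; first by exists (mdist z y), z.
by exists 0 => _ [z' _ <-]; exact: mdist_ge0.
Qed.

Let dC_le z y : C z -> dC y <= mdist z y.
Proof.
move=> Cz; apply: ge_inf; last by exists z.
by exists 0 => _ [z' _ <-]; exact: mdist_ge0.
Qed.

Let dC_lip y y' : C !=set0 -> dC y <= dC y' + mdist y y'.
Proof.
move=> C0; rewrite -lerBlDr; apply: lb_le_inf.
  by have [] := dC_has_inf y' C0.
move=> _ [z Cz <-]; rewrite lerBlDr; apply: le_trans (dC_le y Cz) _.
by rewrite metric_sym [leRHS]addrC [mdist z y']metric_sym; exact: metric_triangle.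
Qed.

(** Zero within r / 2 of C and one beyond r. For empty C, which occurs when k = 0, the real infimum
    would be 0; hence the separate case. *)
Definition away_cut r y : R := if pselect (C !=set0) then ramp (2 * dC y / r - 1) else 1.

Lemma away_cut_itv r y : 0 <= away_cut r y <= 1.
Proof.
by rewrite /away_cut; case: pselect => C0; [exact: ramp_itv|rewrite ler01 lexx].
Qed.

Lemma away_cut_lip r : 0 < r -> away_lip (away_cut r).
Proof.
move=> r0; exists 1, (2 / r), (r / 2); split.
- exact: away_cut_itv.
- move=> y y'; rewrite /away_cut; case: pselect => C0; last first.
    by rewrite subrr normr0; apply: mulr_ge0; [apply: divr_ge0 => //; exact: ltW|exact: mdist_ge0].
  apply: le_trans (ramp_lip _ _) _.
  rewrite (_ : 2 * dC y / r - 1 - (2 * dC y' / r - 1) = 2 / r * (dC y - dC y')); last by ring.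
  rewrite normrM ger0_norm ?divr_ge0 ?(ltW r0)// ler_wpM2l ?divr_ge0 ?(ltW r0)//.
  rewrite ler_norml; apply/andP; split; last by rewrite lerBlDl dC_lip.
  by rewrite lerNl opprB lerBlDl metric_sym dC_lip.
- by rewrite divr_gt0.
- move=> z y Cz zy; rewrite /away_cut; case: pselect => [C0|]; last by move=> n; case: n; exists z.
  apply: ramp_le0; rewrite subr_le0 ler_pdivrMr// mul1r.
  by have := le_trans (dC_le y Cz) zy; lra.
Qed.

Lemma away_cut1 r y : 0 < r -> (forall z, C z -> r <= mdist z y) -> away_cut r y = 1.
Proof.
move=> r0 h; rewrite /away_cut; case: pselect => [C0|//]; apply: ramp_ge1.
have : r <= dC y by apply: lb_le_inf => [|_ [z Cz <-]]; [by have [] := dC_has_inf y C0|exact: h].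
by move=> rd; rewrite lerBrDr ler_pdivlMr//; lra.
Qed.

Lemma fattening_near r z y : C z -> mdist z y <= r -> fattening C r y.
Proof.
move=> Cz zy; rewrite /fattening /=; apply: (@le_trans _ _ (mdist z y)%:E); last by rewrite lee_fin.
by apply: ereal_inf_lbound; exists z.
Qed.

Lemma open_fatteningC r : open (~` fattening C r).
Proof.
have [C0|nC] := pselect (C !=set0); last first.
  rewrite (_ : ~` _ = setT); first exact: openT.
  apply/seteqP; split => // y _; rewrite /fattening /= (_ : [set _ | _ in C] = set0) ?ereal_inf0//.
  by apply/seteqP; split => [u [z Cz _]|//]; case: nC; exists z.
have E y : fattening C r y <-> dC y <= r.
  rewrite /fattening /= (_ : ereal_inf _ = (dC y)%:E) ?lee_fin// /dC -ereal_inf_EFin.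
  - by rewrite image_comp.
  - by have [_] := dC_has_inf y C0.
  - by have [] := dC_has_inf y C0.
rewrite openE => y /= ny; rewrite /interior nbhs_ballP.
have ry : r < dC y by rewrite ltNge; apply/negP => /E.
exists (dC y - r); first by rewrite /= subr_gt0.
move=> y'; rewrite ballEmdist /= => yy' /E h.
have := dC_lip y y' C0; lra.
Qed.

(* The largest [n]-Lipschitz minorant of [g]; it increases to [g] when [g] is
   lower semicontinuous. *)
Definition regularize g (n : nat) y : R := inf [set g z + n%:R * mdist y z | z in [set: T]].

Section regularization.
Variables (g : T -> R) (M : R).
Hypothesis g01 : forall y, 0 <= g y <= M.
Hypothesis g_lsc : lsc g.

Let reg_lb n y z : regularize g n y <= g z + n%:R * mdist y z.
Proof.
apply: ge_inf; last by exists z.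
by exists 0 => _ [z' _ <-]; rewrite addr_ge0 ?mulr_ge0 ?mdist_ge0//; have /andP[] := g01 z'.
Qed.

Let reg_ge n y c : (forall z, c <= g z + n%:R * mdist y z) -> c <= regularize g n y.
Proof. by move=> h; apply: lb_le_inf => [|_ [z _ <-]]; [exists (g y + n%:R * mdist y y), y|exact: h]. Qed.

Lemma regularize_itv n y : 0 <= regularize g n y <= g y.
Proof.
apply/andP; split; last by have := reg_lb n y y; rewrite mdistxx mulr0 addr0.
by apply: reg_ge => z; rewrite addr_ge0 ?mulr_ge0 ?mdist_ge0//; have /andP[] := g01 z.
Qed.

Lemma regularize_lip n y y' : `|regularize g n y - regularize g n y'| <= n%:R * mdist y y'.
Proof.
have step u v : regularize g n u - regularize g n v <= n%:R * mdist u v.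
  rewrite lerBlDl -lerBlDr; apply: reg_ge => z; rewrite lerBlDr; apply: le_trans (reg_lb n u z) _.
  rewrite -addrA lerD2l -mulrDr ler_wpM2l// addrC; exact: metric_triangle.
by rewrite ler_norml step andbT lerNl opprB metric_sym step.
Qed.

Lemma regularize_le n n' y : (n <= n')%N -> regularize g n y <= regularize g n' y.
Proof.
move=> nn; apply: reg_ge => z; apply: le_trans (reg_lb n y z) _.
by rewrite lerD2l ler_wpM2r ?mdist_ge0// ler_nat.
Qed.

Lemma regularize_cvg y : regularize g n y @[n --> \oo] --> g y.
Proof.
apply/cvgrPdist_le => e e0; have [del del0 hd] := g_lsc y e0.
near=> n; have /andP[h0 h1] := regularize_itv n y.
rewrite ger0_norm ?subr_ge0// lerBlDr addrC -lerBlDr; apply: reg_ge => z.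
have [zy|zy] := ltP (mdist y z) del.
  by apply: le_trans (hd _ zy) _; rewrite lerDl mulr_ge0// mdist_ge0.
apply: (@le_trans _ _ (n%:R * mdist y z)); last by rewrite lerDr; have /andP[] := g01 z.
apply: (@le_trans _ _ (n%:R * del)); last by rewrite ler_wpM2l.
rewrite -ler_pdivrMr//; apply: (@le_trans _ _ (M / del)).
  by rewrite ler_pM2r ?invr_gt0// lerBlDr; have /andP[_ gM] := g01 y; apply: le_trans gM _; rewrite lerDl ltW.
near: n; exact: nbhs_infty_ger.
Unshelve. all: by end_near. Qed.

End regularization.
End portmanteau.

(** Compactness in its filter form; a sup-norm ball of radius rx / (p + 1) lies in the Euclidean
    ball of radius rx. *)
Lemma compact_cover {R : realType} {p : nat} (A : set 'cV[R]_p) (F : set_system R) {FF : Filter F}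
    (Q : R -> 'cV[R]_p -> Prop) : compact A ->
  (forall x', A x' -> exists2 rx : R, 0 < rx &
     \forall eta \near F, forall x, A x -> enorm (x - x') <= rx -> Q eta x) ->
  \forall eta \near F, forall x, A x -> Q eta x.
Proof.
move=> /compact_near_coveringP/near_covering_withinP cA h.
apply: (cA R F (fun eta x => Q eta x)) => x' Ax'.
have [rx rx0 hr] := h x' Ax'.
have p0 : 0 < rx / (p%:R + 1) :> R by rewrite divr_gt0// ltr_wpDl.
exists (ball x' (rx / (p%:R + 1)), [set eta | forall x, A x -> enorm (x - x') <= rx -> Q eta x]).
  by split => //=; exact: nbhsx_ballx.
move=> [x eta] [/= + hQ] Ax; rewrite -ball_normE /= => xx'; apply: hQ => //.
rewrite enormB; apply: le_trans (enorm_le_norm _) _.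
apply: (@le_trans _ _ ((p%:R + 1) * (rx / (p%:R + 1)))); last by rewrite mulrC divfK// gt_eqF// ltr_wpDl.
by apply: ler_pM => //; [rewrite lerDl|exact: ltW].
Qed.

Section bounded_integrals.
Context {R : realType} {T : pmetricType R}.
Local Notation G := (borel_space T).
Implicit Types (f g : T -> R) (r e c M : R) (y : T) (C : set T).

Lemma metric_continuous_measurable f : (forall y e, 0 < e -> exists2 del : R, 0 < del &
    forall y', mdist y y' < del -> `|f y - f y'| <= e) -> measurable_fun setT (f : G -> R).
Proof. by move=> h; apply: continuous_borel; exact: metric_continuous. Qed.

Lemma lip_cont f Lf : (forall y y', `|f y - f y'| <= Lf * mdist y y') -> forall y e, 0 < e ->
  exists2 del : R, 0 < del & forall y', mdist y y' < del -> `|f y - f y'| <= e.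
Proof.
move=> fL y e e0; have K0 : 0 < `|Lf| + 1 by rewrite ltr_wpDl.
exists (e / (`|Lf| + 1)) => [|y' yy']; first exact: divr_gt0.
apply: le_trans (fL _ _) _; apply: (@le_trans _ _ ((`|Lf| + 1) * (e / (`|Lf| + 1)))).
  apply: (@le_trans _ _ ((`|Lf| + 1) * mdist y y')).
    by rewrite ler_wpM2r ?mdist_ge0//; apply: le_trans (ler_norm _) _; rewrite lerDl.
  by rewrite ler_wpM2l// ?ltW.
by rewrite mulrC divfK// gt_eqF.
Qed.

Lemma away_lip_measurable C f : away_lip C f -> measurable_fun setT (f : G -> R).
Proof. by move=> [B [Lf [rd [_ fL _ _]]]]; apply: metric_continuous_measurable; exact: lip_cont fL. Qed.

Lemma vanishes_le_cut C rd M g : 0 < rd -> 0 <= M -> (forall y, 0 <= g y <= M) -> vanishes C rd g ->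
  forall y, g y <= M * away_cut C rd y.
Proof.
move=> rd0 M0 gM gv y; have [[z [Cz zy]]|nz] := pselect (exists z, C z /\ mdist z y <= rd).
  by rewrite (gv z)// mulr_ge0//; have /andP[] := away_cut_itv C rd y.
rewrite away_cut1 ?mulr1//; first by have /andP[] := gM y.
by move=> z Cz; rewrite leNgt; apply/negP => zr; apply: nz; exists z; split => //; exact: ltW.
Qed.

Variable mu : {measure set G -> \bar R}.

Lemma bounded_integral_lt C rd M g : 0 < rd -> 0 <= M -> (forall y, 0 <= g y <= M) -> vanishes C rd g ->
  (\int[mu]_y (away_cut C rd y)%:E < +oo -> \int[mu]_y (g y)%:E < +oo)%E.
Proof.
move=> rd0 M0 gM gv cutlt; apply: (@le_lt_trans _ _ (\int[mu]_y (M * away_cut C rd y)%:E)%E).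
  apply: ge0_le_integral_set => y; rewrite lee_fin; first by have /andP[] := gM y.
  exact: vanishes_le_cut gv y.
under eq_integral do rewrite EFinM.
rewrite ge0_integralZl_EFin//; first by rewrite lte_mul_pinfty.
- by move=> y _; rewrite lee_fin; have /andP[] := away_cut_itv C rd y.
- apply/measurable_EFinP; exact: (away_lip_measurable (away_cut_lip C rd0)).
Qed.

Lemma finite_integral_lt M g : (mu setT < +oo)%E -> (forall y, 0 <= g y <= M) -> (\int[mu]_y (g y)%:E < +oo)%E.
Proof.
move=> muT gM; have M0 : 0 <= M by have /andP[h1 h2] := gM point; exact: le_trans h2.
apply: (@le_lt_trans _ _ (\int[mu]_y (cst M%:E) y)%E).
  by apply: ge0_le_integral_set => y; rewrite lee_fin; have /andP[] := gM y.
by rewrite integral_cst// lte_mul_pinfty.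
Qed.

Lemma fine_integral_le f g : measurable_fun setT (f : G -> R) -> measurable_fun setT (g : G -> R) ->
  (forall y, 0 <= f y <= g y) -> (\int[mu]_y (g y)%:E < +oo)%E ->
  fine (\int[mu]_y (f y)%:E)%E <= fine (\int[mu]_y (g y)%:E)%E.
Proof.
move=> mf mg fg glt.
have le : (\int[mu]_y (f y)%:E <= \int[mu]_y (g y)%:E)%E.
  by apply: ge0_le_integral_set => y; rewrite lee_fin; have /andP[] := fg y.
apply: fine_le => //; rewrite ge0_fin_numE//.
- exact: le_lt_trans glt.
- by apply: integral_ge0 => y _; rewrite lee_fin; have /andP[] := fg y.
- by apply: integral_ge0 => y _; rewrite lee_fin; have /andP[h1 h2] := fg y; exact: le_trans h2.
Qed.

Lemma fine_integralB f g : measurable_fun setT (f : G -> R) -> measurable_fun setT (g : G -> R) ->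
  (forall y, 0 <= f y <= g y) -> (\int[mu]_y (g y)%:E < +oo)%E ->
  fine (\int[mu]_y (g y - f y)%:E)%E = fine (\int[mu]_y (g y)%:E)%E - fine (\int[mu]_y (f y)%:E)%E.
Proof.
move=> mf mg fg glt.
have gf0 y : 0 <= g y - f y by rewrite subr_ge0; have /andP[] := fg y.
have f0 y : 0 <= f y by have /andP[] := fg y.
have fin h : (forall y, 0 <= h y <= g y) -> (\int[mu]_y (h y)%:E)%E \is a fin_num.
  move=> hg; rewrite ge0_fin_numE; last by apply: integral_ge0 => y _; rewrite lee_fin; have /andP[] := hg y.
  apply: le_lt_trans glt; apply: ge0_le_integral_set => y; rewrite lee_fin; by have /andP[] := hg y.
have E : (\int[mu]_y (g y)%:E = \int[mu]_y (g y - f y)%:E + \int[mu]_y (f y)%:E)%E.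
  rewrite -ge0_integralD//.
  - by apply: eq_integral => y _; rewrite -EFinD subrK.
  - by move=> y _; rewrite lee_fin.
  - by apply/measurable_EFinP; exact: measurable_funB.
  - by move=> y _; rewrite lee_fin.
  - exact/measurable_EFinP.
have f1 : (\int[mu]_y (f y)%:E)%E \is a fin_num by apply: (fin f).
have f2 : (\int[mu]_y (g y - f y)%:E)%E \is a fin_num.
  by apply: (fin (fun y => g y - f y)) => y; rewrite gf0/= gerBl.
by rewrite E (fineD f2 f1) addrK.
Qed.

End bounded_integrals.

(** * Limits uniform in the starting point *)

Section uniform_portmanteau.
Context {R : realType} {T : pmetricType R} {p : nat}.
Local Notation U := 'cV[R]_p.
Local Notation G := (borel_space T).
Variables (C : set T) (A : set U).
Variables (nu : R -> U -> {measure set G -> \bar R}) (mu : U -> {measure set G -> \bar R}).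
Hypothesis cA : compact A.
Hypothesis nuT : forall eta x, (nu eta x setT < +oo)%E.
Hypothesis mu_lt : forall x f, A x -> away_lip C f -> (\int[mu x]_y (f y)%:E < +oo)%E.
Hypothesis local_limit : forall f x' (e : R), away_lip C f -> A x' -> 0 < e ->
  exists2 rx : R, 0 < rx & \forall eta \near 0^'+, forall x, A x -> enorm (x - x') <= rx ->
  `|fine (\int[nu eta x]_y (f y)%:E)%E - fine (\int[mu x']_y (f y)%:E)%E| <= e.
Variables (g : T -> R) (M rd : R).
Hypothesis mg : measurable_fun setT (g : G -> R).
Hypothesis gM : forall y, 0 <= g y <= M.
Hypothesis rd0 : 0 < rd.
Hypothesis g_van : vanishes C rd g.

Local Notation I m := (fine (\int[m]_y (g y)%:E)%E).

Let M0 : 0 <= M. Proof. by have /andP[h1 h2] := gM point; exact: le_trans h2. Qed.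

Lemma away_integral_lt x : A x -> (\int[mu x]_y (g y)%:E < +oo)%E.
Proof.
move=> Ax; apply: (bounded_integral_lt rd0 M0 gM g_van); apply: mu_lt => //; exact: away_cut_lip.
Qed.

(** Monotone convergence yields a Lipschitz minorant of g with nearly the same limit integral; the
    local limit applies to it, and g lies above it. *)
Lemma lsc_liminf x' c : lsc g -> A x' -> c < I (mu x') -> exists2 rx : R, 0 < rx &
  \forall eta \near 0^'+, forall x, A x -> enorm (x - x') <= rx -> c <= I (nu eta x).
Proof.
move=> gl Ax' cI; pose gn n y := regularize g n y.
have gnI n y : 0 <= gn n y <= g y by exact: (regularize_itv gM).
have aw n : away_lip C (gn n).
  exists M, n%:R, rd; split => //.
  - by move=> y; have /andP[-> /= h] := gnI n y; apply: le_trans h _; have /andP[] := gM y.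
  - exact: (regularize_lip gM).
  - by move=> z y Cz zy; apply/eqP; rewrite eq_le andbC; have := gnI n y; rewrite (g_van Cz zy).
have mgn n : measurable_fun setT (gn n : G -> R) by exact: away_lip_measurable (aw n).
have gE : (\int[mu x']_y (gn n y)%:E @[n --> \oo] --> \int[mu x']_y (g y)%:E)%E.
  have -> : (\int[mu x']_y (g y)%:E = \int[mu x']_y limn (fun n => (gn n y)%:E))%E.
    apply: eq_integral => y _; apply/esym/cvg_lim => //; apply: cvg_EFin; first by near=> n.
    exact: (regularize_cvg gM).
  apply: (@cvg_monotone_convergence _ G R (mu x') setT measurableT (fun n (y : G) => (gn n y)%:E)).
  - by move=> n; exact/measurable_EFinP.
  - by move=> n y _; rewrite lee_fin; have /andP[] := gnI n y.
  - by move=> y _ n n' nn; rewrite lee_fin; exact: (regularize_le gM).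
have Ifin : (\int[mu x']_y (g y)%:E)%E \is a fin_num.
  rewrite ge0_fin_numE ?away_integral_lt//.
  by apply: integral_ge0 => y _; rewrite lee_fin; have /andP[] := gM y.
move: gE; rewrite -(fineK Ifin) => /fine_cvg /cvgrPdist_le gE.
have e0 : 0 < (I (mu x') - c) / 2 by rewrite divr_gt0// subr_gt0.
have [n hn] := filter_ex (gE _ e0).
have [rx rx0 hr] := local_limit (aw n) Ax' e0.
exists rx => //; apply: filterS hr => eta hr x Ax xx'.
have le : fine (\int[nu eta x]_y (gn n y)%:E)%E <= I (nu eta x).
  by apply: fine_integral_le => //; exact: finite_integral_lt gM.
have := hr x Ax xx'; move: hn => /=; rewrite !ler_norml => /andP[_ h1] /andP[h2 _]; lra.
Unshelve. all: by end_near. Qed.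

End uniform_portmanteau.

Section uniform_portmanteau_bounds.
Context {R : realType} {T : pmetricType R} {p : nat}.
Local Notation U := 'cV[R]_p.
Local Notation G := (borel_space T).
Variables (C : set T) (A : set U).
Variables (nu : R -> U -> {measure set G -> \bar R}) (mu : U -> {measure set G -> \bar R}).
Hypothesis cA : compact A.
Hypothesis nuT : forall eta x, (nu eta x setT < +oo)%E.
Hypothesis mu_lt : forall x f, A x -> away_lip C f -> (\int[mu x]_y (f y)%:E < +oo)%E.
Hypothesis local_limit : forall f x' (e : R), away_lip C f -> A x' -> 0 < e ->
  exists2 rx : R, 0 < rx & \forall eta \near 0^'+, forall x, A x -> enorm (x - x') <= rx ->
  `|fine (\int[nu eta x]_y (f y)%:E)%E - fine (\int[mu x']_y (f y)%:E)%E| <= e.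
Variables (g : T -> R) (M rd : R).
Hypothesis mg : measurable_fun setT (g : G -> R).
Hypothesis gM : forall y, 0 <= g y <= M.
Hypothesis rd0 : 0 < rd.
Hypothesis g_van : vanishes C rd g.

Local Notation I m := (fine (\int[m]_y (g y)%:E)%E).

Let M0 : 0 <= M. Proof. by have /andP[h1 h2] := gM point; exact: le_trans h2. Qed.

(* The lower bound applied to [w - g], where [w] is a Lipschitz majorant of [g]. *)
Lemma usc_limsup x' c : lsc (fun y => - g y) -> A x' -> I (mu x') < c -> exists2 rx : R, 0 < rx &
  \forall eta \near 0^'+, forall x, A x -> enorm (x - x') <= rx -> I (nu eta x) <= c.
Proof.
move=> gu Ax' Ic; pose w y := M * away_cut C rd y.
have rd2 : 0 < rd / 2 by rewrite divr_gt0.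
have rdh : rd / 2 <= rd by rewrite ler_pdivrMr// ler_peMr ?(ltW rd0)// ler1n.
have [B0 [L0 [rd1 [cI cL rd10 cv]]]] := away_cut_lip C rd0.
have wM y : 0 <= w y <= M.
  by have /andP[h1 h2] := away_cut_itv C rd y; rewrite mulr_ge0//= ler_piMr.
have gw y : 0 <= g y <= w y.
  by have /andP[-> _] := gM y; exact: (vanishes_le_cut rd0 M0 gM g_van).
have wL y y' : `|w y - w y'| <= M * L0 * mdist y y'.
  by rewrite -mulrBr normrM ger0_norm// -mulrA ler_wpM2l.
have wa : away_lip C w.
  by exists M, (M * L0), rd1; split => // z y Cz zy; rewrite /w (cv z)// mulr0.
have mw := away_lip_measurable wa.
have wg : lsc (fun y => w y - g y).
  move=> y e e0; have e2 : 0 < e / 2 by rewrite divr_gt0.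
  have [d1 d10 h1] := gu y _ e2; have [d2 d20 h2] := lip_cont wL y e2.
  exists (Num.min d1 d2) => [|y']; first by rewrite lt_min d10.
  rewrite lt_min => /andP[/h1 {}h1 /h2]; rewrite ler_norml => /andP[_ {}h2]; lra.
have mwg : measurable_fun setT ((fun y => w y - g y) : G -> R) by exact: measurable_funB.
have wgM y : 0 <= w y - g y <= M.
  by have := gw y; have := wM y; move=> /andP[h1 h2] /andP[h3 h4]; rewrite subr_ge0 h4/=; lra.
have rm : 0 < Num.min rd rd1 by rewrite lt_min rd0.
have wg_van : vanishes C (Num.min rd rd1) (fun y => w y - g y).
  move=> z y Cz; rewrite le_min => /andP[zy zy1]; by rewrite (g_van Cz zy) /w (cv z)// mulr0 subrr.
pose e := (c - I (mu x')) / 2; have e0 : 0 < e by rewrite divr_gt0// subr_gt0.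
have muB : fine (\int[mu x']_y (w y - g y)%:E)%E = fine (\int[mu x']_y (w y)%:E)%E - I (mu x').
  by apply: fine_integralB => //; exact: mu_lt.
have [r1 r10 h1] := local_limit wa Ax' e0.
have lt1 : fine (\int[mu x']_y (w y - g y)%:E)%E - e < fine (\int[mu x']_y (w y - g y)%:E)%E by rewrite gtrBl.
have [r2 r20 h2] := lsc_liminf nuT mu_lt local_limit mwg wgM rm wg_van wg Ax' lt1.
exists (Num.min r1 r2); first by rewrite lt_min r10.
apply: filterS2 h1 h2 => eta h1 h2 x Ax; rewrite le_min => /andP[x1 x2].
have := h2 x Ax x2; have := h1 x Ax x1.
have -> : fine (\int[nu eta x]_y (w y - g y)%:E)%E = fine (\int[nu eta x]_y (w y)%:E)%E - I (nu eta x).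
  by apply: fine_integralB => //; exact: finite_integral_lt wM.
rewrite muB ler_norml => /andP[_]; rewrite /e; lra.
Qed.

Lemma liminf_uniform c : lsc g -> (forall x, A x -> c < I (mu x)) ->
  \forall eta \near 0^'+, forall x, A x -> c <= I (nu eta x).
Proof. by move=> gl h; apply: compact_cover => // x' Ax'; exact: (lsc_liminf nuT mu_lt local_limit mg gM rd0 g_van gl Ax' (h _ Ax')). Qed.

Lemma limsup_uniform c : lsc (fun y => - g y) -> (forall x, A x -> I (mu x) < c) ->
  \forall eta \near 0^'+, forall x, A x -> I (nu eta x) <= c.
Proof. by move=> gl h; apply: compact_cover => // x' Ax'; exact: usc_limsup (h _ Ax'). Qed.

Let near0 : ProperFilter (0^'+ : set_system R) := at_right_proper_filter 0.

Hypotheses (gl : lsc g) (gu : lsc (fun y => - g y)).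

Lemma limit_local x' (e : R) : A x' -> 0 < e -> exists2 rx : R, 0 < rx & \forall eta \near 0^'+,
  forall x, A x -> enorm (x - x') <= rx -> `|I (nu eta x) - I (mu x')| <= e.
Proof.
move=> Ax' e0; have l1 : I (mu x') - e < I (mu x') by rewrite gtrBl.
have l2 : I (mu x') < I (mu x') + e by rewrite ltrDl.
have [r1 r10 h1] := lsc_liminf nuT mu_lt local_limit mg gM rd0 g_van gl Ax' l1.
have [r2 r20 h2] := usc_limsup gu Ax' l2.
exists (Num.min r1 r2); first by rewrite lt_min r10.
apply: filterS2 h1 h2 => eta h1 h2 x Ax; rewrite le_min => /andP[x1 x2].
have := h1 x Ax x1; have := h2 x Ax x2; rewrite ler_norml => u v; apply/andP; split; lra.
Qed.

(** A consequence of local uniformity: at one small eta the same prelimit integral at x is close to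
    the limits at x and at x'. *)
Lemma limit_continuous x' (e : R) : A x' -> 0 < e -> exists2 rx : R, 0 < rx &
  forall x, A x -> enorm (x - x') <= rx -> `|I (mu x) - I (mu x')| <= e.
Proof.
move=> Ax' e0; have e2 : 0 < e / 2 by rewrite divr_gt0.
have [rx rx0 hr] := limit_local Ax' e2; exists rx => // x Ax xx'.
have [ry ry0 hy] := limit_local Ax e2.
have [eta [/(_ x Ax xx') h1 /(_ x Ax)]] := @filter_ex _ _ near0 _ (filterI hr hy).
rewrite subrr enorm0 => /(_ (ltW ry0)); move: h1; rewrite !ler_norml => /andP[h1 h2] /andP[h3 h4].
by apply/andP; split; lra.
Qed.

Lemma limit_uniform e : 0 < e ->
  \forall eta \near 0^'+, forall x, A x -> `|I (nu eta x) - I (mu x)| <= e.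
Proof.
move=> e0; have e2 : 0 < e / 2 by rewrite divr_gt0.
apply: compact_cover => // x' Ax'; have [rx rx0 hr] := limit_local Ax' e2.
have [ry ry0 hy] := limit_continuous Ax' e2.
exists (Num.min rx ry) => [|]; first by rewrite lt_min rx0.
apply: filterS hr => eta h x Ax; rewrite le_min => /andP[/(h x Ax) + /(hy x Ax)].
by rewrite !ler_norml => /andP[h1 h2] /andP[h3 h4]; apply/andP; split; lra.
Qed.

(** Local bounds from [limit_continuous], made global by [compact_cover] along the filter at
    infinity. *)
Lemma limit_bounded : exists c, forall x, A x -> I (mu x) <= c.
Proof.
have : \forall c \near +oo%R, forall x, A x -> I (mu x) <= c.
  apply: compact_cover => // x' Ax'; have [rx rx0 hr] := limit_continuous Ax' ltr01.
  exists rx => //; near=> c => x Ax /(hr x Ax); rewrite ler_norml => /andP[_ h].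
  apply: (@le_trans _ _ (I (mu x') + 1)); first by rewrite -lerBlDl.
  near: c; apply: nbhs_pinfty_ge; exact: num_real.
by move=> /filter_ex.
Unshelve. all: by end_near. Qed.

End uniform_portmanteau_bounds.

Section limf_bounds.
Context {R : realType} (F : set_system R).
Implicit Types (h : R -> \bar R) (c : \bar R).

Lemma le_limf_einf h c : (\forall x \near F, c <= h x)%E -> (c <= limf_einf h F)%E.
Proof.
move=> hc; rewrite limf_einfE; apply: (@le_trans _ _ (ereal_inf [set h x | x in [set x | (c <= h x)%E]])).
  by apply: le_ereal_inf_tmp => _ [x hx <-].
by apply: ereal_sup_ubound; exists [set x | (c <= h x)%E].
Qed.

Lemma limf_esup_le h c : (\forall x \near F, h x <= c)%E -> (limf_esup h F <= c)%E.
Proof.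
move=> hc; rewrite limf_esupE; apply: (@le_trans _ _ (ereal_sup [set h x | x in [set x | (h x <= c)%E]])).
  by apply: ereal_inf_lbound; exists [set x | (h x <= c)%E].
by apply: ge_ereal_sup => _ [x hx <-].
Qed.

Lemma limf_einf_le_esup h h' : ProperFilter F -> (\forall x \near F, h x <= h' x)%E ->
  (limf_einf h F <= limf_esup h' F)%E.
Proof.
move=> FF hh; rewrite limf_einfE limf_esupE; apply: ge_ereal_sup => _ [V FV <-].
apply: le_ereal_inf_tmp => _ [W FW <-].
have [x [[Vx Wx] hx]] := filter_ex (filterI (filterI FV FW) hh).
apply: (@le_trans _ _ (h x)); first by apply: ereal_inf_lbound; exists x.
by apply: le_trans hx _; apply: ereal_sup_ubound; exists x.
Qed.

End limf_bounds.

Section away_functions.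
Context {R : realType} {T : pmetricType R}.
Implicit Types (C B : set T) (f : T -> R).

Lemma cont_lsc f : (forall y e, 0 < e -> exists2 del : R, 0 < del &
    forall y', mdist y y' < del -> `|f y - f y'| <= e) -> lsc f /\ lsc (fun y => - f y).
Proof.
by move=> h; split => y e e0; have [del del0 hd] := h y e e0; exists del => // y' /hd;
  rewrite ler_norml => /andP[h1 h2]; lra.
Qed.

(** Extended by 0, a test function is continuous on the whole space: it vanishes near C, and any
    other point has a ball that avoids C. *)
Lemma test_function_patch C f : test_function C f -> let g := f \_ (~` C) in
  exists M r : R, [/\ 0 < r, forall y, 0 <= g y <= M, vanishes C r g &
  forall y e, 0 < e -> exists2 del : R, 0 < del & forall y', mdist y y' < del -> `|g y - g y'| <= e].
Proof.
move=> [fc f0 [M fM] [r r0 fr]] /=; set g := f \_ (~` C).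
have gv : vanishes C r g.
  move=> z y Cz zy; rewrite /g patchE; case: ifPn => // /set_mem nCy.
  by apply: fr => //; exact: fattening_near zy.
exists (Num.max M 0), r; split => //.
  move=> y; rewrite /g patchE; case: ifPn => [/set_mem nCy|_]; first by rewrite f0//= le_max fM.
  by rewrite lexx le_max lexx orbT.
move=> y e e0; have [[z [Cz zy]]|nz] := pselect (exists z, C z /\ mdist z y < r).
  exists (r - mdist z y); first by rewrite subr_gt0.
  move=> y' yy'; rewrite (gv z y)// ?(ltW zy)// (gv z y')// ?subrr ?normr0 ?ltW//.
  by have := metric_triangle z y y'; lra.
have far y' : mdist y y' < r -> ~ C y' by move=> yy' Cy'; apply: nz; exists y'; rewrite metric_sym.
move/subspace_continuousP: fc => /(_ y); have nCy : (~` C) y by apply: far; rewrite mdistxx.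
move=> /(_ nCy) /cvgrPdist_le /(_ e e0) /nbhs_ballP[del /= del0 hd].
exists (Num.min r del); first by rewrite lt_min r0.
move=> y'; rewrite lt_min => /andP[yr yd]; have nC' := far _ yr.
rewrite /g !patchE !mem_set//; apply: hd => //; by rewrite ballEmdist.
Qed.

Lemma lsc_open B : open B -> lsc (\1_B : T -> R).
Proof.
rewrite openE => oB y e e0; have [By|nBy] := pselect (B y); last first.
  exists 1 => // y' _; rewrite [X in X - _]indicE memNset//= sub0r.
  by apply: (@le_trans _ _ 0); [rewrite oppr_le0 ltW|rewrite indicE ler0n].
have := oB y By; rewrite /interior nbhs_ballP => -[del /= del0 hd]; exists del => // y' yy'.
by rewrite !indicE !mem_set// ?lerBlDr ?lerDl ?ltW//; apply: hd; rewrite ballEmdist.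
Qed.

Lemma usc_closed B : closed B -> lsc (fun y => - (\1_B y : R)).
Proof.
rewrite -openC => /lsc_open h y e e0; have [del del0 hd] := h y e e0; exists del => // y' /hd.
by rewrite !indicE !in_setC; case: (y \in B); case: (y' \in B) => /=; lra.
Qed.

(** Half of the distance between B and C survives for the closure of B. *)
Lemma bounded_away_vanishes C B : bounded_away B C -> exists2 r : R, 0 < r &
  vanishes C r (\1_(closure B)).
Proof.
rewrite /bounded_away => h; have [s s0 hs] : exists2 s : R, 0 < s & forall y z, B y -> C z -> s <= mdist y z.
  have [s /andP[s0 hs]] : exists s : R, (0 < s%:E)%E && (s%:E <= ereal_inf [set (mdist q.1 q.2)%:E | q in B `*` C])%E.
    case: (ereal_inf _) h => [s| |] // s0; first by exists s; rewrite s0 lexx.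
    by exists 1; rewrite lte01 leey.
  exists s; first by rewrite -lte_fin.
  move=> y z By Cz; rewrite -lee_fin; apply: le_trans hs _; apply: ereal_inf_lbound.
  by exists (y, z).
exists (s / 2); first by rewrite divr_gt0.
move=> z y Cz zy; rewrite indicE memNset//= => /(_ (ball y (s / 2)))[|y' [By' ]].
  by apply: nbhsx_ballx; rewrite divr_gt0.
rewrite ballEmdist /= => yy'; have := hs _ _ By' Cz; have := metric_triangle y' y z.
rewrite [mdist y' y]metric_sym [mdist y z]metric_sym; lra.
Qed.

End away_functions.

Section abstract_limit.
Context {R : realType} {T : pmetricType R} {p : nat}.
Local Notation U := 'cV[R]_p.
Local Notation G := (borel_space T).
Variables (C : set T) (A : set U) (K : R -> R) (PS : R -> U -> set T -> \bar R) (muS : U -> set T -> \bar R).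
Variables (nu : R -> U -> {measure set G -> \bar R}) (mu : U -> {measure set G -> \bar R}).
Hypothesis K0 : \forall eta \near 0^'+, 0 <= K eta.
Hypothesis nuE : \forall eta \near 0^'+, forall x (E : set G), measurable E ->
  ((K eta)%:E * PS eta x E = nu eta x E)%E.
Hypothesis muE : forall x (E : set G), measurable E -> muS x E = mu x E.
Hypothesis A0 : A !=set0.
Hypothesis cA : compact A.
Hypothesis nuT : forall eta x, (nu eta x setT < +oo)%E.
Hypothesis mu_lt : forall x f, A x -> away_lip C f -> (\int[mu x]_y (f y)%:E < +oo)%E.
Hypothesis local_limit : forall f x' (e : R), away_lip C f -> A x' -> 0 < e ->
  exists2 rx : R, 0 < rx & \forall eta \near 0^'+, forall x, A x -> enorm (x - x') <= rx ->
  `|fine (\int[nu eta x]_y (f y)%:E)%E - fine (\int[mu x']_y (f y)%:E)%E| <= e.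

Let near0 : ProperFilter (0^'+ : set_system R) := at_right_proper_filter 0.

Lemma M_integralE (m : set T -> \bar R) (m' : {measure set G -> \bar R}) f :
  (forall E : set G, measurable E -> m E = m' E) ->
  M_integral C m f = (\int[m']_y ((f \_ (~` C)) y)%:E)%E.
Proof.
move=> mm; rewrite /M_integral (eq_set_integral _ _ mm) integral_mkcond.
by apply: eq_integral => y _; rewrite !patchE; case: ifP.
Qed.

Lemma M_cvg_unif_abstract :
  M_cvg_unif C 0^'+ A (fun eta x E => ((K eta)%:E * PS eta x E)%E) muS.
Proof.
have mfat r : measurable (~` fattening C r : set G) by apply: open_borel; exact: open_fatteningC.
split.
- apply: filterS nuE => eta h x Ax; split; first by exists (nu eta x) => E mE _; exact: h.
  move=> r r0; rewrite h//; apply: le_lt_trans (nuT eta x); apply: le_measure; rewrite ?inE//.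
- move=> x Ax; split; first by exists (mu x) => E mE _; exact: muE.
  move=> r r0; rewrite muE//.
  have -> : mu x (~` fattening C r) = (\int[mu x]_y (\1_(~` fattening C r) y : R)%:E)%E.
    by rewrite integral_indic// setIT.
  apply: (@away_integral_lt _ _ _ C A mu mu_lt _ 1 r) => //.
    by move=> y; rewrite indicE ler0n lern1 leq_b1.
  move=> z y Cz zy; rewrite indicE memNset//=; apply; exact: fattening_near zy.
- move=> f /test_function_patch[M [r [r0 gM gv gc]]].
  set g := f \_ (~` C) in gM gv gc; have [gl gu] := cont_lsc gc.
  have mg : measurable_fun setT (g : G -> R) by exact: metric_continuous_measurable.
  have g0 y : 0 <= g y by have /andP[] := gM y.
  have lim := limit_uniform cA nuT mu_lt local_limit mg gM r0 gv gl gu.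
  have bnd (e : R) : 0 < e -> \forall eta \near 0^'+, (0 <= ereal_sup [set `|M_integral C (fun E =>
      (K eta)%:E * PS eta x E) f - M_integral C (muS x) f| | x in A] <= e%:E)%E.
    move=> e0; near=> eta.
    have nuE' : forall x (E : set G), measurable E -> ((K eta)%:E * PS eta x E = nu eta x E)%E.
      by near: eta.
    have lim' : forall x, A x -> `|fine (\int[nu eta x]_y (g y)%:E)%E - fine (\int[mu x]_y (g y)%:E)%E| <= e.
      by near: eta; exact: lim.
    apply/andP; split.
      by have [x Ax] := A0; apply: le_trans (abse_ge0 _) (ereal_sup_ubound _); exists x.
    apply: ge_ereal_sup => _ [x Ax <-].
    rewrite (M_integralE f (nuE' x)) (M_integralE f (@muE x)) -/g.
    have f1 : (\int[nu eta x]_y (g y)%:E)%E \is a fin_num.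
      rewrite ge0_fin_numE ?(finite_integral_lt (nuT _ _) gM)//.
      by apply: integral_ge0 => y _; rewrite lee_fin.
    have f2 : (\int[mu x]_y (g y)%:E)%E \is a fin_num.
      rewrite ge0_fin_numE ?(away_integral_lt mu_lt gM r0 gv Ax)//.
      by apply: integral_ge0 => y _; rewrite lee_fin.
    by rewrite -(fineK f1) -(fineK f2) -EFinB abse_EFin lee_fin lim'.
  apply/fine_cvgP; split.
    by apply: filterS (bnd _ ltr01) => eta /andP[h1 h2]; rewrite ge0_fin_numE// (le_lt_trans h2)// ltry.
  apply/cvgrPdist_le => e e0; apply: filterS (bnd _ e0) => eta /andP[h1 h2] /=.
  have fn : (ereal_sup [set `|M_integral C (fun E => (K eta)%:E * PS eta x E) f - M_integral C (muS x) f| | x in A] \is a fin_num)%E.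
    by rewrite ge0_fin_numE// (le_lt_trans h2)// ltry.
  by rewrite sub0r normrN ger0_norm ?fine_ge0// -lee_fin fineK.
Unshelve. all: by end_near. Qed.

Lemma le_inf_scale (c : \bar R) (k : R) (u : U -> \bar R) : 0 <= k ->
  (forall x, A x -> c <= k%:E * u x)%E -> (c <= ereal_inf [set u x | x in A] * k%:E)%E.
Proof.
rewrite le_eqVlt => /orP[/eqP <-|k0] h.
  by have [x Ax] := A0; have := h x Ax; rewrite mul0e mule0.
rewrite muleC -ereal_inf_pZl//; apply: le_ereal_inf_tmp => _ [_ [x Ax <-] <-]; exact: h.
Qed.

Lemma sup_scale_le (c : \bar R) (k : R) (u : U -> \bar R) : 0 <= k ->
  (forall x, A x -> k%:E * u x <= c)%E -> (ereal_sup [set u x | x in A] * k%:E <= c)%E.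
Proof.
rewrite le_eqVlt => /orP[/eqP <-|k0] h.
  by have [x Ax] := A0; have := h x Ax; rewrite mul0e mule0.
rewrite muleC -ereal_sup_pZl//; apply: ge_ereal_sup => _ [_ [x Ax <-] <-]; exact: h.
Qed.

Variable B : set T.
Hypothesis mB : measurable (B : set G).
Hypothesis B_away : bounded_away B C.

Let int_ind (m : {measure set G -> \bar R}) (E : set G) : measurable E ->
  (\int[m]_y (\1_E y : R)%:E)%E = m E.
Proof. by move=> mE; rewrite integral_indic// setIT. Qed.

Let ind01 (E : set T) y : 0 <= (\1_E y : R) <= 1.
Proof. by rewrite indicE ler0n lern1 leq_b1. Qed.

Let mI : measurable (B° : set G). Proof. by apply: open_borel; exact: open_interior. Qed.
Let mCl : measurable (closure B : set G). Proof. by apply: closed_borel; exact: closed_closure. Qed.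

Let van (E : set T) : E `<=` closure B -> exists2 r : R, 0 < r & vanishes C r (\1_E).
Proof.
have [r r0 h] := bounded_away_vanishes B_away; move=> EB; exists r => // z y Cz zy.
apply/eqP; rewrite eq_le; have /andP[-> _] := ind01 E y; rewrite andbT; apply: (@le_trans _ _ (\1_(closure B) y)); last by rewrite (h z).
by rewrite !indicE ler_nat; case: (boolP (y \in E)) => // /set_mem /EB yB; rewrite mem_set.
Qed.

Let mu_fin (E : set G) x : measurable E -> E `<=` closure B -> A x -> mu x E \is a fin_num.
Proof.
move=> mE /van[r r0 h] Ax; rewrite -int_ind// ge0_fin_numE.
  apply: (away_integral_lt mu_lt (ind01 E) r0 h Ax).
by apply: integral_ge0 => y _; rewrite lee_fin.
Qed.

Let nu_fin (E : set G) eta x : measurable E -> nu eta x E \is a fin_num.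
Proof.
by move=> mE; rewrite ge0_fin_numE//; apply: le_lt_trans (nuT eta x); apply: le_measure; rewrite ?inE.
Qed.

Let IB : B° `<=` closure B. Proof. exact: subset_trans (@interior_subset _ _) (@subset_closure _ _). Qed.

Lemma portmanteau_lower : (ereal_inf [set muS x B° | x in A] <=
  limf_einf (fun eta => ereal_inf [set PS eta x B | x in A] * (K eta)%:E) 0^'+)%E.
Proof.
set i := ereal_inf _; have i0 : (0 <= i)%E by apply: le_ereal_inf_tmp => _ [x Ax <-]; rewrite muE.
have ifin : i \is a fin_num.
  rewrite ge0_fin_numE//; have [x Ax] := A0; apply: (@le_lt_trans _ _ (mu x B°)).
    by apply: ereal_inf_lbound; exists x => //; exact: muE.
  by have := mu_fin mI IB Ax; rewrite ge0_fin_numE.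
have [r r0 h] := van IB.
apply/lee_addgt0Pr => e e0; rewrite -leeBlDr// -(fineK ifin) -EFinB; apply: le_limf_einf.
have lt x : A x -> fine i - e < fine (\int[mu x]_y (\1_(B°) y : R)%:E)%E.
  move=> Ax; rewrite int_ind//; apply: (@lt_le_trans _ _ (fine i)); first by rewrite gtrBl.
  by apply: fine_le => //; [exact: mu_fin|apply: ereal_inf_lbound; exists x => //; exact: muE].
have mi : measurable_fun setT (\1_(B°) : G -> R) by exact: measurable_indic.
have := liminf_uniform cA nuT mu_lt local_limit mi (ind01 _) r0 h (lsc_open (@open_interior _ B)) lt.
apply: filterS3 K0 nuE => eta k0 hE hl; apply: le_inf_scale => // x Ax; rewrite hE//.
apply: (@le_trans _ _ (nu eta x B°)); last by apply: le_measure; rewrite ?inE//; exact: interior_subset.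
by rewrite -(fineK (nu_fin eta x mI)) lee_fin -int_ind// hl.
Qed.

(** The indicator of the closure is dominated by a Lipschitz cutoff, whose limit integral is bounded
    on A. *)
Lemma portmanteau_finite : (ereal_sup [set muS x (closure B) | x in A] < +oo)%E.
Proof.
have [r r0 h] := van (@subset_refl _ (closure B)).
have aw := away_cut_lip C r0; have [B0 [L0 [rd [cI cL rd0 cv]]]] := aw.
have [cl cu] := cont_lsc (lip_cont cL).
have [c hc] := limit_bounded cA nuT mu_lt local_limit (away_lip_measurable aw) cI rd0 cv cl cu.
apply: (@le_lt_trans _ _ c%:E); last exact: ltry.
apply: ge_ereal_sup => _ [x Ax <-]; rewrite muE// -int_ind//.
apply: (@le_trans _ _ (\int[mu x]_y (away_cut C r y)%:E)%E).
  apply: ge0_le_integral_set => y; rewrite lee_fin; first by have /andP[] := ind01 (closure B) y.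
  by rewrite -[leRHS]mul1r; exact: (vanishes_le_cut r0 ler01 (ind01 _) h).
rewrite -[leLHS]fineK ?lee_fin ?hc// ge0_fin_numE ?mu_lt//.
by apply: integral_ge0 => y _; rewrite lee_fin; have /andP[] := cI y.
Qed.

Lemma portmanteau_upper : (limf_esup (fun eta => ereal_sup [set PS eta x B | x in A] * (K eta)%:E) 0^'+ <=
  ereal_sup [set muS x (closure B) | x in A])%E.
Proof.
set i := ereal_sup _; have i0 : (0 <= i)%E.
  by have [x Ax] := A0; apply: (@le_trans _ _ (muS x (closure B))); [rewrite muE|apply: ereal_sup_ubound; exists x].
have ifin : i \is a fin_num by rewrite ge0_fin_numE// portmanteau_finite.
have [r r0 h] := van (@subset_refl _ (closure B)).
apply/lee_addgt0Pr => e e0; rewrite -(fineK ifin) -EFinD; apply: limf_esup_le.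
have lt x : A x -> fine (\int[mu x]_y (\1_(closure B) y : R)%:E)%E < fine i + e.
  move=> Ax; rewrite int_ind//; apply: (@le_lt_trans _ _ (fine i)); last by rewrite ltrDl.
  by apply: fine_le => //; [exact: mu_fin|apply: ereal_sup_ubound; exists x => //; exact: muE].
have mi : measurable_fun setT (\1_(closure B) : G -> R) by exact: measurable_indic.
have := limsup_uniform cA nuT mu_lt local_limit mi (ind01 _) r0 h (usc_closed (@closed_closure _ B)) lt.
apply: filterS3 K0 nuE => eta k0 hE hl; apply: sup_scale_le => // x Ax; rewrite hE//.
apply: (@le_trans _ _ (nu eta x (closure B))); first by apply: le_measure; rewrite ?inE//; exact: subset_closure.
by rewrite -(fineK (nu_fin eta x mCl)) lee_fin -int_ind// hl.
Qed.

Lemma portmanteau_middle : (limf_einf (fun eta => ereal_inf [set PS eta x B | x in A] * (K eta)%:E) 0^'+ <=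
  limf_esup (fun eta => ereal_sup [set PS eta x B | x in A] * (K eta)%:E) 0^'+)%E.
Proof.
apply: limf_einf_le_esup; apply: filterS K0 => eta k0; apply: lee_wpmul2r; first by rewrite lee_fin.
have [x Ax] := A0; apply: (@le_trans _ _ (PS eta x B)).
  by apply: ereal_inf_lbound; exists x.
by apply: ereal_sup_ubound; exists x.
Qed.

End abstract_limit.

Section null_restriction.
Import HBNNSimple.
Context {R : realType} d (X : measurableType d) (mu : {measure set X -> \bar R}).

(** Meant for integrands whose measurability is known only on D, as for [h_map] on the simplex: the
    comparison is made for each simple function below f, where equality almost everywhere
    applies. *)
Lemma integral_indic_conull (D : set X) (f : X -> R) : measurable D -> mu (~` D) = 0 ->
  (forall x, 0 <= f x) -> (\int[mu]_x (f x)%:E = \int[mu]_x (f x * \1_D x)%:E)%E.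
Proof.
move=> mD muD f0; have fD0 x : 0 <= f x * \1_D x by rewrite mulr_ge0.
apply/eqP; rewrite eq_le; apply/andP; split; last first.
  by apply: ge0_le_integral_set => x; rewrite lee_fin// indicE ler_piMr// lern1 leq_b1.
rewrite {1}ge0_integralTE => [|x]; last by rewrite lee_fin.
apply: ge_ereal_sup => _ [s /= sf <-]; rewrite -integralT_nnsfun.
have ms : measurable_fun setT s by exact: measurable_funPT.
apply: (@le_trans _ _ (\int[mu]_x (s x * \1_D x)%:E)%E); last first.
  apply: ge0_le_integral_set => x; rewrite lee_fin ?mulr_ge0//.
  by rewrite ler_wpM2r// -lee_fin.
rewrite le_eqVlt; apply/orP; left; apply/eqP; apply: ge0_ae_eq_integral => //.
- exact/measurable_EFinP.
- by apply/measurable_EFinP; apply: measurable_funM => //; exact: measurable_indic.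
- by move=> x _; rewrite lee_fin fun_ge0.
- by move=> x _; rewrite lee_fin mulr_ge0// fun_ge0.
exists (~` D); split => //; first exact: measurableC.
move=> x /= nx Dx; apply: nx => _; by rewrite indicE mem_set// mulr1.
Qed.

End null_restriction.

(** * The limit measure as an image measure *)

Section path_law.
Context {R : realType} (m d : nat) (alpha : R) (S : probability (borel_space (sphere R d)) R).
Hypothesis alpha0 : 0 < alpha.
Variables (a : 'cV[R]_m.+1 -> 'cV[R]_m.+1) (sigma : 'cV[R]_m.+1 -> 'M[R]_(m.+1, d.+1)).
Variables (D b T : R) (k : nat).
Hypothesis D0 : 0 <= D.
Hypothesis aL : forall x y, enorm (a x - a y) <= D * enorm (x - y).
Hypothesis sL : forall x y, opnorm (sigma x - sigma y) <= D * enorm (x - y).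
Hypothesis b0 : 0 < b.
Hypothesis T0 : 0 < T.
Local Notation V := 'cV[R]_d.+1.
Local Notation G := (borel_space (skorokhod T m.+1)).
Local Notation J := (jump_law S alpha0).
Local Notation Q := (product_power J (k:=k) \x @lebesgue_times R T k)%E.
Local Notation Y := (k.-tuple (borel_space V) * k.-tuple R)%type.
Local Notation h x := (fun p : Y => h_map a sigma b T x p.1 p.2).

Let simplex : set Y := [set p | (increasing_times `]0, T[ : set (k.-tuple R)) p.2].

Let simplexE : simplex = setT `*` (increasing_times `]0, T[ : set (k.-tuple R)).
Proof. by apply/seteqP; split => [p ?|p []]. Qed.

Let msimplex : measurable simplex.
Proof. by rewrite simplexE; apply: measurableX => //; exact: measurable_simplex. Qed.

Lemma measurable_h_map x : measurable_fun simplex (h x : Y -> G).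
Proof.
pose c (q : ('I_k * 'I_d.+1) + 'I_k) (p : Y) : R :=
  match q with inl jl => (tnth p.1 jl.1 : V) jl.2 0 | inr j => tnth p.2 j end.
apply: (@measurable_metric_cells _ _ _ _ _ c) => //.
  move=> q; apply: measurable_funTS; case: q => [[j l]|j] /=.
    apply: (measurableT_comp (@measurable_coord _ _ l)).
    by apply: (measurableT_comp (measurable_tnth j)); exact: measurable_fst.
  by apply: (measurableT_comp (measurable_tnth j)); exact: measurable_snd.
(* [h_map_lip] bounds the marks of one of the two paths only, so a bound at the given point is
   enough. *)
move=> p sp e e0; pose M := \sum_(j < k) enorm (tnth p.1 j : V).
have M0 : 0 <= M by apply: sumr_ge0 => j _; exact: enorm_ge0.
have [C C0 hC] := h_map_lip D0 aL sL b0 T0 k M0 (enorm_ge0 x).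
pose Del := e / (2 * C); have Del0 : 0 < Del by rewrite divr_gt0// mulr_gt0.
exists (Del / d.+1%:R) => [|p' sp' hp]; first by rewrite divr_gt0.
apply: (@le_lt_trans _ _ (C * Del)); last first.
  rewrite (_ : C * Del = e / 2); first lra.
  by rewrite /Del; field; rewrite gt_eqF.
apply: hC => //.
- by move=> j; rewrite /M (bigD1 j)//= lerDl sumr_ge0// => i _; exact: enorm_ge0.
- by rewrite subrr enorm0 ltW.
- move=> j; apply: (@le_trans _ _ (d.+1%:R * (Del / d.+1%:R))); last by rewrite mulrC divfK.
  by apply: enorm_le_sum => l; have := hp (inl (j, l)); rewrite /c /= !mxE => /ltW.
- move=> j; have := hp (inr j); rewrite /c /= => /ltW h1; apply: le_trans h1 _.
  by rewrite ler_pdivrMr// ler_peMr ?(ltW Del0)// ler1n.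
Qed.

(** [h_map] made measurable by a constant value off the simplex, a set of measure 0. *)
Definition jump_path x (p : Y) : G := if p \in simplex then h x p else point.

Lemma measurable_jump_path x : measurable_fun setT (jump_path x).
Proof.
apply: measurable_fun_if => //.
- apply: (measurable_fun_bool true); rewrite setTI (_ : _ @^-1` _ = simplex)//.
  by apply/seteqP; split => p hp; [exact: set_mem|exact: mem_set].
- rewrite setTI (_ : _ @^-1` _ = simplex); first exact: measurable_h_map.
  by apply/seteqP; split => p hp; [exact: set_mem|exact: mem_set].
Qed.

Definition path_law x : {measure set G -> \bar R} :=
  measure_function_pushforward__canonical__measure_function_Measure Q (measurable_jump_path x).

Lemma off_simplex_null : Q (~` simplex) = 0%E.
Proof.
rewrite (_ : ~` simplex = setT `*` ~` (increasing_times `]0, T[ : set (k.-tuple R))); last first.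
  by apply/seteqP; split => [p np|p [_ np]] //; split.
have mS := @measurable_simplex R T k.
rewrite [LHS](_ : _ = (product_power J (k:=k) setT * @lebesgue_times R T k (~` increasing_times `]0%R, T[))%E); last first.
  by apply: product_measure1E => //; exact: measurableC.
by rewrite /lebesgue_times setICl measure0 mule0.
Qed.

Lemma integral_path_law x (f : skorokhod T m.+1 -> R) : measurable_fun setT (f : G -> R) -> (forall y, 0 <= f y) ->
  (\int[path_law x]_y (f y)%:E =
   \int[Q]_p (f (h_map a sigma b T x p.1 p.2) * \1_(increasing_times `]0%R, T[ : set (k.-tuple R)) p.2)%:E)%E.
Proof.
move=> mf f0; rewrite (ge0_integral_pushforward (measurable_jump_path x))//; last 2 first.
  by apply/measurable_EFinP.
  by move=> y _; rewrite lee_fin.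
rewrite preimage_setT [LHS](@integral_indic_conull _ _ _ Q simplex (fun p => f (jump_path x p)))//.
  apply: eq_integral => p _; congr (_%:E); rewrite /jump_path !indicE.
  rewrite (_ : (p.2 \in _) = (p \in simplex)); last by apply/idP/idP => /set_mem s; apply/mem_set.
  by case: ifP; rewrite ?mulr0.
exact: off_simplex_null.
Qed.

Lemma limit_measureE x (B : set (skorokhod T m.+1)) : measurable (B : set G) ->
  limit_measure a sigma b alpha S T k x B = path_law x B.
Proof.
move=> mB; rewrite /limit_measure.
rewrite (@eq_set_integral _ _ _ _ Q); last first.
  move=> E mE; apply: eq_set_product => // F mF; apply: eq_product_power => // F' mF'; exact: jump_lawE.
rewrite (@integral_indic_conull _ _ _ Q simplex (fun p => \1_B (h_map a sigma b T x p.1 p.2)))//; last exact: off_simplex_null.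
have -> : path_law x B = (\int[path_law x]_y (\1_B y : R)%:E)%E by rewrite integral_indic// setIT.
by rewrite integral_path_law.
Qed.

End path_law.

(** * The scaled law of the chain and the conclusion *)

Lemma compact_enorm_bounded {R : realType} {p : nat} (A : set 'cV[R]_p) : compact A ->
  exists2 r : R, 0 <= r & forall x, A x -> enorm x <= r.
Proof.
move=> cA; have : \forall c \near +oo%R, forall x, A x -> enorm x <= c.
  apply: compact_cover => // x' Ax'; exists 1 => //; near=> c => x Ax xx'.
  apply: (@le_trans _ _ (1 + enorm x')).
    by rewrite -[x in enorm x <= _](subrK x') (le_trans (enormD _ _))// lerD2r.
  near: c; apply: nbhs_pinfty_ge; exact: num_real.
move=> h; have [r [r0 hr]] := filter_ex (filterI (nbhs_pinfty_ge (num_real (0 : R))) h); by exists r.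
Unshelve. all: by end_near. Qed.

Section scaled_law.
Context {R : realType} d d' (X : measurableType d) (Y : measurableType d') (P : probability X R) (f : X -> Y).
Variable (K : R) (K0 : 0 <= K).

(** The case distinction provides a measure for every real eta, also where the path map is not known
    to be measurable; the limit involves small positive eta only. *)
Definition scaled_law : {measure set Y -> \bar R} :=
  match pselect (measurable_fun setT f) with
  | left mf => mscale (NngNum K0) (measure_function_pushforward__canonical__measure_function_Measure P mf)
  | right _ => mzero
  end.

Lemma scaled_law_lt : (scaled_law setT < +oo)%E.
Proof.
rewrite /scaled_law; case: pselect => mf; last by rewrite /mzero ltry.
rewrite /= /mscale /= /pushforward preimage_setT probability_setT mule1; exact: ltry.
Qed.

Hypothesis mf : measurable_fun setT f.

Lemma scaled_lawE E : (scaled_law E = K%:E * P [set w | E (f w)])%E.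
Proof. by rewrite /scaled_law; case: pselect. Qed.

Lemma integral_scaled_law (g : Y -> R) M : measurable_fun setT g -> (forall y, 0 <= g y <= M) ->
  fine (\int[scaled_law]_y (g y)%:E)%E = K * fine (\int[P]_w (g (f w))%:E)%E.
Proof.
move=> mg gM; have g0 y : 0 <= g y by have /andP[] := gM y.
rewrite /scaled_law; case: pselect => // mf'.
have mg' : measurable_fun setT (fun y => (g y)%:E) by exact/measurable_EFinP.
have g0' y : (0 <= (g y)%:E)%E by rewrite lee_fin.
rewrite ge0_integral_mscale//.
rewrite (ge0_integral_pushforward mf')//.
rewrite preimage_setT fineM//= ge0_fin_numE; last by apply: integral_ge0 => y _; rewrite lee_fin /=.
apply: (@le_lt_trans _ _ (\int[P]_w (cst M%:E) w)%E).
  by apply: ge0_le_integral_set => w; rewrite lee_fin; have /andP[] := gM (f w).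
have M0 : 0 <= M by have /andP[h1 h2] := gM (f point); exact: le_trans h2.
have PT : (P setT < +oo)%E by rewrite probability_setT ltry.
by rewrite integral_cst//; apply: lte_mul_pinfty.
Qed.

End scaled_law.

(* Dimensions are positive: R^m and R^d are 'cV[R]_m.+1 and 'cV[R]_d.+1.
   Z 0 is the generic copy of the noise, Z 1, Z 2, ... drive the recursion. *)
Theorem theorem2p5 (R : realType) (disp : measure_display)
    (Omega : measurableType disp) (P : probability Omega R) (m d : nat)
    (Z : nat -> {RV P >-> borel_space 'cV[R]_d.+1})
    (alpha : R) (S : probability (borel_space (sphere R d)) R)
    (a : 'cV[R]_m.+1 -> 'cV[R]_m.+1) (sigma : 'cV[R]_m.+1 -> 'M[R]_(m.+1, d.+1))
    (D : R) (k : nat) (b T eps : R) (A : set 'cV[R]_m.+1) :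
  iid Z ->
  centered P (Z 0%N) ->
  1 < alpha ->
  mv_regularly_varying P (Z 0%N) alpha S ->
  1 <= D ->
  (forall x y, Num.max (opnorm (sigma x - sigma y)) (enorm (a x - a y))
                 <= D * enorm (x - y)) ->
  0 < b -> 0 < T -> 0 < eps ->
  A !=set0 -> compact A ->
  let X eta x w := chain_path a sigma b T (fun i => Z i w) eta x in
  let C := limit_measure a sigma b alpha S T k in
  let lam eta := lambda P (Z 0%N) eta in
  M_cvg_unif (jump_paths_pred a sigma b T k A eps) 0^'+ A
    (fun eta x E => ((lam eta ^- k)%:E * P [set w | E (X eta x w)])%E) C /\
  forall B : set (skorokhod T m.+1),
    measurable (B : set (borel_space (skorokhod T m.+1))) ->
    (exists2 e : R, 0 < e & bounded_away B (jump_paths_pred a sigma b T k A e)) ->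
    let PB eta x := P [set w | B (X eta x w)] in
    [/\ (ereal_inf [set C x B° | x in A] <=
           limf_einf (fun eta => ereal_inf [set PB eta x | x in A]
                                   * (lam eta ^- k)%:E) 0^'+)%E,
        (limf_einf (fun eta => ereal_inf [set PB eta x | x in A]
                                 * (lam eta ^- k)%:E) 0^'+ <=
           limf_esup (fun eta => ereal_sup [set PB eta x | x in A]
                                   * (lam eta ^- k)%:E) 0^'+)%E,
        (limf_esup (fun eta => ereal_sup [set PB eta x | x in A]
                                 * (lam eta ^- k)%:E) 0^'+ <=
           ereal_sup [set C x (closure B) | x in A])%E &
        (ereal_sup [set C x (closure B) | x in A] < +oo)%E].
Proof.
move=> Ziid Zc alpha1 RV D1 lip b0 T0 eps0 A0 cA X C lam.
have D0 : 0 <= D by exact: le_trans D1.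
have aL x y : enorm (a x - a y) <= D * enorm (x - y).
  by have := lip x y; rewrite ge_max => /andP[].
have sL x y : opnorm (sigma x - sigma y) <= D * enorm (x - y).
  by have := lip x y; rewrite ge_max => /andP[].
have [r r0 Ar] := compact_enorm_bounded cA.
pose alpha0 := lt_trans ltr01 alpha1.
pose mu := path_law S alpha0 k D0 aL sL b0 T0.
have K0 eta : 0 < eta -> 0 <= lam eta ^- k.
  by move=> eta0; rewrite invr_ge0 exprn_ge0// mulr_ge0 ?invr_ge0 ?(ltW eta0)//; exact: norm_tail_ge0.
have pos : \forall eta \near (0 : R)^'+, 0 < eta by exact: nbhs_right_gt.
have K0near : \forall eta \near 0^'+, 0 <= lam eta ^- k by apply: filterS pos => eta; exact: K0.
(* The absolute value makes the factor nonnegative for all eta and changes nothing for eta > 0. *)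
pose nu eta x : {measure set (borel_space (skorokhod T m.+1)) -> \bar R} :=
  scaled_law P (fun w => X eta x w : borel_space (skorokhod T m.+1)) (normr_ge0 (lam eta ^- k)).
have mX eta x : 0 < eta -> measurable_fun setT (fun w => X eta x w : borel_space (skorokhod T m.+1)).
  move=> eta0; exact: (measurable_path Z D0 aL sL b0 T0 x eta0).
have nuE : \forall eta \near 0^'+, forall x (E : set (borel_space (skorokhod T m.+1))), measurable E ->
    ((lam eta ^- k)%:E * P [set w | E (X eta x w)] = nu eta x E)%E.
  near=> eta => x E mE; have eta0 : 0 < eta by near: eta; exact: nbhs_right_gt.
  by rewrite /nu scaled_lawE ?ger0_norm//; [exact: K0|exact: mX].
have muE x (E : set (borel_space (skorokhod T m.+1))) : measurable E -> C x E = mu x E.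
  by move=> mE; exact: limit_measureE.
have nuT eta x : (nu eta x setT < +oo)%E by exact: scaled_law_lt.
(* Stated for every e, because the bounds for a set B use the displacement bound for which B is
   bounded away, not [eps]. *)
have mu_lt e : 0 < e -> forall x f, A x -> away_lip (jump_paths_pred a sigma b T k A e) f ->
    (\int[mu x]_y (f y)%:E < +oo)%E.
  move=> e0 x f Ax fa; have mf := away_lip_measurable fa.
  have [B [Lf [rd [fB fL rd0 f_off]]]] := fa.
  rewrite integral_path_law//; last by move=> y; have /andP[] := fB y.
  have [d1 d10 van1] := small_mark_vanish D0 aL sL b0 T0 Ar e0 rd0 f_off.
  exact: (limit_fun_lt S alpha1 fB d10 Ax van1).
have loc e : 0 < e -> forall f x' (c : R), away_lip (jump_paths_pred a sigma b T k A e) f -> A x' -> 0 < c ->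
    exists2 rx : R, 0 < rx & \forall eta \near 0^'+, forall x, A x -> enorm (x - x') <= rx ->
    `|fine (\int[nu eta x]_y (f y)%:E)%E - fine (\int[mu x']_y (f y)%:E)%E| <= c.
  move=> e0 f x' c fa Ax' c0; have mf := away_lip_measurable fa.
  have [B [Lf [rd [fB fL rd0 f_off]]]] := fa.
  have [rx rx0 hr] := lipschitz_limit Ziid alpha1 RV Zc D0 aL sL b0 T0 r0 Ar e0 rd0 fB fL f_off Ax' c0.
  exists rx => //.
  apply: filterS2 hr pos => eta hr eta0 x Ax xx'.
  rewrite (@integral_scaled_law _ _ _ _ _ P _ _ (normr_ge0 (lam eta ^- k)) (mX eta x eta0) f B mf fB) (ger0_norm (K0 _ eta0)).
  rewrite integral_path_law//; last first; first by move=> y; have /andP[] := fB y.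
  exact: hr.
split.
  exact: (M_cvg_unif_abstract nuE muE A0 cA nuT (mu_lt _ eps0) (loc _ eps0)).
move=> B mB [e e0 Ba] PB; split.
- exact: (portmanteau_lower K0near nuE muE A0 cA nuT (mu_lt _ e0) (loc _ e0) mB Ba).
- exact: (portmanteau_middle (fun eta x (E : set (skorokhod T m.+1)) => P [set w | E (X eta x w)]) K0near A0 B).
- exact: (portmanteau_upper K0near nuE muE A0 cA nuT (mu_lt _ e0) (loc _ e0) mB Ba).
- exact: (portmanteau_finite muE cA nuT (mu_lt _ e0) (loc _ e0) Ba).
Unshelve. all: by end_near. Qed.
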